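(* Let $\tfrac12\le\theta<1$ and let $\varphi$ be an FBI phase. Let $\{h_\alpha\}_{\alpha\in\mathbb{N}^d}$ be a family of entire functions $h_\alpha:\mathbb{C}^d\to\mathbb{C}$ such that for every $\varepsilon>0$ and $\alpha$ there is a constant $D_{\varepsilon,\alpha}>0$ with $$|h_\alpha(z)|\le D_{\varepsilon,\alpha}\,e^{\varepsilon|z|^{1/\theta}},\quad z\in\mathbb{C}^d,$$ where, for every $\varepsilon>0$ and some constant $D'_\varepsilon>0$ independent of $\alpha$, $$D_{\varepsilon,\alpha}\le\frac{D'_\varepsilon\,\varepsilon^{|\alpha|}}{\alpha!^\theta}.$$ Then $$Au=\sum_{\alpha\in\mathbb{N}^d}T_\varphi^*\big(h_\alpha\,\partial_z^\alpha T_\varphi u\big)$$ defines a continuous map $\mathcal{S}'_{\theta,\Gamma}(\mathbb{R}^d)\to\mathcal{S}'_{\theta,\Gamma}(\mathbb{R}^d)$ for every closed cone $\Gamma\subset\mathbb{R}^{2d}\setminus\{0\}$. In particular $\mathrm{WF}^\theta_{\mathrm{gl}}(Au)\subset\mathrm{WF}^\theta_{\mathrm{gl}}(u)$ for $u\in\mathcal{S}'_\theta(\mathbb{R}^d)$, and $A$ maps $\mathcal{S}_\theta(\mathbb{R}^d)$ into itself.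
   Context: $\mathcal{S}_\theta(\mathbb{R}^d)$ is the union over $C>0$ of the Banach spaces of all $f\in C^\infty(\mathbb{R}^d)$ with $\sup_{\alpha,\beta\in\mathbb{N}^d}\sup_{x} C^{-|\alpha|-|\beta|}(\alpha!\,\beta!)^{-\theta}|x^\alpha\partial^\beta f(x)|<\infty$, with the inductive limit topology. $\mathcal{S}_\theta'(\mathbb{R}^d)$ is its topological dual with the weak topology; $\langle\cdot,\cdot\rangle$ is the bilinear duality pairing. FBI phase: $\varphi(z,y)=\frac12\langle Az,z\rangle+\langle Bz,y\rangle+\frac12\langle Cy,y\rangle$ on $\mathbb{C}^d\times\mathbb{R}^d$ with complex $d\times d$ matrices $A,B,C$ ($\langle\cdot,\cdot\rangle$ bilinear), $A,C$ symmetric, $\det B\ne0$, $\Im C>0$. FBI transform: $T_\varphi u(z)=c_\varphi\langle u_y,e^{i\varphi(z,y)}\rangle$, $c_\varphi=2^{-d/2}\pi^{-3d/4}(\det\Im C)^{-1/4}|\det B|$. $\Phi(z)=\max_{y\in\mathbb{R}^d}(-\Im\varphi(z,y))$. $T_\varphi$ is an isometry of $L^2(\mathbb{R}^d)$ into $L^2(\mathbb{C}^d,e^{-2\Phi}d\lambda)$ ($\lambda$ Lebesgue measure), and $T_\varphi^*$ is its adjoint; for entire $U$ with $|U(z)|\le C_\varepsilon e^{\varepsilon|z|^{1/\theta}+\Phi(z)}$ for all $\varepsilon>0$, $T_\varphi^*U\in\mathcal{S}'_\theta(\mathbb{R}^d)$ is defined by $(T_\varphi^*U,v)=\int_{\mathbb{C}^d}U(z)\overline{T_\varphi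 v(z)}e^{-2\Phi(z)}d\lambda(z)$, $v\in\mathcal{S}_\theta(\mathbb{R}^d)$, with $(w,v)=\langle w,\overline v\rangle$. A subset of $\mathbb{R}^{2d}\setminus\{0\}$ is conic (a cone) if it is invariant under multiplication of all $2d$ coordinates by positive reals; closed means closed in $\mathbb{R}^{2d}\setminus\{0\}$. Global wave front set: for $u\in\mathcal{S}_\theta'(\mathbb{R}^d)$, a point $(x_0,\xi_0)\in\mathbb{R}^{2d}\setminus\{0\}$ is not in $\mathrm{WF}^\theta_{\mathrm{gl}}(u)$ iff there are an open conic neighbourhood $\Gamma'$ of $(x_0,\xi_0)$ and $C,\varepsilon>0$ with $|\langle u_y, e^{-i\langle y,\xi\rangle-\frac12|y-x|^2}\rangle|\le C e^{-\varepsilon(|x|^{1/\theta}+|\xi|^{1/\theta})}$ for all $(x,\xi)\in\Gamma'$. Equivalently (for any FBI phase $\varphi$): there are $\varepsilon, C>0$ and an open conic neighbourhood $\Lambda\subset\mathbb{C}^d\setminus\{0\}$ of $\chi^b_\varphi(x_0,\xi_0)$ with $|T_\varphi u(z)|\le Ce^{-\varepsilon|z|^{1/\theta}+\Phi(z)}$ on $\Lambda$, where $\chi^b_\varphi(y,\eta)$ is the unique $z\in\mathbb{C}^d$ with $\eta=-\varphi'_y(z,y)$. For a closed cone $\Gamma\subset\mathbb{R}^{2d}\setminus\{0\}$, $\mathcal{S}'_{\theta,\Gamma}(\mathbb{R}^d)=\{u\in\mathcal{S}'_\theta(\mathbb{R}^d):\mathrm{WF}^\theta_{\mathrm{gl}}(u)\subset\Gamma\}$,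 with the following notion of convergence: $u_n\to0$ in $\mathcal{S}'_{\theta,\Gamma}$ if (1) $u_n\to 0$ in $\mathcal{S}'_\theta$, and (2) every $w\in(\mathbb{R}^{2d}\setminus\{0\})\setminus\Gamma$ admits a conic neighbourhood $L$ of $\chi^b_\varphi(w)$ and constants $C,\varepsilon>0$ such that $|T_\varphi u_n(z)|\le Ce^{-\varepsilon|z|^{1/\theta}+\Phi(z)}$ for all $n$ and all $z\in L$; $u_n\to u$ means $u_n-u\to0$. Continuity is with respect to this convergence. *)

(* Defs.v *)
(* MathComp-Analysis over R : realType; complex numbers are R[i] from
   mathcomp-real-closed. *)
From HB Require Import structures.
From mathcomp Require Import all_boot all_order all_algebra finmap complex.
From mathcomp Require Import all_classical all_reals all_analysis.
From mathcomp.analysis.showcase Require Import summability.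

Set Implicit Arguments.
Unset Strict Implicit.
Unset Printing Implicit Defensive.

Import Order.TTheory GRing.Theory Num.Theory.
Import numFieldNormedType.Exports.

Local Open Scope classical_set_scope.
Local Open Scope ring_scope.

Section LebesgueMeasure.
Variable R : realType.

Definition cons_pair n (p : measurableTypeR R * n.-tuple (measurableTypeR R)) :
  n.+1.-tuple (measurableTypeR R) := cons_tuple p.1 p.2.

Lemma measurable_cons_pair n : measurable_fun [set: _] (@cons_pair n).
Proof.
exact: (measurable_cons measurable_fst measurable_snd).
Qed.

Section Step.
Variables (n : nat).
Variable mu : {sigma_finite_measure set (n.-tuple (measurableTypeR R)) -> \bar R}.

Definition lebesgue_cons : set (n.+1.-tuple (measurableTypeR R)) -> \bar R :=
  pushforward (@lebesgue_measure R \x mu)%E (@cons_pair n).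

Let cons0 : lebesgue_cons set0 = 0%E.
Proof. by rewrite /lebesgue_cons /pushforward preimage_set0 measure0. Qed.

Let cons_ge0 A : (0 <= lebesgue_cons A)%E.
Proof. exact: (measure_ge0 (@lebesgue_measure R \x mu)%E). Qed.

Let measurable_pre A : measurable A -> measurable (@cons_pair n @^-1` A).
Proof.
by move=> mA; rewrite -[X in measurable X]setTI; exact: measurable_cons_pair.
Qed.

Let cons_sigma_additive : semi_sigma_additive lebesgue_cons.
Proof.
move=> F mF tF mUF; rewrite /lebesgue_cons /pushforward preimage_bigcup.
apply: (measure_semi_sigma_additive (s := (@lebesgue_measure R \x mu)%E)).
- by move=> k; exact: measurable_pre.
- apply/trivIsetP => /= i j _ _ ij; rewrite -preimage_setI.
  by move/trivIsetP : tF => /(_ _ _ _ _ ij) ->//; rewrite preimage_set0.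
- by rewrite -preimage_bigcup; exact: measurable_pre.
Qed.

HB.instance Definition _ :=
  isMeasure.Build _ _ _ lebesgue_cons cons0 cons_ge0 cons_sigma_additive.

Let cons_sigma_finite : sigma_finite setT lebesgue_cons.
Proof.
have /sigma_finiteP[F [TF ndF Foo]] := sigma_finiteT (@lebesgue_measure R).
have /sigma_finiteP[G [TG ndG Goo]] := sigma_finiteT mu.
pose H k := F k `*` G k.
have TH : [set: measurableTypeR R * n.-tuple (measurableTypeR R)] = \bigcup_k H k.
  rewrite -setXTT TF TG predeqE => -[x y]; split.
    move=> [/= [i _ Fx] [k _ Gy]]; exists (maxn i k) => //; split.
    - by move: x Fx; exact/subsetPset/ndF/leq_maxl.
    - by move: y Gy; exact/subsetPset/ndG/leq_maxr.
  by move=> [i _ []/= ? ?]; split; exists i.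
have mH k : measurable (H k) /\ ((@lebesgue_measure R \x mu) (H k) < +oo)%E.
  have [? ?] := Foo k; have [? ?] := Goo k.
  split; first exact: measurableX.
  by rewrite product_measure1E// lte_mul_pinfty// ge0_fin_numE.
pose uncons (t : n.+1.-tuple (measurableTypeR R)) := (thead t, [tuple of behead t]).
have unconsK p : uncons (cons_pair p) = p.
  by case: p => x t; rewrite /uncons /cons_pair theadE; congr pair; exact: val_inj.
have muncons : measurable_fun [set: _] uncons.
  apply/measurable_fun_pairP; split.
    exact: measurable_tnth.
  exact: measurable_behead.
exists (fun k => uncons @^-1` H k).
  by rewrite -preimage_bigcup -TH preimage_setT.
move=> k; have [mHk Hk] := mH k; split.
  by rewrite -[X in measurable X]setTI; exact: muncons.
rewrite /lebesgue_cons /pushforward -comp_preimage.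
by rewrite (_ : uncons \o @cons_pair n = id) //; apply/funext => p; exact: unconsK.
Qed.

HB.instance Definition _ :=
  Measure_isSigmaFinite.Build _ _ _ lebesgue_cons cons_sigma_finite.

End Step.

(* d-dimensional Lebesgue measure: the d-fold product of lebesgue_measure, carried
   by the type of d-tuples. *)
Fixpoint lebesgue_tuple n :
    {sigma_finite_measure set (n.-tuple (measurableTypeR R)) -> \bar R} :=
  match n with
  | 0 => dirac ([tuple] : 0.-tuple (measurableTypeR R))
  | n'.+1 => lebesgue_cons (lebesgue_tuple n')
  end.

End LebesgueMeasure.

Section Complex.
Variable R : realType.

(* R[i] as a numClosedFieldType: this is what gives it the topology and the
   structure of normed module over itself of numFieldNormedType. *)
Definition Cplx : numClosedFieldType := R[i].

Definition toC (x : R) : Cplx := Complex x 0.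
Definition reC (z : Cplx) : R := complex.Re z.
Definition imC (z : Cplx) : R := complex.Im z.
Definition cconj (z : Cplx) : Cplx := conjc z.

(* The modulus as an element of R; the ring norm `|z| lives in R[i]. *)
Definition cabs (z : Cplx) : R := Normc.normc z.

Definition cexp (z : Cplx) : Cplx :=
  Complex (expR (reC z) * cos (imC z)) (expR (reC z) * sin (imC z)).

End Complex.

Section Vectors.
Variables (R : realType) (d : nat).
Local Notation C := (Cplx R).

(* Euclidean norms; the norm of the normedModType 'rV_d is the sup norm. *)
Definition enorm (x : 'rV[R]_d) : R := Num.sqrt (\sum_j x 0 j ^+ 2).
Definition cenorm (z : 'rV[C]_d) : R := Num.sqrt (\sum_j cabs (z 0 j) ^+ 2).

(* The bilinear (not sesquilinear) pairing. *)
Definition dot (K : fieldType) (x y : 'rV[K]_d) : K := \sum_j x 0 j * y 0 j.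

(* Vectors are rows, so M acts by x |-> x M^T. *)
Definition mxact (K : fieldType) (M : 'M[K]_d) (x : 'rV[K]_d) : 'rV[K]_d :=
  x *m M^T.

Definition vecC (x : 'rV[R]_d) : 'rV[C]_d := map_mx (@toC R) x.

End Vectors.

Section Integrals.
Variables (R : realType) (d : nat).
Local Notation C := (Cplx R).

Definition row_of_tuple (t : d.-tuple (measurableTypeR R)) : 'rV[R]_d :=
  \row_j tnth t j.

Definition integralR (f : 'rV[R]_d -> C) : C :=
  let mu := lebesgue_tuple R d in
  Complex (\int[mu]_t reC (f (row_of_tuple t)))
          (\int[mu]_t imC (f (row_of_tuple t))).

(* Lebesgue measure on C^d, through z = x + i y. *)
Definition integralC (f : 'rV[C]_d -> C) : C :=
  let mu := (lebesgue_tuple R d \x lebesgue_tuple R d)%E in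
  let z p := \row_j (Complex (tnth p.1 j) (tnth p.2 j) : C) in
  Complex (\int[mu]_p reC (f (z p))) (\int[mu]_p imC (f (z p))).

End Integrals.

Section Multiindices.
Variable d : nat.

Definition mindex := {ffun 'I_d -> nat}.
Definition mabs (a : mindex) : nat := (\sum_j a j)%N.
Definition mfact (a : mindex) : nat := (\prod_j (a j)`!)%N.

Definition miter (F : Type) (D : 'I_d -> F -> F) (a : mindex) (f : F) : F :=
  foldr (fun j g => iter (a j) (D j) g) f (enum 'I_d).

End Multiindices.

Section Derivatives.
Variables (R : realType) (d : nat).
Local Notation C := (Cplx R).

Definition pderivR (j : 'I_d) (f : 'rV[R]_d -> C) (x : 'rV[R]_d) : C :=
  Complex ('D_(delta_mx 0 j) (@reC R \o f) x) ('D_(delta_mx 0 j) (@imC R \o f) x).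

Definition continuous_derivable (f : 'rV[R]_d -> C) : Prop :=
  [/\ continuous (@reC R \o f), continuous (@imC R \o f) &
   forall x (j : 'I_d), derivable (@reC R \o f) x (delta_mx 0 j) /\
                        derivable (@imC R \o f) x (delta_mx 0 j)].

(* C^oo; partial derivatives are taken in every order. *)
Definition smooth (f : 'rV[R]_d -> C) : Prop :=
  forall s : seq 'I_d, continuous_derivable (foldr pderivR f s).

Definition entire (h : 'rV[C]_d -> C) : Prop := forall z, differentiable h z.

Definition pderivC (j : 'I_d) (h : 'rV[C]_d -> C) (z : 'rV[C]_d) : C :=
  'D_(delta_mx 0 j) h z.

End Derivatives.

Section GelfandShilov.
Variables (R : realType) (d : nat) (theta : R).
Local Notation C := (Cplx R).
Local Notation V := 'rV[R]_d.

Definition monomial (a : mindex d) (x : V) : R := \prod_j x 0 j ^+ a j.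

Definition gs_norm (c : R) (f : V -> C) : \bar R :=
  ereal_sup (range (fun p : mindex d * mindex d * V =>
    let: (a, b, x) := p in
    (c ^- (mabs a + mabs b) * (mfact a * mfact b)%:R `^ (- theta) *
     cabs (toC (monomial a x) * miter (@pderivR R d) b f x))%:E)).

Definition gs_step (c : R) : set (V -> C) :=
  [set f | smooth f /\ (gs_norm c f < +oo)%E].

Definition gs : set (V -> C) := \bigcup_(c in [set c : R | 0 < c]) gs_step c.

Definition absolutely_convex (W : set (V -> C)) : Prop :=
  forall (f g : V -> C) (a b : C), W f -> W g -> cabs a + cabs b <= 1 ->
    W (fun x => a * f x + b * g x).

(* Neighbourhoods of 0 in the (locally convex) inductive limit topology. *)
Definition gs_nbhs0 (U : set (V -> C)) : Prop :=
  exists W : set (V -> C),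
    [/\ W `<=` U, W `<=` gs, absolutely_convex W &
     forall c, 0 < c -> exists2 r, 0 < r &
       forall f, gs_step c f -> (gs_norm c f < r%:E)%E -> W f].

(* A functional on S_theta is represented by a function on all of V -> C, whose
   values outside S_theta are irrelevant. *)
Definition functional := (V -> C) -> C.

Definition gs_dual (u : functional) : Prop :=
  (forall (f g : V -> C) (a b : C), gs f -> gs g ->
     u (fun x => a * f x + b * g x) = a * u f + b * u g) /\
  (forall e, 0 < e -> gs_nbhs0 [set f | gs f /\ cabs (u f) < e]).

Definition weak_cvg0 (u : nat -> functional) : Prop :=
  forall f, gs f -> u n f @[n --> \oo] --> (0 : C).

Definition embed (f : V -> C) : functional :=
  fun g => integralR (fun x => f x * g x).

End GelfandShilov.

Section WaveFront.
Variables (R : realType) (d : nat) (theta : R).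
Local Notation C := (Cplx R).
Local Notation V := 'rV[R]_d.

Definition conic (A : set (V * V)) : Prop :=
  forall t : R, 0 < t -> forall w, A w -> A (t *: w).

Definition conicC (A : set 'rV[C]_d) : Prop :=
  forall t : R, 0 < t -> forall z, A z -> A (toC t *: z).

(* Closed means closed in R^{2d} minus the origin. *)
Definition closed_cone (G : set (V * V)) : Prop :=
  conic G /\ exists2 F : set (V * V), closed F & G = F `&` ~` [set 0].

(* y |-> exp (- i <y, xi> - |y - x|^2 / 2), split into real and imaginary parts of
   the exponent. *)
Definition wave_packet (x xi : V) : V -> C :=
  fun y => cexp (Complex (- (2^-1 * enorm (y - x) ^+ 2)) (- dot y xi)).

Definition WF (u : functional R d) : set (V * V) :=
  [set w | w != 0 /\ ~ exists G : set (V * V),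
    [/\ open G, conic G, ~ G 0, G w &
     exists c e : R, [/\ 0 < c, 0 < e & forall x xi, G (x, xi) ->
       cabs (u (wave_packet x xi)) <=
       c * expR (- e * (enorm x `^ theta^-1 + enorm xi `^ theta^-1))]]].

End WaveFront.

Section FBI.
Variables (R : realType) (d : nat).
Local Notation C := (Cplx R).
Local Notation V := 'rV[R]_d.

Record FBI_phase := FBIPhase {
  phA : 'M[C]_d;
  phB : 'M[C]_d;
  phC : 'M[C]_d;
  phA_sym : phA^T = phA;
  phC_sym : phC^T = phC;
  phB_det : \det phB != 0;
  phC_im : forall y : V, y != 0 -> 0 < dot (mxact (map_mx (@imC R) phC) y) y
}.

Variable phi : FBI_phase.

Definition phase (z : 'rV[C]_d) (y : V) : C :=
  2^-1 * dot (mxact (phA phi) z) z + dot (mxact (phB phi) z) (vecC y) +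
  2^-1 * dot (mxact (phC phi) (vecC y)) (vecC y).

Definition c_phi : R :=
  2 `^ (- (d%:R / 2)) * pi `^ (- (3 * d%:R / 4)) *
  (\det (map_mx (@imC R) (phC phi))) `^ (- 4^-1) * cabs (\det (phB phi)).

(* Phi z = max_y (- Im phi (z, y)); the maximum is attained as Im C > 0. *)
Definition weight (z : 'rV[C]_d) : R :=
  sup (range (fun y : V => - imC (phase z y))).

Definition fbi_kernel (z : 'rV[C]_d) : V -> C :=
  fun y => cexp ('i * phase z y).

Definition fbi (u : functional R d) (z : 'rV[C]_d) : C :=
  toC c_phi * u (fbi_kernel z).

(* <T^* U, v> = (T^* U, conj v). *)
Definition fbi_adj (U : 'rV[C]_d -> C) : functional R d :=
  fun v => integralC (fun z =>
    U z * cconj (fbi (embed (fun y => cconj (v y))) z) *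
    toC (expR (- (2 * weight z)))).

(* The functions to which T^* applies, with values in S'_theta. *)
Definition fbi_admissible (theta : R) (U : 'rV[C]_d -> C) : Prop :=
  entire U /\ forall e, 0 < e -> exists K : R, forall z,
    cabs (U z) <= K * expR (e * cenorm z `^ theta^-1 + weight z).

Definition phase_y (z : 'rV[C]_d) (y : V) : 'rV[C]_d :=
  \row_j pderivR j (phase z) y.

(* As det B != 0, there is exactly one z with eta = - phi'_y (z, y). *)
Definition chi_b (w : V * V) : 'rV[C]_d :=
  get [set z | vecC w.2 = - phase_y z w.1].

Definition gs_dual_cone (theta : R) (G : set (V * V)) (u : functional R d) :
    Prop :=
  gs_dual theta u /\ WF theta u `<=` G.

Definition cone_cvg0 (theta : R) (G : set (V * V)) (u : nat -> functional R d) :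
    Prop :=
  weak_cvg0 theta u /\
  forall w, w != 0 -> ~ G w -> exists L : set 'rV[C]_d,
    [/\ nbhs (chi_b w) L, conicC L, ~ L 0 &
     exists c e : R, [/\ 0 < c, 0 < e & forall n z, L z ->
       cabs (fbi (u n) z) <= c * expR (- e * cenorm z `^ theta^-1 + weight z)]].

Definition cone_cvg (theta : R) (G : set (V * V)) (u : nat -> functional R d)
    (v : functional R d) : Prop :=
  cone_cvg0 theta G (fun n f => u n f - v f).

Variable h : mindex d -> 'rV[C]_d -> C.

Definition symbol_term (u : functional R d) (a : mindex d) : 'rV[C]_d -> C :=
  fun z => h a z * miter (@pderivC R d) a (fbi u) z.

(* The sum over N^d is unordered. *)
Definition opA (u : functional R d) : functional R d :=
  fun v => sum (fun a => fbi_adj (symbol_term u a) v : C).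

End FBI.

(* Main.v *)
(** The FBI kernel is [K_z = exp (Phi z) * unimodular * gp C x xi] with [z = chi x xi], where
    [gp M x xi y = exp (i <M (y - x), y - x> / 2 - i <y, xi>)]. Since [T u] is entire and bounded
    by [exp (eps |z|^(1/theta) + Phi)], Cauchy's estimate on a ball of radius [|a|^(1 - theta)]
    bounds [h_a d^a T u] by [exp (- |a|)] times the same kind of bound, and preserves decay near a
    ray. Pairing with a test function or a wave packet, whose transform decays like
    [exp (Phi - eps |z - chi x xi|^(1/theta))], gives convergence of the series, its continuity and
    the decay of [A u] on wave packets. The wave packets of the wave front set are those with
    [M = i]; one passes from [i] to [C] by small steps [M -> M + E], expanding
    [exp (i <E s, s> / 2)] and controlling the terms by Cauchy's estimate for the entire function
    [zeta |-> <u, gp M x xi * exp <zeta, y - x>>]. A weakly null sequence has uniformly bounded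
    transforms by a gliding hump argument, which makes dominated convergence applicable. *)

From HB Require Import structures.
Require Import Defs.
From mathcomp Require Import all_boot all_order all_algebra finmap complex.
From mathcomp Require Import all_classical all_reals all_analysis.
From mathcomp Require Import measurable_realfun.
From mathcomp.analysis.showcase Require Import summability.
From mathcomp Require Import ring lra zify.

Set Implicit Arguments.
Unset Strict Implicit.
Unset Printing Implicit Defensive.

Import Order.TTheory GRing.Theory Num.Theory.
Import numFieldNormedType.Exports.

Local Open Scope classical_set_scope.
Local Open Scope ring_scope.

(** The radius |a|^(1 - theta) is forced. With n = |a| derivatives, Cauchy's estimate on it costs
    n^(theta n), which is a!^theta up to exp (c n); the bound on [h] cancels this with any geometric
    factor to spare, its epsilon being free. On that ball the quadratic weight Phi changes by |z|
    n^(1 - theta) + n^(2 - 2 theta), which Young's inequality and theta >= 1/2 turn into eps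
    |z|^(1/theta) + C n. The same balance governs the derivatives of Gaussians in y, so that a
    single mechanism puts all kernels and packets in one fixed step of S_theta. The change of
    Gaussian proceeds by small steps because its k-th term is of size |E|^k exp (c k) k^k / k!,
    summable only for small E. The admissible size of E depends only on a lower bound for Im M and
    an upper bound for M, and both hold along the whole segment from i to C. Estimates are made for
    sets of functionals with a common bound on their transforms: singletons give the mapping
    properties, ranges of sequences give continuity. *)

Section ComplexNumbers.
Variable R : realType.
Local Notation C := (Cplx R).
Implicit Types (z w : C) (x y t : R).

Lemma complexP z w : reC z = reC w -> imC z = imC w -> z = w.
Proof. by case: z => a b; case: w => c e /= -> ->. Qed.

Lemma reC_toC x : reC (toC x) = x. Proof. by []. Qed.
Lemma imC_toC x : imC (toC x) = 0. Proof. by []. Qed.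
Definition mkC x y : C := Complex x y.
Lemma reC_mkC x y : reC (mkC x y) = x. Proof. by []. Qed.
Lemma imC_mkC x y : imC (mkC x y) = y. Proof. by []. Qed.
Lemma mkC_reim z : mkC (reC z) (imC z) = z. Proof. by case: z. Qed.
Lemma reCD z w : reC (z + w) = reC z + reC w. Proof. by case: z; case: w. Qed.
Lemma imCD z w : imC (z + w) = imC z + imC w. Proof. by case: z; case: w. Qed.
Lemma reCN z : reC (- z) = - reC z. Proof. by case: z. Qed.
Lemma imCN z : imC (- z) = - imC z. Proof. by case: z. Qed.
Lemma reCB z w : reC (z - w) = reC z - reC w. Proof. by rewrite reCD reCN. Qed.
Lemma imCB z w : imC (z - w) = imC z - imC w. Proof. by rewrite imCD imCN. Qed.
Lemma reCM z w : reC (z * w) = reC z * reC w - imC z * imC w.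
Proof. by case: z; case: w. Qed.
Lemma imCM z w : imC (z * w) = reC z * imC w + imC z * reC w.
Proof. by case: z => a b; case: w => c e /=; rewrite addrC. Qed.
Lemma reC0 : reC (0 : C) = 0. Proof. by []. Qed.
Lemma imC0 : imC (0 : C) = 0. Proof. by []. Qed.
Lemma reC1 : reC (1 : C) = 1. Proof. by []. Qed.
Lemma imC1 : imC (1 : C) = 0. Proof. by []. Qed.
Lemma reCi : reC ('i : C) = 0. Proof. by []. Qed.
Lemma imCi : imC ('i : C) = 1. Proof. by []. Qed.
Lemma reC_conj z : reC (cconj z) = reC z. Proof. by case: z. Qed.
Lemma imC_conj z : imC (cconj z) = - imC z. Proof. by case: z. Qed.
Lemma reC_sum I (r : seq I) (P : pred I) (F : I -> C) :
  reC (\sum_(i <- r | P i) F i) = \sum_(i <- r | P i) reC (F i).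
Proof. by apply: (big_morph (@reC R)) => // a b; exact: reCD. Qed.
Lemma imC_sum I (r : seq I) (P : pred I) (F : I -> C) :
  imC (\sum_(i <- r | P i) F i) = \sum_(i <- r | P i) imC (F i).
Proof. by apply: (big_morph (@imC R)) => // a b; exact: imCD. Qed.

Lemma toCD x y : toC (x + y) = toC x + toC y.
Proof. by apply: complexP; rewrite ?(reCD, imCD) /= ?addr0. Qed.
Lemma toCN x : toC (- x) = - toC x.
Proof. by apply: complexP; rewrite ?(reCN, imCN) /= ?oppr0. Qed.
Lemma toCB x y : toC (x - y) = toC x - toC y. Proof. by rewrite toCD toCN. Qed.
Lemma toCM x y : toC (x * y) = toC x * toC y.
Proof. by apply: complexP; rewrite ?(reCM, imCM) /= ?mulr0 ?mul0r ?subr0 ?addr0. Qed.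
Lemma toC0 : toC 0 = 0 :> C. Proof. by []. Qed.
Lemma toC1 : toC 1 = 1 :> C. Proof. by []. Qed.
Lemma toCV x : toC (x^-1) = (toC x)^-1.
Proof.
have [->|x0] := eqVneq x 0; first by rewrite !(invr0, toC0).
have tx : toC x != 0 by apply: contra_neq x0 => /(congr1 (@reC R)).
by apply: (mulfI tx); rewrite -toCM !mulfV.
Qed.

Lemma toC_sum I (r : seq I) (P : pred I) (F : I -> R) :
  toC (\sum_(i <- r | P i) F i) = \sum_(i <- r | P i) toC (F i).
Proof. by apply: (big_morph (@toC R)) => // a b; exact: toCD. Qed.
Lemma toCnat n : toC n%:R = n%:R :> C.
Proof. by elim: n => // n IH; rewrite -!natr1 toCD IH. Qed.

Lemma Cnorm z : `|z| = toC (cabs z). Proof. by []. Qed.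
Lemma toC_le x y : (toC x <= toC y) = (x <= y). Proof. exact: lecR. Qed.
Lemma toC_lt x y : (toC x < toC y) = (x < y). Proof. exact: ltcR. Qed.
Lemma Cpos_re (e : C) : 0 < e -> e = toC (reC e) /\ 0 < reC e.
Proof.
case: e => a b; rewrite ltcE /= => /andP[/eqP b0 a0].
by subst b.
Qed.
Lemma Cge0_re (e : C) : 0 <= e -> e = toC (reC e) /\ 0 <= reC e.
Proof.
case: e => a b; rewrite lecE /= => /andP[/eqP b0 a0].
by subst b.
Qed.

Lemma cabsE z : cabs z = Num.sqrt (reC z ^+ 2 + imC z ^+ 2). Proof. by case: z. Qed.
Lemma cabs_ge0 z : 0 <= cabs z. Proof. by rewrite cabsE sqrtr_ge0. Qed.
Lemma cabs0 : cabs (0 : C) = 0. Proof. exact: Normc.normc0. Qed.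
Lemma cabs1 : cabs (1 : C) = 1. Proof. exact: Normc.normc1. Qed.
Lemma cabs_eq0 z : (cabs z == 0) = (z == 0).
Proof.
by apply/eqP/eqP => [/Normc.eq0_normc//|->]; exact: cabs0.
Qed.
Lemma cabsM z w : cabs (z * w) = cabs z * cabs w. Proof. exact: Normc.normcM. Qed.
Lemma cabsD z w : cabs (z + w) <= cabs z + cabs w. Proof. exact: le_normcD. Qed.
Lemma cabsN z : cabs (- z) = cabs z. Proof. exact: normcN. Qed.
Lemma cabsB z w : cabs (z - w) <= cabs z + cabs w.
Proof. by rewrite -(cabsN w) cabsD. Qed.
Lemma cabsBC z w : cabs (z - w) = cabs (w - z).
Proof. by rewrite -cabsN opprB. Qed.
Lemma cabsV z : cabs z^-1 = (cabs z)^-1. Proof. exact: Normc.normcV. Qed.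
Lemma cabsX z n : cabs (z ^+ n) = cabs z ^+ n.
Proof. by elim: n => [|n IH]; rewrite ?cabs1// !exprS cabsM IH. Qed.
Lemma cabs_toC x : cabs (toC x) = `|x|.
Proof. by rewrite cabsE /= expr0n addr0 sqrtr_sqr. Qed.
Lemma cabs_nat n : cabs (n%:R : C) = n%:R.
Proof. by rewrite -toCnat cabs_toC normr_nat. Qed.
Lemma cabs_i : cabs ('i : C) = 1.
Proof. by rewrite cabsE /= expr0n expr1n add0r sqrtr1. Qed.
Lemma cabs_conj z : cabs (cconj z) = cabs z.
Proof. by rewrite !cabsE reC_conj imC_conj sqrrN. Qed.
Lemma cabs_sum I (r : seq I) (P : pred I) (F : I -> C) :
  cabs (\sum_(i <- r | P i) F i) <= \sum_(i <- r | P i) cabs (F i).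
Proof.
elim/big_ind2 : _ => [|a b c e h h'|//]; first by rewrite cabs0.
exact: le_trans (cabsD _ _) (lerD _ _).
Qed.
Lemma cabs_re z : `|reC z| <= cabs z.
Proof. by rewrite cabsE -sqrtr_sqr ler_wsqrtr// lerDl sqr_ge0. Qed.
Lemma cabs_im z : `|imC z| <= cabs z.
Proof. by rewrite cabsE -sqrtr_sqr ler_wsqrtr// lerDr sqr_ge0. Qed.
Lemma cabs_reim z : cabs z <= `|reC z| + `|imC z|.
Proof.
have -> : z = toC (reC z) + 'i * toC (imC z).
  by apply: complexP; rewrite ?(reCD, imCD, reCM, imCM) /=; ring.
apply: le_trans (cabsD _ _) _; rewrite cabsM cabs_i mul1r !cabs_toC.
by rewrite ?(reCD, imCD, reCM, imCM) /= !(mul0r, mul1r, mulr0, subr0, addr0, add0r).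
Qed.
Lemma cabs_le_dist z w : cabs z <= cabs w + cabs (z - w).
Proof. by rewrite -{1}(subrK w z) addrC cabsD. Qed.

Lemma conjCD z w : cconj (z + w) = cconj z + cconj w.
Proof. by apply: complexP; rewrite ?(reC_conj, imC_conj, reCD, imCD)// opprD. Qed.
Lemma conjCM z w : cconj (z * w) = cconj z * cconj w.
Proof.
by apply: complexP; rewrite ?(reC_conj, imC_conj, reCM, imCM); ring.
Qed.
Lemma conjCN z : cconj (- z) = - cconj z.
Proof. by apply: complexP; rewrite ?(reC_conj, imC_conj, reCN, imCN). Qed.

Lemma cexpD z w : cexp (z + w) = cexp z * cexp w.
Proof.
apply: complexP; rewrite ?(reCM, imCM) /= reCD imCD expRD ?cosD ?sinD; ring.
Qed.
Lemma cexp0 : cexp (0 : C) = 1.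
Proof. by apply: complexP; rewrite /= expR0 ?cos0 ?sin0 mul1r. Qed.
Lemma cabs_cexp z : cabs (cexp z) = expR (reC z).
Proof.
by rewrite cabsE /= !exprMn -mulrDr cos2Dsin2 mulr1 sqrtr_sqr ger0_norm// expR_ge0.
Qed.
Lemma cexp_conj z : cconj (cexp z) = cexp (cconj z).
Proof.
apply: complexP; rewrite ?(reC_conj, imC_conj) /=.
- by rewrite reC_conj imC_conj cosN.
- by rewrite reC_conj imC_conj sinN mulrN.
Qed.
Lemma cexpX z n : cexp z ^+ n = cexp (n%:R * z).
Proof.
elim: n => [|n IH]; first by rewrite mul0r cexp0.
by rewrite exprS IH -cexpD -natr1 mulrDl mul1r addrC.
Qed.

End ComplexNumbers.

(** * Calculus along real curves with complex values *)

Section RealCurves.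
Variable R : realType.
Local Notation C := (Cplx R).

(** Complex curves are differentiated through their real and imaginary parts, since the mean value
    theorem is real; [rderiv_diff] and [pderivR_rderiv] link this to complex directional derivatives
    and to [pderivR]. *)
Definition rderiv (f : R -> C) (t : R) (l : C) : Prop :=
  is_derive t 1 (@reC R \o f) (reC l) /\ is_derive t 1 (@imC R \o f) (imC l).

Lemma is_derive_eps (f : R -> R) (t l : R) :
  (forall e : R, 0 < e -> exists2 r : R, 0 < r & forall h : R, `|h| < r ->
     `|f (t + h) - f t - h * l| <= e * `|h|) -> is_derive t 1 f l.
Proof.
move=> H; have cv : h^-1 *: ((f \o shift t) (h *: 1) - f t) @[h --> 0^'] --> l.
  apply/cvgrPdist_le => e e0; have [r r0 Hr] := H _ e0.
  near=> h.
  have h0 : h != 0 by near: h; exact: nbhs_dnbhs_neq.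
  have hr : `|h| < r.
    near: h; apply: nbhs_dnbhs; apply/nbhs_ballP; exists r => //= h.
    by rewrite /ball /= sub0r normrN.
  rewrite /= [h *: 1]mulr1 (addrC h).
  rewrite (_ : l - _ = - (h^-1 * (f (t + h) - f t - h * l))); last first.
    by rewrite [h^-1 *: _]/(h^-1 * _) mulrBr mulKf// opprB.
  rewrite normrN normrM normfV ler_pdivrMl ?normr_gt0// (mulrC `|h|); exact: Hr.
split; first by apply/cvg_ex; exists l.
exact: (@cvg_lim _ _ _ _ _ _ _ cv).
Unshelve. all: by end_near. Qed.

Lemma rderiv_eps (f : R -> C) (t : R) (l : C) :
  (forall e : R, 0 < e -> exists2 r : R, 0 < r & forall h : R, `|h| < r ->
     cabs (f (t + h) - f t - toC h * l) <= e * `|h|) -> rderiv f t l.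
Proof.
move=> H; split; apply: is_derive_eps => e e0; have [r r0 Hr] := H _ e0;
  exists r => // h /Hr; apply: le_trans.
- have := cabs_re (f (t + h) - f t - toC h * l).
  by rewrite !(reCB, reCM) /= mul0r subr0.
- have := cabs_im (f (t + h) - f t - toC h * l).
  by rewrite !(imCB, imCM) /= mul0r addr0.
Qed.

Lemma is_derive_continuous (f : R -> R) (a b : R) (df : R -> R) :
  (forall t, t \in `[a, b] -> is_derive t 1 f (df t)) -> {within `[a, b], continuous f}.
Proof.
move=> H; apply: derivable_within_continuous => t tab.
by have [] := H t tab.
Qed.

Lemma mvt_real (f df : R -> R) (a b B : R) : a <= b ->
  (forall t, t \in `[a, b] -> is_derive t 1 f (df t) /\ `|df t| <= B) ->
  `|f b - f a| <= B * (b - a).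
Proof.
move=> ab H.
have [] := @MVT_segment R f df a b ab.
- by move=> t; rewrite in_itv /= => /andP[at_ tb]; have [|] := H t;
    rewrite // in_itv /= !ltW.
- by apply: is_derive_continuous => t /H[].
move=> c /H[_ cB] ->; rewrite normrM (ger0_norm (_ : 0 <= b - a)) ?subr_ge0//.
by rewrite ler_wpM2r ?subr_ge0.
Qed.

(** The real mean value theorem is applied to the real and to the imaginary part. The factor 2 is
    the price of adding the two; the constants 4 and 8 in the second-order estimates below are its
    powers. *)
Lemma mvt_cplx (f df : R -> C) (a b B : R) : a <= b ->
  (forall t, a <= t <= b -> rderiv f t (df t) /\ cabs (df t) <= B) ->
  cabs (f b - f a) <= 2 * B * (b - a).
Proof.
move=> ab H; apply: le_trans (cabs_reim _) _; rewrite reCB imCB.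
have -> : 2 * B * (b - a) = B * (b - a) + B * (b - a) by ring.
apply: lerD.
- apply: (@mvt_real (@reC R \o f) (@reC R \o df)) => // t; rewrite in_itv /=.
  by move=> /H[[]] ? _ tB; split => //; exact: le_trans (cabs_re _) tB.
- apply: (@mvt_real (@imC R \o f) (@imC R \o df)) => // t; rewrite in_itv /=.
  by move=> /H[[]] _ ? tB; split => //; exact: le_trans (cabs_im _) tB.
Qed.

Lemma rderivD f g t l m : rderiv f t l -> rderiv g t m ->
  rderiv (fun t => f t + g t) t (l + m).
Proof.
move=> [f1 f2] [g1 g2]; split.
- rewrite reCD (_ : _ \o _ = (@reC R \o f) + (@reC R \o g)).
    exact: is_deriveD.
  by apply/funext => s /=; rewrite reCD.
- rewrite imCD (_ : _ \o _ = (@imC R \o f) + (@imC R \o g)).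
    exact: is_deriveD.
  by apply/funext => s /=; rewrite imCD.
Qed.

Lemma rderiv_lin (c : C) t : rderiv (fun t => toC t * c) t c.
Proof.
apply: rderiv_eps => e e0; exists 1 => // h _.
rewrite (_ : _ - _ - _ = 0); first by rewrite cabs0 mulr_ge0// ltW.
by rewrite toCD; ring.
Qed.

Lemma rderivZ (c : C) f t l : rderiv f t l -> rderiv (fun t => c * f t) t (c * l).
Proof.
move=> [f1 f2]; split.
- rewrite reCM (_ : _ \o _ = (reC c *: (@reC R \o f)) - (imC c *: (@imC R \o f))).
    exact: is_deriveB.
  by apply/funext => s /=; rewrite reCM.
- rewrite imCM (_ : _ \o _ = (reC c *: (@imC R \o f)) + (imC c *: (@reC R \o f))).
    exact: is_deriveD.
  by apply/funext => s /=; rewrite imCM.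
Qed.

Lemma rderiv_linN (c : C) t : rderiv (fun t => -1 * (toC t * c)) t (- c).
Proof. by have := rderivZ (-1) (rderiv_lin c t); rewrite [X in rderiv _ _ X]mulN1r. Qed.

Lemma rderiv_sum (I : Type) (r : seq I) (f : I -> R -> C) (l : I -> C) t :
  (forall i, rderiv (f i) t (l i)) ->
  rderiv (fun t => \sum_(i <- r) f i t) t (\sum_(i <- r) l i).
Proof.
move=> H; elim: r => [|i r IH].
  rewrite big_nil (_ : (fun _ => _) = fun=> 0); last first.
    by apply/funext => s; rewrite big_nil.
  by split; exact: is_derive_cst.
rewrite big_cons (_ : (fun _ => _) = fun t => f i t + \sum_(i <- r) f i t).
  by apply: rderivD.
by apply/funext => s; rewrite big_cons.
Qed.

End RealCurves.

Section ComplexExponential.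
Variable R : realType.
Local Notation C := (Cplx R).

Lemma rderiv_cexp (z : C) t : rderiv (fun s => cexp (toC s * z)) t (z * cexp (toC t * z)).
Proof.
have dl : is_derive t 1 (fun s : R => s * reC z) (reC z).
  by have [+ _] := rderiv_lin z t; congr (is_derive _ _ _ _);
    apply/funext => s /=; rewrite reCM /= mul0r subr0.
have dm : is_derive t 1 (fun s : R => s * imC z) (imC z).
  by have [_ +] := rderiv_lin z t; congr (is_derive _ _ _ _);
    apply/funext => s /=; rewrite imCM /= mul0r addr0.
split.
- have -> : @reC R \o (fun s => cexp (toC s * z)) =
    (fun s => expR (s * reC z)) * (fun s => cos (s * imC z)).
    by apply/funext => s /=; rewrite reCM imCM /= mul0r subr0 mul0r addr0.
  apply: (is_derive_eq (is_deriveM (is_derive1_comp (is_derive_expR _) dl)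
    (is_derive1_comp (is_derive_cos _) dm))).
  rewrite ?(reCM, imCM) /= ?(reCM, imCM) /= !(mul0r, subr0, addr0) /GRing.scale /=; ring.
- have -> : @imC R \o (fun s => cexp (toC s * z)) =
    (fun s => expR (s * reC z)) * (fun s => sin (s * imC z)).
    by apply/funext => s /=; rewrite reCM imCM /= mul0r subr0 mul0r addr0.
  apply: (is_derive_eq (is_deriveM (is_derive1_comp (is_derive_expR _) dl)
    (is_derive1_comp (is_derive_sin _) dm))).
  rewrite ?(reCM, imCM) /= ?(reCM, imCM) /= !(mul0r, subr0, addr0) /GRing.scale /=; ring.
Qed.

End ComplexExponential.

#[local] Opaque Cplx.

(** * Holomorphic functions on normed spaces *)

Section ComplexDerivatives.
Variable R : realType.
Local Notation C := (Cplx R).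

(** Balls over [Cplx R] have their radii in [Cplx R], whose positive elements are the positive reals
    ([Cpos_re]); later estimates can therefore use a real radius. *)
Lemma nbhs_Cball (V : normedModType C) (z : V) (A : set V) :
  nbhs z A <-> exists2 r : R, 0 < r & forall w, `|w - z| < toC r -> A w.
Proof.
split=> [/nbhs_ballP[e /Cpos_re[ee e0] eA]|[r r0 rA]].
  exists (reC e) => // w wz; apply: eA; rewrite -ball_normE /= distrC.
  by rewrite [X in _ < X]ee.
apply/nbhs_ballP; exists (toC r); first by rewrite /= -toC0 toC_lt.
by move=> w; rewrite -ball_normE /= distrC; exact: rA.
Qed.

Lemma is_cderive_eps (V : normedModType C) (F : V -> C) (a v : V) (l : C) :
  (forall e : R, 0 < e -> exists2 r : R, 0 < r & forall h : C, cabs h < r ->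
     cabs (F (a + h *: v) - F a - h * l) <= e * cabs h) -> is_derive a v F l.
Proof.
move=> H; have cv : h^-1 *: ((F \o shift a) (h *: v) - F a) @[h --> 0^'] --> l.
  apply/cvgrPdist_le => e' /Cpos_re[-> e0]; have [r r0 Hr] := H _ e0.
  near=> h.
  have h0 : h != 0 by near: h; exact: nbhs_dnbhs_neq.
  have hr : cabs h < r.
    near: h; apply: nbhs_dnbhs; apply/nbhs_Cball; exists r => //= h.
    by rewrite subr0 Cnorm toC_lt.
  rewrite /= (addrC (h *: v)).
  rewrite (_ : l - _ = - (h^-1 * (F (a + h *: v) - F a - h * l))); last first.
    by rewrite [h^-1 *: _]/(h^-1 * _) mulrBr mulKf// opprB.
  rewrite Cnorm toC_le cabsN cabsM cabsV ler_pdivrMl; last first.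
    by rewrite lt_def cabs_ge0 cabs_eq0 h0.
  by rewrite (mulrC (cabs h)); exact: Hr.
split; first by apply/cvg_ex; exists l.
exact: (@cvg_lim _ _ _ _ _ _ _ cv).
Unshelve. all: by end_near. Qed.

Lemma derivable_ceps (V : normedModType C) (F : V -> C) (a v : V) :
  derivable F a v -> forall e : R, 0 < e -> exists2 r : R, 0 < r &
  forall h : C, cabs h < r ->
     cabs (F (a + h *: v) - F a - h * 'D_v F a) <= e * cabs h.
Proof.
move=> /derivable_nbhs /eqaddoP H e e0.
have e0' : 0 < toC e by rewrite -toC0 toC_lt.
have /nbhs_Cball[r r0 Hr] := H _ e0'.
exists r => // h hr; have := Hr h; rewrite subr0 Cnorm toC_lt => /(_ hr).
rewrite /= [X in `|X|](_ : _ = F (a + h *: v) - F a - h * 'D_v F a).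
  by rewrite !Cnorm -toCM toC_le.
by rewrite (addrC a) -addrA -opprD.
Qed.

(* A constant of type [V -> C]: ['D_v F] has the codomain of a structure that unfolds badly. *)
Definition ddir (V : normedModType C) (v : V) (F : V -> C) : V -> C := fun z => 'D_v F z.

Lemma rderiv_diff (V : normedModType C) (F : V -> C) (z v : V) (t : R) :
  differentiable F (z + toC t *: v) ->
  rderiv (fun s => F (z + toC s *: v)) t (ddir v F (z + toC t *: v)).
Proof.
move=> dF; apply: rderiv_eps => e e0.
have [|r r0 Hr] := @derivable_ceps _ F (z + toC t *: v) v _ _ e0.
  exact: diff_derivable.
exists r => // h hr; have := Hr (toC h); rewrite cabs_toC => /(_ hr).
by rewrite toCD scalerDl addrA.
Qed.

Lemma cabs_scale01 (t : R) (h : C) : 0 <= t <= 1 -> cabs (toC t * h) <= cabs h.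
Proof.
move=> /andP[t0 t1]; by rewrite cabsM cabs_toC ger0_norm// ler_piMl// cabs_ge0.
Qed.

Lemma cexp_sub1 (h : C) : cabs (cexp h - 1) <= 2 * (cabs h * expR (cabs h)).
Proof.
have := @mvt_cplx R (fun t => cexp (toC t * h)) (fun t => h * cexp (toC t * h))
  0 1 (cabs h * expR (cabs h)) ler01.
rewrite toC1 toC0 mul1r mul0r cexp0 subr0 mulr1; apply => t t01.
split; first exact: rderiv_cexp.
rewrite cabsM ler_wpM2l ?cabs_ge0// cabs_cexp ler_expR.
by apply: le_trans (ler_norm _) (le_trans (cabs_re _) (cabs_scale01 _ t01)).
Qed.

Lemma cexp_taylor1 (h : C) :
  cabs (cexp h - 1 - h) <= 4 * (cabs h ^+ 2 * expR (cabs h)).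
Proof.
have := @mvt_cplx R (fun t => cexp (toC t * h) + (-1) * (toC t * h))
  (fun t => h * cexp (toC t * h) + (-1) * h) 0 1 (2 * (cabs h ^+ 2 * expR (cabs h))) ler01.
rewrite toC1 toC0 mul1r mul0r cexp0 subr0 mulr1 mulr0 addr0 mulN1r addrAC => H.
apply: le_trans (H _) _; last by rewrite le_eqVlt; apply/orP; left; apply/eqP; ring.
move=> t t01; split.
  apply: rderivD; first exact: rderiv_cexp.
  have := rderivZ (-1) (rderiv_lin h t); rewrite [X in rderiv _ _ X]mulN1r.
  exact.
rewrite (_ : _ - h = h * (cexp (toC t * h) - 1)); last by rewrite mulrBr mulr1.
rewrite cabsM (_ : 2 * _ = cabs h * (2 * (cabs h * expR (cabs h)))); last by ring.
rewrite ler_wpM2l ?cabs_ge0//; apply: le_trans (cexp_sub1 _) _.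
rewrite ler_wpM2l// ler_pM ?cabs_ge0 ?expR_ge0 ?cabs_scale01// ler_expR.
exact: cabs_scale01.
Qed.

Lemma is_derive_cexp (z : C) : is_derive z 1 (@cexp R : C -> C) (cexp z).
Proof.
apply: is_cderive_eps => e e0.
pose K := 4 * expR 1 * expR (reC z) : R.
have K0 : 0 < K by rewrite !mulr_gt0// expR_gt0.
exists (Num.min 1 (e / K)); first by rewrite lt_min ltr01 divr_gt0.
move=> h; rewrite lt_min => /andP[h1 hK].
rewrite [h *: 1]mulr1 cexpD.
rewrite (_ : _ - _ - _ = cexp z * (cexp h - 1 - h)); last by ring.
rewrite cabsM cabs_cexp.
apply: (@le_trans _ _ (K * cabs h * cabs h)).
  apply: (@le_trans _ _ (expR (reC z) * (4 * (cabs h ^+ 2 * expR (cabs h))))).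
    by rewrite ler_wpM2l ?expR_ge0// cexp_taylor1.
  rewrite [leRHS](_ : _ = expR (reC z) * (4 * (cabs h ^+ 2 * expR 1))); last first.
    by rewrite /K; ring.
  rewrite !ler_wpM2l ?expR_ge0// ?sqr_ge0// ler_expR; exact: ltW.
rewrite ler_wpM2r ?cabs_ge0// -ler_pdivlMl// mulrC; exact: ltW.
Qed.

Lemma differentiable_cexp (z : C) : differentiable (@cexp R : C -> C) z.
Proof. by apply/derivable1_diffP; have [] := is_derive_cexp z. Qed.

Lemma derive_cexp_comp (V : normedModType C) (F : V -> C) (z v : V) :
  differentiable F z ->
  ddir v (fun w => cexp (F w)) z = ddir v F z * cexp (F z).
Proof.
move=> dF.
have dc : differentiable (@cexp R : C -> C) (F z) by exact: differentiable_cexp.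
have dd : differentiable (fun w => cexp (F w)) z.
  exact: (@differentiable_comp _ _ _ _ F (@cexp R : C -> C)).
have lin1 (L : {linear C -> C}) x : L x = x * L 1.
  by rewrite -[X in L X](mulr1 x) -[x * 1]/(x *: 1) linearZ.
rewrite /ddir !deriveE//.
have := @diff_comp _ _ _ _ F (@cexp R : C -> C) z dF dc.
move=> /(congr1 (fun f => f v)) /= E.
transitivity ('d (@cexp R : C -> C) (F z) ('d F z v)); first exact: E.
rewrite lin1; congr (_ * _).
by have [_ <-] := is_derive_cexp (F z); rewrite deriveE.
Qed.

End ComplexDerivatives.

Section ComplexSmooth.
Variable R : realType.
Local Notation C := (Cplx R).

(** Holomorphy with the iterated directional derivatives built in. [cauchy_dir] bounds a first
    derivative by means of a third one, and differentiation under a functional uses a second one, so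
    the class has to be stable under [ddir]. *)
Fixpoint csm (V : normedModType C) n (F : V -> C) : Prop :=
  if n is n'.+1 then (forall z, differentiable F z) /\ (forall v, csm n' (ddir v F))
  else True.

Definition csmooth (V : normedModType C) (F : V -> C) := forall n, csm n F.

Lemma csm_succ (V : normedModType C) n (F : V -> C) :
  csm n.+1 F <-> (forall z, differentiable F z) /\ (forall v, csm n (ddir v F)).
Proof. by []. Qed.

Lemma csmS (V : normedModType C) n (F : V -> C) : csm n.+1 F -> csm n F.
Proof.
elim: n F => [//|n IH] F /csm_succ[dF DF]; apply/csm_succ; split=> // v; apply: IH; exact: DF.
Qed.

Lemma csmooth_diff (V : normedModType C) (F : V -> C) z :
  csmooth F -> differentiable F z.
Proof. by move=> /(_ 1)[]. Qed.

Lemma csmooth_D (V : normedModType C) (F : V -> C) v :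
  csmooth F -> csmooth (ddir v F).
Proof. by move=> h n; have [_] := h n.+1; apply. Qed.

(** [csmooth] as a greatest fixed point. It serves for functions z |-> l (k (z, .)), whose
    derivatives have the same form with another kernel. *)
Lemma csmooth_coind (V : normedModType C) (P : (V -> C) -> Prop) :
  (forall F, P F -> (forall z, differentiable F z) /\ forall v, P (ddir v F)) ->
  forall F, P F -> csmooth F.
Proof.
move=> H F PF n; elim: n F PF => [//|n IH] F PF.
by have [dF DF] := H F PF; apply/csm_succ; split=> // v; apply/IH/DF.
Qed.

Lemma csm_cst (V : normedModType C) n (c : C) : csm n (fun _ : V => c).
Proof.
elim: n c => [//|n IH] c; apply/csm_succ; split=> [z|v].
  exact: differentiable_cst.
rewrite (_ : ddir v _ = fun=> 0); first exact: IH.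
by apply/funext => z; exact: derive_cst.
Qed.

Lemma csmooth_cst (V : normedModType C) (c : C) : csmooth (fun _ : V => c).
Proof. by move=> n; exact: csm_cst. Qed.

Lemma csm_add (V : normedModType C) n (F G : V -> C) :
  csm n F -> csm n G -> csm n (fun z => F z + G z).
Proof.
elim: n F G => [//|n IH] F G /csm_succ[dF DF] /csm_succ[dG DG]; apply/csm_succ; split=> [z|v].
  exact: differentiableD.
rewrite (_ : ddir v _ = fun z => ddir v F z + ddir v G z); first exact: IH.
by apply/funext => z; apply: deriveD; exact: diff_derivable.
Qed.

Lemma derive_mulE (V : normedModType C) (F G : V -> C) v z :
  differentiable F z -> differentiable G z ->
  ddir v (fun z => F z * G z) z = F z * ddir v G z + G z * ddir v F z.
Proof. by move=> dF dG; apply: deriveM; exact: diff_derivable. Qed.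

Lemma csm_mul (V : normedModType C) n (F G : V -> C) :
  csm n F -> csm n G -> csm n (fun z => F z * G z).
Proof.
elim: n F G => [//|n IH] F G /csm_succ[dF DF] /csm_succ[dG DG]; apply/csm_succ; split=> [z|v].
  exact: differentiableM.
rewrite (_ : ddir v _ = fun z => F z * ddir v G z + G z * ddir v F z); last first.
  by apply/funext => z; exact: derive_mulE.
by apply: csm_add; apply: IH => //; apply: csmS; apply/csm_succ; split.
Qed.

Lemma csm_cexp (V : normedModType C) n (F : V -> C) :
  csm n F -> csm n (fun z => cexp (F z)).
Proof.
elim: n F => [//|n IH] F /csm_succ[dF DF]; apply/csm_succ; split=> [z|v].
  apply: (@differentiable_comp _ _ _ _ F (@cexp R : C -> C)) => //.
  exact: differentiable_cexp.
rewrite (_ : ddir v _ = fun z => ddir v F z * cexp (F z)); last first.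
  by apply/funext => z; exact: derive_cexp_comp.
by apply: csm_mul => //; apply/IH/csmS/csm_succ; split.
Qed.

Lemma csmoothD (V : normedModType C) (F G : V -> C) :
  csmooth F -> csmooth G -> csmooth (fun z => F z + G z).
Proof. by move=> f g n; exact: csm_add. Qed.
Lemma csmoothM (V : normedModType C) (F G : V -> C) :
  csmooth F -> csmooth G -> csmooth (fun z => F z * G z).
Proof. by move=> f g n; exact: csm_mul. Qed.
Lemma csmooth_cexp (V : normedModType C) (F : V -> C) :
  csmooth F -> csmooth (fun z => cexp (F z)).
Proof. by move=> f n; exact: csm_cexp. Qed.
Lemma csmoothZ (V : normedModType C) (c : C) (F : V -> C) :
  csmooth F -> csmooth (fun z => c * F z).
Proof. by move=> f; apply: csmoothM => //; exact: csmooth_cst. Qed.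
Lemma csmoothN (V : normedModType C) (F : V -> C) :
  csmooth F -> csmooth (fun z => - F z).
Proof.
move=> f; rewrite (_ : (fun _ => _) = fun z => (-1) * F z); first exact: csmoothZ.
by apply/funext => z; rewrite mulN1r.
Qed.
Lemma csmoothB (V : normedModType C) (F G : V -> C) :
  csmooth F -> csmooth G -> csmooth (fun z => F z - G z).
Proof. by move=> f g; apply: csmoothD => //; exact: csmoothN. Qed.
Lemma csmoothX (V : normedModType C) n (F : V -> C) :
  csmooth F -> csmooth (fun z => F z ^+ n).
Proof.
move=> f; elim: n => [|n IH]; first exact: csmooth_cst.
by under eq_fun do rewrite exprS; exact: csmoothM.
Qed.
Lemma csmooth_sum (V : normedModType C) (I : Type) (r : seq I) (F : I -> V -> C) :
  (forall i, csmooth (F i)) -> csmooth (fun z => \sum_(i <- r) F i z).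
Proof.
move=> f; elim: r => [|i r IH].
  by under eq_fun do rewrite big_nil; exact: csmooth_cst.
by under eq_fun do rewrite big_cons; exact: csmoothD.
Qed.

Lemma derive_line (V W : normedModType C) (L : V -> W) (F : W -> C) (z v : V) (v' : W) :
  (forall h : C, L (h *: v + z) = h *: v' + L z) ->
  ddir v (fun w => F (L w)) z = ddir v' F (L z).
Proof.
move=> H; rewrite /ddir /derive (_ : (fun h : C => _) =
  (fun h : C => h^-1 *: ((F \o shift (L z)) (h *: v') - F (L z))))//.
by apply/funext => h /=; rewrite H.
Qed.

Lemma csm_affine (V W : normedModType C) (L : {linear V -> W}) (c : W) n
    (F : W -> C) : continuous L -> csm n F -> csm n (fun v => F (L v + c)).
Proof.
move=> cL; elim: n F => [//|n IH] F /csm_succ[dF DF]; apply/csm_succ; split=> [z|v].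
  have dL : differentiable (fun v => L v + c) z.
    apply: differentiableD; last exact: differentiable_cst.
    exact: linear_differentiable.
  exact: (@differentiable_comp _ _ _ _ (fun v => L v + c) F).
rewrite (_ : ddir v _ = fun z => ddir (L v) F (L z + c)); first exact: (IH (ddir (L v) F)).
apply/funext => z; apply: (@derive_line _ _ (fun v => L v + c)) => h.
by rewrite linearD linearZ addrA.
Qed.

Lemma csmooth_affine (V W : normedModType C) (L : {linear V -> W}) (c : W)
    (F : W -> C) : continuous L -> csmooth F -> csmooth (fun v => F (L v + c)).
Proof. by move=> cL h n; exact: csm_affine. Qed.

Lemma csmooth_linear (V : normedModType C) (L : {linear V -> C}) :
  continuous L -> csmooth L.
Proof.
move=> cL [//|n]; apply/csm_succ; split=> [z|v]; first exact: linear_differentiable.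
rewrite (_ : ddir v _ = fun=> L v); first exact: csm_cst.
apply/funext => z; rewrite /ddir deriveE; first by rewrite diff_lin.
exact: linear_differentiable.
Qed.

End ComplexSmooth.

(** * Norms on R^d and C^d *)

Section Norms.
Variable R : realType.
Local Notation C := (Cplx R).

(** Sums of moduli in place of the Euclidean norms of the statement: the triangle inequality and the
    bounds of bilinear forms become coordinatewise, and unit vectors have norm 1. [cenorm_le_nC],
    [nC_le_cenorm], [enorm_le_nR] and [nR_le_enorm] compare the two, with a factor d in one
    direction. *)
Definition nR d (x : 'rV[R]_d) : R := \sum_j `|x 0 j|.
Definition nC d (z : 'rV[C]_d) : R := \sum_j cabs (z 0 j).

Lemma nR_ge0 d (x : 'rV[R]_d) : 0 <= nR x. Proof. exact: sumr_ge0. Qed.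
Lemma nC_ge0 d (x : 'rV[C]_d) : 0 <= nC x.
Proof. by apply: sumr_ge0 => j _; exact: cabs_ge0. Qed.
Lemma nR0 d : nR (0 : 'rV[R]_d) = 0.
Proof. by rewrite /nR big1// => j _; rewrite mxE normr0. Qed.
Lemma nC0 d : nC (0 : 'rV[C]_d) = 0.
Proof. by rewrite /nC big1// => j _; rewrite mxE cabs0. Qed.
Lemma nRD d (x y : 'rV[R]_d) : nR (x + y) <= nR x + nR y.
Proof. by rewrite -big_split ler_sum// => j _; rewrite mxE ler_normD. Qed.
Lemma nCD d (x y : 'rV[C]_d) : nC (x + y) <= nC x + nC y.
Proof. by rewrite -big_split ler_sum// => j _; rewrite mxE cabsD. Qed.
Lemma nRN d (x : 'rV[R]_d) : nR (- x) = nR x.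
Proof. by apply: eq_bigr => j _; rewrite mxE normrN. Qed.
Lemma nCN d (x : 'rV[C]_d) : nC (- x) = nC x.
Proof. by apply: eq_bigr => j _; rewrite mxE cabsN. Qed.
Lemma nRBC d (x y : 'rV[R]_d) : nR (x - y) = nR (y - x).
Proof. by rewrite -nRN opprB. Qed.
Lemma nCBC d (x y : 'rV[C]_d) : nC (x - y) = nC (y - x).
Proof. by rewrite -nCN opprB. Qed.
Lemma nRZ d (a : R) (x : 'rV[R]_d) : nR (a *: x) = `|a| * nR x.
Proof. by rewrite /nR mulr_sumr; apply: eq_bigr => j _; rewrite mxE normrM. Qed.
Lemma nCZ d (a : C) (x : 'rV[C]_d) : nC (a *: x) = cabs a * nC x.
Proof. by rewrite /nC mulr_sumr; apply: eq_bigr => j _; rewrite mxE cabsM. Qed.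
Lemma nC_vecC d (x : 'rV[R]_d) : nC (vecC x) = nR x.
Proof. by apply: eq_bigr => j _; rewrite mxE cabs_toC. Qed.
Lemma nR_coord d (x : 'rV[R]_d) j : `|x 0 j| <= nR x.
Proof. by rewrite /nR (bigD1 j)//= lerDl sumr_ge0. Qed.
Lemma nC_coord d (x : 'rV[C]_d) j : cabs (x 0 j) <= nC x.
Proof. by rewrite /nC (bigD1 j)//= lerDl sumr_ge0// => i _; exact: cabs_ge0. Qed.
Lemma nR_le_dist d (x y : 'rV[R]_d) : nR x <= nR y + nR (x - y).
Proof. by rewrite -{1}(subrK y x) addrC nRD. Qed.
Lemma nC_le_dist d (x y : 'rV[C]_d) : nC x <= nC y + nC (x - y).
Proof. by rewrite -{1}(subrK y x) addrC nCD. Qed.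
Lemma nR_tri d (x y z : 'rV[R]_d) : nR (x - z) <= nR (x - y) + nR (y - z).
Proof. by rewrite (_ : x - z = (x - y) + (y - z)) ?nRD// addrA subrK. Qed.

Lemma nR_eq0 d (x : 'rV[R]_d) : nR x = 0 -> x = 0.
Proof.
move=> x0; apply/rowP => j; rewrite mxE; apply/eqP; rewrite -normr_le0 -x0.
exact: nR_coord.
Qed.
Lemma nC_eq0 d (x : 'rV[C]_d) : nC x = 0 -> x = 0.
Proof.
move=> x0; apply/rowP => j; rewrite mxE; apply/eqP; rewrite -cabs_eq0 eq_le cabs_ge0.
by rewrite -x0 nC_coord.
Qed.
Lemma nC_delta d (j : 'I_d) : nC (delta_mx 0 j : 'rV[C]_d) = 1.
Proof.
rewrite /nC (bigD1 j)//= big1 ?addr0 ?mxE ?eqxx ?cabs1// => i ij.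
by rewrite mxE (negPf ij) andbF cabs0.
Qed.
Lemma nR_delta d (j : 'I_d) : nR (delta_mx 0 j : 'rV[R]_d) = 1.
Proof.
rewrite /nR (bigD1 j)//= big1 ?addr0 ?mxE ?eqxx ?normr1// => i ij.
by rewrite mxE (negPf ij) andbF normr0.
Qed.

Lemma mx_norm_coord (K : numFieldType) d (x : 'rV[K]_d) j : `|x 0 j| <= `|x|.
Proof.
have := lexx (mx_norm x); rewrite [in X in X <= _]mx_normE [in X in _ <= X]mx_normE num_le.
by move=> /bigmax_leP[_ /(_ (0, j) isT)]; rewrite -num_le.
Qed.

Lemma sumr_const_ord (K : pzRingType) n (c : K) : \sum_(i < n) c = n%:R * c.
Proof. by rewrite sumr_const card_ord mulr_natl. Qed.

Lemma nC_mx_norm d (z : 'rV[C]_d) : toC (nC z) <= d%:R * `|z|.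
Proof.
rewrite toC_sum (@le_trans _ _ (\sum_(j < d) `|z|))//.
  by apply: ler_sum => j _; rewrite -Cnorm mx_norm_coord.
by rewrite sumr_const_ord.
Qed.

Lemma nR_mx_norm d (z : 'rV[R]_d) : nR z <= d%:R * `|z|.
Proof.
rewrite (@le_trans _ _ (\sum_(j < d) `|z|))//.
  by apply: ler_sum => j _; rewrite mx_norm_coord.
by rewrite sumr_const_ord.
Qed.

Lemma mx_norm_nC d (z : 'rV[C]_d) : `|z| <= toC (nC z).
Proof.
have [->|/mx_norm_neq0[[i j] zij]] := eqVneq `|z| 0.
  by rewrite -toC0 toC_le nC_ge0.
by rewrite [leLHS]zij /= ord1 Cnorm toC_le nC_coord.
Qed.

Lemma mx_norm_nR d (z : 'rV[R]_d) : `|z| <= nR z.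
Proof.
rewrite [leLHS]/Num.norm /= mx_normrE; elim/big_ind : _ => [|a b ha hb|[i j] _ /=].
- exact: nR_ge0.
- by rewrite ge_max ha.
- by rewrite ord1 nR_coord.
Qed.

Lemma nbhs_nC d (z : 'rV[C]_d) (A : set 'rV[C]_d) :
  nbhs z A <-> exists2 r : R, 0 < r & forall w, nC (w - z) < r -> A w.
Proof.
split=> [/nbhs_Cball[r r0 H]|[r r0 H]].
  by exists r => // w wr; apply: H; apply: le_lt_trans (mx_norm_nC _) _; rewrite toC_lt.
apply/nbhs_Cball; exists (r / d.+1%:R); first by rewrite divr_gt0.
move=> w wr; apply: H; rewrite -toC_lt; apply: le_lt_trans (nC_mx_norm _) _.
have d0 : 0 < d.+1%:R :> C by rewrite ltr0n.
apply: (@le_lt_trans _ _ (d.+1%:R * `|w - z|)); first by rewrite ler_wpM2r// ler_nat.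
by rewrite -ltr_pdivlMl// mulrC -toCnat -toCV -toCM.
Qed.

Lemma nbhs_nR d (z : 'rV[R]_d) (A : set 'rV[R]_d) :
  nbhs z A <-> exists2 r : R, 0 < r & forall w, nR (w - z) < r -> A w.
Proof.
split=> [/nbhs_ballP[r r0 H]|[r r0 H]].
  exists r => // w wr; apply: H; rewrite -ball_normE /= distrC.
  exact: le_lt_trans (mx_norm_nR _) _.
apply/nbhs_ballP; exists (r / d.+1%:R); first by rewrite /= divr_gt0.
move=> w; rewrite -ball_normE /= distrC => wr; apply: H.
apply: le_lt_trans (nR_mx_norm _) _.
have d0 : 0 < d.+1%:R :> R by rewrite ltr0n.
apply: (@le_lt_trans _ _ (d.+1%:R * `|w - z|)); first by rewrite ler_wpM2r// ler_nat.
by rewrite -ltr_pdivlMl// mulrC.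
Qed.

End Norms.

(** * Cauchy's estimate *)

Section Cauchy.
Variable R : realType.
Local Notation C := (Cplx R).

Lemma derive_dirZ (V : normedModType C) (F : V -> C) z v (k : C) :
  differentiable F z -> ddir (k *: v) F z = k * ddir v F z.
Proof. by move=> dF; rewrite /ddir !deriveE// linearZ. Qed.

Lemma derive_dirD (V : normedModType C) (F : V -> C) z v w :
  differentiable F z -> ddir (v + w) F z = ddir v F z + ddir w F z.
Proof. by move=> dF; rewrite /ddir !deriveE// linearD. Qed.

Lemma taylor1_dir (V : normedModType C) (F : V -> C) (z w : V) (B : R) :
  csmooth F ->
  (forall t : R, 0 <= t <= 1 -> cabs (ddir w (ddir w F) (z + toC t *: w)) <= B) ->
  cabs (F (z + w) - F z - ddir w F z) <= 4 * B.
Proof.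
move=> sF HB.
have := @mvt_cplx R (fun t => F (z + toC t *: w) + (-1) * (toC t * ddir w F z))
  (fun t => ddir w F (z + toC t *: w) + (-1) * ddir w F z) 0 1 (2 * B) ler01.
rewrite toC1 toC0 mul1r mul0r scale1r scale0r addr0 subr0 mulr1 mulr0 addr0 mulN1r.
rewrite addrAC => H; have -> : 4 * B = 2 * (2 * B) by ring.
apply: H => t /andP[t0 t1]; split.
  apply: rderivD; first by apply: rderiv_diff; exact: csmooth_diff.
  exact: rderiv_linN.
have := @mvt_cplx R (fun s => ddir w F (z + toC s *: w))
  (fun s => ddir w (ddir w F) (z + toC s *: w)) 0 t B t0.
rewrite toC0 scale0r addr0 subr0 => H; apply: le_trans (H _) _.
  move=> s /andP[s0 st]; split; first by apply: rderiv_diff; exact/csmooth_diff/csmooth_D.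
  by apply: HB; rewrite s0 (le_trans st).
rewrite ler_piMr// mulr_ge0//.
by apply: le_trans (HB 0 _); rewrite ?cabs_ge0 ?lexx ?ler01.
Qed.

Lemma cabs_dist (z w : C) : `|cabs z - cabs w| <= cabs (z - w).
Proof.
rewrite ler_norml; apply/andP; split.
  by rewrite lerBrDr addrC lerBlDr addrC (cabsBC z) addrC cabs_le_dist.
by rewrite lerBlDr addrC cabs_le_dist.
Qed.

Lemma continuous_curve_eps (V : normedModType C) (F : V -> C) (z v : V) (a0 b0 e : R) :
  (forall w, differentiable F w) -> 0 < e -> exists2 r : R, 0 < r & forall a b,
  `|a - a0| < r -> `|b - b0| < r ->
  cabs (F (z + mkC a0 b0 *: v) - F (z + mkC a b *: v)) < e.
Proof.
move=> dF e0; set z0 := z + mkC a0 b0 *: v.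
have Fc : {for z0, continuous F} by exact: differentiable_continuous.
have /nbhs_Cball[r r0 Hr] : nbhs z0 [set w | `|F z0 - F w| < toC e].
  by move/cvgrPdist_lt : Fc; apply; rewrite -toC0 toC_lt.
have /Cge0_re[vE v0] : 0 <= `|v| by [].
set K := reC `|v| in vE v0.
have K0 : 0 < K + 1 by rewrite ltr_wpDl.
exists (r / (K + 1) / 2); first by rewrite !divr_gt0.
move=> a b ha hb; have := Hr (z + mkC a b *: v).
have -> : z + mkC a b *: v - z0 = mkC (a - a0) (b - b0) *: v.
  rewrite /z0 opprD addrACA subrr add0r -scalerBl.
  have -> // : mkC (a - a0) (b - b0) = mkC a b - mkC a0 b0.
  by apply: complexP; rewrite ?(reCB, imCB).
rewrite normrZ vE Cnorm -toCM toC_lt => H.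
suff /H : cabs (mkC (a - a0) (b - b0)) * K < r by rewrite /= Cnorm toC_lt.
apply: (@le_lt_trans _ _ (cabs (mkC (a - a0) (b - b0)) * (K + 1))).
  by rewrite ler_wpM2l ?cabs_ge0// lerDl.
rewrite -ltr_pdivlMr//; apply: le_lt_trans (cabs_reim _) _.
by rewrite reC_mkC imC_mkC [ltRHS]splitr ltrD.
Qed.

Lemma continuous_cabs_curve (V : normedModType C) (F : V -> C) (z v : V) :
  (forall w, differentiable F w) ->
  continuous (fun p : R * R => cabs (F (z + mkC p.1 p.2 *: v))).
Proof.
move=> dF p; apply/cvgrPdist_lt => e e0.
have [r r0 H] := continuous_curve_eps z v p.1 p.2 dF e0.
exists ([set a | `|a - p.1| < r], [set b | `|b - p.2| < r]).
  by split; apply/nbhs_ballP; exists r => // a; rewrite /ball /= distrC.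
by move=> [a b] [/= ha hb]; apply: le_lt_trans (cabs_dist _ _) _; exact: H.
Qed.

(** The extreme value theorem is applied on the square of side 2 r containing the disc, to the
    modulus as a function of the two real coordinates of [k]. *)
Lemma bounded_disc (V : normedModType C) (F : V -> C) (z v : V) (r : R) :
  0 <= r -> (forall w, differentiable F w) ->
  exists2 B, 0 <= B & forall k : C, cabs k <= r -> cabs (F (z + k *: v)) <= B.
Proof.
move=> r0 dF.
pose A := [set p : R * R | p.1 \in `[(-r), r] /\ p.2 \in `[(-r), r]].
have AE : A = `[(-r), r]%classic `*` `[(-r), r]%classic by [].
have rr : -r <= r by rewrite (le_trans _ r0)// oppr_le0.
have [] := @compact_EVT_max _ R (fun p : R * R => cabs (F (z + mkC p.1 p.2 *: v))) A.
- by exists (r, r); split; rewrite /= in_itv /= lexx rr.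
- by rewrite AE; apply: compact_setX; exact: segment_compact.
- by apply: continuous_subspaceT; exact: continuous_cabs_curve.
move=> c Ac H; exists (cabs (F (z + mkC c.1 c.2 *: v))); first exact: cabs_ge0.
move=> k kr; have := H (reC k, imC k) _; rewrite (_ : mkC _ _ = k); last exact: complexP.
apply; rewrite inE; split; rewrite in_itv /= -ler_norml.
- exact: le_trans (cabs_re _) kr.
- exact: le_trans (cabs_im _) kr.
Qed.

Lemma root_of_unity_near1 (e : R) : 0 < e -> exists N (w : C),
  [/\ (0 < N)%N, w ^+ N = 1, w != 1, cabs w = 1 & cabs (w - 1) <= e].
Proof.
move=> e0; pose K := 2 * (2 * pi * expR (2 * pi)) : R.
have K0 : 0 < K by rewrite !mulr_gt0 ?pi_gt0 ?expR_gt0.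
(* At least 4, so that the angle 2 pi / N lies strictly between 0 and pi: then [w] has a positive
   imaginary part, whence [w != 1]. *)
pose N := (Num.truncn (K / e)).+4.
have N0 : 0 < N%:R :> R by rewrite ltr0n.
pose a := 2 * pi / N%:R : R.
have a0 : 0 < a by rewrite divr_gt0// mulr_gt0// pi_gt0.
have aN : a <= 2 * pi by rewrite ler_pdivrMr// ler_peMr ?ler1n// mulr_ge0// pi_ge0.
have cabsa : cabs (Complex 0 a : C) = a.
  by rewrite cabsE /= expr0n add0r sqrtr_sqr gtr0_norm.
exists N, (cexp (Complex 0 a)); split => //.
- rewrite cexpX (_ : N%:R * _ = Complex 0 (2 * pi)); last first.
    rewrite -toCnat; apply: complexP; rewrite ?reCM ?imCM /= ?mulr0 ?mul0r ?subr0 ?addr0//.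
    by rewrite /a mulrC divfK// gt_eqF.
  apply: complexP; rewrite /= expR0 mul1r mulr_natl ?cos2pi ?sin2pi//.
- apply/eqP => /(congr1 (@imC R)) /=; rewrite expR0 mul1r => /eqP.
  rewrite gt_eqF// sin_gt0_pi// a0 /= /a ltr_pdivrMr// mulrC ltr_pM2l ?pi_gt0//.
  by rewrite ltr_nat.
- by rewrite cabs_cexp /= expR0.
- apply: le_trans (cexp_sub1 _) _; rewrite cabsa.
  apply: (@le_trans _ _ (K / N%:R)).
    rewrite /K (_ : 2 * (2 * pi * expR (2 * pi)) / N%:R = 2 * (a * expR (2 * pi))); last first.
      by rewrite /a; ring.
    by rewrite ler_pM2l// ler_pM2l// ler_expR.
  rewrite ler_pdivrMr// mulrC -ler_pdivrMr//.
  apply: le_trans (ltW (truncnS_gt _)) _; by rewrite ler_nat /N; do 3 apply: leqW.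
Qed.

Lemma derive_mulZ (V : normedModType C) (G : V -> C) (k : C) v z :
  differentiable G z -> ddir v (fun x => k * G x) z = k * ddir v G z.
Proof.
move=> dG; rewrite (@derive_mulE _ _ (fun=> k))//.
by rewrite /ddir (derive_cst k) mulr0 addr0.
Qed.

Lemma derive2_dirZ (V : normedModType C) (p : V -> C) (h : C) v z :
  csmooth p -> ddir (h *: v) (ddir (h *: v) p) z = h ^+ 2 * ddir v (ddir v p) z.
Proof.
move=> sp.
have -> : ddir (h *: v) p = fun x => h * ddir v p x.
  by apply/funext => x; rewrite derive_dirZ//; exact: csmooth_diff.
rewrite derive_mulZ; last exact/csmooth_diff/csmooth_D.
rewrite derive_dirZ; last exact/csmooth_diff/csmooth_D.
by rewrite expr2 mulrA.
Qed.

Lemma taylor1_line (V : normedModType C) (p : V -> C) (z v : V) (r B : R) (k l : C) :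
  csmooth p ->
  (forall k : C, cabs k <= r -> cabs (ddir v (ddir v p) (z + k *: v)) <= B) ->
  cabs k <= r -> cabs l <= r ->
  cabs (p (z + l *: v) - p (z + k *: v) - (l - k) * ddir v p (z + k *: v)) <=
    4 * (cabs (l - k) ^+ 2 * B).
Proof.
move=> sp HB kr lr.
have := @taylor1_dir V p (z + k *: v) ((l - k) *: v) (cabs (l - k) ^+ 2 * B) sp.
rewrite (_ : z + k *: v + (l - k) *: v = z + l *: v); last first.
  by rewrite -addrA -scalerDl addrCA subrr addr0.
rewrite derive_dirZ; last exact: csmooth_diff.
apply => t t01; rewrite derive2_dirZ// cabsM cabsX ler_wpM2l ?sqr_ge0//.
rewrite scalerA -addrA -scalerDl; apply: HB.
have -> : k + toC t * (l - k) = toC (1 - t) * k + toC t * l by rewrite toCB toC1; ring.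
case/andP: t01 => t0 t1; apply: le_trans (cabsD _ _) _.
rewrite !cabsM !cabs_toC !ger0_norm ?subr_ge0//.
have -> : r = (1 - t) * r + t * r by ring.
by apply: lerD; rewrite ler_wpM2l// subr_ge0.
Qed.

(** Discrete form of the vanishing of the integral of a derivative around a circle. By Taylor, t (w
    - 1) w^k p' at the k-th vertex is the increment of p to the next vertex, up to a second-order
    error, and the increments telescope to 0 since w^N = 1. Division by t (w - 1) follows, so t = 0
    is treated apart: there the powers of w sum to 0. *)
Lemma average_circle_derive (V : normedModType C) (p : V -> C) (z v : V) (r B : R) N (w : C) :
  csmooth p -> w ^+ N = 1 -> w != 1 -> cabs w = 1 -> 0 <= B ->
  (forall k : C, cabs k <= r -> cabs (ddir v (ddir v p) (z + k *: v)) <= B) ->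
  forall t : R, 0 <= t <= r ->
  cabs (\sum_(k < N) w ^+ k * ddir v p (z + (toC t * w ^+ k) *: v)) <=
    4 * N%:R * r * B * cabs (w - 1).
Proof.
move=> sp wN w1 aw B0 HB t /andP[].
have cw k : cabs (w ^+ k) = 1 by rewrite cabsX aw expr1n.
have cw0 : 0 < cabs (w - 1) by rewrite lt_def cabs_ge0 cabs_eq0 subr_eq0 w1.
rewrite le_eqVlt => /orP[/eqP<- r0|t0 tr].
  under eq_bigr do rewrite toC0 mul0r scale0r addr0.
  rewrite -mulr_suml (_ : \sum_(i < N) w ^+ i = 0).
    by rewrite mul0r cabs0 !mulr_ge0// ltW.
  have w10 : w - 1 != 0 by rewrite subr_eq0.
  by apply: (mulfI w10); rewrite mulr0 -subrX1 wN subrr.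
have ct k : cabs (toC t * w ^+ k) <= r by rewrite cabsM cw mulr1 cabs_toC gtr0_norm.
pose q k := p (z + (toC t * w ^+ k) *: v).
pose q' k := ddir v p (z + (toC t * w ^+ k) *: v).
have tel : \sum_(k < N) (q k.+1 - q k) = 0.
  rewrite -(big_mkord xpredT (fun k => q k.+1 - q k)) telescope_sumr//.
  by rewrite /q wN expr0 subrr.
have rem k : cabs (q k.+1 - q k - toC t * (w - 1) * (w ^+ k * q' k))
    <= 4 * (t ^+ 2 * cabs (w - 1) ^+ 2 * B).
  have := @taylor1_line V p z v r B _ _ sp HB (ct k) (ct k.+1).
  have -> : toC t * w ^+ k.+1 - toC t * w ^+ k = toC t * (w - 1) * w ^+ k.
    by rewrite exprS; ring.
  rewrite !cabsM cw mulr1 cabs_toC gtr0_norm// exprMn -/(q _) -/(q _) -/(q' _).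
  by rewrite -[in X in X -> _](mulrA (toC t * (w - 1))).
have E : toC t * (w - 1) * (\sum_(k < N) w ^+ k * q' k) =
    - \sum_(k < N) (q k.+1 - q k - toC t * (w - 1) * (w ^+ k * q' k)).
  by rewrite sumrB tel sub0r opprK mulr_sumr.
have : cabs (toC t * (w - 1) * (\sum_(k < N) w ^+ k * q' k))
    <= N%:R * (4 * (t ^+ 2 * cabs (w - 1) ^+ 2 * B)).
  rewrite E cabsN; apply: le_trans (cabs_sum _ _ _) _.
  apply: le_trans (ler_sum _ (fun (k : 'I_N) _ => rem k)) _.
  by rewrite sumr_const_ord.
rewrite cabsM cabsM cabs_toC gtr0_norm// -ler_pdivlMl ?mulr_gt0// => H1.
apply: le_trans H1 _.
rewrite (_ : (t * cabs (w - 1))^-1 * _ = 4 * N%:R * t * B * cabs (w - 1)); last first.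
  by field; rewrite !gt_eqF.
by rewrite ler_wpM2r ?(ltW cw0)// ler_wpM2r// ler_wpM2l// mulr_ge0.
Qed.

(** The radial derivative of the sum over the vertices is the sum estimated in
    [average_circle_derive]; the mean value theorem from 0 to s then gives the mean value property
    up to O(|w - 1|). *)
Lemma average_circle (V : normedModType C) (p : V -> C) (z v : V) (r B : R) N (w : C) :
  csmooth p -> w ^+ N = 1 -> w != 1 -> cabs w = 1 -> 0 <= B ->
  (forall k : C, cabs k <= r -> cabs (ddir v (ddir v p) (z + k *: v)) <= B) ->
  forall s : R, 0 <= s <= r ->
  cabs ((\sum_(k < N) p (z + (toC s * w ^+ k) *: v)) - N%:R * p z) <=
    8 * N%:R * r ^+ 2 * B * cabs (w - 1).
Proof.
move=> sp wN w1 aw B0 HB s /andP[s0 sr].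
have r0 : 0 <= r := le_trans s0 sr.
have := @mvt_cplx R (fun t => \sum_(k < N) p (z + toC t *: (w ^+ k *: v)))
  (fun t => \sum_(k < N) w ^+ k * ddir v p (z + toC t *: (w ^+ k *: v))) 0 s
  (4 * N%:R * r * B * cabs (w - 1)) s0.
rewrite subr0 => M.
rewrite (_ : \sum_(k < N) p (z + (toC s * w ^+ k) *: v) =
  \sum_(k < N) p (z + toC s *: (w ^+ k *: v))); last first.
  by apply: eq_bigr => k _; rewrite scalerA.
rewrite (_ : N%:R * p z = \sum_(k < N) p (z + toC 0 *: (w ^+ k *: v))); last first.
  under eq_bigr do rewrite toC0 scale0r addr0.
  by rewrite sumr_const_ord.
apply: le_trans (M _) _.
  move=> t /andP[t0 ts]; split.
    apply: rderiv_sum => k; rewrite -derive_dirZ; last exact: csmooth_diff.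
    by apply: rderiv_diff; exact: csmooth_diff.
  under eq_bigr do rewrite scalerA.
  by apply: average_circle_derive => //; rewrite t0 (le_trans ts).
rewrite (_ : 8 * _ * _ * _ * _ = 2 * (4 * N%:R * r * B * cabs (w - 1)) * r); last by ring.
by rewrite ler_wpM2l// !mulr_ge0// cabs_ge0.
Qed.

(* No contour integral: means over the vertices of a regular polygon replace it, their
   distance to the value at the centre being [O(|w - 1|)] by telescoping. *)
Lemma cauchy_dir (V : normedModType C) (F : V -> C) (z v : V) (r M : R) :
  csmooth F -> 0 < r -> (forall k : C, cabs k <= r -> cabs (F (z + k *: v)) <= M) ->
  cabs (ddir v F z) <= M / r.
Proof.
move=> sF r0 HM.
have [B B0 HB] := @bounded_disc V (ddir v (ddir v (ddir v F))) z v r (ltW r0)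
  (fun w => csmooth_diff w (csmooth_D v (csmooth_D v (csmooth_D v sF)))).
have M0 : 0 <= M by apply: le_trans (HM 0 _); rewrite ?cabs_ge0 ?cabs0 ?ltW.
(* [e] bounds |w - 1|, that is, the fineness of the polygon; it tends to 0. *)
suff H e : 0 < e -> r * cabs (ddir v F z) <= M + 16 * r ^+ 3 * B * e.
  rewrite ler_pdivlMr// mulrC; apply/ler_addgt0Pl => e e0.
  have K0 : 0 < 16 * r ^+ 3 * B + 1 by rewrite ltr_wpDl// !mulr_ge0// ltW// exprn_gt0.
  apply: le_trans (H (e / (16 * r ^+ 3 * B + 1)) _) _; first by rewrite divr_gt0.
  by rewrite (addrC e) lerD2l mulrA ler_pdivrMr// (mulrC e) ler_wpM2r ?(ltW e0)// lerDl.
move=> e0; have [N [w [N0 wN w1 aw we]]] := root_of_unity_near1 e0.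
have cw k : cabs (w ^+ k) = 1 by rewrite cabsX aw expr1n.
have w0 : w != 0 by rewrite -cabs_eq0 aw oner_eq0.
have wk k : w ^+ k != 0 by rewrite expf_neq0.
have NR0 : 0 < N%:R :> R by rewrite ltr0n.
have NC0 : N%:R != 0 :> C by rewrite pnatr_eq0 -lt0n.
have avg s : 0 <= s <= r ->
    cabs ((\sum_(k < N) ddir v F (z + (toC s * w ^+ k) *: v)) - N%:R * ddir v F z) <=
    8 * N%:R * r ^+ 2 * B * cabs (w - 1).
  by apply: average_circle => //; exact: csmooth_D.
(* The weights [(w ^+ k)^-1] turn the derivative of each summand into F' at a vertex, so the
   derivative of the curve is the sum of these values minus N F'(z), small by [average_circle] for
   F'. The curve vanishes at 0, as the powers of w^-1 sum to 0; at r it compares N r F'(z) with N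
   values of F. *)
have := @mvt_cplx R (fun t => (\sum_(k < N) (w ^+ k)^-1 * F (z + toC t *: (w ^+ k *: v)))
    + (- N%:R) * (toC t * ddir v F z))
  (fun t => (\sum_(k < N) ddir v F (z + toC t *: (w ^+ k *: v))) + (- N%:R) * ddir v F z) 0 r
  (8 * N%:R * r ^+ 2 * B * e) (ltW r0).
rewrite toC0 mul0r mulr0 addr0 subr0.
have -> : \sum_(k < N) (w ^+ k)^-1 * F (z + 0 *: (w ^+ k *: v)) = 0.
  under eq_bigr do rewrite scale0r addr0 -exprVn.
  rewrite -mulr_suml (_ : \sum_(i < N) w^-1 ^+ i = 0) ?mul0r//.
  have wV1 : w^-1 - 1 != 0 by rewrite subr_eq0 invr_eq1.
  by apply: (mulfI wV1); rewrite mulr0 -subrX1 exprVn wN invr1 subrr.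
rewrite subr0 => H.
have {}H := H _.
have {H} : cabs (\sum_(k < N) (w ^+ k)^-1 * F (z + toC r *: (w ^+ k *: v)) +
   - N%:R * (toC r * ddir v F z)) <= 2 * (8 * N%:R * r ^+ 2 * B * e) * r.
  apply: H => t t0r; split.
    apply: rderivD; last by apply: rderivZ; exact: rderiv_lin.
    apply: rderiv_sum => k.
    have -> : ddir v F (z + toC t *: (w ^+ k *: v)) =
      (w ^+ k)^-1 * ddir (w ^+ k *: v) F (z + toC t *: (w ^+ k *: v)).
      by rewrite derive_dirZ ?mulKf//; exact: csmooth_diff.
    by apply: rderivZ; apply: rderiv_diff; exact: csmooth_diff.
  rewrite mulNr; under eq_bigr do rewrite scalerA.
  apply: le_trans (avg t t0r) _.
  by rewrite ler_wpM2l// !mulr_ge0// ?sqr_ge0// ltW.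
move=> H.
have S : cabs (\sum_(k < N) (w ^+ k)^-1 * F (z + toC r *: (w ^+ k *: v))) <= N%:R * M.
  apply: le_trans (cabs_sum _ _ _) _; rewrite mulr_natl -[X in _ *+ X](card_ord N) -sumr_const.
  apply: ler_sum => k _; rewrite cabsM cabsV cw invr1 mul1r scalerA; apply: HM.
  by rewrite cabsM cw mulr1 cabs_toC gtr0_norm.
have : N%:R * (r * cabs (ddir v F z)) <= N%:R * (M + 16 * r ^+ 3 * B * e).
  rewrite -[X in X * (r * _)]cabs_nat -{1}(gtr0_norm r0) -cabs_toC -!cabsM.
  set a := N%:R * (_ * _) in H *.
  apply: le_trans (cabs_le_dist _ (\sum_(k < N) (w ^+ k)^-1 * F (z + toC r *: (w ^+ k *: v)))) _.
  rewrite mulNr in H; rewrite cabsBC mulrDr lerD//; apply: le_trans H _.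
  by rewrite le_eqVlt; apply/orP; left; apply/eqP; ring.
by rewrite ler_pM2l.
Qed.

End Cauchy.

(** * Powers, factorials and subexponential decay *)

Section RealPowers.
Variables (R : realType) (theta : R).
Hypotheses (theta_ge : 2^-1 <= theta) (theta_lt : theta < 1).
Local Notation p := (theta^-1).

Lemma theta_gt0 : 0 < theta. Proof. by apply: lt_le_trans theta_ge; rewrite invr_gt0. Qed.
Lemma p_gt1 : 1 < p. Proof. by rewrite invf_gt1// theta_gt0. Qed.
Lemma p_le2 : p <= 2.
Proof. by rewrite -[leRHS]invrK lef_pV2// posrE ?invr_gt0// theta_gt0. Qed.
Lemma p_gt0 : 0 < p. Proof. exact: lt_trans p_gt1. Qed.
Lemma p_neq0 : p != 0. Proof. by rewrite gt_eqF// p_gt0. Qed.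
Lemma theta_neq0 : theta != 0. Proof. by rewrite gt_eqF// theta_gt0. Qed.
Lemma p1_gt0 : 0 < p - 1. Proof. by rewrite subr_gt0 p_gt1. Qed.

Lemma powRpK (x : R) : 0 <= x -> (x `^ p) `^ theta = x.
Proof. by move=> x0; rewrite -powRrM mulVf ?theta_neq0// powRr1. Qed.
Lemma powRtK (x : R) : 0 <= x -> (x `^ theta) `^ p = x.
Proof. by move=> x0; rewrite -powRrM mulfV ?theta_neq0// powRr1. Qed.
Lemma powRp_le (x y : R) : 0 <= x -> x <= y -> x `^ p <= y `^ p.
Proof.
by move=> x0 xy; apply: (ge0_ler_powR (ltW p_gt0)); rewrite ?nnegrE ?(le_trans x0).
Qed.
Lemma powRt_le (x y : R) : 0 <= x -> x <= y -> x `^ theta <= y `^ theta.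
Proof.
by move=> x0 xy; apply: (ge0_ler_powR (ltW theta_gt0)); rewrite ?nnegrE ?(le_trans x0).
Qed.
(** The larger of the two terms is doubled, and 2^p <= 4 because theta >= 1/2. *)
Lemma powRp_add (x y : R) : 0 <= x -> 0 <= y -> (x + y) `^ p <= 4 * (x `^ p + y `^ p).
Proof.
move=> x0 y0.
have H z : 0 <= z -> (2 * z) `^ p <= 4 * z `^ p.
  move=> z0; rewrite powRM// ler_wpM2r ?powR_ge0//.
  apply: (@le_trans _ _ (2 `^ 2%:R)); last by rewrite powR_mulrn// expr2 -natrM.
  by apply: ler_powR; [rewrite ler1n|exact: p_le2].
have [xy|yx] := leP x y.
- apply: (@le_trans _ _ ((2 * y) `^ p)).
    by apply: powRp_le; [rewrite addr_ge0|rewrite mulr_natl mulr2n lerD2r].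
  by apply: le_trans (H _ y0) _; rewrite ler_wpM2l// lerDr powR_ge0.
- apply: (@le_trans _ _ ((2 * x) `^ p)).
    by apply: powRp_le; [rewrite addr_ge0|rewrite mulr_natl mulr2n lerD2l ltW].
  by apply: le_trans (H _ x0) _; rewrite ler_wpM2l// lerDl powR_ge0.
Qed.
Lemma powRp_le_sqr (x : R) : 0 <= x -> x `^ p <= 1 + x ^+ 2.
Proof.
move=> x0; have [x1|x1] := leP x 1.
  apply: (@le_trans _ _ 1); last by rewrite lerDl sqr_ge0.
  by have := powRp_le x0 x1; rewrite (powR1 _).
apply: (@le_trans _ _ (x `^ 2%:R)); first by apply: ler_powR; [exact: ltW|exact: p_le2].
by rewrite powR_mulrn// lerDr.
Qed.

Lemma powRpS (x : R) : 0 < x -> x `^ p = x `^ (p - 1) * x.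
Proof.
move=> x0; rewrite -[X in _ * X](powRr1 (ltW x0)) -powRD ?subrK//.
by rewrite (gt_eqF x0) implybT.
Qed.

(** As p > 1, x^(p - 1) exceeds 1 / e beyond the threshold K. Thus decay exp (- e |z|^p) always
    yields exponential decay, which makes integrals converge. *)
Lemma lin_le_powRp (e : R) : 0 < e -> exists2 K : R, 0 < K & forall x : R, 0 <= x ->
  x <= e * x `^ p + K.
Proof.
move=> e0; pose K := (e^-1) `^ ((p - 1)^-1).
have K0 : 0 < K by rewrite powR_gt0// invr_gt0.
exists K => // x x0; have [xK|Kx] := leP x K.
  by apply: (le_trans xK); rewrite lerDr mulr_ge0 ?powR_ge0// ltW.
rewrite -[leLHS]addr0 lerD ?(ltW K0)//.
have xpos : 0 < x by exact: lt_trans Kx.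
rewrite (powRpS xpos).
rewrite mulrA ler_peMl// -ler_pdivrMl// mulr1.
have -> : e^-1 = K `^ (p - 1).
  rewrite /K -powRrM mulVf ?powRr1//; last by rewrite gt_eqF// p1_gt0.
  by rewrite invr_ge0 ltW.
by apply: ge0_ler_powR; rewrite ?nnegrE// ?ltW// p1_gt0.
Qed.

(** Young's inequality for the conjugate exponents 1 / theta and 1 / (1 - theta), by comparing x
    with K n^theta. It trades a frequency x on a Cauchy ball of radius n^(1 - theta) for e x^p and a
    factor geometric in n. *)
Lemma young (e : R) : 0 < e -> exists2 K : R, 0 < K & forall n x : R, 0 <= n -> 0 <= x ->
  n `^ (1 - theta) * x <= e * x `^ p + K * n.
Proof.
move=> e0; pose K := (e^-1) `^ ((p - 1)^-1).
have K0 : 0 < K by rewrite powR_gt0// invr_gt0.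
have t1 : 1 - theta != 0 by rewrite subr_eq0 gt_eqF.
exists K => // n x n0 x0; have [->|nn0] := eqVneq n 0.
  by rewrite powR0// mul0r mulr0 addr0 mulr_ge0 ?powR_ge0// ltW.
have npos : 0 < n by rewrite lt_def nn0.
have [xK|Kx] := leP x (K * n `^ theta).
  apply: (@le_trans _ _ (K * n)); last by rewrite lerDr mulr_ge0 ?powR_ge0// ltW.
  apply: (@le_trans _ _ (n `^ (1 - theta) * (K * n `^ theta))).
    by rewrite ler_wpM2l ?powR_ge0.
  by rewrite mulrCA -powRD ?subrK ?powRr1// nn0 implybT.
apply: (@le_trans _ _ (e * x `^ p)); last by rewrite lerDl mulr_ge0 ?ltW.
have xpos : 0 < x by apply: le_lt_trans Kx; rewrite mulr_ge0 ?powR_ge0// ltW.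
rewrite (powRpS xpos).
rewrite mulrA ler_wpM2r//.
have -> : n `^ (1 - theta) = (n `^ theta) `^ (p - 1).
  by rewrite -powRrM mulrBr mulr1 mulfV ?theta_neq0.
rewrite -ler_pdivrMl// mulrC.
have -> : (n `^ theta) `^ (p - 1) * e^-1 = (K * n `^ theta) `^ (p - 1).
  rewrite powRM ?powR_ge0 ?(ltW K0)// [RHS]mulrC; congr (_ * _).
  rewrite /K -powRrM mulVf ?powRr1//; last by rewrite gt_eqF// p1_gt0.
  by rewrite invr_ge0 ltW.
by apply: ge0_ler_powR; rewrite ?nnegrE ?mulr_ge0 ?powR_ge0// ?ltW// p1_gt0.
Qed.

(** Errors quadratic in the Cauchy radius n^(1 - theta) stay linear in n, hence geometric after
    exponentiation, precisely because 2 (1 - theta) <= 1. *)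
Lemma nat_powR_sqr (n : nat) : (n%:R `^ (1 - theta)) ^+ 2 <= n%:R.
Proof.
case: n => [|n]; first by rewrite powR0 ?expr0n// subr_eq0 gt_eqF.
rewrite -powR_mulrn ?powR_ge0// -powRrM -[leRHS]powRr1//.
by apply: ler_powR; [rewrite ler1n|have := theta_ge; lra].
Qed.

(* [(k ^ k) ^ theta], with value 1 at 0, plays the role of [k! ^ theta]. *)
Definition kk (k : nat) : R := (k%:R ^+ k) `^ theta.

Lemma kk_ge0 k : 0 <= kk k. Proof. exact: powR_ge0. Qed.
Lemma kkE k : kk k = (k%:R `^ theta) ^+ k.
Proof.
by rewrite /kk -powR_mulrn// -powRrM mulrC powRrM powR_mulrn ?powR_ge0.
Qed.

(** The inequality t <= exp t at t = e x^p / k, raised to the power theta k. *)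
Lemma poly_growth (e : R) : 0 < e -> exists2 K : R, 0 < K & forall (k : nat) (x : R), 0 <= x ->
  x ^+ k <= K ^+ k * kk k * expR (e * x `^ p).
Proof.
move=> e0; exists (e^-1 `^ theta); first by rewrite powR_gt0// invr_gt0.
case=> [|k] x x0.
  rewrite !expr0 mul1r kkE expr0 mul1r -expR0 ler_expR mulr_ge0 ?powR_ge0//.
  exact: ltW.
set n := k.+1; have n0 : 0 < n%:R :> R by rewrite ltr0n.
set u := x `^ p; have u0 : 0 <= u by exact: powR_ge0.
have H : u <= e^-1 * n%:R * expR (e * u / n%:R).
  have -> : u = e^-1 * n%:R * (e * u / n%:R) by field; rewrite !gt_eqF.
  rewrite [in leRHS](_ : e^-1 * n%:R * (e * u / n%:R) = u); last by field; rewrite !gt_eqF.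
  rewrite ler_wpM2l ?mulr_ge0 ?invr_ge0 ?(ltW e0)//.
  by have := expR_ge1Dx (e * u / n%:R); apply: le_trans; rewrite lerDr.
have {}H : x <= e^-1 `^ theta * n%:R `^ theta * expR (theta * (e * u / n%:R)).
  rewrite -(powRpK x0) -/u mulrC (mulrC theta) expRM mulrC.
  rewrite -!powRM ?mulr_ge0 ?expR_ge0 ?invr_ge0 ?(ltW e0)//.
  exact: powRt_le.
apply: (@le_trans _ _ ((e^-1 `^ theta * n%:R `^ theta * expR (theta * (e * u / n%:R))) ^+ n)).
  by apply: lerXn2r; rewrite ?nnegrE ?mulr_ge0 ?expR_ge0 ?powR_ge0.
rewrite !exprMn kkE -expRM_natl ler_wpM2l ?mulr_ge0 ?exprn_ge0 ?powR_ge0//.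
rewrite ler_expR (_ : _ * _ = theta * (e * u)); last by field; rewrite gt_eqF.
by rewrite ler_piMl ?mulr_ge0// ltW.
Qed.

(** A converse to [poly_growth]. The order k is the integer part of T = (x / q)^p with q = c exp 1:
    then c k^theta <= x exp (-1), so the k-th bound gives M exp (- k), and k > T - 1. *)
Lemma decay_opt (c : R) : 0 < c -> exists2 e : R, 0 < e & forall (V M x : R),
  0 <= V -> 0 <= x -> (forall k, V * x ^+ k <= M * c ^+ k * kk k) ->
  V <= M * expR 1 * expR (- (e * x `^ p)).
Proof.
move=> c0; pose q := expR 1 * c; have q0 : 0 < q by rewrite mulr_gt0 ?expR_gt0.
exists (q^-1 `^ p); first by rewrite powR_gt0// invr_gt0.
move=> V M x V0 x0 H.
have VM : V <= M by have := H 0%N; rewrite kkE !expr0 !mulr1.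
have M0 := le_trans V0 VM.
have -> : q^-1 `^ p * x `^ p = (q^-1 * x) `^ p by rewrite powRM// invr_ge0 ltW.
set T := (q^-1 * x) `^ p; have T0 : 0 <= T by exact: powR_ge0.
have [x00|xn0] := eqVneq x 0.
  rewrite /T x00 mulr0 powR0 ?p_neq0// oppr0 expR0 mulr1 (le_trans VM)// ler_peMr//.
  by have := expR_ge1Dx (1 : R); apply: le_trans; rewrite lerDl.
have xpos : 0 < x by rewrite lt_def xn0.
set k := Num.truncn T; have /andP[kT Tk] := truncn_itv T0.
have kx : k%:R `^ theta <= q^-1 * x.
  rewrite -[leRHS]powRpK; last by rewrite mulr_ge0 ?invr_ge0// ltW.
  exact: powRt_le.
have := H k; rewrite -ler_pdivlMr ?exprn_gt0// => /le_trans; apply.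
apply: (@le_trans _ _ (M * expR (- k%:R))).
  rewrite -mulrA -mulrA ler_wpM2l// kkE -exprMn -exprVn -exprMn.
  have -> : expR (- k%:R) = (expR (-1)) ^+ k :> R by rewrite -expRM_natl mulrN1.
  apply: lerXn2r; rewrite ?nnegrE ?expR_ge0 ?mulr_ge0 ?invr_ge0 ?powR_ge0 ?(ltW c0)//.
  rewrite ler_pdivrMr// expRN; apply: (@le_trans _ _ (c * (q^-1 * x))).
    by rewrite ler_wpM2l// ltW.
  rewrite le_eqVlt; apply/orP; left; apply/eqP; rewrite /q; field.
  by rewrite !gt_eqF// expR_gt0.
rewrite -mulrA ler_wpM2l// -expRD ler_expR.
by move: Tk; rewrite -natr1 -/k; lra.
Qed.

Lemma expR_ge_pow_fact (x : R) k : 0 <= x -> x ^+ k <= k`!%:R * expR x.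
Proof.
move=> x0; rewrite -ler_pdivrMl ?ltr0n ?fact_gt0//.
have := nondecreasing_cvgn_le _ (@is_cvg_series_exp_coeff R x) k.+1.
rewrite -/(expR x) => H; apply: le_trans (H _); last first.
  by apply/nondecreasing_seqP => n; rewrite !seriesEnat/= big_nat_recr//= lerDl exp_coeff_ge0.
rewrite seriesEnat/= big_nat_recr//= exp_coeffE /= lerDr sumr_ge0// => i _.
by rewrite mulr_ge0 ?exprn_ge0// invr_ge0.
Qed.

(** With n = |a|, each factor of n^n = prod_j n^(a_j) is at most a_j! exp n, by the exponential
    series; there are d of them. *)
Lemma kk_mfact d (a : mindex d) : kk (mabs a) <= expR d%:R ^+ mabs a * (mfact a)%:R `^ theta.
Proof.
set n := mabs a.
have H : n%:R ^+ n <= expR d%:R ^+ n * (mfact a)%:R :> R.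
  rewrite {1}/n /mabs -prodrXr.
  have -> : expR d%:R ^+ n = \prod_(j < d) expR n%:R :> R.
    by rewrite prodr_const card_ord -!expRM_natl mulrC.
  rewrite /mfact natr_prod -big_split /=; apply: ler_prod => j _.
  by rewrite exprn_ge0//= mulrC expR_ge_pow_fact.
apply: (@le_trans _ _ ((expR d%:R ^+ n * (mfact a)%:R) `^ theta)).
  by apply: powRt_le => //; rewrite exprn_ge0.
rewrite powRM// ?exprn_ge0 ?expR_ge0// ler_wpM2r ?powR_ge0//.
rewrite -[leRHS]powRr1 ?exprn_ge0 ?expR_ge0//; apply: ler_powR; last exact: ltW.
by rewrite exprn_ege1// -expR0 ler_expR.
Qed.

End RealPowers.

(** * Iterated partial derivatives *)

Section MultiCauchy.
Variables (R : realType) (d : nat).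
Local Notation C := (Cplx R).

Definition dd (j : 'I_d) (F : 'rV[C]_d -> C) := ddir (delta_mx 0 j : 'rV[C]_d) F.

Lemma csmooth_dd j F : csmooth F -> csmooth (dd j F).
Proof. exact: csmooth_D. Qed.

Lemma csmooth_foldr s F : csmooth F -> csmooth (foldr dd F s).
Proof. by move=> sF; elim: s => // j s IH; exact: csmooth_dd. Qed.

(** One directional estimate per derivative, each consuming a radius r: the total radius is r times
    the order, the loss r to that order. *)
Lemma cauchy_foldr F s z (r M : R) : csmooth F -> 0 < r ->
  (forall z', nC (z' - z) <= r * (size s)%:R -> cabs (F z') <= M) ->
  cabs (foldr dd F s z) <= M / r ^+ size s.
Proof.
move=> sF r0; elim: s z M => [|j s IH] z M H /=.
  by rewrite divr1; apply: H; rewrite subrr nC0 mulr0.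
rewrite exprS invfM mulrCA mulrC; apply: cauchy_dir => //.
  exact: csmooth_foldr.
move=> k kr; apply: IH => z' z'k; apply: H.
rewrite (_ : z' - z = (z' - (z + k *: delta_mx 0 j)) + k *: delta_mx 0 j); last first.
  by rewrite opprD addrA subrK.
apply: le_trans (nCD _ _) _; rewrite -natr1 mulrDr mulr1 lerD//.
by rewrite nCZ nC_delta mulr1.
Qed.

(** Derivatives along a multi-index are flattened to a list of directions, so that inductions run
    over lists. The list does not depend on the function differentiated. *)
Lemma miter_foldr (T : Type) (D : 'I_d -> T -> T) (a : mindex d) : exists2 s,
  size s = mabs a & forall f, miter D a f = foldr D f s.
Proof.
exists (flatten [seq nseq (a j) j | j <- enum 'I_d]).
  rewrite size_flatten /shape -map_comp /mabs sumnE big_map big_enum /=.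
  by apply: eq_bigr => j _; rewrite size_nseq.
move=> f; rewrite /miter; elim: (enum 'I_d) => //= j s ->.
by rewrite foldr_cat; elim: (a j) => //= n ->.
Qed.

Lemma is_derive_line (G : 'rV[R]_d -> R) (y v : 'rV[R]_d) (l : R) :
  is_derive (0 : R) (1 : R) (fun h : R => G (h *: v + y)) l -> is_derive y v G l.
Proof.
move=> [dg el]; split; first exact/derivable1P.
rewrite -el /derive (_ : (fun h : R => h^-1 *: ((G \o shift y) (h *: v) - G y)) =
  (fun h : R => h^-1 *: (((fun h : R => G (h *: v + y)) \o shift 0) (h *: 1) - G (0 *: v + y))))//.
by apply/funext => h; rewrite /= addr0 [h *: 1]mulr1 scale0r add0r.
Qed.

Lemma pderivR_vecC j (F : 'rV[C]_d -> C) (y : 'rV[R]_d) : csmooth F ->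
  pderivR j (F \o @vecC R d) y = dd j F (vecC y) /\
  derivable (@reC R \o (F \o @vecC R d)) y (delta_mx 0 j) /\
  derivable (@imC R \o (F \o @vecC R d)) y (delta_mx 0 j).
Proof.
move=> sF.
have vE (h : R) : vecC (h *: delta_mx 0 j + y) = vecC y + toC h *: (delta_mx 0 j : 'rV[C]_d).
  apply/rowP => i; rewrite !mxE toCD addrC; congr (_ + _).
  by rewrite eqxx /=; case: (i == j); rewrite ?mulr1 ?mulr0.
have [h1 h2] := @rderiv_diff R _ F (vecC y) (delta_mx 0 j : 'rV[C]_d) 0 (csmooth_diff _ sF).
have [|d1 e1] := @is_derive_line (@reC R \o (F \o @vecC R d)) y (delta_mx 0 j)
    (reC (ddir (delta_mx 0 j) F (vecC y + toC 0 *: delta_mx 0 j))).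
  rewrite (_ : (fun _ => _) = @reC R \o (fun s : R => F (vecC y + toC s *: delta_mx 0 j)))//.
  by apply/funext => h; rewrite /= vE.
have [|d2 e2] := @is_derive_line (@imC R \o (F \o @vecC R d)) y (delta_mx 0 j)
    (imC (ddir (delta_mx 0 j) F (vecC y + toC 0 *: delta_mx 0 j))).
  rewrite (_ : (fun _ => _) = @imC R \o (fun s : R => F (vecC y + toC s *: delta_mx 0 j)))//.
  by apply/funext => h; rewrite /= vE.
split; [|split; [exact: d1|exact: d2]].
rewrite /pderivR e1 e2 toC0 scale0r addr0.
exact: mkC_reim.
Qed.

Lemma pderivR_foldr (F : 'rV[C]_d -> C) s : csmooth F ->
  foldr (@pderivR R d) (F \o @vecC R d) s = foldr dd F s \o @vecC R d.
Proof.
move=> sF; elim: s => //= j s ->; apply/funext => y.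
by have [-> _] := pderivR_vecC j y (csmooth_foldr s sF).
Qed.

Lemma continuous_csmooth_real (F : 'rV[C]_d -> C) : csmooth F ->
  continuous (@reC R \o (F \o @vecC R d)) /\ continuous (@imC R \o (F \o @vecC R d)).
Proof.
move=> sF; suff H (y : 'rV[R]_d) (e : R) : 0 < e -> nbhs y [set y' | cabs (F (vecC y) - F (vecC y')) < e].
  split=> y; apply/(@cvgrPdist_lt _ _ _ (nbhs y) (nbhs_filter y)) => e e0; apply: filterS (H y e e0) => y' /=;
    apply: le_lt_trans; rewrite -?(reCB, imCB); [exact: cabs_re|exact: cabs_im].
move=> e0.
have Fc : {for vecC y, continuous F} by apply: differentiable_continuous; exact: csmooth_diff.
have /nbhs_nC[r r0 Hr] : nbhs (vecC y) [set w | `|F (vecC y) - F w| < toC e].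
  by move/cvgrPdist_lt : Fc; apply; rewrite -toC0 toC_lt.
apply/nbhs_nR; exists r => // w wr; rewrite /=.
have /= := Hr (vecC w); rewrite Cnorm toC_lt; apply.
rewrite (_ : vecC w - vecC y = vecC (w - y)) ?nC_vecC//.
by apply/rowP => j; rewrite !mxE toCB.
Qed.

Lemma smooth_csmooth (F : 'rV[C]_d -> C) : csmooth F -> smooth (F \o @vecC R d).
Proof.
move=> sF s; rewrite pderivR_foldr//.
have sG := csmooth_foldr s sF.
have [c1 c2] := continuous_csmooth_real sG.
by split => // x j; have [_] := pderivR_vecC j x sG.
Qed.

End MultiCauchy.

(** * Gelfand-Shilov spaces and their duals *)

Section GelfandShilovBounds.
Variables (R : realType) (d : nat) (theta : R).
Local Notation C := (Cplx R).
Local Notation V := 'rV[R]_d.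

Definition gs_weight (c : R) (a b : mindex d) : R :=
  c ^+ (mabs a + mabs b) * (mfact a * mfact b)%:R `^ theta.

(* [f] belongs to the step [c] with norm at most [m]. *)
Definition gsb (c m : R) (f : V -> C) : Prop :=
  smooth f /\ forall a b x,
    `|monomial a x| * cabs (miter (@pderivR R d) b f x) <= m * gs_weight c a b.

Lemma mfact_gt0 (a : mindex d) : (0 < mfact a)%N.
Proof. by rewrite /mfact prodn_gt0// => j; exact: fact_gt0. Qed.

Lemma gs_weight_gt0 c a b : 0 < c -> 0 < gs_weight c a b.
Proof.
move=> c0; rewrite /gs_weight mulr_gt0 ?exprn_gt0// powR_gt0// ltr0n muln_gt0.
by rewrite !mfact_gt0.
Qed.

Lemma gsb_ge0 c m f : 0 < c -> gsb c m f -> 0 <= m.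
Proof.
move=> c0 [_ /(_ [ffun=> 0%N] [ffun=> 0%N] 0)] H.
rewrite -(pmulr_lge0 _ (gs_weight_gt0 [ffun=> 0%N] [ffun=> 0%N] c0)).
by apply: le_trans H; rewrite mulr_ge0 ?cabs_ge0.
Qed.

Lemma gs_term_le c m (f : V -> C) a b x : 0 < c ->
  (c ^- (mabs a + mabs b) * (mfact a * mfact b)%:R `^ (- theta) *
     cabs (toC (monomial a x) * miter (@pderivR R d) b f x) <= m) =
  (`|monomial a x| * cabs (miter (@pderivR R d) b f x) <= m * gs_weight c a b).
Proof.
move=> c0; rewrite powRN -invfM mulrC -/(gs_weight c a b) ler_pdivrMr ?gs_weight_gt0//.
by rewrite cabsM cabs_toC.
Qed.

Lemma gs_norm_le c m (f : V -> C) : 0 < c ->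
  (gs_norm theta c f <= m%:E)%E <-> forall a b x,
    `|monomial a x| * cabs (miter (@pderivR R d) b f x) <= m * gs_weight c a b.
Proof.
move=> c0; split=> [H a b x|H].
  rewrite -gs_term_le// -lee_fin; apply: le_trans H.
  by apply: ereal_sup_ubound => /=; exists (a, b, x).
by apply: ge_ereal_sup => _ [[[a b] x] _ <-]; rewrite lee_fin gs_term_le.
Qed.

Lemma gs_norm_ge0 c (f : V -> C) : 0 < c -> (0 <= gs_norm theta c f)%E.
Proof.
move=> c0; apply: (@le_trans _ _ (c ^- (mabs [ffun=> 0%N : nat] + mabs [ffun=> 0%N : nat]) *
  (mfact [ffun=> 0%N] * mfact [ffun=> 0%N])%:R `^ (- theta) *
   cabs (toC (monomial [ffun=> 0%N] (0 : V)) * miter (@pderivR R d) [ffun=> 0%N] f 0))%:E).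
  by rewrite lee_fin !mulr_ge0 ?powR_ge0 ?cabs_ge0// invr_ge0 exprn_ge0// ltW.
by apply: ereal_sup_ubound => /=; exists ([ffun=> 0%N], [ffun=> 0%N], 0).
Qed.

Lemma gsb_step c m f : 0 < c -> gsb c m f ->
  gs_step theta c f /\ (gs_norm theta c f <= m%:E)%E.
Proof.
move=> c0 [sf H]; have Hm : (gs_norm theta c f <= m%:E)%E by apply/gs_norm_le.
by split=> //; split=> //; apply: le_lt_trans Hm _; rewrite ltry.
Qed.

Lemma gs_step_gsb c f : 0 < c -> gs_step theta c f ->
  exists2 m, gs_norm theta c f = m%:E & gsb c m f.
Proof.
move=> c0 [sf fin].
have fE : gs_norm theta c f = (fine (gs_norm theta c f))%:E.
  by rewrite fineK// ge0_fin_numE// gs_norm_ge0.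
exists (fine (gs_norm theta c f)) => //; split=> //.
by apply/gs_norm_le; rewrite // -fE.
Qed.

Lemma gsP f : gs theta f <-> exists c m : R, 0 < c /\ gsb c m f.
Proof.
split=> [[c c0 sf]|[c [m [c0 H]]]].
  by have [m _ H] := gs_step_gsb c0 sf; exists c, m.
by exists c => //; have [] := gsb_step c0 H.
Qed.

Lemma gsb_mono c c' m m' f : 0 < c -> c <= c' -> m <= m' -> gsb c m f -> gsb c' m' f.
Proof.
move=> c0 cc mm H; have m0 := gsb_ge0 c0 H; case: H => sf H; split=> // a b x.
apply: le_trans (H a b x) _; rewrite ler_pM ?(ltW (gs_weight_gt0 _ _ c0))//.
rewrite /gs_weight ler_wpM2r ?powR_ge0// lerXn2r ?nnegrE ?(ltW c0)//.
exact: le_trans (ltW c0) cc.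
Qed.

Lemma is_derive_lineN (G : V -> R) (y v : V) (l : R) :
  is_derive y v G l -> is_derive (0 : R) (1 : R) (fun h : R => G (h *: v + y)) l.
Proof.
move=> [dg el]; split; first by move/derivable1P : dg.
rewrite -el /derive (_ : (fun h : R => h^-1 *: ((G \o shift y) (h *: v) - G y)) =
  (fun h : R => h^-1 *: (((fun h : R => G (h *: v + y)) \o shift 0) (h *: 1) - G (0 *: v + y))))//.
by apply/funext => h; rewrite /= addr0 [h *: 1]mulr1 scale0r add0r.
Qed.

Lemma rderiv_pderivR (f : V -> C) (y : V) j :
  derivable (@reC R \o f) y (delta_mx 0 j) -> derivable (@imC R \o f) y (delta_mx 0 j) ->
  rderiv (fun h => f (h *: delta_mx 0 j + y)) 0 (pderivR j f y).
Proof.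
move=> d1 d2; split.
- apply: (is_derive_lineN (G := @reC R \o f)); exact: derivableP.
- apply: (is_derive_lineN (G := @imC R \o f)); exact: derivableP.
Qed.

Lemma pderivR_rderiv (f : V -> C) (y : V) j (l : C) :
  rderiv (fun h => f (h *: delta_mx 0 j + y)) 0 l ->
  [/\ derivable (@reC R \o f) y (delta_mx 0 j), derivable (@imC R \o f) y (delta_mx 0 j)
    & pderivR j f y = l].
Proof.
move=> [h1 h2].
have [d1 e1] := @is_derive_line _ _ (@reC R \o f) y (delta_mx 0 j) _ h1.
have [d2 e2] := @is_derive_line _ _ (@imC R \o f) y (delta_mx 0 j) _ h2.
split; [exact: d1|exact: d2|].
by rewrite /pderivR e1 e2; exact: mkC_reim.
Qed.

Lemma continuous_lin (k l : R) (f g : V -> R) : continuous f -> continuous g ->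
  continuous (fun x => k * f x + l * g x).
Proof.
move=> cf cg x.
exact: (cvgD (cvgM (cvg_cst k) (cf x)) (cvgM (cvg_cst l) (cg x))).
Qed.

Lemma pderivR_lin (f g : V -> C) (a b : C) j :
  continuous_derivable f -> continuous_derivable g ->
  continuous_derivable (fun x => a * f x + b * g x) /\
  pderivR j (fun x => a * f x + b * g x) = fun x => a * pderivR j f x + b * pderivR j g x.
Proof.
move=> [cf1 cf2 df] [cg1 cg2 dg].
have H x i := pderivR_rderiv (f := fun x => a * f x + b * g x) (y := x) (j := i) (rderivD
  (rderivZ a (rderiv_pderivR (proj1 (df x i)) (proj2 (df x i))))
  (rderivZ b (rderiv_pderivR (proj1 (dg x i)) (proj2 (dg x i))))).
split; last by apply/funext => x; have [_ _ ->] := H x j.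
split.
- rewrite (_ : _ \o _ = fun x => 1 * (reC a * reC (f x) + (- imC a) * imC (f x)) +
    1 * (reC b * reC (g x) + (- imC b) * imC (g x))).
    by apply: continuous_lin; apply: continuous_lin.
  by apply/funext => x /=; rewrite reCD !reCM; ring.
- rewrite (_ : _ \o _ = fun x => 1 * (reC a * imC (f x) + imC a * reC (f x)) +
    1 * (reC b * imC (g x) + imC b * reC (g x))).
    by apply: continuous_lin; apply: continuous_lin.
  by apply/funext => x /=; rewrite imCD !imCM; ring.
- by move=> x i; have [? ? _] := H x i.
Qed.

Lemma foldr_pderivR_lin (f g : V -> C) (a b : C) s : smooth f -> smooth g ->
  foldr (@pderivR R d) (fun x => a * f x + b * g x) s =
  fun x => a * foldr (@pderivR R d) f s x + b * foldr (@pderivR R d) g s x.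
Proof.
move=> sf sg; elim: s => //= j s ->.
by have [_ ->] := pderivR_lin a b j (sf s) (sg s).
Qed.

Lemma smooth_lin (f g : V -> C) (a b : C) : (0 < d)%N -> smooth f -> smooth g ->
  smooth (fun x => a * f x + b * g x).
Proof.
move=> d0 sf sg s; rewrite foldr_pderivR_lin//.
by have [+ _] := pderivR_lin a b (Ordinal d0) (sf s) (sg s).
Qed.

Lemma gsb_lin c m m' (f g : V -> C) (a b : C) : (0 < d)%N ->
  gsb c m f -> gsb c m' g -> gsb c (cabs a * m + cabs b * m') (fun x => a * f x + b * g x).
Proof.
move=> d0 [sf Hf] [sg Hg]; split; first exact: smooth_lin.
move=> k l x; have [s _ E] := @miter_foldr d (V -> C) (@pderivR R d) l.
move: (Hf k l x) (Hg k l x); rewrite !E foldr_pderivR_lin// => hf hg.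
apply: (@le_trans _ _ (cabs a * (`|monomial k x| * cabs (foldr (@pderivR R d) f s x)) +
   cabs b * (`|monomial k x| * cabs (foldr (@pderivR R d) g s x)))).
  rewrite ![cabs _ * (`|_| * _)]mulrCA -mulrDr ler_wpM2l// -!cabsM; exact: cabsD.
by rewrite mulrDl -!mulrA lerD// ler_wpM2l ?cabs_ge0.
Qed.

Lemma gsb_scale c m (f : V -> C) (a : C) : (0 < d)%N ->
  gsb c m f -> gsb c (cabs a * m) (fun x => a * f x).
Proof.
move=> d0 H; have := gsb_lin a 0 d0 H H; rewrite cabs0 mul0r addr0.
by under eq_fun do rewrite mul0r addr0.
Qed.

Lemma gs_lin (f g : V -> C) (a b : C) : (0 < d)%N ->
  gs theta f -> gs theta g -> gs theta (fun x => a * f x + b * g x).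
Proof.
move=> d0 /gsP[c [m [c0 Hf]]] /gsP[c' [m' [c0' Hg]]]; apply/gsP.
exists (Num.max c c'), (cabs a * m + cabs b * m'); split; first by rewrite lt_max c0.
apply: gsb_lin => //.
- by apply: gsb_mono Hf => //; rewrite le_max lexx.
- by apply: gsb_mono Hg => //; rewrite le_max lexx orbT.
Qed.

Definition gs_linear (u : functional R d) : Prop :=
  forall (f g : V -> C) (a b : C), gs theta f -> gs theta g ->
     u (fun x => a * f x + b * g x) = a * u f + b * u g.

Lemma gs_linearZ u f a : gs_linear u -> gs theta f -> u (fun x => a * f x) = a * u f.
Proof.
move=> lu sf; have := lu f f a 0 sf sf; rewrite mul0r addr0 => <-.
by congr u; apply/funext => x; rewrite mul0r addr0.
Qed.

(** With [dual_bound], this reduces the inductive limit topology to one norm estimate on each Banach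
    step. The set of all f with |u f| < e is its own absolutely convex neighbourhood. *)
Lemma dual_intro (u : functional R d) : (0 < d)%N -> gs_linear u ->
  (forall c, 0 < c -> exists2 K : R, 0 <= K & forall f m, gsb c m f -> cabs (u f) <= K * m) ->
  gs_dual theta u.
Proof.
move=> d0 lu H; split=> // e e0.
exists [set f | gs theta f /\ cabs (u f) < e]; split => //.
- by move=> f [].
- move=> f g a b [sf uf] [sg ug] ab; split; first exact: gs_lin.
  rewrite lu//; apply: le_lt_trans (cabsD _ _) _; rewrite !cabsM.
  have [a0|a0] := eqVneq (cabs a) 0.
    have [b0|b0] := eqVneq (cabs b) 0; first by rewrite a0 b0 !mul0r addr0.
    have bp : 0 < cabs b by rewrite lt_def b0 cabs_ge0.
    rewrite a0 mul0r add0r; rewrite a0 add0r in ab.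
    apply: (@lt_le_trans _ _ (cabs b * e)); first by rewrite ltr_pM2l.
    by rewrite ler_piMl// ltW.
  have ap : 0 < cabs a by rewrite lt_def a0 cabs_ge0.
  apply: (@lt_le_trans _ _ (cabs a * e + cabs b * e)).
    by rewrite ltr_leD ?ltr_pM2l// ler_wpM2l ?cabs_ge0// ltW.
  by rewrite -mulrDl ler_piMl// ltW.
- move=> c c0; have [K K0 HK] := H c c0.
  exists (e / (K + 1)); first by rewrite divr_gt0// ltr_wpDl.
  move=> f sf; have [m mE Hm] := gs_step_gsb c0 sf; rewrite mE lte_fin => mr.
  split; first by exists c.
  apply: le_lt_trans (HK _ _ Hm) _; apply: (@le_lt_trans _ _ ((K + 1) * m)).
    by rewrite ler_wpM2r ?(gsb_ge0 c0 Hm)// lerDl.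
  by rewrite mulrC -ltr_pdivlMr// ltr_wpDl.
Qed.

(** A multiple of f is moved into the ball of the step contained in the neighbourhood where |u| < 1.
    That ball is open and m may be 0, which is why a slack [e] is introduced and then removed. *)
Lemma dual_bound (u : functional R d) c : (0 < d)%N -> gs_dual theta u -> 0 < c ->
  exists2 K : R, 0 <= K & forall f m, gsb c m f -> cabs (u f) <= K * m.
Proof.
move=> d0 [lu H] c0; have [W [WU Wgs _ HW]] := H 1 ltr01.
have [r r0 Hr] := HW c c0.
exists (2 / r); first by rewrite divr_ge0// ltW.
move=> f m Hf; have m0 := gsb_ge0 c0 Hf.
have sf : gs theta f by apply/gsP; exists c, m.
apply/ler_addgt0Pr => e e0.
(* Chosen so that t m < r and 1 / t = (2 / r) m + e. *)
pose t := r / (2 * (m + e * r / 2)).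
have me : 0 < m + e * r / 2 by rewrite ltr_wpDl// !mulr_gt0// invr_gt0.
have t0 : 0 < t by rewrite divr_gt0// mulr_gt0.
have Hg := gsb_scale (toC t) d0 Hf.
have [sg ng] := gsb_step c0 Hg.
have /WU[_] : W (fun x => toC t * f x).
  apply: Hr => //; apply: le_lt_trans ng _; rewrite lte_fin cabs_toC gtr0_norm//.
  rewrite /t mulrAC ltr_pdivrMr ?mulr_gt0// ltr_pM2l//.
  have : 0 < e * r / 2 by rewrite !mulr_gt0// invr_gt0.
  by lra.
rewrite gs_linearZ// cabsM cabs_toC gtr0_norm// -ltr_pdivlMl// mulr1 => /ltW/le_trans; apply.
rewrite le_eqVlt; apply/orP; left; apply/eqP; rewrite /t.
by field; rewrite !gt_eqF//; lra.
Qed.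

Lemma dual_sub (u v : functional R d) : (0 < d)%N -> gs_dual theta u -> gs_dual theta v ->
  gs_dual theta (fun f => u f - v f).
Proof.
move=> d0 du dv; apply: dual_intro => //.
  move=> f g a b sf sg; rewrite (proj1 du)// (proj1 dv)//; ring.
move=> c c0; have [K K0 HK] := dual_bound d0 du c0; have [L L0 HL] := dual_bound d0 dv c0.
exists (K + L); first exact: addr_ge0.
by move=> f m H; rewrite mulrDl (le_trans (cabsB _ _))// lerD ?HK ?HL.
Qed.

End GelfandShilovBounds.

(** * From Gaussian bounds on C^d to Gelfand-Shilov norms *)

Section GaussianBounds.
Variables (R : realType) (d : nat) (theta : R).
Hypotheses (theta_ge : 2^-1 <= theta) (theta_lt : theta < 1).
Local Notation C := (Cplx R).
Local Notation V := 'rV[R]_d.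
Local Notation p := (theta^-1).

Definition reV (z : 'rV[C]_d) : V := \row_j reC (z 0 j).
Definition imV (z : 'rV[C]_d) : V := \row_j imC (z 0 j).

Lemma reV_vecC x : reV (vecC x) = x. Proof. by apply/rowP => j; rewrite !mxE. Qed.
Lemma imV_vecC x : imV (vecC x) = 0. Proof. by apply/rowP => j; rewrite !mxE. Qed.
Lemma nR_reV z : nR (reV z) <= nC z.
Proof. by apply: ler_sum => j _; rewrite mxE cabs_re. Qed.
Lemma nR_imV z : nR (imV z) <= nC z.
Proof. by apply: ler_sum => j _; rewrite mxE cabs_im. Qed.
Lemma reVB z w : reV (z - w) = reV z - reV w.
Proof. by apply/rowP => j; rewrite !mxE reCB. Qed.
Lemma imVB z w : imV (z - w) = imV z - imV w.
Proof. by apply/rowP => j; rewrite !mxE imCB. Qed.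

Lemma norm_monomial (a : mindex d) (x : V) : `|monomial a x| <= nR x ^+ mabs a.
Proof.
rewrite /monomial normr_prod /mabs -prodrXr; apply: ler_prod => j _.
by rewrite normr_ge0 normrX lerXn2r ?nnegrE ?nR_ge0 ?nR_coord.
Qed.

Lemma half_sqr (u v s : R) : 0 <= v -> 0 <= u -> 0 <= s -> u <= v + s ->
  u ^+ 2 / 2 - s ^+ 2 <= v ^+ 2.
Proof.
move=> v0 u0 s0 uvs; have : u ^+ 2 <= (v + s) ^+ 2 by rewrite lerXn2r ?nnegrE ?addr_ge0.
have := sqr_ge0 (v - s); rewrite !expr2; nra.
Qed.

(* Cauchy's estimate with total radius [|b| ^ (1 - theta)] for the derivative of order [b]. *)
Lemma gauss_derive (a b e : R) : 0 < a -> 0 <= b -> 0 < e ->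
  exists2 K : R, 0 < K & forall (x : V) (xi M : R) (F : 'rV[C]_d -> C),
  csmooth F -> 0 <= xi -> 0 <= M ->
  (forall y, cabs (F y) <= M * expR (- (a * nR (reV y - x) ^+ 2) + b * nR (imV y) ^+ 2
      + nR (imV y) * xi)) ->
  forall (s : seq 'I_d) (y : V),
  cabs (foldr (@dd R d) F s (vecC y)) <=
    M * (K ^+ size s * kk theta (size s)) * expR (e * xi `^ p) *
    expR (- (a / 2 * nR (y - x) ^+ 2)).
Proof.
move=> a0 b0 e0; have [L L0 HL] := young theta_ge theta_lt e0.
exists (expR (a + b + L)); first exact: expR_gt0.
move=> x xi M F sF xi0 M0 HF s y; set n := size s.
have [n0|nn0] := posnP n.
  move: n0; rewrite /n => /size0nil ->/=.
  rewrite kkE !expr0 !mulr1; apply: le_trans (HF _) _.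
  rewrite reV_vecC imV_vecC nR0 expr0n mulr0 mul0r !addr0 -mulrA -expRD ler_wpM2l//.
  rewrite ler_expR -[leLHS]add0r lerD ?mulr_ge0 ?powR_ge0 ?(ltW e0)//.
  by rewrite lerN2 ler_wpM2r ?sqr_ge0//; lra.
have nR0' : 0 < n%:R :> R by rewrite ltr0n.
(* Radius per derivative: the total radius r n is n^(1 - theta), and the loss r^(-n) is exactly
   [kk theta n]. *)
pose r := n%:R `^ (- theta) : R.
have r0 : 0 < r by rewrite powR_gt0.
pose t := n%:R `^ (1 - theta) : R.
have t0 : 0 <= t by exact: powR_ge0.
have rt : r * n%:R = t.
  by rewrite /r /t powRD ?powRr1 ?(ltW nR0') 1?mulrC// (gt_eqF nR0') implybT.
have t2 : t ^+ 2 <= n%:R by exact: nat_powR_sqr.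
have HLn := HL n%:R xi (ltW nR0') xi0; rewrite -/t in HLn.
have B z' : nC (z' - vecC y) <= r * n%:R -> cabs (F z') <=
    M * expR (a + b + L) ^+ n * expR (e * xi `^ p) * expR (- (a / 2 * nR (y - x) ^+ 2)).
  rewrite rt => z't; apply: le_trans (HF _) _; rewrite -!mulrA ler_wpM2l//.
  rewrite -expRM_natl -!expRD ler_expR.
  have it : nR (imV z') <= t.
    apply: le_trans z't; have := nR_imV (z' - vecC y).
    by rewrite imVB imV_vecC subr0.
  have ht : nR (y - x) <= nR (reV z' - x) + t.
    rewrite -lerBlDl; apply: le_trans z't; apply: le_trans (nR_reV _).
    by rewrite reVB reV_vecC lerBlDl [leRHS]addrC (nRBC (reV z') y) nR_tri.
  have H1 := half_sqr (nR_ge0 _) (nR_ge0 _) t0 ht.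
  have H2 : nR (imV z') ^+ 2 <= n%:R.
    by apply: le_trans t2; rewrite lerXn2r ?nnegrE ?nR_ge0.
  have H3 : nR (imV z') * xi <= e * xi `^ p + L * n%:R.
    by apply: le_trans HLn; rewrite ler_wpM2r.
  have H4 : b * nR (imV z') ^+ 2 <= b * n%:R by rewrite ler_wpM2l.
  have H5 : a * (nR (y - x) ^+ 2 / 2 - n%:R) <= a * nR (reV z' - x) ^+ 2.
    by rewrite ler_wpM2l ?(ltW a0)//; apply: le_trans H1; rewrite lerD2l lerN2.
  have H6 : a / 2 * nR (y - x) ^+ 2 = a * (nR (y - x) ^+ 2 / 2 - n%:R) + a * n%:R by field.
  lra.
apply: le_trans (cauchy_foldr sF r0 B) _.
rewrite -/n le_eqVlt; apply/orP; left; apply/eqP.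
have -> : (r ^+ n)^-1 = kk theta n.
  by rewrite kkE -exprVn /r powRN invrK.
ring.
Qed.

(** The step c is the same for all centres x and frequencies xi, and only the norm depends on them,
    subexponentially. Derivatives are bounded by [gauss_derive], powers of y by [poly_growth], whose
    growth in y is shared between the centre and the Gaussian around it. *)
Lemma gauss_gsb (a b e : R) : 0 < a -> 0 <= b -> 0 < e ->
  exists c K : R, [/\ 0 < c, 0 < K & forall (x : V) (xi M : R) (F : 'rV[C]_d -> C),
  csmooth F -> 0 <= xi -> 0 <= M ->
  (forall y, cabs (F y) <= M * expR (- (a * nR (reV y - x) ^+ 2) + b * nR (imV y) ^+ 2
      + nR (imV y) * xi)) ->
  gsb theta c (K * M * expR (e * (nR x `^ p + xi `^ p))) (F \o @vecC R d)].
Proof.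
move=> a0 b0 e0; have [L L0 HL] := gauss_derive a0 b0 e0.
(* From |y|^p <= 4 (|x|^p + 1 + |y - x|^2): 4 e' <= e charges the norm with e |x|^p, and 4 e' <= a /
   2 is covered by the Gaussian that [gauss_derive] leaves. *)
pose e' := Num.min (e / 4) (a / 8).
have e'0 : 0 < e' by rewrite lt_min !divr_gt0.
have [P P0 HP] := poly_growth theta_ge theta_lt e'0.
pose c := Num.max (P * expR d%:R) (L * expR d%:R).
have c0 : 0 < c by rewrite lt_max mulr_gt0 ?expR_gt0.
exists c, (expR (a / 2)); split; [exact: c0|exact: expR_gt0|].
move=> x xi M F sF xi0 M0 HF; split; first exact: smooth_csmooth.
move=> k l y; have [s ss E] := @miter_foldr d (V -> C) (@pderivR R d) l.
rewrite E pderivR_foldr//=.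
have := HL x xi M F sF xi0 M0 HF s y; rewrite ss => H1.
have H2 : `|monomial k y| <= P ^+ mabs k * kk theta (mabs k) * expR (e' * nR y `^ p).
  exact: le_trans (norm_monomial _ _) (HP _ _ (nR_ge0 _)).
apply: le_trans (ler_pM _ _ H2 H1) _; rewrite ?cabs_ge0//.
have Hy : e' * nR y `^ p <= e * nR x `^ p + a / 2 + a / 2 * nR (y - x) ^+ 2.
  have h1 : nR y `^ p <= 4 * (nR x `^ p + nR (y - x) `^ p).
    apply: le_trans (powRp_add theta_ge theta_lt (nR_ge0 _) (nR_ge0 _)).
    by apply: powRp_le => //; [exact: nR_ge0|exact: nR_le_dist].
  have h2 := powRp_le_sqr theta_ge theta_lt (nR_ge0 (y - x)).
  have h3 : e' * nR y `^ p <= e' * (4 * (nR x `^ p + (1 + nR (y - x) ^+ 2))).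
    by rewrite ler_wpM2l ?(ltW e'0)//; apply: le_trans h1 _; rewrite ler_wpM2l// lerD2l.
  apply: le_trans h3 _.
  have e1 : 4 * e' <= e by rewrite mulrC -ler_pdivlMr// ge_min lexx.
  have e2 : 4 * e' <= a / 2.
    have : e' <= a / 8 by rewrite ge_min lexx orbT.
    lra.
  have : 4 * e' * nR x `^ p <= e * nR x `^ p by rewrite ler_wpM2r ?powR_ge0.
  have : 4 * e' * (1 + nR (y - x) ^+ 2) <= a / 2 * (1 + nR (y - x) ^+ 2).
    by rewrite ler_wpM2r// addr_ge0 ?sqr_ge0.
  lra.
have Hc : P ^+ mabs k * kk theta (mabs k) * (L ^+ mabs l * kk theta (mabs l)) <= gs_weight theta c k l.
  rewrite /gs_weight natrM powRM// exprD [leRHS]mulrACA.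
  apply: ler_pM; rewrite ?mulr_ge0 ?exprn_ge0 ?kk_ge0 ?(ltW P0) ?(ltW L0)//.
  - apply: (@le_trans _ _ (P ^+ mabs k * (expR d%:R ^+ mabs k * (mfact k)%:R `^ theta))).
      by rewrite ler_wpM2l ?exprn_ge0 ?(ltW P0)//; exact: (kk_mfact theta_ge theta_lt).
    rewrite mulrA -exprMn ler_wpM2r ?powR_ge0// lerXn2r ?nnegrE ?mulr_ge0 ?expR_ge0 ?(ltW P0) ?(ltW c0)//.
    by rewrite le_max lexx.
  - apply: (@le_trans _ _ (L ^+ mabs l * (expR d%:R ^+ mabs l * (mfact l)%:R `^ theta))).
      by rewrite ler_wpM2l ?exprn_ge0 ?(ltW L0)//; exact: (kk_mfact theta_ge theta_lt).
    rewrite mulrA -exprMn ler_wpM2r ?powR_ge0// lerXn2r ?nnegrE ?mulr_ge0 ?expR_ge0 ?(ltW L0) ?(ltW c0)//.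
    by rewrite le_max lexx orbT.
have HE : expR (e' * nR y `^ p) * (expR (e * xi `^ p) * expR (- (a / 2 * nR (y - x) ^+ 2))) <=
    expR (a / 2) * expR (e * (nR x `^ p + xi `^ p)).
  by rewrite -!expRD ler_expR; lra.
rewrite (_ : P ^+ mabs k * kk theta (mabs k) * expR (e' * nR y `^ p) *
  (M * (L ^+ mabs l * kk theta (mabs l)) * expR (e * xi `^ p) *
   expR (- (a / 2 * nR (y - x) ^+ 2))) = M * (P ^+ mabs k * kk theta (mabs k) * (L ^+ mabs l * kk theta (mabs l))) *
  (expR (e' * nR y `^ p) * (expR (e * xi `^ p) * expR (- (a / 2 * nR (y - x) ^+ 2))))); last by ring.
rewrite (_ : expR (a / 2) * M * expR (e * (nR x `^ p + xi `^ p)) * gs_weight theta c k l =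
  M * gs_weight theta c k l *
  (expR (a / 2) * expR (e * (nR x `^ p + xi `^ p)))); last by ring.
apply: ler_pM; rewrite ?mulr_ge0 ?expR_ge0 ?exprn_ge0 ?kk_ge0 ?(ltW P0) ?(ltW L0)//.
by rewrite ler_wpM2l.
Qed.

End GaussianBounds.

(** * Frechet differentiability from remainder estimates *)

Lemma differentiable_rem (K : numFieldType) (V W : normedModType K) (F : V -> W)
    (L : {linear V -> W}) (z : V) : continuous L ->
  (forall e : K, 0 < e -> \forall w \near (0 : V), `|F (z + w) - F z - L w| <= e * `|w|) ->
  differentiable F z /\ forall v, 'd F z v = L v.
Proof.
move=> cL H.
have E : F \o shift z = cst (F z) + L +o_ 0 id.
  apply/eqaddoP => _/posnumP[e]; apply: filterS (H e%:num _) => // w.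
  rewrite [X in `|X| <= _ -> _](_ : _ = (F \o shift z - (cst (F z) + L)) w)//.
  by rewrite !fctE /= opprD addrA (addrC w).
have dE := diff_unique cL E.
have dF : differentiable F z by apply/diff_locallyP; rewrite dE.
by split=> // v; rewrite dE.
Qed.

Section Frechet.
Variable R : realType.
Local Notation C := (Cplx R).

Lemma frechet_lin m (F : 'rV[C]_m -> C) (L : {linear 'rV[C]_m -> C}) (z : 'rV[C]_m) (K : R) :
  0 <= K -> (forall w, cabs (L w) <= K * nC w) ->
  (forall w, nC w <= 1 -> cabs (F (z + w) - F z - L w) <= K * nC w ^+ 2) ->
  differentiable F z /\ forall v, ddir v F z = L v.
Proof.
move=> K0 LK HF.
have cL : continuous L.
  move=> x; apply/(@cvgrPdist_lt _ _ _ (nbhs x) (nbhs_filter x)) => e1 /Cpos_re[-> e0].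
  apply/nbhs_nC; exists (reC e1 / (K + 1)); first by rewrite divr_gt0// ltr_wpDl.
  move=> w wx; rewrite /= Cnorm toC_lt -(linearB L).
  apply: le_lt_trans (LK _) _; rewrite nCBC.
  apply: (@le_lt_trans _ _ ((K + 1) * nC (w - x))).
    by rewrite ler_wpM2r ?nC_ge0// lerDl.
  by rewrite mulrC -ltr_pdivlMr// ltr_wpDl.
have [|dF dE] := @differentiable_rem _ _ _ F L z cL.
  move=> e /Cpos_re[-> e0].
  have KD : 0 < K * m%:R + 1 by rewrite ltr_wpDl// mulr_ge0.
  apply/nbhs_nC; exists (Num.min 1 (reC e / (K * m%:R + 1))).
    by rewrite lt_min ltr01 divr_gt0.
  move=> w; rewrite subr0 lt_min => /andP[w1 wK].
  rewrite Cnorm; apply: (@le_trans _ _ (toC (K * nC w) * (m%:R * `|w|))).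
    apply: (@le_trans _ _ (toC (K * nC w) * toC (nC w))).
      by rewrite -toCM toC_le -mulrA -expr2 HF// ltW.
    by rewrite ler_wpM2l ?nC_mx_norm// -toC0 toC_le mulr_ge0 ?nC_ge0.
  rewrite mulrA ler_wpM2r// -toCnat -toCM toC_le mulrAC.
  apply: (@le_trans _ _ ((K * m%:R + 1) * nC w)).
    by rewrite ler_wpM2r ?nC_ge0// lerDl.
  by rewrite mulrC -ler_pdivlMr// ltW.
by split=> // v; rewrite /ddir deriveE// dE.
Qed.

Lemma frechet_rem m (F L : 'rV[C]_m -> C) (z : 'rV[C]_m) (K : R) :
  0 <= K -> linear L -> (forall w, cabs (L w) <= K * nC w) ->
  (forall w, nC w <= 1 -> cabs (F (z + w) - F z - L w) <= K * nC w ^+ 2) ->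
  differentiable F z /\ forall v, ddir v F z = L v.
Proof.
move=> K0 Llin.
exact: (@frechet_lin m F (HB.pack L (GRing.isLinear.Build _ _ _ _ L Llin)) z K K0).
Qed.

End Frechet.

(** * Holomorphic families of test functions *)

Section HolomorphicFamilies.
Variables (R : realType) (m d : nat).
Local Notation C := (Cplx R).
Local Notation W := 'rV[C]_m.
Local Notation Y := 'rV[C]_d.
Variables (om : Y -> R) (l : (Y -> C) -> C) (K : R).
Hypothesis K_ge0 : 0 <= K.

(** The functional [l] is controlled only on functions dominated by the weight [om]. The lemmas are
    used with a Gaussian [om] for an element of S'_theta, and with the weight [omw] for
    superpositions of FBI kernels. *)
Definition dominated (f : Y -> C) := csmooth f /\ exists M, forall y, cabs (f y) <= M * om y.

Hypothesis l_lin : forall f g a b, dominated f -> dominated g ->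
  l (fun y => a * f y + b * g y) = a * l f + b * l g.
Hypothesis l_bound : forall f M, csmooth f -> 0 <= M -> (forall y, cabs (f y) <= M * om y) ->
  cabs (l f) <= K * M.

Definition locally_dominated (k : W * Y -> C) := forall r : R, exists2 M : R, 0 <= M &
  forall z, nC z <= r -> forall y, cabs (k (z, y)) <= M * om y.

Lemma csmooth_slice (k : W * Y -> C) z : csmooth k -> csmooth (fun y => k (z, y)).
Proof.
move=> sk.
have Ll : linear (fun y : Y => (0 : W, y)).
  by move=> a x y /=; congr pair; rewrite /= ?scaler0 ?addr0.
pose L : {linear Y -> (W * Y)%type} :=
  HB.pack (fun y : Y => (0 : W, y)) (GRing.isLinear.Build _ _ _ _ _ Ll).
have -> : (fun y => k (z, y)) = fun y => k (L y + (z, 0)).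
  by apply/funext => y; congr k; congr pair; rewrite /= ?add0r ?addr0.
apply: csmooth_affine => // x.
move=> A [[P Q] /= [P0 Qx] PQ]; apply: filterS Qx => y Qy.
by apply: PQ; split => //=; exact: nbhs_singleton.
Qed.

(** In the direction w, a disc of radius 1 / |w| displaces z by at most 1: this is the unit lost
    between r + 1 and r. *)
Lemma slice_cauchy (k : W * Y -> C) (r M : R) w : csmooth k ->
  (forall z, nC z <= r + 1 -> forall y, cabs (k (z, y)) <= M * om y) ->
  forall z, nC z <= r -> forall y, cabs (ddir (w, 0 : Y) k (z, y)) <= nC w * M * om y.
Proof.
move=> sk H z zr y; have [w0|w0] := eqVneq (nC w) 0.
  rewrite w0 !mul0r (nC_eq0 w0) (_ : (0 : W, 0 : Y) = 0)//.
  by rewrite /ddir derive0 cabs0.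
have wp : 0 < nC w by rewrite lt_def w0 nC_ge0.
rewrite (_ : nC w * M * om y = M * om y / (nC w)^-1); last by rewrite invrK; ring.
apply: cauchy_dir => //; first by rewrite invr_gt0.
move=> h hw.
rewrite (_ : (z, y) + h *: (w, 0) = (z + h *: w, y)); last first.
  by congr pair; rewrite /= scaler0 addr0.
apply: H; apply: le_trans (nCD _ _) _; rewrite lerD// nCZ.
by rewrite -ler_pdivlMr// div1r.
Qed.

Lemma locally_dominated_D k w : csmooth k -> locally_dominated k ->
  locally_dominated (ddir (w, 0 : Y) k).
Proof.
move=> sk H r; have [M M0 HM] := H (r + 1).
exists (nC w * M); first by rewrite mulr_ge0 ?nC_ge0.
exact: slice_cauchy.
Qed.

Lemma slice_dominated k z : csmooth k -> locally_dominated k -> dominated (fun y => k (z, y)).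
Proof.
move=> sk H; split; first exact: csmooth_slice.
by have [M _ HM] := H (nC z); exists M => y; apply: HM.
Qed.

(** Differentiation under [l]. The second-order Taylor remainder of the kernel in z is O(|w|^2)
    relative to [om], by two Cauchy estimates in z, so [l] of it is O(|w|^2). *)
Lemma family_derive k z : csmooth k -> locally_dominated k ->
  differentiable (fun z => l (fun y => k (z, y))) z /\
  forall v, ddir v (fun z => l (fun y => k (z, y))) z = l (fun y => ddir (v, 0 : Y) k (z, y)).
Proof.
(* Two units of radius for the two Cauchy estimates, the third for the segment from z to z + w with
   |w| <= 1. *)
move=> sk gk; have [M M0 HM] := gk (nC z + 1 + 1 + 1).
have sD w : csmooth (ddir (w, 0 : Y) k) by exact: csmooth_D.
have dk w : dominated (fun y => ddir (w, 0 : Y) k (z, y)).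
  by apply: slice_dominated; [exact: sD|exact: locally_dominated_D].
apply: (@frechet_rem R m (fun z => l (fun y => k (z, y)))
   (fun w => l (fun y => ddir (w, 0 : Y) k (z, y))) z (4 * (K * M))).
- by rewrite !mulr_ge0.
- move=> a x y /=; have := l_lin a 1 (dk x) (dk y); rewrite mul1r => <-.
  congr l; apply/funext => q; rewrite mul1r.
  rewrite (_ : (a *: x + y, 0 : Y) = a *: (x, 0 : Y) + (y, 0 : Y)); last first.
    by congr pair; rewrite /= scaler0 addr0.
  rewrite derive_dirD; last exact: csmooth_diff.
  by rewrite derive_dirZ//; exact: csmooth_diff.
- move=> w; apply: (@le_trans _ _ (K * (nC w * M))).
    apply: l_bound; [exact/csmooth_slice/sD|by rewrite mulr_ge0 ?nC_ge0|].
    apply: (@slice_cauchy k (nC z + 1 + 1) M w sk) => //.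
    by rewrite -!addrA lerDl// !addr_ge0.
  have := mulr_ge0 (mulr_ge0 K_ge0 M0) (nC_ge0 w); lra.
- move=> w w1.
  have dz := slice_dominated z sk gk; have dzw := slice_dominated (z + w) sk gk.
  have d1 : dominated (fun y => 1 * k (z + w, y) + (-1) * k (z, y)).
    split; first by apply: csmoothD; apply: csmoothZ; [case: dzw|case: dz].
    have [_ [A HA]] := dzw; have [_ [B HB]] := dz; exists (A + B) => y.
    rewrite mul1r mulN1r mulrDl; apply: le_trans (cabsB _ _) _; exact: lerD.
  have -> : l (fun y => k (z + w, y)) - l (fun y => k (z, y)) -
      l (fun y => ddir (w, 0 : Y) k (z, y)) =
      l (fun y => 1 * (1 * k (z + w, y) + (-1) * k (z, y)) + (-1) * ddir (w, 0 : Y) k (z, y)).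
    by rewrite l_lin// l_lin// !mul1r !mulN1r.
  rewrite (_ : 4 * (K * M) * nC w ^+ 2 = K * (4 * (nC w ^+ 2 * M))); last by ring.
  apply: l_bound.
  + by apply: csmoothD; apply: csmoothZ; [case: d1|case: (dk w)].
  + by rewrite !mulr_ge0// ?exprn_ge0 ?nC_ge0.
  + move=> y; rewrite !mul1r !mulN1r -mulrA.
    have := @taylor1_dir R _ k (z, y) (w, 0) (nC w ^+ 2 * M * om y) sk.
    rewrite (_ : (z, y) + (w, 0) = (z + w, y)); last by congr pair; rewrite /= addr0.
    apply => t t01; rewrite (_ : (z, y) + toC t *: (w, 0) = (z + toC t *: w, y)); last first.
      by congr pair; rewrite /= scaler0 addr0.
    rewrite expr2 -(mulrA (nC w)); apply: (@slice_cauchy (ddir (w, 0) k) (nC z + 1) (nC w * M) w (sD w)).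
      exact: (@slice_cauchy k (nC z + 1 + 1) M w sk HM).
    apply: le_trans (nCD _ _) _; rewrite lerD2l nCZ cabs_toC; case/andP: t01 => t0 t1.
    by rewrite ger0_norm// -[leRHS]mulr1 ler_pM ?nC_ge0.
Qed.

Lemma family_csmooth k : csmooth k -> locally_dominated k ->
  csmooth (fun z => l (fun y => k (z, y))).
Proof.
move=> sk gk.
apply: (@csmooth_coind R _ (fun U => exists k, [/\ csmooth k, locally_dominated k &
  U = fun z => l (fun y => k (z, y))])); last by exists k.
move=> U [k' [sk' gk' ->]]; split=> [z|v]; first by have [] := family_derive z sk' gk'.
exists (ddir (v, 0 : Y) k'); split; [exact: csmooth_D|exact: locally_dominated_D|].
by apply/funext => z; have [_ ->] := family_derive z sk' gk'.
Qed.

Definition ddz (j : 'I_m) (k : W * Y -> C) := ddir (delta_mx 0 j : W, 0 : Y) k.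

Lemma family_foldr k s : csmooth k -> locally_dominated k ->
  [/\ csmooth (foldr ddz k s), locally_dominated (foldr ddz k s) &
   foldr (@dd R m) (fun z => l (fun y => k (z, y))) s =
   fun z => l (fun y => foldr ddz k s (z, y))].
Proof.
move=> sk gk; elim: s => [|j s [IH1 IH2 IH3]] //=.
split; [exact: csmooth_D|exact: locally_dominated_D|].
rewrite IH3; apply/funext => z; rewrite /dd.
by have [_ ->] := family_derive z IH1 IH2.
Qed.

End HolomorphicFamilies.

(** * Bilinear and quadratic forms *)

Section BilinearForms.
Variables (K : fieldType) (d : nat).
Implicit Types (x y z : 'rV[K]_d) (M : 'M[K]_d).

Lemma dotC x y : dot x y = dot y x.
Proof. by apply: eq_bigr => j _; rewrite mulrC. Qed.
Lemma dotDl x y z : dot (x + y) z = dot x z + dot y z.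
Proof. by rewrite -big_split; apply: eq_bigr => j _; rewrite mxE mulrDl. Qed.
Lemma dotZl a x y : dot (a *: x) y = a * dot x y.
Proof. by rewrite /dot mulr_sumr; apply: eq_bigr => j _; rewrite mxE mulrA. Qed.
Lemma dotDr x y z : dot x (y + z) = dot x y + dot x z.
Proof. by rewrite dotC dotDl !(dotC x). Qed.
Lemma dotZr a x y : dot x (a *: y) = a * dot x y.
Proof. by rewrite dotC dotZl dotC. Qed.
Lemma dotNl x y : dot (- x) y = - dot x y.
Proof. by rewrite -scaleN1r dotZl mulN1r. Qed.
Lemma dotNr x y : dot x (- y) = - dot x y.
Proof. by rewrite dotC dotNl dotC. Qed.
Lemma dot0l x : dot 0 x = 0. Proof. by rewrite -(scale0r 0) dotZl mul0r. Qed.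
Lemma dot0r x : dot x 0 = 0. Proof. by rewrite dotC dot0l. Qed.

Lemma mxactD M x y : mxact M (x + y) = mxact M x + mxact M y.
Proof. by rewrite /mxact mulmxDl. Qed.
Lemma mxactZ M a x : mxact M (a *: x) = a *: mxact M x.
Proof. by rewrite /mxact scalemxAl. Qed.
Lemma mxactN M x : mxact M (- x) = - mxact M x.
Proof. by rewrite /mxact mulNmx. Qed.
Lemma mxact0 M : mxact M 0 = 0. Proof. by rewrite /mxact mul0mx. Qed.
Lemma mxactDl M N x : mxact (M + N) x = mxact M x + mxact N x.
Proof. by rewrite /mxact linearD mulmxDr. Qed.
Lemma mxactZl a M x : mxact (a *: M) x = a *: mxact M x.
Proof. by rewrite /mxact linearZ scalemxAr. Qed.
Lemma mxactE M x j : mxact M x 0 j = \sum_i M j i * x 0 i.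
Proof. by rewrite !mxE; apply: eq_bigr => i _; rewrite !mxE mulrC. Qed.
Lemma mxactM M N x : mxact M (mxact N x) = mxact (M *m N) x.
Proof. by rewrite /mxact -mulmxA trmx_mul. Qed.
Lemma mxact1 x : mxact 1%:M x = x. Proof. by rewrite /mxact trmx1 mulmx1. Qed.

Lemma dot_mxact_sym M x y : M^T = M -> dot (mxact M x) y = dot (mxact M y) x.
Proof.
move=> sM; rewrite /dot; under eq_bigr do rewrite mxactE mulr_suml.
under [RHS]eq_bigr do rewrite mxactE mulr_suml.
rewrite exchange_big /=; apply: eq_bigr => i _; apply: eq_bigr => j _.
by rewrite -{1}sM mxE mulrAC.
Qed.

Lemma quad_add M x y : M^T = M -> dot (mxact M (x + y)) (x + y) =
  dot (mxact M x) x + (1 + 1) * dot (mxact M x) y + dot (mxact M y) y.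
Proof.
move=> sM; rewrite mxactD !dotDl !dotDr (dot_mxact_sym y x sM); ring.
Qed.

End BilinearForms.

Section ComplexForms.
Variables (R : realType) (d : nat).
Local Notation C := (Cplx R).
Local Notation V := 'rV[R]_d.

Definition mnorm (M : 'M[C]_d) : R := \sum_i \sum_j cabs (M i j).

Lemma mnorm_ge0 M : 0 <= mnorm M.
Proof. by apply: sumr_ge0 => i _; apply: sumr_ge0 => j _; exact: cabs_ge0. Qed.

Lemma nC_mxact M (x : 'rV[C]_d) : nC (mxact M x) <= mnorm M * nC x.
Proof.
rewrite /nC /mnorm mulr_suml; apply: ler_sum => i _; rewrite mxactE.
apply: le_trans (cabs_sum _ _ _) _; rewrite mulr_suml; apply: ler_sum => j _.
by rewrite cabsM ler_wpM2l ?cabs_ge0// nC_coord.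
Qed.

Lemma cabs_dot (x y : 'rV[C]_d) : cabs (dot x y) <= nC x * nC y.
Proof.
apply: le_trans (cabs_sum _ _ _) _; rewrite /nC mulr_suml; apply: ler_sum => j _.
by rewrite cabsM ler_wpM2l ?cabs_ge0// nC_coord.
Qed.

Lemma norm_dot (x y : V) : `|dot x y| <= nR x * nR y.
Proof.
apply: le_trans (ler_norm_sum _ _ _) _; rewrite /nR mulr_suml; apply: ler_sum => j _.
by rewrite normrM ler_wpM2l// nR_coord.
Qed.

Lemma cabs_quad M (x y : 'rV[C]_d) : cabs (dot (mxact M x) y) <= mnorm M * nC x * nC y.
Proof.
by apply: le_trans (cabs_dot _ _) _; rewrite ler_wpM2r ?nC_ge0// nC_mxact.
Qed.

Lemma vecCD (x y : V) : vecC (x + y) = vecC x + vecC y.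
Proof. by apply/rowP => j; rewrite !mxE toCD. Qed.
Lemma vecCN (x : V) : vecC (- x) = - vecC x.
Proof. by apply/rowP => j; rewrite !mxE toCN. Qed.
Lemma vecCB (x y : V) : vecC (x - y) = vecC x - vecC y.
Proof. by rewrite vecCD vecCN. Qed.
Lemma vecCZ a (x : V) : vecC (a *: x) = toC a *: vecC x.
Proof. by apply/rowP => j; rewrite !mxE toCM. Qed.
Lemma vecC0 : vecC (0 : V) = 0.
Proof. by apply/rowP => j; rewrite !mxE. Qed.
Lemma dot_vecC (x y : V) : dot (vecC x) (vecC y) = toC (dot x y).
Proof. by rewrite /dot toC_sum; apply: eq_bigr => j _; rewrite !mxE toCM. Qed.

Lemma reimV (z : 'rV[C]_d) : z = vecC (reV z) + 'i *: vecC (imV z).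
Proof.
apply/rowP => j; rewrite !mxE; apply: complexP.
  by rewrite reCD reCM reCi imCi reC_toC imC_toC mul0r mulr0 subr0 addr0.
by rewrite imCD imCM reCi imCi reC_toC imC_toC mul0r mul1r add0r add0r.
Qed.

Lemma reV_mxact M (x : V) : reV (mxact M (vecC x)) = mxact (map_mx (@reC R) M) x.
Proof.
apply/rowP => j; rewrite mxE !mxactE reC_sum; apply: eq_bigr => i _.
by rewrite !mxE reCM reC_toC imC_toC mulr0 subr0.
Qed.
Lemma imV_mxact M (x : V) : imV (mxact M (vecC x)) = mxact (map_mx (@imC R) M) x.
Proof.
apply/rowP => j; rewrite mxE !mxactE imC_sum; apply: eq_bigr => i _.
by rewrite !mxE imCM reC_toC imC_toC mulr0 add0r.
Qed.
Lemma reC_dot (z : 'rV[C]_d) (x : V) : reC (dot z (vecC x)) = dot (reV z) x.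
Proof.
rewrite /dot reC_sum; apply: eq_bigr => j _.
by rewrite !mxE reCM reC_toC imC_toC mulr0 subr0.
Qed.
Lemma imC_dot (z : 'rV[C]_d) (x : V) : imC (dot z (vecC x)) = dot (imV z) x.
Proof.
rewrite /dot imC_sum; apply: eq_bigr => j _.
by rewrite !mxE imCM reC_toC imC_toC mulr0 add0r.
Qed.

Lemma nR_mxact_im M (x : V) : nR (mxact (map_mx (@imC R) M) x) <= mnorm M * nR x.
Proof.
rewrite -imV_mxact -(nC_vecC x); apply: le_trans (nR_imV _) (nC_mxact _ _).
Qed.
Lemma nR_mxact_re M (x : V) : nR (mxact (map_mx (@reC R) M) x) <= mnorm M * nR x.
Proof.
rewrite -reV_mxact -(nC_vecC x); apply: le_trans (nR_reV _) (nC_mxact _ _).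
Qed.

(** The constant [a] is explicit because the Gaussian estimates, and the size of a step between
    Gaussians, are controlled by [a] and [mnorm M] alone. *)
Definition posim (a : R) (M : 'M[C]_d) : Prop :=
  [/\ 0 < a, M^T = M & forall x : V, a * nR x ^+ 2 <= dot (mxact (map_mx (@imC R) M) x) x].

Lemma imC_quad M (y : 'rV[C]_d) : M^T = M -> imC (dot (mxact M y) y) =
  dot (mxact (map_mx (@imC R) M) (reV y)) (reV y)
  - dot (mxact (map_mx (@imC R) M) (imV y)) (imV y)
  + 2 * dot (mxact (map_mx (@reC R) M) (reV y)) (imV y).
Proof.
move=> sM; set S := vecC (reV y); set T := vecC (imV y).
have yE : y = S + 'i *: T by exact: reimV.
have ii : 'i * 'i = -1 :> C by rewrite -expr2 sqrCi.
have E : dot (mxact M y) y = dot (mxact M S) S +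
    (1 + 1) * ('i * dot (mxact M S) T) - dot (mxact M T) T.
  rewrite [in LHS]yE quad_add//; congr (_ + _); first by rewrite dotZr.
  by rewrite mxactZ dotZl dotZr mulrA ii mulN1r.
have c2 : imC (1 + 1 : C) = 0 by rewrite imCD imC1 addr0.
have c3 : reC (1 + 1 : C) = 2 by rewrite reCD reC1.
rewrite E imCB imCD !imC_dot !imV_mxact imCM c2 c3 mul0r addr0.
by rewrite imCM reCi imCi mul0r add0r mul1r reC_dot reV_mxact addrAC.
Qed.

(** The mixed term Re M (Re y, Im y) is absorbed by completing a square: of the rate a / 2 in Re y
    one half survives, and N^2 / a is added to the growth in Im y, N being [mnorm M]. *)
Lemma gauss_real_part a M (y : 'rV[C]_d) : posim a M ->
  - (2^-1 * imC (dot (mxact M y) y)) <=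
  - (a / 4 * nR (reV y) ^+ 2) + (mnorm M + mnorm M ^+ 2 / a) * nR (imV y) ^+ 2.
Proof.
move=> [a0 sM pM]; rewrite imC_quad//.
set s := reV y; set t := imV y; set N := mnorm M.
have N0 : 0 <= N := mnorm_ge0 M.
have H1 := pM s.
have H2 : `|dot (mxact (map_mx (@imC R) M) t) t| <= N * nR t ^+ 2.
  apply: le_trans (norm_dot _ _) _; rewrite expr2 mulrA.
  by rewrite ler_wpM2r ?nR_ge0// nR_mxact_im.
have H3 : `|dot (mxact (map_mx (@reC R) M) s) t| <= N * nR s * nR t.
  by apply: le_trans (norm_dot _ _) _; rewrite ler_wpM2r ?nR_ge0// nR_mxact_re.
have H4 : N * nR s * nR t <= a / 4 * nR s ^+ 2 + N ^+ 2 / a * nR t ^+ 2.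
  rewrite -subr_ge0 (_ : _ - _ = (a * nR s / 2 - N * nR t) ^+ 2 / a); last first.
    by field; rewrite gt_eqF.
  by rewrite divr_ge0 ?sqr_ge0// ltW.
move: H2 H3; rewrite !ler_norml => /andP[_ H2] /andP[H3 _].
have := mulr_ge0 N0 (sqr_ge0 (nR t)).
set q1 := dot _ s in H1 *; set q2 := dot _ t in H2 *; set q3 := dot _ t in H3 *.
clearbody q1 q2 q3 s t N; clear -a0 H1 H2 H3 H4 => h; lra.
Qed.

End ComplexForms.

Section SmoothForms.
Variables (R : realType) (d : nat).
Local Notation C := (Cplx R).

Definition cvec (V : normedModType C) (f : V -> 'rV[C]_d) := forall j, csmooth (fun v => f v 0 j).

Lemma cvec_cst (V : normedModType C) (w : 'rV[C]_d) : cvec (fun _ : V => w).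
Proof. by move=> j; exact: csmooth_cst. Qed.

Lemma cvecB (V : normedModType C) (f g : V -> 'rV[C]_d) :
  cvec f -> cvec g -> cvec (fun v => f v - g v).
Proof. by move=> sf sg j; under eq_fun do rewrite !mxE; exact: csmoothB. Qed.
Lemma cvec_mxact (V : normedModType C) M (f : V -> 'rV[C]_d) :
  cvec f -> cvec (fun v => mxact M (f v)).
Proof.
move=> sf j; under eq_fun do rewrite mxactE.
by apply: csmooth_sum => i; exact: csmoothZ.
Qed.
Lemma csmooth_dot (V : normedModType C) (f g : V -> 'rV[C]_d) :
  cvec f -> cvec g -> csmooth (fun v => dot (f v) (g v)).
Proof. by move=> sf sg; apply: csmooth_sum => i; exact: csmoothM. Qed.

Lemma csmooth_coord j : csmooth (fun v : 'rV[C]_d => v 0 j).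
Proof.
have Ll : linear (fun v : 'rV[C]_d => v 0 j) by move=> a x y; rewrite !mxE.
pose L : {linear 'rV[C]_d -> C} :=
  HB.pack (fun v : 'rV[C]_d => v 0 j) (GRing.isLinear.Build _ _ _ _ _ Ll).
apply: (@csmooth_linear R _ L) => x.
apply/(@cvgrPdist_lt _ _ _ (nbhs x) (nbhs_filter x)) => e /Cpos_re[-> e0].
apply/nbhs_nC; exists (reC e) => // w wx; rewrite Cnorm toC_lt.
apply: le_lt_trans wx; rewrite nCBC.
by have := nC_coord (x - w) j; rewrite !mxE.
Qed.

Lemma cvec_id : cvec (fun v : 'rV[C]_d => v).
Proof. exact: csmooth_coord. Qed.

Lemma csmooth_fst (V W : normedModType C) (F : V -> C) :
  csmooth F -> csmooth (fun p : V * W => F p.1).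
Proof.
move=> sF.
have Ll : linear (fun p : (V * W)%type => p.1) by [].
pose L : {linear (V * W)%type -> V} :=
  HB.pack (fun p : (V * W)%type => p.1) (GRing.isLinear.Build _ _ _ _ _ Ll).
have -> : (fun p : V * W => F p.1) = fun p => F (L p + 0).
  by apply/funext => p; rewrite addr0.
apply: csmooth_affine => // x A /= Ax.
by exists (A, setT); [split => //; exact: filterT|move=> p []].
Qed.

Lemma csmooth_snd (V W : normedModType C) (F : W -> C) :
  csmooth F -> csmooth (fun p : V * W => F p.2).
Proof.
move=> sF.
have Ll : linear (fun p : (V * W)%type => p.2) by [].
pose L : {linear (V * W)%type -> W} :=
  HB.pack (fun p : (V * W)%type => p.2) (GRing.isLinear.Build _ _ _ _ _ Ll).
have -> : (fun p : V * W => F p.2) = fun p => F (L p + 0).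
  by apply/funext => p; rewrite addr0.
apply: csmooth_affine => // x A /= Ax.
by exists (setT, A); [split => //; exact: filterT|move=> p []].
Qed.

Lemma cvec_fst (W : normedModType C) : cvec (fun p : 'rV[C]_d * W => p.1).
Proof. by move=> j; exact: (csmooth_fst W (csmooth_coord j)). Qed.
Lemma cvec_snd (W : normedModType C) : cvec (fun p : W * 'rV[C]_d => p.2).
Proof. by move=> j; exact: (csmooth_snd W (csmooth_coord j)). Qed.

End SmoothForms.

(** * Wave packets *)

Section Packets.
Variables (R : realType) (d : nat).
Local Notation C := (Cplx R).
Local Notation V := 'rV[R]_d.

(** The holomorphic extension of the packet in y. Its modulus on C^d, through Cauchy's estimate,
    yields all derivatives of the packet on R^d. *)
Definition gpC (M : 'M[C]_d) (x xi : V) (y : 'rV[C]_d) : C :=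
  cexp ('i * (2^-1 * dot (mxact M (y - vecC x)) (y - vecC x)) - 'i * dot y (vecC xi)).
Definition gp (M : 'M[C]_d) (x xi : V) : V -> C := gpC M x xi \o @vecC R d.

Lemma csmooth_gpC M x xi : csmooth (gpC M x xi).
Proof.
have h := cvecB (@cvec_id R d) (cvec_cst _ (vecC x)).
apply: csmooth_cexp; apply: csmoothB; apply: csmoothZ.
  by apply: csmoothZ; apply: csmooth_dot => //; exact: cvec_mxact.
by apply: csmooth_dot; [exact: cvec_id|exact: cvec_cst].
Qed.

Lemma reC_iM (z : C) : reC ('i * z) = - imC z.
Proof. by rewrite reCM reCi imCi mul0r mul1r sub0r. Qed.

Lemma imC_half (z : C) : imC (2^-1 * z) = 2^-1 * imC z.
Proof. by rewrite -(toCnat R 2) -toCV imCM reC_toC imC_toC mul0r addr0. Qed.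

Lemma reC_half (z : C) : reC (2^-1 * z) = 2^-1 * reC z.
Proof. by rewrite -(toCnat R 2) -toCV reCM reC_toC imC_toC mul0r subr0. Qed.

Lemma cabs_gpC M x xi y : cabs (gpC M x xi y) =
  expR (- (2^-1 * imC (dot (mxact M (y - vecC x)) (y - vecC x))) + dot (imV y) xi).
Proof. by rewrite cabs_cexp reCB !reC_iM imC_half imC_dot opprK. Qed.

Definition gpb (a : R) (M : 'M[C]_d) : R := mnorm M + mnorm M ^+ 2 / a.

Lemma gpb_ge0 a M : 0 < a -> 0 <= gpb a M.
Proof. by move=> a0; rewrite addr_ge0 ?mnorm_ge0// divr_ge0 ?sqr_ge0// ltW. Qed.

Lemma gpC_bound a M x xi y : posim a M -> cabs (gpC M x xi y) <=
  expR (- (a / 4 * nR (reV y - x) ^+ 2) + gpb a M * nR (imV y) ^+ 2 + nR (imV y) * nR xi).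
Proof.
move=> pM; rewrite cabs_gpC ler_expR; apply: lerD.
  have := gauss_real_part (y - vecC x) pM.
  by rewrite reVB imVB reV_vecC imV_vecC subr0.
exact: le_trans (ler_norm _) (norm_dot _ _).
Qed.

Lemma gp_gsb (theta : R) a M (e : R) : 2^-1 <= theta -> theta < 1 -> posim a M -> 0 < e ->
  exists c K : R, [/\ 0 < c, 0 < K & forall x xi : V,
    gsb theta c (K * expR (e * (nR x `^ theta^-1 + nR xi `^ theta^-1))) (gp M x xi)].
Proof.
move=> t1 t2 pM e0; have [a0 _ _] := pM.
have a40 : 0 < a / 4 by rewrite divr_gt0.
have [c [K [c0 K0 H]]] := gauss_gsb d t1 t2 a40 (gpb_ge0 M a0) e0.
exists c, K; split => // x xi.
have := H x (nR xi) 1 (gpC M x xi) (csmooth_gpC M x xi) (nR_ge0 _) ler01.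
rewrite mulr1; apply => y; rewrite mul1r; exact: gpC_bound.
Qed.

(** The constant 1 / d compares the sum norm with the Euclidean one: |x|^2 <= d <x, x>. *)
Lemma posim_i : (0 < d)%N -> posim (d%:R^-1) ('i%:M : 'M[C]_d).
Proof.
move=> d0; split; [by rewrite invr_gt0 ltr0n|exact: tr_scalar_mx|].
move=> x.
have -> : mxact (map_mx (@imC R) 'i%:M) x = x.
  have -> : map_mx (@imC R) 'i%:M = 1%:M :> 'M[R]_d.
    apply/matrixP => i j; rewrite !mxE.
    by case: (i == j); rewrite ?mulr1n ?mulr0n ?imCi ?imC0.
  by rewrite mxact1.
rewrite mulrC ler_pdivrMr ?ltr0n//.
rewrite (_ : dot x x = \sum_j `|x 0 j| ^+ 2); last first.
  by apply: eq_bigr => j _; rewrite -expr2 -normrX ger0_norm// sqr_ge0.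
rewrite expr2 /nR big_distrlr /=.
apply: (@le_trans _ _ (\sum_(i < d) \sum_(j < d) (`|x 0 i| ^+ 2 / 2 + `|x 0 j| ^+ 2 / 2))).
  apply: ler_sum => i _; apply: ler_sum => j _.
  by have := sqr_ge0 (`|x 0 i| - `|x 0 j|); rewrite !expr2; lra.
rewrite (eq_bigr (fun i => d%:R * (`|x 0 i| ^+ 2 / 2) + (\sum_(j < d) `|x 0 j| ^+ 2) / 2)); last first.
  by move=> i _; rewrite big_split /= sumr_const_ord mulr_suml.
rewrite big_split /= sumr_const_ord -mulr_sumr -mulr_suml.
by rewrite le_eqVlt; apply/orP; left; apply/eqP; field.
Qed.

Lemma wave_packetE (x xi : V) : wave_packet x xi = gp ('i%:M) x xi.
Proof.
apply/funext => y; rewrite /wave_packet /gp /gpC /=; congr cexp; apply: complexP.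
  rewrite reCB !reC_iM imC_half imC_dot imV_vecC dot0l oppr0 subr0.
  rewrite -vecCB imC_quad ?tr_scalar_mx// imV_vecC reV_vecC !dot0r mulr0 addr0 subr0.
  have -> : mxact (map_mx (@imC R) 'i%:M) (y - x) = y - x.
    have -> : map_mx (@imC R) 'i%:M = 1%:M :> 'M[R]_d.
      apply/matrixP => i j; rewrite !mxE.
      by case: (i == j); rewrite ?mulr1n ?mulr0n ?imCi ?imC0.
    by rewrite mxact1.
  have -> : enorm (y - x) ^+ 2 = dot (y - x) (y - x).
    rewrite /enorm sqr_sqrtr; last by apply: sumr_ge0 => j _; exact: sqr_ge0.
    by apply: eq_bigr => j _; rewrite expr2.
  by [].
have h0 : imC ('i * (2^-1 * dot (mxact ('i%:M : 'M[C]_d) (vecC y - vecC x)) (vecC y - vecC x))) = 0.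
  rewrite imCM reCi imCi mul0r add0r mul1r reC_half -vecCB reC_dot reV_mxact.
  rewrite (_ : map_mx _ _ = 0) ?/mxact ?trmx0 ?mulmx0 ?dot0l ?mulr0//.
  apply/matrixP => i j; rewrite !mxE.
  by case: (i == j); rewrite ?mulr1n ?mulr0n ?reCi.
by rewrite imCB h0 sub0r imCM reCi imCi mul0r add0r mul1r reC_dot reV_vecC.
Qed.

End Packets.

(** * Holomorphic families tested against a functional *)

Section DualFamilies.
Variables (R : realType) (d : nat) (theta : R).
Hypotheses (d_gt0 : (0 < d)%N) (theta_ge : 2^-1 <= theta) (theta_lt : theta < 1).
Local Notation C := (Cplx R).
Local Notation V := 'rV[R]_d.

Definition om (a b : R) (y : 'rV[C]_d) : R :=
  expR (- (a * nR (reV y) ^+ 2) + b * nR (imV y) ^+ 2).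

Lemma om_gt0 a b y : 0 < om a b y. Proof. exact: expR_gt0. Qed.
Lemma om_ge0 a b y : 0 <= om a b y. Proof. exact/ltW/om_gt0. Qed.

(** Recentring the Gaussian at 0 halves its rate, by [half_sqr], and one more unit of quadratic
    growth in Im y absorbs the linear term. *)
Lemma om_shift a b (x : V) (X : R) (y : 'rV[C]_d) : 0 <= a ->
  expR (- (a * nR (reV y - x) ^+ 2) + b * nR (imV y) ^+ 2 + nR (imV y) * X) <=
  expR (a * nR x ^+ 2 + X ^+ 2) * om (a / 2) (b + 1) y.
Proof.
move=> a0; rewrite -expRD ler_expR.
have H := half_sqr (nR_ge0 (reV y - x)) (nR_ge0 (reV y)) (nR_ge0 x).
have {}H : nR (reV y) ^+ 2 / 2 - nR x ^+ 2 <= nR (reV y - x) ^+ 2.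
  by apply: H; rewrite addrC nR_le_dist.
have H1 := ler_wpM2l a0 H.
have H2 := sqr_ge0 (nR (imV y) - X); have H3 := sqr_ge0 (nR (imV y)); have H4 := sqr_ge0 X.
have -> : a / 2 * nR (reV y) ^+ 2 = a * (nR (reV y) ^+ 2 / 2) by ring.
rewrite mulrBr in H1; rewrite !expr2 in H1 H2 H3 H4 *.
clear -H1 H2 H3 H4; lra.
Qed.

Lemma om_gsb a b : 0 < a -> 0 <= b -> exists c K : R, [/\ 0 < c, 0 < K &
  forall f M, csmooth f -> 0 <= M -> (forall y, cabs (f y) <= M * om a b y) ->
  gsb theta c (K * M) (f \o @vecC R d)].
Proof.
move=> a0 b0; have [c [K [c0 K0 H]]] := gauss_gsb d theta_ge theta_lt a0 b0 ltr01.
exists c, K; split=> // f M sf M0 Hf.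
have := H 0 0 M f sf (lexx _) M0.
rewrite nR0 powR0 ?(p_neq0 theta_ge theta_lt)// addr0 mulr0 expR0 mulr1; apply => y.
by rewrite subr0 mulr0 addr0; exact: Hf.
Qed.

Lemma dominated_gs a b f : 0 < a -> 0 <= b -> dominated (om a b) f -> gs theta (f \o @vecC R d).
Proof.
move=> a0 b0 [sf [M HM]]; have [c [K [c0 _ H]]] := om_gsb a0 b0.
have M0 : 0 <= M.
  by rewrite -(pmulr_lge0 _ (om_gt0 a b 0)); apply: le_trans (HM 0); exact: cabs_ge0.
by apply/gsP; exists c, (K * M); split=> //; exact: H.
Qed.

Definition equibounded (U : set (functional R d)) : Prop :=
  forall c, 0 < c -> exists2 K : R, 0 <= K & forall u, U u ->
  forall f m, gsb theta c m f -> cabs (u f) <= K * m.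

Lemma dual_equibounded u : gs_dual theta u -> equibounded [set u].
Proof.
by move=> du c c0; have [K K0 H] := dual_bound d_gt0 du c0; exists K => // _ ->.
Qed.

Section OneDual.
Variables (u : functional R d) (a b : R).
Hypotheses (du : gs_dual theta u) (a0 : 0 < a) (b0 : 0 <= b).

Let l (f : 'rV[C]_d -> C) := u (f \o @vecC R d).

Lemma dual_l_lin f g x y : dominated (om a b) f -> dominated (om a b) g ->
  l (fun z => x * f z + y * g z) = x * l f + y * l g.
Proof. by move=> df dg; apply: (proj1 du); exact: (dominated_gs a0 b0). Qed.

Lemma dual_l_bound : exists2 K, 0 <= K & forall f M, csmooth f -> 0 <= M ->
  (forall y, cabs (f y) <= M * om a b y) -> cabs (l f) <= K * M.
Proof.
have [c [L [c0 L0 H]]] := om_gsb a0 b0.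
have [K K0 HK] := dual_bound d_gt0 du c0.
exists (K * L); first by rewrite mulr_ge0// ltW.
by move=> f M sf M0 Hf; rewrite -mulrA; apply: HK; exact: H.
Qed.

Lemma dual_family m (k : 'rV[C]_m * 'rV[C]_d -> C) s : csmooth k ->
  locally_dominated (om a b) k ->
  [/\ csmooth (fun z => u ((fun y => k (z, y)) \o @vecC R d)),
   forall z, gs theta ((fun y => foldr (@ddz R m d) k s (z, y)) \o @vecC R d) &
   foldr (@dd R m) (fun z => u ((fun y => k (z, y)) \o @vecC R d)) s =
   fun z => u ((fun y => foldr (@ddz R m d) k s (z, y)) \o @vecC R d)].
Proof.
move=> sk gk; have [K K0 HK] := dual_l_bound.
have [s1 s2 s3] := family_foldr K0 dual_l_lin HK s sk gk.
split; [|by move=> z; apply: (dominated_gs a0 b0); exact: slice_dominated|exact: s3].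
exact: (family_csmooth K0 dual_l_lin HK sk gk).
Qed.

End OneDual.
End DualFamilies.

Section FieldIdentities.
Variable F : numFieldType.

Lemma half_quad_sub (a1 a2 a3 q1 q2 q3 : F) :
  2^-1 * (a1 + (1 + 1) * a2 + a3) - 2^-1 * (q1 + (1 + 1) * q2 + q3) -
   (2^-1 * a1 - 2^-1 * q1) = (a2 - q2) + 2^-1 * (a3 - q3).
Proof. by field. Qed.

Lemma half_quad_incr (a b e f q s t u : F) :
  a + (b + q * f) + 2^-1 * (s + (1 + 1) * (q * t) + q * (q * u)) =
  a + b + 2^-1 * s + q * (f + t) + q ^+ 2 * (2^-1 * u).
Proof. by field. Qed.

End FieldIdentities.

Lemma dot_delta (F : fieldType) d (x : 'rV[F]_d) j : dot x (delta_mx 0 j) = x 0 j.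
Proof.
rewrite /dot (bigD1 j)//= big1 ?addr0 ?mxE ?eqxx ?mulr1// => i ij.
by rewrite mxE (negPf ij) andbF mulr0.
Qed.

Lemma nRE (R : realType) d (x : 'rV[R]_d) : nR x = \sum_j `|x 0 j|.
Proof. by []. Qed.

Lemma mxact_trE (F : fieldType) d (M : 'M[F]_d) x : mxact M x = x *m M^T.
Proof. by []. Qed.

#[local] Opaque dot mxact nC nR mnorm cabs cexp reC imC toC reV imV vecC.

(** * Geometry of the phase *)

Section PhaseGeometry.
Variables (R : realType) (d : nat) (phi : FBI_phase R d).
Hypothesis d_gt0 : (0 < d)%N.
Local Notation C := (Cplx R).
Local Notation V := 'rV[R]_d.
Local Notation A := (phA phi).
Local Notation B := (phB phi).
Local Notation Q := (phC phi).
Local Notation IQ := (map_mx (@imC R) (phC phi)).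

Lemma continuous_nR_quad (M : 'M[R]_d) : continuous (fun x : V => dot (mxact M x) x).
Proof.
have sF : csmooth (fun y : 'rV[C]_d => dot (mxact (map_mx (@toC R) M) y) y).
  by apply: csmooth_dot; [apply: cvec_mxact|]; exact: cvec_id.
have [+ _] := continuous_csmooth_real sF.
rewrite (_ : _ \o _ = fun x : V => dot (mxact M x) x)//.
apply/funext => x /=; rewrite reC_dot reV_mxact; congr (dot (mxact _ x) x).
by apply/matrixP => i j; rewrite !mxE.
Qed.

Lemma nR_dist (x y : V) : `|nR x - nR y| <= nR (x - y).
Proof.
rewrite ler_norml lerBlDl nR_le_dist andbT lerNl opprB lerBlDl nRBC.
exact: nR_le_dist.
Qed.

Lemma continuous_nR : continuous (@nR R d).
Proof.
move=> x; apply/(@cvgrPdist_lt _ _ _ (nbhs x) (nbhs_filter x)) => e e0.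
apply/nbhs_nR; exists e => // w wx; apply: le_lt_trans (nR_dist _ _) _.
by rewrite nRBC.
Qed.

(** [a] is the minimum of the form Im C on the compact sphere |x| = 1, positive by [phC_im]. *)
Lemma phC_posim : exists a, posim a Q.
Proof.
pose S := [set x : V | nR x = 1].
have [|||c Sc cmin] := @EVT_min_rV R d (fun x => dot (mxact IQ x) x) S.
- exists (delta_mx 0 (Ordinal d_gt0)); exact: nR_delta.
- apply: bounded_closed_compact.
    exists 1; split => // r r1 x Sx; apply: ltW; apply: le_lt_trans r1.
    by rewrite -Sx; exact: mx_norm_nR.
  rewrite (_ : S = @nR R d @^-1` [set 1])//; apply: closed_comp; last exact: closed_eq.
  by move=> x _; exact: continuous_nR.
- by apply: continuous_subspaceT; exact: continuous_nR_quad.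
have c0 : c != 0.
  apply/eqP => c0; move: Sc; rewrite inE /S /= c0 nR0 => /eqP.
  by rewrite eq_sym oner_eq0.
exists (dot (mxact IQ c) c); split; [exact: (@phC_im _ _ phi)|exact: phC_sym|].
move=> x; have [x0|x0] := eqVneq (nR x) 0.
  by rewrite (nR_eq0 x0) mxact0 dot0l nR0 expr0n mulr0.
have xp : 0 < nR x by rewrite lt_def x0 nR_ge0.
have := cmin ((nR x)^-1 *: x); rewrite inE /S /= nRZ normfV ger0_norm ?nR_ge0// mulVf//.
move=> /(_ erefl); rewrite mxactZ dotZl dotZr mulrA -invfM -expr2.
by rewrite ler_pdivlMl ?exprn_gt0// mulrC.
Qed.

Lemma IQ_unit : IQ \in unitmx.
Proof.
rewrite unitmxE unitfE; apply/negP => /det0P[v v0 vIQ].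
have E : IQ^T = IQ by apply/matrixP => i j; rewrite !mxE -{1}(phC_sym phi) mxE.
by have := @phC_im _ _ phi v v0; rewrite mxact_trE E vIQ dot0l ltxx.
Qed.

Lemma B_unit : B \in unitmx.
Proof. by rewrite unitmxE unitfE; exact: phB_det. Qed.

(* [chi phi] inverts [z |-> (xz z, xiz z)]; all three are sealed, as unfolding them makes
   unification explode. *)
Fact xz_sealed :
  {f : 'rV[C]_d -> V | forall z, f z = - mxact (invmx IQ) (imV (mxact B z))}.
Proof. by exists (fun z => - mxact (invmx IQ) (imV (mxact B z))). Qed.
Definition xz := sval xz_sealed.
Lemma xzE z : xz z = - mxact (invmx IQ) (imV (mxact B z)).
Proof. exact: (svalP xz_sealed). Qed.

Fact xiz_sealed :
  {f : 'rV[C]_d -> V | forall z, f z = - reV (mxact B z + mxact Q (vecC (xz z)))}.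
Proof. by exists (fun z => - reV (mxact B z + mxact Q (vecC (xz z)))). Qed.
Definition xiz := sval xiz_sealed.
Lemma xizE z : xiz z = - reV (mxact B z + mxact Q (vecC (xz z))).
Proof. exact: (svalP xiz_sealed). Qed.

Fact chi_sealed : {f : V -> V -> 'rV[C]_d |
  forall x xi, f x xi = mxact (invmx B) (- (vecC xi + mxact Q (vecC x)))}.
Proof. by exists (fun x xi => mxact (invmx B) (- (vecC xi + mxact Q (vecC x)))). Qed.
Definition chi := sval chi_sealed.
Lemma chiE x xi : chi x xi = mxact (invmx B) (- (vecC xi + mxact Q (vecC x))).
Proof. exact: (svalP chi_sealed). Qed.

Lemma imVD (z w : 'rV[C]_d) : imV (z + w) = imV z + imV w.
Proof. by apply/rowP => j; rewrite !mxE imCD. Qed.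
Lemma reVD (z w : 'rV[C]_d) : reV (z + w) = reV z + reV w.
Proof. by apply/rowP => j; rewrite !mxE reCD. Qed.
Lemma imVN (z : 'rV[C]_d) : imV (- z) = - imV z.
Proof. by apply/rowP => j; rewrite !mxE imCN. Qed.
Lemma reVN (z : 'rV[C]_d) : reV (- z) = - reV z.
Proof. by apply/rowP => j; rewrite !mxE reCN. Qed.

(** [xz z] is the point y at which phi'_y (z, y) = B z + C y is real, which is the maximum point of
    - Im phi (z, .); [xiz z] is minus that real value. *)
Lemma phase_critical z : mxact B z = - (vecC (xiz z) + mxact Q (vecC (xz z))).
Proof.
apply/eqP; rewrite -subr_eq0 opprK (addrC (vecC _)) addrA; apply/eqP.
set v := mxact B z + mxact Q (vecC (xz z)).
have im0 : imV v = 0.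
  rewrite imVD imV_mxact xzE mxactN mxactM mulmxV ?IQ_unit// mxact1 subrr//.
by rewrite {1}(reimV v) im0 vecC0 scaler0 addr0 !xizE -/v vecCN subrr.
Qed.

Lemma chi_phase z : chi (xz z) (xiz z) = z.
Proof. by rewrite !chiE -phase_critical mxactM mulVmx ?B_unit// mxact1. Qed.

Lemma mxB_chi x xi : mxact B (chi x xi) = - (vecC xi + mxact Q (vecC x)).
Proof. by rewrite !chiE mxactM mulmxV ?B_unit// mxact1. Qed.

Lemma xz_chi x xi : xz (chi x xi) = x.
Proof.
rewrite !xzE mxB_chi imVN imVD imV_vecC add0r imV_mxact mxactN opprK mxactM.
by rewrite mulVmx ?IQ_unit// mxact1.
Qed.

Lemma xiz_chi x xi : xiz (chi x xi) = xi.
Proof.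
rewrite !xizE xz_chi mxB_chi opprD addrNK reVN opprK reV_vecC//.
Qed.

Lemma xzD z w : xz (z + w) = xz z + xz w.
Proof. by rewrite !xzE mxactD imVD mxactD opprD. Qed.
Lemma xizD z w : xiz (z + w) = xiz z + xiz w.
Proof. by rewrite !xizE xzD vecCD !mxactD addrACA reVD opprD. Qed.
Lemma xzN z : xz (- z) = - xz z.
Proof. by rewrite !xzE mxactN imVN mxactN. Qed.
Lemma xizN z : xiz (- z) = - xiz z.
Proof. by rewrite !xizE xzN vecCN !mxactN -opprD reVN. Qed.
Lemma chiZ (t : R) x xi : chi (t *: x) (t *: xi) = toC t *: chi x xi.
Proof. by rewrite !chiE !vecCZ mxactZ -scalerDr -scalerN mxactZ. Qed.
Lemma chiD x xi x' xi' : chi (x + x') (xi + xi') = chi x xi + chi x' xi'.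
Proof.
by rewrite !chiE !vecCD (mxactD Q) addrACA opprD (mxactD (invmx B)).
Qed.
Lemma chiN x xi : chi (- x) (- xi) = - chi x xi.
Proof. by rewrite !chiE !vecCN (mxactN Q) -opprD -(mxactN (invmx B)). Qed.
Lemma chiB x xi x' xi' : chi x xi - chi x' xi' = chi (x - x') (xi - xi').
Proof. by rewrite chiD chiN. Qed.

Lemma phase_bounds : exists2 K : R, 0 < K & (forall z, nR (xz z) + nR (xiz z) <= K * nC z) /\
  forall x xi, nC (chi x xi) <= K * (nR x + nR xi).
Proof.
pose N : R := \sum_i \sum_j `|invmx IQ i j|.
have N0 : 0 <= N by apply: sumr_ge0 => i _; exact: sumr_ge0.
have HN (x : V) : nR (mxact (invmx IQ) x) <= N * nR x.
  rewrite nRE [in leRHS]nRE /N mulr_suml; apply: ler_sum => i _; rewrite mxactE.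
  apply: le_trans (ler_norm_sum _ _ _) _; rewrite mulr_suml; apply: ler_sum => j _.
  by rewrite normrM ler_wpM2l// nR_coord.
pose K1 : R := N * mnorm B; pose K2 : R := mnorm B + mnorm Q * K1.
pose K3 : R := mnorm (invmx B) * (1 + mnorm Q).
have [B0 Q0 I0] : [/\ 0 <= mnorm B, 0 <= mnorm Q & 0 <= mnorm (invmx B)].
  by split; exact: mnorm_ge0.
have K10 : 0 <= K1 by rewrite mulr_ge0.
have K20 : 0 <= K2 by rewrite addr_ge0// mulr_ge0.
have K30 : 0 <= K3 by rewrite mulr_ge0// addr_ge0.
have Hx z : nR (xz z) <= K1 * nC z.
  rewrite xzE nRN; apply: le_trans (HN _) _; rewrite -mulrA ler_wpM2l//.
  exact: le_trans (nR_imV _) (nC_mxact _ _).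
have K120 : 0 <= K1 + K2 + K3 by rewrite addr_ge0// addr_ge0.
exists (K1 + K2 + K3 + 1); first by rewrite ltr_wpDl.
split=> [z|x xi].
  apply: (@le_trans _ _ ((K1 + K2) * nC z)); last first.
    by rewrite ler_wpM2r ?nC_ge0// -addrA lerDl addr_ge0.
  rewrite mulrDl lerD// xizE nRN; apply: le_trans (nR_reV _) _; apply: le_trans (nCD _ _) _.
  rewrite mulrDl lerD ?nC_mxact//; apply: le_trans (nC_mxact _ _) _.
  by rewrite -mulrA ler_wpM2l// nC_vecC.
apply: (@le_trans _ _ (K3 * (nR x + nR xi))); last first.
  by rewrite ler_wpM2r ?addr_ge0 ?nR_ge0// addrAC lerDr addr_ge0// addr_ge0.
rewrite chiE; apply: le_trans (nC_mxact _ _) _; rewrite -mulrA ler_wpM2l// nCN.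
apply: le_trans (nCD _ _) _; rewrite nC_vecC.
apply: (@le_trans _ _ (nR xi + mnorm Q * nR x)).
  by rewrite lerD2l -(nC_vecC x) nC_mxact.
rewrite mulrDl mul1r mulrDr.
have := mulr_ge0 Q0 (nR_ge0 xi); have := nR_ge0 x; lra.
Qed.

Fact pref_sealed : {f : 'rV[C]_d -> C | forall z, f z =
  'i * (2^-1 * dot (mxact A z) z - 2^-1 * dot (mxact Q (vecC (xz z))) (vecC (xz z)))}.
Proof. by eexists. Qed.
Definition pref := sval pref_sealed.
Lemma prefE z : pref z =
  'i * (2^-1 * dot (mxact A z) z - 2^-1 * dot (mxact Q (vecC (xz z))) (vecC (xz z))).
Proof. exact: (svalP pref_sealed). Qed.

Definition kerC (q : 'rV[C]_d * 'rV[C]_d) : C :=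
  cexp ('i * (2^-1 * dot (mxact A q.1) q.1 + dot (mxact B q.1) q.2
    + 2^-1 * dot (mxact Q q.2) q.2)).

Lemma csmooth_kerC : csmooth kerC.
Proof.
have f1 := @cvec_fst R d ('rV[C]_d : normedModType C).
have f2 := @cvec_snd R d ('rV[C]_d : normedModType C).
apply: csmooth_cexp; apply: csmoothZ; apply: csmoothD; first apply: csmoothD.
- by apply: csmoothZ; apply: csmooth_dot => //; exact: cvec_mxact.
- by apply: csmooth_dot => //; exact: cvec_mxact.
- by apply: csmoothZ; apply: csmooth_dot => //; exact: cvec_mxact.
Qed.

(** Completing the square in y about the real point [xz z]: by [phase_critical] the linear
    coefficient B z is - (xi + C x). This identifies the FBI kernel with a wave packet of matrix C
    at the phase space point of z. *)
Lemma kerC_split z y : kerC (z, y) = cexp (pref z) * gpC Q (xz z) (xiz z) y.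
Proof.
rewrite /kerC /gpC prefE -cexpD; congr cexp.
rewrite [(z, y).1]/= [(z, y).2]/= phase_critical dotNl dotDl.
have -> : dot (mxact Q (y - vecC (xz z))) (y - vecC (xz z)) =
   dot (mxact Q y) y - (1 + 1) * dot (mxact Q (vecC (xz z))) y
   + dot (mxact Q (vecC (xz z))) (vecC (xz z)).
  rewrite (quad_add _ _ (phC_sym phi)) (dot_mxact_sym _ _ (phC_sym phi)).
  by rewrite (mxactN Q) !dotNl (dotNr _ (vecC (xz z))) opprK mulrN.
rewrite (dotC (vecC (xiz z))).
set X := dot (mxact Q (vecC (xz z))) (vecC (xz z)); set Y := dot (mxact Q y) y.
set Z := dot (mxact Q (vecC (xz z))) y; set T := dot y _; set S := dot (mxact A z) z.
have c2 : 2 != 0 :> C by rewrite pnatr_eq0.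
by field.
Qed.

Lemma fbi_kernelE z : fbi_kernel phi z = (fun y => kerC (z, y)) \o @vecC R d.
Proof. by []. Qed.

Lemma fbi_kernel_split z :
  fbi_kernel phi z = fun y => cexp (pref z) * gp Q (xz z) (xiz z) y.
Proof. by rewrite fbi_kernelE; apply/funext => y /=; rewrite kerC_split. Qed.

(** On R^d the packet in [kerC_split] has modulus at most 1, with equality at y = [xz z]; so the
    maximum defining Phi is the real part of [pref]. *)
Lemma weightE z : weight phi z = reC (pref z).
Proof.
have E y : - imC (phase phi z y) =
    reC (pref z) - 2^-1 * dot (mxact IQ (y - xz z)) (y - xz z).
  have : cabs (kerC (z, vecC y)) = cabs (cexp (pref z)) * cabs (gpC Q (xz z) (xiz z) (vecC y)).
    by rewrite kerC_split cabsM.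
  rewrite !cabs_cexp -expRD => /expR_inj.
  rewrite reCB !reC_iM imC_dot imV_vecC dot0l oppr0 subr0 imC_half -vecCB.
  by rewrite imC_quad ?phC_sym// imV_vecC reV_vecC !dot0r mulr0 addr0 subr0.
have ge y : - imC (phase phi z y) <= reC (pref z).
  rewrite E lerBlDr lerDl mulr_ge0//.
  have [a [a0 _ pa]] := phC_posim.
  by apply: le_trans (pa _); rewrite mulr_ge0 ?sqr_ge0// ltW.
apply/eqP; rewrite eq_le; apply/andP; split.
  apply: ge_sup; first by exists (- imC (phase phi z 0)); exists 0.
  by move=> _ [y _ <-].
rewrite {1}(_ : reC (pref z) = - imC (phase phi z (xz z))).
  apply: ub_le_sup; last by exists (xz z).
  by exists (reC (pref z)) => _ [y _ <-].
by rewrite E subrr dot0r mulr0 subr0.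
Qed.

Lemma cabs_pref z : cabs (cexp (pref z)) = expR (weight phi z).
Proof. by rewrite cabs_cexp weightE. Qed.

Lemma pref_sub z w : pref (z + w) - pref z =
  'i * ((dot (mxact A z) w - dot (mxact Q (vecC (xz z))) (vecC (xz w))) +
   2^-1 * (dot (mxact A w) w - dot (mxact Q (vecC (xz w))) (vecC (xz w)))).
Proof.
rewrite !prefE -mulrBr xzD vecCD (quad_add _ _ (phA_sym phi)) (quad_add _ _ (phC_sym phi)).
by rewrite half_quad_sub.
Qed.

Lemma re_quad_le (a2 a3 q2 q3 : C) (mA mQ n1 n2 k : R) :
  0 <= mA -> 0 <= mQ -> 0 <= n1 -> 0 <= n2 ->
  cabs a2 <= mA * n1 -> cabs a3 <= mA * n2 ->
  cabs q2 <= mQ * (k * n1) -> cabs q3 <= mQ * (k * n2) ->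
  reC ('i * ((a2 - q2) + 2^-1 * (a3 - q3))) <= (mA + mQ * k + 1) * (n1 + n2).
Proof.
move=> A0 Q0 n10 n20 h2 h3 g2 g3; rewrite reC_iM.
apply: le_trans (ler_norm _) _; rewrite normrN; apply: le_trans (cabs_im _) _.
have ch : cabs (2^-1 : C) = 2^-1 by rewrite -(toCnat R 2) -toCV cabs_toC ger0_norm.
apply: le_trans (cabsD _ _) _; rewrite cabsM ch.
have e1 := cabsB a2 q2; have e2 := cabsB a3 q3; have n3 := cabs_ge0 (a3 - q3).
have -> : (mA + mQ * k + 1) * (n1 + n2) =
  mA * n1 + mA * n2 + mQ * (k * n1) + mQ * (k * n2) + n1 + n2 by ring.
clear -h2 h3 g2 g3 e1 e2 n3 n10 n20; lra.
Qed.

(** Phi is a real quadratic form, the real part of [pref]. The symbol estimates use Phi through this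
    increment bound alone. *)
Lemma weight_lip : exists2 K : R, 0 < K & forall z w,
  weight phi (z + w) <= weight phi z + K * (nC z * nC w + nC w ^+ 2).
Proof.
have [K K0 [HK _]] := phase_bounds.
have Kx z : nR (xz z) <= K * nC z.
  by apply: le_trans (HK z); rewrite lerDl nR_ge0.
have [A0 Q0] : 0 <= mnorm A /\ 0 <= mnorm Q by split; exact: mnorm_ge0.
have cq M (x y : 'rV[C]_d) : cabs (dot (mxact M x) y) <= mnorm M * (nC x * nC y).
  by rewrite mulrA; exact: cabs_quad.
have cx z w : cabs (dot (mxact Q (vecC (xz z))) (vecC (xz w))) <=
    mnorm Q * (K ^+ 2 * (nC z * nC w)).
  apply: le_trans (cq _ _ _) _; rewrite !nC_vecC ler_wpM2l// expr2 mulrACA.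
  by rewrite ler_pM ?nR_ge0.
exists (mnorm A + mnorm Q * K ^+ 2 + 1).
  by rewrite ltr_wpDl// addr_ge0// mulr_ge0// exprn_ge0// (ltW K0).
move=> z w; rewrite -lerBlDl !weightE -reCB pref_sub expr2.
have w0 := nC_ge0 w; have z0 := nC_ge0 z.
by apply: (re_quad_le A0 Q0 (mulr_ge0 z0 w0) (mulr_ge0 w0 w0)
  (cq _ _ _) (cq _ _ _) (cx _ _) (cx _ _)).
Qed.

Lemma xz0 : xz 0 = 0.
Proof. by apply: (addrI (xz 0)); rewrite -xzD !addr0. Qed.

Lemma weight0 : weight phi 0 = 0.
Proof.
by rewrite weightE !prefE xz0 vecC0 !mxact0 !dot0l subrr mulr0.
Qed.

Lemma kerC_dominated : exists a b : R, [/\ 0 < a, 0 <= b & locally_dominated (om a b) kerC].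
Proof.
have [a pa] := phC_posim; have [a0 _ _] := pa.
exists (a / 4 / 2), (gpb a Q + 1); split.
- by rewrite !divr_gt0.
- by rewrite addr_ge0// gpb_ge0.
have [K K0 [HK _]] := phase_bounds; have [L L0 HL] := weight_lip.
move=> r; exists (expR (L * r ^+ 2 + a / 4 * (K * r) ^+ 2 + (K * r) ^+ 2)); first exact: expR_ge0.
move=> z zr y; rewrite kerC_split cabsM cabs_pref.
have r0 : 0 <= r := le_trans (nC_ge0 z) zr.
have Kr : K * nC z <= K * r by rewrite ler_wpM2l// ltW.
have Kr0 : 0 <= K * r by rewrite mulr_ge0// ltW.
have hx : nR (xz z) <= K * r.
  by apply: le_trans Kr; apply: le_trans (HK z); rewrite lerDl nR_ge0.
have hxi : nR (xiz z) <= K * r.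
  by apply: le_trans Kr; apply: le_trans (HK z); rewrite lerDr nR_ge0.
apply: (@le_trans _ _ (expR (weight phi z) * (expR (a / 4 * nR (xz z) ^+ 2 + nR (xiz z) ^+ 2) *
   om (a / 4 / 2) (gpb a Q + 1) y))).
  rewrite ler_wpM2l ?expR_ge0//; apply: le_trans (gpC_bound _ _ _ pa) _.
  by apply: om_shift; rewrite divr_ge0// ltW.
rewrite mulrA ler_wpM2r ?om_ge0// -expRD ler_expR -addrA.
apply: lerD.
  have := HL 0 z; rewrite weight0 nC0 mul0r !add0r => h; apply: le_trans h _.
  by rewrite ler_wpM2l ?(ltW L0)// lerXn2r ?nnegrE ?nC_ge0.
apply: lerD; last by rewrite lerXn2r ?nnegrE ?nR_ge0.
by rewrite ler_wpM2l ?divr_ge0 ?(ltW a0)// lerXn2r ?nnegrE ?nR_ge0.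
Qed.

Lemma ddir_quad (W : normedModType C) (F : W -> C) (y v : W) (l c : C) :
  (forall h : C, F (y + h *: v) = F y + h * l + h ^+ 2 * c) -> ddir v F y = l.
Proof.
move=> H; suff : is_derive y v F l by rewrite /ddir; case.
apply: is_cderive_eps => e e0; have c0 := cabs_ge0 c.
exists (e / (cabs c + 1)); first by rewrite divr_gt0// ltr_wpDl.
move=> h hr; rewrite H (_ : _ - _ - _ = h * (h * c)); last by ring.
rewrite cabsM mulrC ler_wpM2r ?cabs_ge0// cabsM.
apply: (@le_trans _ _ (cabs h * (cabs c + 1))).
  by rewrite ler_wpM2l ?cabs_ge0// lerDl.
by rewrite -ler_pdivlMr ?ltW// ltr_wpDl.
Qed.

Lemma phase_yE z y : phase_y phi z y = mxact B z + mxact Q (vecC y).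
Proof.
pose F (y : 'rV[C]_d) := 2^-1 * dot (mxact A z) z + dot (mxact B z) y
    + 2^-1 * dot (mxact Q y) y.
have sF : csmooth F.
  apply: csmoothD; first apply: csmoothD.
  - exact: csmooth_cst.
  - by apply: csmooth_dot; [exact: cvec_cst|exact: cvec_id].
  - by apply: csmoothZ; apply: csmooth_dot; [apply: cvec_mxact|]; exact: cvec_id.
apply/rowP => j; rewrite mxE.
have [-> _] := pderivR_vecC j y sF; rewrite /dd.
rewrite (@ddir_quad _ F (vecC y) (delta_mx 0 j) ((mxact B z + mxact Q (vecC y)) 0 j)
  (2^-1 * dot (mxact Q (delta_mx 0 j)) (delta_mx 0 j)))// => h.
have dotd (x : 'rV[C]_d) : dot x (delta_mx 0 j) = x 0 j.
  exact: dot_delta.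
rewrite /F (quad_add _ _ (phC_sym phi)) (mxactZ Q) !dotDr !dotZr !dotZl.
rewrite (dotd (mxact B z)) (dotd (mxact Q (vecC y))) [in RHS]mxE.
exact: half_quad_incr.
Qed.

(** [chi_b] is a chosen solution of a linear equation; the injectivity of B identifies it with the
    explicit one. *)
Lemma chi_bE (w : V * V) : chi_b phi w = chi w.1 w.2.
Proof.
have P : [set z | vecC w.2 = - phase_y phi z w.1] (chi w.1 w.2).
  by rewrite /mkset phase_yE mxB_chi opprD opprK addrK.
have := getPex (ex_intro _ _ P); rewrite -/(chi_b phi w) /= phase_yE => E.
have E2 : mxact B (chi_b phi w) = mxact B (chi w.1 w.2).
  by rewrite mxB_chi E opprD opprK addrK.
have := congr1 (mxact (invmx B)) E2.
by rewrite !mxactM !mulVmx ?B_unit// !mxact1.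
Qed.

End PhaseGeometry.

(** * Growth of the FBI transform *)

Section FBITransform.
Variables (R : realType) (d : nat) (theta : R) (phi : FBI_phase R d).
Hypotheses (d_gt0 : (0 < d)%N) (theta_ge : 2^-1 <= theta) (theta_lt : theta < 1).
Local Notation C := (Cplx R).
Local Notation V := 'rV[R]_d.
Local Notation p := (theta^-1).

Definition kerD (s : seq 'I_d) (z : 'rV[C]_d) : V -> C :=
  (fun y => foldr (@ddz R d d) (kerC phi) s (z, y)) \o @vecC R d.

Lemma foldr_dd_scale (k : C) (F : 'rV[C]_d -> C) s : csmooth F ->
  foldr (@dd R d) (fun z => k * F z) s = fun z => k * foldr (@dd R d) F s z.
Proof.
move=> sF; elim: s => [//|j s IH]; rewrite /= IH; apply/funext => z.
by rewrite /dd derive_mulZ//; apply: csmooth_diff; exact: csmooth_foldr.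
Qed.

Lemma fbi_family u s : gs_dual theta u ->
  [/\ csmooth (fbi phi u), forall z, gs theta (kerD s z) &
   forall z, foldr (@dd R d) (fbi phi u) s z = toC (c_phi phi) * u (kerD s z)].
Proof.
move=> du; have [a [b [a0 b0 ld]]] := kerC_dominated phi d_gt0.
have [s1 s2 s3] := dual_family d_gt0 theta_ge theta_lt du a0 b0 s (csmooth_kerC phi) ld.
have sF : csmooth (fbi phi u) by apply: csmoothZ; exact: s1.
split=> // z; have := foldr_dd_scale (toC (c_phi phi)) s s1 => ->.
by rewrite s3.
Qed.

Lemma fbi_csmooth u : gs_dual theta u -> csmooth (fbi phi u).
Proof. by move=> /(fbi_family [::])[]. Qed.

Lemma powRp_scale (c x : R) : 0 <= c -> 0 <= x -> (c * x) `^ p = c `^ p * x `^ p.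
Proof. by move=> c0 x0; rewrite powRM. Qed.

Lemma xz_growth : exists2 K : R, 0 < K & forall z,
  nR (xz phi z) `^ p + nR (xiz phi z) `^ p <= K * nC z `^ p.
Proof.
have [K K0 [HK _]] := phase_bounds phi.
exists (2 * K `^ p); first by rewrite mulr_gt0// powR_gt0.
move=> z; rewrite mulr_natl mulr2n mulrDl -powRM ?nC_ge0 ?(ltW K0)//.
apply: lerD; apply: (powRp_le theta_ge); rewrite ?nR_ge0//; apply: le_trans (HK z).
  by rewrite lerDl nR_ge0.
by rewrite lerDr nR_ge0.
Qed.

(** By [fbi_kernel_split] the kernel is a packet times a factor of modulus exp Phi, and [gp_gsb]
    puts all packets in one step. A functional, bounded on that step, thus has a transform bounded
    by exp (Phi + e |z|^p). *)
Lemma kernel_gsb (e : R) : 0 < e -> exists c K : R, [/\ 0 < c, 0 < K & forall z,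
  gsb theta c (K * expR (e * nC z `^ p + weight phi z)) (fbi_kernel phi z)].
Proof.
move=> e0; have [L L0 HL] := xz_growth; have [a pQ] := phC_posim phi d_gt0.
have [c [K [c0 K0 H]]] := gp_gsb theta_ge theta_lt pQ (divr_gt0 e0 L0).
exists c, K; split=> // z; rewrite fbi_kernel_split.
have := gsb_scale (cexp (pref phi z)) d_gt0 (H (xz phi z) (xiz phi z)).
rewrite (cabs_pref phi d_gt0) mulrCA -expRD; apply: gsb_mono => //.
rewrite ler_wpM2l ?(ltW K0)// ler_expR addrC lerD2r.
rewrite mulrAC ler_pdivrMr// -mulrA ler_wpM2l ?(ltW e0)// mulrC.
exact: HL.
Qed.

Lemma equi_fbi (U : set (functional R d)) (e : R) : equibounded theta U -> 0 < e ->
  exists2 K : R, 0 <= K & forall u, U u -> forall z,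
    cabs (fbi phi u z) <= K * expR (e * nC z `^ p + weight phi z).
Proof.
move=> eU e0; have [c [L [c0 L0 H]]] := kernel_gsb e0.
have [K K0 HK] := eU c c0; exists (cabs (toC (c_phi phi)) * (K * L)).
  by rewrite !mulr_ge0 ?cabs_ge0// ltW.
move=> u Uu z; rewrite /fbi cabsM -mulrA ler_wpM2l ?cabs_ge0// -mulrA; exact: HK.
Qed.

Lemma cenorm_le_nC (z : 'rV[C]_d) : cenorm z <= nC z.
Proof.
rewrite /cenorm -[leRHS]ger0_norm ?nC_ge0// -sqrtr_sqr ler_wsqrtr//.
Transparent nC.
rewrite /nC expr2 mulr_suml; apply: ler_sum => j _.
rewrite expr2 ler_wpM2l ?cabs_ge0// (bigD1 j)//= lerDl; apply: sumr_ge0 => i _.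
exact: cabs_ge0.
Qed.
Opaque nC.

Lemma cabs_le_cenorm (z : 'rV[C]_d) j : cabs (z 0 j) <= cenorm z.
Proof.
rewrite -[leLHS]ger0_norm ?cabs_ge0// -sqrtr_sqr ler_wsqrtr// (bigD1 j)//= lerDl.
by apply: sumr_ge0 => i _; exact: sqr_ge0.
Qed.

Lemma nC_le_cenorm (z : 'rV[C]_d) : nC z <= d%:R * cenorm z.
Proof.
Transparent nC.
rewrite /nC -sumr_const_ord; apply: ler_sum => j _; exact: cabs_le_cenorm.
Qed.
Opaque nC.

Lemma enorm_le_nR (x : V) : enorm x <= nR x.
Proof.
rewrite /enorm -[leRHS]ger0_norm ?nR_ge0// -sqrtr_sqr ler_wsqrtr//.
rewrite expr2 [X in _ <= X * _]nRE mulr_suml; apply: ler_sum => j _.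
by rewrite -real_normK ?num_real// expr2 ler_wpM2l// nR_coord.
Qed.

Lemma nR_le_enorm (x : V) : nR x <= d%:R * enorm x.
Proof.
rewrite nRE -sumr_const_ord; apply: ler_sum => j _.
rewrite -sqrtr_sqr ler_wsqrtr// (bigD1 j)//= lerDl.
by apply: sumr_ge0 => i _; exact: sqr_ge0.
Qed.

End FBITransform.

(** * Estimates of the symbol terms *)

Section SymbolEstimates.
Variables (R : realType) (d : nat) (theta : R).
Hypotheses (theta_ge : 2^-1 <= theta) (theta_lt : theta < 1).
Local Notation C := (Cplx R).
Local Notation p := (theta^-1).
Variables (W : 'rV[C]_d -> R) (L : R) (h : mindex d -> 'rV[C]_d -> C).
Hypothesis L_gt0 : 0 < L.
Hypothesis W_lip : forall z w, W (z + w) <= W z + L * (nC z * nC w + nC w ^+ 2).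
Hypothesis h_bound : forall e : R, 0 < e -> exists2 D : R, 0 < D & forall a z,
  cabs (h a z) <= D * (e ^+ mabs a / (mfact a)%:R `^ theta) * expR (e * nC z `^ p).

Let symb (a : mindex d) (F : 'rV[C]_d -> C) z := h a z * miter (@pderivC R d) a F z.

Lemma cauchy_radius (n : nat) : exists2 r : R, 0 < r &
  r * n%:R <= n%:R `^ (1 - theta) /\ (r ^+ n)^-1 = kk theta n.
Proof.
have [->|n0] := eqVneq n 0%N.
  by exists 1; rewrite // mulr0 powR_ge0 expr0 invr1 kkE.
have np : 0 < n%:R :> R by rewrite ltr0n lt0n.
exists ((n%:R `^ theta)^-1); first by rewrite invr_gt0 powR_gt0.
split; last by rewrite exprVn invrK kkE.
rewrite powRB ?(gt_eqF np) ?implybT// powRr1 ?(ltW np)// mulrC //.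
Qed.

(* Cauchy's estimate with total radius [|a| ^ (1 - theta)]: the powers of the radius give
   [a! ^ theta], which the bound on [h] cancels, and by Young's inequality [W] grows on that
   ball by at most [e |z| ^ (1 / theta) + C |a|]. *)
Lemma symbol_core (N e : R) : 0 <= N -> 0 < e -> exists2 K : R, 0 < K &
  forall F a z (M A : R), csmooth F -> 0 <= M ->
  (forall w, nC w <= (mabs a)%:R `^ (1 - theta) -> cabs (F (z + w)) <= M * expR (A + W (z + w))) ->
  cabs (symb a F z) <= K * M * expR (A + e * nC z `^ p + W z - N * (mabs a)%:R).
Proof.
move=> N0 e0.
have [K1 K10 HY] := young theta_ge theta_lt (divr_gt0 e0 (mulr_gt0 (ltr0Sn R 1) L_gt0)).
(* Geometric factors to be paid by the free epsilon in the bound on [h]: exp d per derivative from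
   [kk_mfact], exp C1 from the growth of W on the Cauchy ball, and exp N for the decay in |a| that
   is wanted. *)
pose C1 := L * K1 + L; pose q : R := expR (- (d%:R + C1 + N)).
pose ep := Num.min (e / 2) q.
have ep0 : 0 < ep by rewrite lt_min expR_gt0 divr_gt0.
have [D D0 HD] := h_bound ep0.
exists D => // F a z M A sF M0 HF; set n := mabs a in HF *; set r := n%:R `^ (1 - theta) in HF.
have z0 := nC_ge0 z; have r0 : 0 <= r by exact: powR_ge0.
have n0 : 0 <= n%:R :> R by [].
have Hw w : nC w <= r -> W (z + w) <= W z + e / 2 * nC z `^ p + C1 * n%:R.
  move=> wr; have w0 := nC_ge0 w; apply: le_trans (W_lip z w) _; rewrite -addrA lerD2l.
  have := HY n%:R (nC z) n0 z0; rewrite -/r => hy.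
  have h1 : nC z * nC w + nC w ^+ 2 <= r * nC z + n%:R.
    rewrite lerD// 1?(mulrC r) ?ler_wpM2l//.
    apply: (@le_trans _ _ (r ^+ 2)); last exact: nat_powR_sqr.
    by rewrite lerXn2r ?nnegrE.
  have {hy h1} h2 := ler_wpM2l (ltW L_gt0) (le_trans h1 (lerD hy (lexx n%:R))).
  apply: le_trans h2 _; rewrite le_eqVlt; apply/orP; left; apply/eqP.
  by rewrite /C1; field; rewrite gt_eqF.
have [s sn sE] := miter_foldr (@pderivC R d) a.
have [t t0 [tr tk]] := cauchy_radius n.
have HC : cabs (miter (@pderivC R d) a F z) <=
    M * expR (A + W z + e / 2 * nC z `^ p + C1 * n%:R) * kk theta n.
  rewrite sE -tk -[X in (_ ^+ X)^-1]sn.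
  apply: cauchy_foldr => // z' zz'.
  rewrite -(subrK z z') addrC.
  have wr : nC (z' - z) <= r by apply: le_trans zz' _; rewrite sn; exact: tr.
  apply: le_trans (HF _ wr) _; rewrite ler_wpM2l// ler_expR -!addrA lerD2l.
  by have := Hw _ wr; rewrite -!addrA.
rewrite /symb cabsM; apply: le_trans (ler_pM (cabs_ge0 _) (cabs_ge0 _) (HD a z) HC) _.
have f0 : 0 < (mfact a)%:R `^ theta :> R by rewrite powR_gt0// ltr0n mfact_gt0.
have HK : kk theta n <= expR d%:R ^+ n * (mfact a)%:R `^ theta by exact: kk_mfact.
rewrite -/n.
have -> : D * (ep ^+ n / (mfact a)%:R `^ theta) * expR (ep * nC z `^ p) *
  (M * expR (A + W z + e / 2 * nC z `^ p + C1 * n%:R) * kk theta n) =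
  D * M * (ep ^+ n * (kk theta n / (mfact a)%:R `^ theta) * (expR (ep * nC z `^ p) *
    expR (A + W z + e / 2 * nC z `^ p + C1 * n%:R))) by field; rewrite gt_eqF.
apply: ler_wpM2l; first by rewrite mulr_ge0// ltW.
have h1 : ep ^+ n * (kk theta n / (mfact a)%:R `^ theta) <= expR (- (C1 + N) * n%:R).
  apply: (@le_trans _ _ (q ^+ n * expR d%:R ^+ n)).
    apply: ler_pM; rewrite ?exprn_ge0 ?(ltW ep0) ?divr_ge0 ?(ltW f0) ?kk_ge0//.
      by rewrite lerXn2r ?nnegrE ?(ltW ep0) ?expR_ge0// ge_min lexx orbT.
    by rewrite ler_pdivrMr.
  rewrite -exprMn -expRD -expRM_natl mulr_natl -mulr_natr ler_expR ler_wpM2r//.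
  by lra.
rewrite -expRD; apply: le_trans (ler_wpM2r (expR_ge0 _) h1) _.
rewrite -expRD ler_expR.
have h2 : ep * nC z `^ p <= e / 2 * nC z `^ p.
  by rewrite ler_wpM2r ?powR_ge0// ge_min lexx.
set X := nC z `^ p in h2 *; rewrite mulNr !mulrDl; lra.
Qed.

Lemma symbol_global (e : R) : 0 < e -> exists2 K : R, 0 < K & exists2 e1 : R, 0 < e1 &
  forall F a z (M : R), csmooth F -> 0 <= M ->
  (forall w, cabs (F w) <= M * expR (e1 * nC w `^ p + W w)) ->
  cabs (symb a F z) <= K * M * expR (e * nC z `^ p + W z - 2 * (mabs a)%:R).
Proof.
move=> e0; pose e1 : R := e / 8; have e10 : 0 < e1 by rewrite divr_gt0.
(* On the ball, |z + w|^p is at most 4 (|z|^p + 1 + |a|). The part 4 e1 of N pays for the share of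
   |a|, leaving exp (- 2 |a|); 4 e1 = e / 2 and the e / 2 given to [symbol_core] add up to e. *)
have N0 : 0 <= 4 * e1 + 2 by rewrite addr_ge0// mulr_ge0// ltW.
have [K K0 HK] := symbol_core N0 (divr_gt0 e0 (ltr0Sn R 1)).
exists (K * expR (4 * e1)); first by rewrite mulr_gt0// expR_gt0.
exists e1 => // F a z M sF M0 HF.
apply: le_trans (HK F a z M (e1 * (4 * (nC z `^ p + (1 + (mabs a)%:R)))) sF M0 _) _.
  move=> w wr; apply: le_trans (HF _) _; rewrite ler_wpM2l// ler_expR lerD2r.
  rewrite ler_wpM2l ?(ltW e10)//.
  apply: (@le_trans _ _ ((nC z + nC w) `^ p)).
    by apply: powRp_le => //; rewrite ?nC_ge0 ?nCD.
  apply: le_trans (powRp_add theta_ge theta_lt (nC_ge0 _) (nC_ge0 _)) _.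
  rewrite ler_wpM2l// lerD2l; apply: le_trans (powRp_le_sqr theta_ge theta_lt (nC_ge0 _)) _.
  rewrite lerD2l; apply: (@le_trans _ _ (((mabs a)%:R `^ (1 - theta)) ^+ 2)).
    by rewrite lerXn2r ?nnegrE ?nC_ge0 ?powR_ge0.
  exact: nat_powR_sqr.
have -> B : K * expR (4 * e1) * M * B = K * M * (expR (4 * e1) * B) by ring.
rewrite ler_wpM2l ?mulr_ge0 ?(ltW K0)//.
rewrite -expRD ler_expR /e1; set X := nC z `^ p; set n : R := (mabs a)%:R; set w := W z.
have X0 : 0 <= X by exact: powR_ge0.
lra.
Qed.

(** Cones are written as sets of points within k s of s z0, with the scale s explicit. If |a|^(1 -
    theta) <= k' s, the Cauchy ball stays in the larger cone and inherits its decay. Otherwise |a|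
    >= c' |z|^p for a constant c', and the factor exp (- 2 |a|) of [symbol_global] supplies both the
    decay in z and the decay in |a|. *)
Lemma symbol_cone (z0 : 'rV[C]_d) (k e : R) : z0 != 0 -> 0 < k -> 0 < e ->
  exists k' e' e1 K : R, [/\ 0 < k', 0 < e', 0 < e1, 0 < K &
  forall F (M : R), csmooth F -> 0 <= M ->
  (forall w, cabs (F w) <= M * expR (e1 * nC w `^ p + W w)) ->
  (forall w s, 0 < s -> nC (w - toC s *: z0) <= k * s ->
     cabs (F w) <= M * expR (- (e * nC w `^ p) + W w)) ->
  forall a z s, 0 < s -> nC (z - toC s *: z0) <= k' * s ->
  cabs (symb a F z) <= K * M * expR (- (e' * nC z `^ p) + W z - (mabs a)%:R)].
Proof.
move=> z00 k0 e0.
have Z0 : 0 < nC z0 by rewrite lt_def nC_ge0 andbT; apply: contra_neq z00 => /nC_eq0.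
pose k1 := Num.min k (nC z0 / 2); pose k' := k1 / 2.
have k10 : 0 < k1 by rewrite lt_min k0 divr_gt0.
have k'0 : 0 < k' by rewrite divr_gt0.
have k1k : k1 <= k by rewrite ge_min lexx.
have k1Z : k1 <= nC z0 / 2 by rewrite ge_min lexx orbT.
pose c := k' / (2 * nC z0); have c0 : 0 < c by rewrite divr_gt0// mulr_gt0.
pose cp := c `^ p; have cp0 : 0 < cp by rewrite powR_gt0.
have [K1 K10 H1] := symbol_core ler01 (divr_gt0 e0 (ltr0Sn R 31)).
have [K2 K20 [e1 e10 H2]] := symbol_global (divr_gt0 cp0 (ltr0Sn R 1)).
pose e' := Num.min (e / 32) (cp / 2).
have e'0 : 0 < e' by rewrite lt_min !divr_gt0.
exists k', e', e1, (K1 + K2); split; rewrite ?addr_gt0// => F M sF M0 HG HL a z s s0 zs.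
have X0 : 0 <= nC z `^ p by exact: powR_ge0.
have sz0 : nC (toC s *: z0) = s * nC z0 by rewrite nCZ cabs_toC ger0_norm// ltW.
have zup : nC z <= 2 * nC z0 * s.
  rewrite -(subrK (toC s *: z0) z); apply: le_trans (nCD _ _) _; rewrite sz0.
  have := ler_wpM2r (ltW s0) k1Z; move: zs; rewrite /k'; have := mulr_gt0 s0 Z0.
  lra.
have [nr|nr] := leP ((mabs a)%:R `^ (1 - theta)) (k' * s).
  apply: (@le_trans _ _ (K1 * M * expR (- (e / 16 * nC z `^ p) + e / 32 * nC z `^ p + W z
      - 1 * (mabs a)%:R))).
    apply: H1 => // w wr.
    have wk : nC (z + w - toC s *: z0) <= k1 * s.
      rewrite addrAC; apply: le_trans (nCD _ _) _.
      by have := le_trans wr nr; move: zs; rewrite /k'; lra.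
    apply: le_trans (HL _ s s0 _) _.
      by apply: le_trans wk _; rewrite ler_wpM2r// ltW.
    apply: ler_wpM2l; first exact: M0.
    rewrite ler_expR; apply: lerD; last exact: lexx.
    rewrite lerN2.
    have zw : nC z / 4 <= nC (z + w).
      have h3 : nC (toC s *: z0) <= nC (z + w) + nC (z + w - toC s *: z0).
        rewrite -[X in nC X](subrK (z + w)) addrC nCBC.
        by apply: le_trans (nCD _ _) _; rewrite lerD2l nCBC.
      move: h3; rewrite sz0; have := ler_wpM2r (ltW s0) k1Z.
      by move: zup wk; lra.
    have z4 : 0 <= nC z / 4 by rewrite divr_ge0 ?nC_ge0.
    have h4 : (nC z / 4) `^ p <= nC (z + w) `^ p by apply: powRp_le.
    have q0 : 16^-1 <= 4^-1 `^ p :> R.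
      have -> : 16^-1 = 4^-1 `^ 2 :> R by rewrite powR_mulrn ?invr_ge0// exprVn -natrX.
      apply: ger_powR; last exact: (p_le2 theta_ge).
      by rewrite invr_gt0 ltr0n invf_le1 ?ler1n.
    rewrite -mulrA; apply: ler_wpM2l; first exact: ltW.
    apply: le_trans h4; rewrite powRM ?invr_ge0 ?nC_ge0// mulrC.
    exact: ler_wpM2l.
  apply: ler_pM; rewrite ?expR_ge0 ?mulr_ge0 ?(ltW K10)//.
    by rewrite ler_wpM2r// lerDl ltW.
  rewrite ler_expR mul1r lerD2r lerD2r.
  have h5 : e' * nC z `^ p <= e / 32 * nC z `^ p by rewrite ler_wpM2r// ge_min lexx.
  move: h5; set X := nC z `^ p; lra.
apply: le_trans (H2 F a z M sF M0 HG) _.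
apply: ler_pM; rewrite ?expR_ge0 ?mulr_ge0 ?(ltW K20)//.
  by rewrite ler_wpM2r// lerDr ltW.
rewrite ler_expR.
(* By theta >= 1/2, a lower bound on the Cauchy radius |a|^(1 - theta) is one on |a|^theta, hence on
   |a| against |z|^p. *)
have na : (mabs a)%:R `^ (1 - theta) <= (mabs a)%:R `^ theta :> R.
  case: (mabs a) => [|n]; last by rewrite ler_powR ?ler1n//; move: theta_ge; lra.
  rewrite !powR0 ?(theta_neq0 theta_ge)// subr_eq0 eq_sym lt_eqF//.
have cz : c * nC z <= (mabs a)%:R `^ theta.
  apply: le_trans na; apply: le_trans (ltW nr).
  have -> : c * nC z = k' * (nC z / (2 * nC z0)) by rewrite /c mulrAC -mulrA.
  apply: ler_wpM2l; first exact: ltW.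
  by rewrite ler_pdivrMr ?mulr_gt0// mulrC.
have {cz} : cp * nC z `^ p <= (mabs a)%:R.
  rewrite -powRM ?nC_ge0 ?(ltW c0)// -[leRHS](powRtK theta_ge (ler0n _ _)).
  apply: powRp_le => //; rewrite mulr_ge0 ?nC_ge0 ?(ltW c0)//.
have : e' * nC z `^ p <= cp / 2 * nC z `^ p by rewrite ler_wpM2r// ge_min lexx orbT.
set X := nC z `^ p; set n := (mabs a)%:R; lra.
Qed.

End SymbolEstimates.

#[local] Existing Instance totally_filter.

(** * Unordered sums *)

Section UnorderedSums.
Variables (R : realType) (I : choiceType).
Local Notation C := (Cplx R).

Lemma psumE (K : zmodType) (x : I -> K) (A : {fset I}) : partial_sum x A = \sum_(i <- A) x i.
Proof. by rewrite /partial_sum big_seq_fsetE. Qed.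

Lemma psum_split (K : zmodType) (x : I -> K) (A B : {fset I}) : (A `<=` B)%fset ->
  partial_sum x B = partial_sum x A + partial_sum x (B `\` A)%fset.
Proof.
move=> AB; rewrite !psumE (big_fsetID _ (mem A)) /=; congr (_ + _); apply: eq_fbigl => i.
  by rewrite !inE /=; case: (boolP (i \in A)) => [/(fsubsetP AB) ->|_]; rewrite ?andbF.
by rewrite !inE /= andbC.
Qed.

Lemma fdisjoint_D (A B : {fset I}) : [disjoint A & (B `\` A)]%fset.
Proof. by apply/fdisjointP => i iA; rewrite !inE iA. Qed.

Variables (w : I -> R) (S : R).
Hypothesis w_ge0 : forall i, 0 <= w i.
Hypothesis w_bound : forall A : {fset I}, partial_sum w A <= S.

Lemma psum_ge0 (A : {fset I}) : 0 <= partial_sum w A.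
Proof. by apply: sumr_ge0 => i _; exact: w_ge0. Qed.

(** [A] nearly attains the supremum of the finite sums, so that a set disjoint from it can add at
    most e. *)
Lemma psum_tail (e : R) : 0 < e -> exists A : {fset I}, forall B : {fset I},
  [disjoint A & B]%fset -> partial_sum w B <= e.
Proof.
move=> e0; pose E := range (partial_sum w : {fset I} -> R).
have hE : has_sup E.
  by split; [exists (partial_sum w fset0); exists fset0|exists S => _ [A _ <-]].
have [_ [A _ <-] hA] := sup_adherent e0 hE; exists A => B dAB.
have /(ub_le_sup (proj2 hE)) : E (partial_sum w (A `|` B)%fset) by exists (A `|` B)%fset.
rewrite (@psum_split _ w A (A `|` B)%fset) ?fsubsetUl//.
have -> : ((A `|` B) `\` A)%fset = B.
  by rewrite fsetDUl fsetDv fset0U; apply/fsetDidPl; rewrite fdisjoint_sym.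
by move: hA; lra.
Qed.

Lemma psum_le (x : I -> C) (M : R) (A : {fset I}) : (forall i, cabs (x i) <= M * w i) ->
  cabs (partial_sum x A) <= M * partial_sum w A.
Proof.
move=> H; apply: le_trans (cabs_sum _ _ _) _; rewrite mulr_sumr.
by apply: ler_sum => i _; exact: H.
Qed.

Lemma near_totally (A : {fset I}) : \forall B \near totally, (A `<=` B)%fset.
Proof. by exists A. Qed.

Lemma sum_cvg (x : I -> C) (M : R) : 0 <= M -> (forall i, cabs (x i) <= M * w i) ->
  partial_sum x @ totally --> (sum x : C).
Proof.
move=> M0 H.
have tail (e : R) : 0 < e -> exists A : {fset I}, forall B : {fset I}, (A `<=` B)%fset ->
    cabs (partial_sum x B - partial_sum x A) <= e.
  move=> e0; have M1 : 0 < M + 1 by rewrite ltr_wpDl.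
  have [A HA] := psum_tail (divr_gt0 e0 M1); exists A => B AB.
  rewrite (psum_split x AB) addrC addKr; apply: le_trans (psum_le _ H) _.
  apply: (@le_trans _ _ ((M + 1) * (e / (M + 1)))).
    apply: ler_pM => //; rewrite ?psum_ge0 ?lerDl//; apply: HA.
    exact: fdisjoint_D.
  by rewrite mulrC divfK// gt_eqF.
have part (f : C -> R) : (forall z z', f (z - z') = f z - f z') ->
    (forall z, `|f z| <= cabs z) -> exists l : R, f \o partial_sum x @ totally --> l.
  move=> fB fle; have FF : ProperFilter (f \o partial_sum x @ totally).
    exact: fmap_proper_filter.
  apply/cvg_ex; apply: R_complete; apply/cauchy_exP => e e0.
  have [A HA] := tail (e / 2) (divr_gt0 e0 (ltr0Sn R 1)).
  exists (f (partial_sum x A)); exists A => // B AB; rewrite /= /ball /= distrC -fB.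
  apply: le_lt_trans (fle _) _; apply: le_lt_trans (HA _ AB) _.
  by rewrite ltr_pdivrMr// ltr_pMr// ltr1n.
have [a Ha] := part _ (@reCB R) (@cabs_re R).
have [b Hb] := part _ (@imCB R) (@cabs_im R).
suff : partial_sum x @ totally --> mkC a b by exact: cvgP.
apply/(@cvgrPdist_lt _ _ _ totally _) => e /Cpos_re[-> e0].
have e20 : 0 < reC e / 2 by rewrite divr_gt0.
have /(@cvgrPdist_lt _ _ _ totally _)/(_ _ e20) ha := Ha.
have /(@cvgrPdist_lt _ _ _ totally _)/(_ _ e20) hb := Hb.
near=> A; rewrite Cnorm toC_lt; apply: le_lt_trans (cabs_reim _) _.
rewrite reCB imCB reC_mkC imC_mkC [ltRHS]splitr; apply: ltrD.
  by near: A; exact: ha.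
by near: A; exact: hb.
Unshelve. all: by end_near. Qed.

Lemma sum_unique (x : I -> C) (l : C) : partial_sum x @ totally --> l -> sum x = l.
Proof. by move=> h; apply: cvg_lim => //; exact: (@norm_hausdorff (Cplx R) (Cplx R)). Qed.

Lemma sum_dist (x : I -> C) (M e : R) (A : {fset I}) : 0 <= M ->
  (forall i, cabs (x i) <= M * w i) ->
  (forall B : {fset I}, [disjoint A & B]%fset -> partial_sum w B <= e) ->
  cabs (sum x - partial_sum x A) <= M * e.
Proof.
move=> M0 H HA; apply/ler_addgt0Pr => h h0.
have hC : 0 < toC h by rewrite -toC0 toC_lt.
have /(@cvgrPdist_lt _ _ _ totally _)/(_ _ hC) hx := sum_cvg M0 H.
have [B [/= B1 B2]] := filter_ex (filterI hx (near_totally A)).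
rewrite Cnorm toC_lt in B1.
have -> : sum x - partial_sum x A = (sum x - partial_sum x B) + (partial_sum x B - partial_sum x A).
  by rewrite addrA subrK.
apply: le_trans (cabsD _ _) _; rewrite addrC; apply: lerD; last exact: ltW.
rewrite (psum_split x B2) addrC addKr; apply: le_trans (psum_le _ H) _.
by rewrite ler_wpM2l//; apply: HA; exact: fdisjoint_D.
Qed.

Lemma sum_bound (x : I -> C) (M : R) : 0 <= M -> (forall i, cabs (x i) <= M * w i) ->
  cabs (sum x) <= M * S.
Proof.
move=> M0 H; have -> : sum x = sum x - partial_sum x fset0.
  by rewrite psumE big_seq_fset0 subr0.
by apply: sum_dist.
Qed.

Lemma sum_lin (x y : I -> C) (a b : C) (M N : R) : 0 <= M -> 0 <= N ->
  (forall i, cabs (x i) <= M * w i) -> (forall i, cabs (y i) <= N * w i) ->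
  sum (fun i => a * x i + b * y i) = a * sum x + b * sum y.
Proof.
move=> M0 N0 Hx Hy; apply: sum_unique.
rewrite (_ : partial_sum _ = fun A => a * partial_sum x A + b * partial_sum y A).
  by apply: cvgD; apply: cvgM; [exact: cvg_cst|exact: (sum_cvg _ Hx)|exact: cvg_cst|exact: (sum_cvg _ Hy)].
by apply/funext => A; rewrite /partial_sum big_split !mulr_sumr.
Qed.

Lemma cvg0P (x : nat -> C) : x n @[n --> \oo] --> (0 : C) <->
  forall e : R, 0 < e -> \forall n \near \oo, cabs (x n) < e.
Proof.
split=> [/(@cvgrPdist_lt _ _ _ \oo) H e e0|H].
  have e0C : 0 < toC e by rewrite -toC0 toC_lt.
  by have := H _ e0C; apply: filterS => n; rewrite sub0r normrN Cnorm toC_lt.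
apply/(@cvgrPdist_lt _ _ _ \oo) => e /Cpos_re[-> e0].
by have := H _ e0; apply: filterS => n; rewrite sub0r normrN Cnorm toC_lt.
Qed.

(** Tannery's theorem: finitely many terms tend to 0, and the tail is small uniformly in n. *)
Lemma sum_tannery (x : nat -> I -> C) (M : R) : 0 <= M ->
  (forall n i, cabs (x n i) <= M * w i) ->
  (forall i (e : R), 0 < e -> \forall n \near \oo, cabs (x n i) < e) ->
  forall e : R, 0 < e -> \forall n \near \oo, cabs (sum (x n)) < e.
Proof.
move=> M0 H Hx e e0.
have e20 : 0 < e / 2 by rewrite divr_gt0.
have M1 : 0 < M + 1 by rewrite ltr_wpDl.
have [A HA] := psum_tail (divr_gt0 e20 M1).
have : \forall n \near \oo, cabs (\sum_(i <- A) x n i) < e / 2.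
  elim: (enum_fset A) (e / 2) e20 => [|i s IH] h h0.
    by apply: nearW => n; rewrite big_nil cabs0.
  have h20 : 0 < h / 2 by rewrite divr_gt0.
  have h1 := Hx i _ h20; have h2 := IH _ h20.
  near=> n; rewrite big_cons; apply: le_lt_trans (cabsD _ _) _.
  rewrite [ltRHS]splitr; apply: ltrD.
    by near: n; exact: h1.
  by near: n; exact: h2.
apply: filterS => n hn.
apply: le_lt_trans (cabs_le_dist _ (partial_sum (x n) A)) _.
rewrite [ltRHS]splitr; apply: ltr_leD; first by rewrite psumE.
apply: le_trans (sum_dist M0 (H n) HA) _.
apply: (@le_trans _ _ ((M + 1) * (e / 2 / (M + 1)))).
  by rewrite ler_wpM2r ?lerDl// divr_ge0 ?ltW.
by rewrite mulrC divfK// gt_eqF.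
Unshelve. all: by end_near. Qed.

End UnorderedSums.

Section MultiindexSums.
Variables (R : realType) (d : nat).

Definition mweight (a : mindex d) : R := expR (- (mabs a)%:R).

Lemma mweight_ge0 a : 0 <= mweight a. Proof. exact: expR_ge0. Qed.

Lemma geo_bound (q : R) n : 0 < q < 1 -> \sum_(k < n) q ^+ k <= (1 - q)^-1.
Proof.
move=> /andP[q0 q1]; rewrite -[leRHS]mul1r ler_pdivlMr ?subr_gt0// mulrC.
by rewrite -opprB mulNr -subrX1 opprB gerBl exprn_ge0 ?(ltW q0).
Qed.

(** A finite set of multi-indices lies in a box, over which the sum of exp (- |a|) factors into d
    geometric sums. *)
Lemma mweight_bound (A : {fset mindex d}) :
  partial_sum mweight A <= ((1 - expR (-1))^-1) ^+ d.
Proof.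
pose n := (\max_(a : A) mabs (val a)).+1.
pose q : R := expR (-1).
have q1 : 0 < q < 1 by rewrite expR_gt0 expR_lt1 ltrN10.
apply: (@le_trans _ _ (\prod_(j < d) \sum_(k < n) q ^+ k)); last first.
  rewrite -[in leRHS](card_ord d) -prodr_const; apply: ler_prod => j _.
  rewrite geo_bound// andbT; apply: sumr_ge0 => k _; rewrite exprn_ge0//; exact: expR_ge0.
rewrite bigA_distr_bigA /=.
pose g (a : A) : {ffun 'I_d -> 'I_n} := [ffun j => inord (val a j)].
have gE (a : A) j : g a j = val a j :> nat.
  rewrite ffunE inordK// ltnS; apply: leq_trans (leq_bigmax a).
  by rewrite /mabs (bigD1 j)//= leq_addr.
have ginj : injective g.
  move=> a b ab; apply: val_inj; apply/ffunP => j.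
  by rewrite -gE ab gE.
rewrite /partial_sum (eq_bigr (fun a => \prod_i q ^+ g a i)); last first.
  move=> a _; rewrite /mweight prodrXr /q -expRM_natl mulrN1; congr (expR (- _%:R)).
  by apply: eq_bigr => j _; rewrite gE.
rewrite (partition_big g xpredT)//=; apply: ler_sum => f _.
have f0 : 0 <= \prod_i q ^+ f i.
  by apply: prodr_ge0 => i _; rewrite exprn_ge0//; exact: expR_ge0.
case: (pickP (fun a => g a == f)) => [a /eqP E|none]; last by rewrite big_pred0.
rewrite (big_pred1 a) ?E// => b; rewrite /= -E.
by apply/eqP/eqP => [/ginj|->].
Qed.

End MultiindexSums.

(** * Integration of complex functions *)

Section ComplexIntegral.
Context (disp : measure_display) (T : measurableType disp) (R : realType).
Variable mu : {measure set T -> \bar R}.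
Local Notation C := (Cplx R).

Definition cint (F : T -> C) : C :=
  mkC (\int[mu]_t reC (F t))%R (\int[mu]_t imC (F t))%R.

Definition cmeas (F : T -> C) : Prop :=
  measurable_fun setT (fun t => reC (F t)) /\ measurable_fun setT (fun t => imC (F t)).

Definition rintegrable (g : T -> R) : Prop := mu.-integrable setT (fun t => (g t)%:E).

Definition cdom (g : T -> R) (F : T -> C) : Prop :=
  cmeas F /\ forall t, cabs (F t) <= g t.

Lemma cdom_integrable g F : rintegrable g -> cdom g F ->
  rintegrable (fun t => reC (F t)) /\ rintegrable (fun t => imC (F t)).
Proof.
move=> ig [[m1 m2] H]; split; apply: (@le_integrable _ _ _ mu setT measurableT _ (fun t => (g t)%:E)) => //.
- exact/measurable_EFinP.
- move=> t _; rewrite /= lee_fin; apply: le_trans (cabs_re _) _.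
  by apply: le_trans (H t) _; rewrite ler_norm.
- exact/measurable_EFinP.
- move=> t _; rewrite /= lee_fin; apply: le_trans (cabs_im _) _.
  by apply: le_trans (H t) _; rewrite ler_norm.
Qed.

Lemma cint_lin F G f g a b : rintegrable f -> rintegrable g -> cdom f F -> cdom g G ->
  cint (fun t => a * F t + b * G t) = a * cint F + b * cint G.
Proof.
move=> If Ig /(cdom_integrable If)[F1 F2] /(cdom_integrable Ig)[G1 G2].
have iZ k (u : T -> R) : rintegrable u -> rintegrable (fun t => k * u t).
  by move=> iu; have := integrableZl measurableT k iu.
have iD (u v : T -> R) : rintegrable u -> rintegrable v -> rintegrable (fun t => u t + v t).
  by move=> iu iv; have := integrableD measurableT iu iv.
have iB (u v : T -> R) : rintegrable u -> rintegrable v -> rintegrable (fun t => u t - v t).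
  by move=> iu iv; have := integrableB measurableT iu iv.
apply: complexP; rewrite ?reCD ?imCD ?reCM ?imCM !(reC_mkC, imC_mkC).
  under eq_Rintegral do rewrite reCD !reCM.
  rewrite RintegralD//; [|by apply: (iB _ _ (iZ _ _ _) (iZ _ _ _))..].
  by rewrite !RintegralB// ?RintegralZl//; exact: iZ.
under eq_Rintegral do rewrite imCD !imCM.
rewrite RintegralD//; [|by apply: (iD _ _ (iZ _ _ _) (iZ _ _ _))..].
by rewrite !(RintegralD _ (iZ _ _ _) (iZ _ _ _))// !RintegralZl.
Qed.

Lemma cint_le F g : rintegrable g -> cdom g F -> cabs (cint F) <= 2 * (\int[mu]_t g t)%R.
Proof.
move=> Ig dF; have [F1 F2] := cdom_integrable Ig dF; have [_ H] := dF.
apply: le_trans (cabs_reim _) _; rewrite reC_mkC imC_mkC mulr_natl mulr2n.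
have iN (u : T -> R) : rintegrable u -> rintegrable (fun t => `|u t|).
  by move=> iu; exact: (integrable_norm iu).
apply: lerD; apply: le_trans (le_normr_Rintegral measurableT _) _ => //;
  apply: le_Rintegral => //; try exact: iN; move=> t _; apply: le_trans (H t).
  exact: cabs_re.
exact: cabs_im.
Qed.

Lemma cint_conj F g : rintegrable g -> cdom g F ->
  cint (fun t => cconj (F t)) = cconj (cint F).
Proof.
move=> Ig dF; have [F1 F2] := cdom_integrable Ig dF.
apply: complexP; rewrite ?reC_conj ?imC_conj !(reC_mkC, imC_mkC).
  by under eq_Rintegral do rewrite reC_conj.
under eq_Rintegral do rewrite imC_conj -mulN1r.
by rewrite RintegralZl// mulN1r.
Qed.

Lemma real_dct (f : nat -> T -> R) g : rintegrable g -> (forall n, measurable_fun setT (f n)) ->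
  (forall n t, `|f n t| <= g t) ->
  (forall t (e : R), 0 < e -> \forall n \near \oo, `|f n t| < e) ->
  forall e : R, 0 < e -> \forall n \near \oo, `|(\int[mu]_t f n t)%R| < e.
Proof.
move=> Ig mf fg f0 e e0.
have h1 n : measurable_fun setT (fun t => (f n t)%:E) by exact/measurable_EFinP.
have h2 : {ae mu, forall t, setT t -> (f n t)%:E @[n --> \oo] --> 0%E}.
  apply/aeW => t _; apply/fine_cvgP; split; first exact: nearW.
  apply/(@cvgrPdist_lt _ _ _ \oo) => h h0; have := f0 t h h0; apply: filterS => n.
  by rewrite /= sub0r normrN.
have h3 : {ae mu, forall t n, setT t -> (`|(f n t)%:E| <= (g t)%:E)%E}.
  by apply/aeW => t n _; rewrite /= lee_fin.
case: (@dominated_convergence _ _ _ mu setT measurableT (fun n t => (f n t)%:E)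
  (fun=> 0%E) (fun t => (g t)%:E) h1 (measurable_cst _) h2 Ig h3) => _ _.
rewrite integral0 => /fine_cvgP[_ /(@cvgrPdist_lt _ _ _ \oo)/(_ _ e0)].
by apply: filterS => n; rewrite /= sub0r normrN.
Qed.

Lemma cint_dct (F : nat -> T -> C) g : rintegrable g -> (forall n, cdom g (F n)) ->
  (forall t (e : R), 0 < e -> \forall n \near \oo, cabs (F n t) < e) ->
  forall e : R, 0 < e -> \forall n \near \oo, cabs (cint (F n)) < e.
Proof.
move=> Ig dF F0 e e0; have e20 : 0 < e / 2 by rewrite divr_gt0.
have h1 : \forall n \near \oo, `|reC (cint (F n))| < e / 2.
  rewrite /cint; under eq_near do rewrite reC_mkC.
  apply: (real_dct Ig) => // [n|n t|t h h0].
  - exact: (proj1 (proj1 (dF n))).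
  - exact: le_trans (cabs_re _) (proj2 (dF n) t).
  - have := F0 t h h0; apply: filterS => n; apply: le_lt_trans; exact: cabs_re.
have h2 : \forall n \near \oo, `|imC (cint (F n))| < e / 2.
  rewrite /cint; under eq_near do rewrite imC_mkC.
  apply: (real_dct Ig) => // [n|n t|t h h0].
  - exact: (proj2 (proj1 (dF n))).
  - exact: le_trans (cabs_im _) (proj2 (dF n) t).
  - have := F0 t h h0; apply: filterS => n; apply: le_lt_trans; exact: cabs_im.
near=> n; apply: le_lt_trans (cabs_reim _) _; rewrite [ltRHS]splitr; apply: ltrD.
  by near: n; exact: h1.
by near: n; exact: h2.
Unshelve. all: by end_near. Qed.

End ComplexIntegral.

Section ProductIntegral.
Context (d1 d2 : measure_display) (T1 : measurableType d1) (T2 : measurableType d2) (R : realType).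
Variables (m1 : {sigma_finite_measure set T1 -> \bar R}) (m2 : {sigma_finite_measure set T2 -> \bar R}).
Local Notation C := (Cplx R).

Lemma prod_integrable (g1 : T1 -> R) (g2 : T2 -> R) :
  (forall x, 0 <= g1 x) -> (forall y, 0 <= g2 y) ->
  rintegrable m1 g1 -> rintegrable m2 g2 ->
  rintegrable (m1 \x m2)%E (fun p => g1 p.1 * g2 p.2).
Proof.
move=> g10 g20 I1 I2.
have mg1 : measurable_fun setT g1 by apply/measurable_EFinP; case/integrableP: I1.
have mg2 : measurable_fun setT g2 by apply/measurable_EFinP; case/integrableP: I2.
have mg : measurable_fun setT (fun p : T1 * T2 => (g1 p.1 * g2 p.2)%:E).
  by apply/measurable_EFinP; apply: measurable_funM; exact: measurableT_comp.
apply/integrable12ltyP => //.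
have -> : (\int[m1]_x \int[m2]_y `|(g1 (x, y).1 * g2 (x, y).2)%:E| =
   \int[m1]_x ((\int[m2]_y (g2 y)%:E) * (g1 x)%:E))%E.
  apply: eq_integral => x _ /=.
  under eq_integral do rewrite ger0_norm ?mulr_ge0// EFinM.
  rewrite ge0_integralZl ?lee_fin//; first by rewrite muleC.
    exact/measurable_EFinP.
  by move=> y _; rewrite lee_fin.
have If2 : (\int[m2]_y (g2 y)%:E \is a fin_num)%E by exact: integrable_fin_num.
rewrite -(fineK If2) ge0_integralZl//; last 3 first.
- exact/measurable_EFinP.
- by move=> x _; rewrite lee_fin.
- by rewrite lee_fin fine_ge0// integral_ge0// => y _; rewrite lee_fin.
have If1 : (\int[m1]_x (g1 x)%:E \is a fin_num)%E by exact: integrable_fin_num.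
by rewrite -(fineK If1) -EFinM ltry.
Qed.

Lemma real_fubini (f : T1 * T2 -> R) (g1 : T1 -> R) (g2 : T2 -> R) :
  (forall x, 0 <= g1 x) -> (forall y, 0 <= g2 y) ->
  rintegrable m1 g1 -> rintegrable m2 g2 -> measurable_fun setT f ->
  (forall x y, `|f (x, y)| <= g1 x * g2 y) ->
  (\int[m1]_x (\int[m2]_y f (x, y)) = \int[m2]_y (\int[m1]_x f (x, y)))%R.
Proof.
move=> g10 g20 I1 I2 mf H.
have If : (m1 \x m2)%E.-integrable setT (EFin \o f).
  apply: (@le_integrable _ _ _ _ setT measurableT _ (fun p => (g1 p.1 * g2 p.2)%:E)).
  - exact/measurable_EFinP.
  - by move=> [x y] _; rewrite /= lee_fin (ger0_norm (mulr_ge0 _ _)).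
  - exact: prod_integrable.
have i2 x : m2.-integrable setT (fun y => (f (x, y))%:E).
  apply: (@le_integrable _ _ _ _ setT measurableT _ (fun y => (g1 x * g2 y)%:E)).
  - by apply/measurable_EFinP; exact: measurableT_comp.
  - by move=> y _; rewrite /= lee_fin (ger0_norm (mulr_ge0 _ _)).
  - by have := integrableZl measurableT (g1 x) I2.
have i1 y : m1.-integrable setT (fun x => (f (x, y))%:E).
  apply: (@le_integrable _ _ _ _ setT measurableT _ (fun x => (g1 x * g2 y)%:E)).
  - by apply/measurable_EFinP; exact: measurableT_comp.
  - by move=> x _; rewrite /= lee_fin (ger0_norm (mulr_ge0 _ _)).
  - have := integrableZl measurableT (g2 y) I1.
    by under [X in _ -> integrable _ _ X]eq_fun do rewrite mulrC EFinM.
have /(congr1 fine) := Fubini If.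
rewrite /Rintegral => E; apply: etrans (etrans E _); congr fine; apply: eq_integral => x _;
  rewrite fineK//; exact: integrable_fin_num.
Qed.

Lemma cint_fubini (F : T1 * T2 -> C) (g1 : T1 -> R) (g2 : T2 -> R) :
  (forall x, 0 <= g1 x) -> (forall y, 0 <= g2 y) ->
  rintegrable m1 g1 -> rintegrable m2 g2 -> cmeas F ->
  (forall x y, cabs (F (x, y)) <= g1 x * g2 y) ->
  cint m1 (fun x => cint m2 (fun y => F (x, y))) =
  cint m2 (fun y => cint m1 (fun x => F (x, y))).
Proof.
move=> g10 g20 I1 I2 [m_re m_im] H; rewrite {1 3}/cint; congr mkC.
  under eq_Rintegral do rewrite reC_mkC; under [RHS]eq_Rintegral do rewrite reC_mkC.
  apply: (@real_fubini (fun p => reC (F p)) g1 g2) => // x y.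
  exact: le_trans (cabs_re _) (H x y).
under eq_Rintegral do rewrite imC_mkC; under [RHS]eq_Rintegral do rewrite imC_mkC.
apply: (@real_fubini (fun p => imC (F p)) g1 g2) => // x y.
exact: le_trans (cabs_im _) (H x y).
Qed.

End ProductIntegral.

Section TripleIntegral.
Context (d1 d2 d3 : measure_display) (T1 : measurableType d1) (T2 : measurableType d2)
  (T3 : measurableType d3) (R : realType).
Variables (m1 : {sigma_finite_measure set T1 -> \bar R})
  (m2 : {sigma_finite_measure set T2 -> \bar R})
  (m3 : {sigma_finite_measure set T3 -> \bar R}).

Lemma prod_sigma_finite : sigma_finite setT (m2 \x m3)%E.
Proof.
have /sigma_finiteP[F [TF ndF Foo]] := sigma_finiteT m2.
have /sigma_finiteP[G [TG ndG Goo]] := sigma_finiteT m3.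
exists (fun k => F k `*` G k).
  rewrite -setXTT TF TG predeqE => -[x y]; split.
    move=> [/= [i _ Fx] [k _ Gy]]; exists (maxn i k) => //; split.
    - by move: x Fx; exact/subsetPset/ndF/leq_maxl.
    - by move: y Gy; exact/subsetPset/ndG/leq_maxr.
  by move=> [i _ []/= ? ?]; split; exists i.
move=> k; have [? ?] := Foo k; have [? ?] := Goo k.
split; first exact: measurableX.
by rewrite product_measure1E// lte_mul_pinfty// ge0_fin_numE.
Qed.

(** C^d carries the product of two copies of the measure of R^d, so exchanging an integral over R^d
    with one over C^d is Fubini with a product as second factor, packed here as a sigma-finite
    measure. *)
Lemma cint_fubini3 (F : T1 * (T2 * T3) -> Cplx R) (g1 : T1 -> R) (g2 : T2 * T3 -> R) :
  (forall x, 0 <= g1 x) -> (forall y, 0 <= g2 y) ->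
  rintegrable m1 g1 -> rintegrable (m2 \x m3)%E g2 -> cmeas F ->
  (forall x y, cabs (F (x, y)) <= g1 x * g2 y) ->
  cint m1 (fun x => cint (m2 \x m3)%E (fun y => F (x, y))) =
  cint (m2 \x m3)%E (fun y => cint m1 (fun x => F (x, y))).
Proof.
move=> g10 g20 I1 I2 mF H.
pose m23 : {sigma_finite_measure set (T2 * T3)%type -> \bar R} :=
  HB.pack (m2 \x m3)%E (Measure_isSigmaFinite.Build _ _ _ (m2 \x m3)%E prod_sigma_finite).
exact: (@cint_fubini _ _ _ _ R m1 m23 F g1 g2).
Qed.

End TripleIntegral.

Section CoordinateMeasurability.
Context (disp : measure_display) (T : measurableType disp) (R : realType) (J : finType).
Variable c : J -> T -> R.
Hypothesis mc : forall j, measurable_fun setT (c j).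

(** [U] is the union of the boxes contained in it with rational centres and radii 1 / (m + 1), which
    are enumerated by [pickle]. Continuity in the coordinates hence implies measurability on spaces
    of tuples. *)
Lemma open_coord_measurable (U : set T) :
  (forall t, U t -> exists2 e : R, 0 < e & forall t', (forall j, `|c j t' - c j t| < e) -> U t') ->
  measurable U.
Proof.
move=> oU.
pose box (q : {ffun J -> rat}) (m : nat) : set T :=
  \bigcap_(j in [set: J]) [set t | `|c j t - ratr (q j)| < m.+1%:R^-1].
pose piece (i : nat) : set T :=
  if (choice.unpickle i : option ({ffun J -> rat} * nat)) is Some (q, m) then
  (if `[< box q m `<=` U >] then box q m else set0) else set0.
have mbox q m : measurable (box q m).
  apply: fin_bigcap_measurable => // j _.
  rewrite (_ : [set t | _] = setT `&` c j @^-1` (ball (ratr (q j) : R) m.+1%:R^-1)).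
    by apply: mc => //; apply: measurable_ball.
  by rewrite setTI; apply/seteqP; split=> t; rewrite /= /ball /= distrC.
rewrite (_ : U = \bigcup_i piece i); last first.
  apply/seteqP; split=> [t Ut|t [i _]]; last first.
    rewrite /piece; case: choice.unpickle => [[q m]|//].
    by case: asboolP => // bU; exact: bU.
  have [e e0 He] := oU _ Ut.
  have [m _ hm] : exists2 m, True & (m.+1%:R^-1 : R) < e / 2.
    have e20 : 0 < e / 2 by rewrite divr_gt0.
    by have [k hk] := ltr_add_invr e20; exists k => //; rewrite add0r in hk.
  have hq j : {q : rat | `|c j t - ratr q| < m.+1%:R^-1}.
    apply/cid; have lt : c j t < c j t + m.+1%:R^-1 by rewrite ltrDl invr_gt0.
    have [q /andP[q1 q2]] := rat_in_itvoo lt; exists q.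
    by rewrite distrC gtr0_norm ?subr_gt0// ltrBlDl.
  pose q : {ffun J -> rat} := [ffun j => sval (hq j)].
  have tb : box q m t by move=> j _ /=; rewrite /q ffunE; exact: (svalP (hq j)).
  exists (choice.pickle (q, m)) => //; rewrite /piece choice.pickleK asboolT// => t' bt'.
  apply: He => j; have := bt' j I; have := tb j I => /= h1 h2.
  rewrite -(subrKA (ratr (q j))); apply: le_lt_trans (ler_normD _ _) _.
  rewrite [ltRHS]splitr; apply: ltrD; apply: lt_trans hm => //.
  by rewrite distrC.
apply: bigcup_measurable => i _; rewrite /piece; case: choice.unpickle => [[q m]|//].
by case: asboolP.
Qed.

Lemma coord_measurable_fun (g : T -> R) :
  (forall t (h : R), 0 < h -> exists2 e : R, 0 < e &
     forall t', (forall j, `|c j t' - c j t| < e) -> `|g t' - g t| < h) ->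
  measurable_fun setT g.
Proof.
move=> cg; apply: (measurability _ (RGenOpens.measurableE R)).
move=> _ [_ [a [b ->] <-]]; rewrite setTI; apply: open_coord_measurable => t.
rewrite /= in_itv /= => /andP[ag gb].
have h0 : 0 < Num.min (g t - a) (b - g t) by rewrite lt_min !subr_gt0 ag gb.
have [e e0 He] := cg t _ h0; exists e => // t' /He.
rewrite in_itv /= lt_min => /andP[h1 h2].
move: h1 h2; rewrite !ltr_distl => /andP[h1 _] /andP[_ h2]; apply/andP; split; lra.
Qed.

End CoordinateMeasurability.

(** * Lebesgue integrals on R^d and C^d *)

Section LebesgueTuple.
Variable R : realType.
Local Notation mu1 := (@lebesgue_measure R).
Local Notation mu n := (lebesgue_tuple R n).

Lemma rint_exp1 : rintegrable mu1 (fun x : measurableTypeR R => expR (- `|x|)).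
Proof.
have cf : continuous (fun x : R => expR (- `|x|)).
  move=> x; apply: continuous_comp; last exact: continuous_expR.
  by apply: cvgN; exact: norm_continuous.
have mf : measurable_fun setT (fun x : R => expR (- `|x|)) by exact: continuous_measurable_fun.
apply/integrableP; split; first exact/measurable_EFinP.
under eq_integral do rewrite gee0_abs ?lee_fin ?expR_ge0//.
rewrite ge0_symfun_integralT//; last by move=> x; rewrite /= normrN.
have h : (\int[mu1]_(x in [set x | (0 <= x)%R]) (expR (- `|x|))%:E <=
   \int[mu1]_x (exponential_pdf 1 x)%:E)%E.
  rewrite integral_mkcond; apply: ge0_le_integral => //.
  - move=> x _; rewrite /patch; case: ifP => // _; rewrite lee_fin; exact: expR_ge0.
  - apply/(measurable_restrictT _ _).1; last first.
      by apply/measurable_EFinP; exact: measurable_funTS.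
    rewrite (_ : [set x | 0 <= x] = `[0, +oo[%classic)//.
    by rewrite set_itvE.
  - by apply/measurable_EFinP; exact: measurable_exponential_pdf.
  - move=> x _; rewrite patchE; case: ifPn => [|_]; last by rewrite lee_fin exponential_pdf_ge0.
    rewrite inE /= => x0; rewrite /exponential_pdf patchE ifT; last by rewrite inE /= in_itv /= x0.
    by rewrite lee_fin mul1r mulN1r ger0_norm.
apply: le_lt_trans (lee_wpmul2l _ h) _ => //.
by rewrite integral_exponential_pdf// mule1 ltry.
Qed.

Lemma nR_cons n (p : measurableTypeR R * n.-tuple (measurableTypeR R)) :
  nR (row_of_tuple (cons_pair p)) = `|p.1| + nR (row_of_tuple p.2).
Proof.
rewrite !nRE big_ord_recl; congr (`|_| + _); rewrite ?mxE//.
by apply: eq_bigr => j _; rewrite !mxE tnthS.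
Qed.

Lemma measurable_expnR n : measurable_fun setT
  (fun t : n.-tuple (measurableTypeR R) => expR (- nR (row_of_tuple t))).
Proof.
apply: measurableT_comp => //; apply: measurableT_comp => //.
under eq_fun do rewrite nRE; apply: measurable_sum => j.
under eq_fun do rewrite mxE; apply: measurableT_comp => //; exact: measurable_tnth.
Qed.

Lemma rint_exp n : rintegrable (mu n) (fun t => expR (- nR (row_of_tuple t))).
Proof.
have m n' : measurable_fun setT
    (fun t : n'.-tuple (measurableTypeR R) => (expR (- nR (row_of_tuple t)))%:E).
  by apply/measurable_EFinP; exact: measurable_expnR.
elim: n => [|n IH].
  apply/integrableP; split; first exact: m.
  under eq_integral do rewrite nRE big_ord0 oppr0 expR0 abse1.
  by rewrite integral_cst// mul1e /= diracE mem_set// ltry.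
have H := @integrable_pushforward _ _ _ _ R _ (@measurable_cons_pair R n)
  (mu1 \x mu n)%E setT (fun t : n.+1.-tuple (measurableTypeR R) => (expR (- nR (row_of_tuple t)))%:E).
apply: H; [exact: m| |exact: measurableT].
have P : rintegrable (mu1 \x mu n)%E (fun p => expR (- `|p.1 : R|) * expR (- nR (row_of_tuple p.2))).
  by apply: (prod_integrable _ _ rint_exp1 IH) => ?; exact: expR_ge0.
rewrite (_ : _ \o _ = fun p => (expR (- `|p.1 : R|) * expR (- nR (row_of_tuple p.2)))%:E).
  exact: P.
by apply/funext => p; rewrite /= nR_cons opprD expRD.
Qed.

(** The image of Lebesgue measure under a translation agrees with it on intervals, and uniqueness
    concludes. [shift_tuple] carries this to R^n one coordinate at a time, by Tonelli. *)
Lemma shift1 (a : R) (F : measurableTypeR R -> \bar R) : measurable_fun setT F ->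
  (forall x, 0 <= F x)%E -> (\int[mu1]_x F ((x : R) + a)%R = \int[mu1]_x F x)%E.
Proof.
move=> mF F0; pose s (x : measurableTypeR R) : measurableTypeR R := x + a.
have ms : measurable_fun setT s by exact: measurable_funD.
pose S : {mfun _ >-> _} := HB.pack s (isMeasurableFun.Build _ _ _ _ _ ms).
rewrite -[LHS]/(\int[mu1]_(x in s @^-1` setT) (F \o s) x)%E.
rewrite -(ge0_integral_pushforward ms)//.
apply: eq_measure_integral => A mA _; apply/esym.
apply: (@lebesgue_measure_unique R (pushforward mu1 S)) => //.
move=> _ [[x y] _ <-] /=; rewrite /pushforward (_ : s @^-1` _ = `]x - a, y - a]%classic).
  by rewrite !lebesgue_measure_itv /= !lte_fin ltrD2r; case: ifP => // _; rewrite -!EFinB; congr EFin; ring.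
by apply/seteqP; split=> t /=; rewrite !in_itv /= ltrBlDr lerBrDr.
Qed.

Definition tshift n (v : 'rV[R]_n) (t : n.-tuple (measurableTypeR R)) :
  n.-tuple (measurableTypeR R) := [tuple (tnth t j + v 0 j : measurableTypeR R) | j < n].

Lemma row_tshift n v t : row_of_tuple (@tshift n v t) = row_of_tuple t + v.
Proof. by apply/rowP => j; rewrite !mxE tnth_mktuple. Qed.

Lemma measurable_tshift n v : measurable_fun setT (@tshift n v).
Proof.
apply/measurable_fun_tnthP => j.
rewrite (_ : _ \o _ = fun t => tnth t j + v 0 j); last first.
  by apply/funext => t /=; rewrite tnth_mktuple.
apply: measurable_funD; [exact: measurable_tnth|exact: measurable_cst].
Qed.

Lemma shift_tuple n (v : 'rV[R]_n) (F : n.-tuple (measurableTypeR R) -> \bar R) :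
  measurable_fun setT F -> (forall x, 0 <= F x)%E ->
  (\int[mu n]_t F (tshift v t) = \int[mu n]_t F t)%E.
Proof.
elim: n v F => [|n IH] v F mF F0.
  by apply: eq_integral => t _; congr F; apply: eq_from_tnth => -[].
pose v' : 'rV[R]_n := \row_j v 0 (lift ord0 j).
have cE p : tshift v (cons_pair p) = cons_pair (p.1 + v 0 ord0, tshift v' p.2).
  apply: eq_from_tnth => j; rewrite tnth_mktuple.
  case: (unliftP ord0 j) => [j' ->|->]; last by [].
  by rewrite !tnthS tnth_mktuple mxE.
have mG : measurable_fun setT (F \o @cons_pair R n).
  by apply: measurableT_comp => //; exact: measurable_cons_pair.
rewrite (@ge0_integral_pushforward _ _ _ _ R _ (@measurable_cons_pair R n) (mu1 \x mu n)%E)//; last first.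
  by apply: measurableT_comp => //; exact: measurable_tshift.
rewrite [RHS](@ge0_integral_pushforward _ _ _ _ R _ (@measurable_cons_pair R n) (mu1 \x mu n)%E)//.
transitivity (\int[(mu1 \x mu n)%E]_p F (tshift v (cons_pair p)))%E; first by [].
transitivity (\int[(mu1 \x mu n)%E]_p F (cons_pair p))%E; last by [].
rewrite [RHS]fubini_tonelli1// fubini_tonelli1//; last first.
  exact: (measurableT_comp (measurableT_comp mF (measurable_tshift v)) (@measurable_cons_pair R n)).
pose G x := (\int[mu n]_t (F \o @cons_pair R n) (x, t))%E.
rewrite -[RHS](@shift1 (v 0 ord0) G).
- apply: eq_integral => x _; rewrite /fubini_F /G -(IH v').
  + by apply: eq_integral => t _ /=; rewrite cE.
  + by apply: measurableT_comp => //; exact: measurable_pair1.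
  + by move=> t; exact: F0.
- by apply: (measurable_fun_fubini_tonelli_F (F \o @cons_pair R n)) => // p; exact: F0.
- by move=> x; apply: integral_ge0 => t _; exact: F0.
Qed.

Lemma Rintegral_shift n (v : 'rV[R]_n) (f : n.-tuple (measurableTypeR R) -> R) :
  measurable_fun setT f ->
  (\int[mu n]_t f (tshift v t) = \int[mu n]_t f t)%R.
Proof.
move=> mf; have mF : measurable_fun setT (EFin \o f) by exact/measurable_EFinP.
rewrite /Rintegral; congr fine.
rewrite integralE [RHS]integralE.
have h1 : (\int[mu n]_t (EFin \o f)^\+ (tshift v t) = \int[mu n]_t (EFin \o f)^\+ t)%E.
  apply: shift_tuple; last by move=> t; exact: funepos_ge0.
  exact: measurable_funepos.
have h2 : (\int[mu n]_t (EFin \o f)^\- (tshift v t) = \int[mu n]_t (EFin \o f)^\- t)%E.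
  apply: shift_tuple; last by move=> t; exact: funeneg_ge0.
  exact: measurable_funeneg.
rewrite -h1 -h2; congr (_ - _)%E; apply: eq_integral => t _.
  by rewrite !funepos.unlock.
by rewrite !funeneg.unlock.
Qed.

End LebesgueTuple.

Section VectorIntegrals.
Variables (R : realType) (d : nat).
Local Notation C := (Cplx R).
Local Notation V := 'rV[R]_d.
Local Notation Z := 'rV[C]_d.
Local Notation mu := (lebesgue_tuple R d).

Definition contR (f : V -> C) : Prop := forall x (h : R), 0 < h ->
  exists2 e : R, 0 < e & forall x', nR (x' - x) < e -> cabs (f x' - f x) < h.
Definition contC (f : Z -> C) : Prop := forall z (h : R), 0 < h ->
  exists2 e : R, 0 < e & forall z', nC (z' - z) < e -> cabs (f z' - f z) < h.
Definition contRC (f : V * Z -> C) : Prop := forall q (h : R), 0 < h ->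
  exists2 e : R, 0 < e & forall q', nR (q'.1 - q.1) < e -> nC (q'.2 - q.2) < e ->
    cabs (f q' - f q) < h.

Definition ztuple (p : d.-tuple (measurableTypeR R) * d.-tuple (measurableTypeR R)) : Z :=
  \row_j (mkC (tnth p.1 j) (tnth p.2 j) : C).

Lemma integralRE f : integralR f = cint mu (f \o @row_of_tuple R d). Proof. by []. Qed.
Lemma integralCE f : integralC f = cint (mu \x mu)%E (f \o ztuple). Proof. by []. Qed.

Lemma sum_lt n (u : 'I_n -> R) (e : R) : 0 < e -> (forall j, `|u j| < e / n.+1%:R) ->
  \sum_j `|u j| < e.
Proof.
move=> e0 H; apply: (@le_lt_trans _ _ (\sum_(j < n) e / n.+1%:R)).
  by apply: ler_sum => j _; exact: ltW.
rewrite sumr_const_ord mulrCA gtr_pMr// ltr_pdivrMr// mul1r ltr_nat.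
exact: ltnSn.
Qed.

Lemma nC_reim (z : Z) : nC z <= nR (reV z) + nR (imV z).
Proof.
Transparent nC.
rewrite /nC !nRE -big_split /=; apply: ler_sum => j _.
Transparent reV imV.
by rewrite !mxE; exact: cabs_reim.
Qed.
Opaque nC reV imV.

Lemma reV_ztuple p : reV (ztuple p) = row_of_tuple p.1.
Proof. by apply/rowP => j; rewrite !mxE. Qed.
Lemma imV_ztuple p : imV (ztuple p) = row_of_tuple p.2.
Proof. by apply/rowP => j; rewrite !mxE. Qed.

Lemma row_close (t t' : d.-tuple (measurableTypeR R)) (e : R) : 0 < e ->
  (forall j, `|tnth t' j - tnth t j| < e / d.+1%:R) ->
  nR (row_of_tuple t' - row_of_tuple t) < e.
Proof. by move=> e0 H; rewrite nRE; apply: sum_lt => // j; rewrite !mxE; exact: H. Qed.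

Lemma cmeas_coord (disp : measure_display) (T : measurableType disp) (J : finType) (c : J -> T -> R)
  (F : T -> C) : (forall j, measurable_fun setT (c j)) ->
  (forall t (h : R), 0 < h -> exists2 e : R, 0 < e &
     forall t', (forall j, `|c j t' - c j t| < e) -> cabs (F t' - F t) < h) -> cmeas F.
Proof.
move=> mc H; split; apply: (coord_measurable_fun mc) => t h h0;
  have [e e0 He] := H t h h0; exists e => // t' /He; apply: le_lt_trans.
  by rewrite -reCB cabs_re.
by rewrite -imCB cabs_im.
Qed.

Lemma cmeas_row f : contR f -> cmeas (f \o @row_of_tuple R d).
Proof.
move=> cf; apply: (@cmeas_coord _ _ 'I_d (fun j t => tnth t j)).
  by move=> j; exact: measurable_tnth.
move=> t h h0; have [e e0 He] := cf (row_of_tuple t) h h0.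
exists (e / d.+1%:R); first by rewrite divr_gt0.
by move=> t' Ht; apply: He; exact: row_close.
Qed.

Definition zcoord (j : 'I_d + 'I_d)
    (p : d.-tuple (measurableTypeR R) * d.-tuple (measurableTypeR R)) : R :=
  match j with inl i => tnth p.1 i | inr i => tnth p.2 i end.

Lemma measurable_zcoord j : measurable_fun setT (zcoord j).
Proof.
case: j => j; apply: (@measurableT_comp _ _ _ _ _ _ (fun t => tnth t j)) => //;
  exact: measurable_tnth.
Qed.

Lemma z_close p p' (e : R) : 0 < e ->
  (forall j, `|zcoord j p' - zcoord j p| < e / 2 / d.+1%:R) -> nC (ztuple p' - ztuple p) < e.
Proof.
move=> e0 H; have e20 : 0 < e / 2 by rewrite divr_gt0.
apply: le_lt_trans (nC_reim _) _; rewrite reVB imVB !reV_ztuple !imV_ztuple [ltRHS]splitr.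
by apply: ltrD; apply: row_close => // j; [exact: (H (inl j))|exact: (H (inr j))].
Qed.

Lemma cmeas_z f : contC f -> cmeas (f \o ztuple).
Proof.
move=> cf; apply: (@cmeas_coord _ _ _ zcoord) => [j|]; first exact: measurable_zcoord.
move=> t h h0; have [e e0 He] := cf (ztuple t) h h0.
exists (e / 2 / d.+1%:R); first by rewrite !divr_gt0.
by move=> t' Ht; apply: He; exact: z_close.
Qed.

Lemma cmeas_joint f : contRC f -> cmeas (fun q : d.-tuple (measurableTypeR R) *
  (d.-tuple (measurableTypeR R) * d.-tuple (measurableTypeR R)) =>
  f (row_of_tuple q.1, ztuple q.2)).
Proof.
move=> cf; pose c (j : 'I_d + ('I_d + 'I_d)) (q : d.-tuple (measurableTypeR R) *
  (d.-tuple (measurableTypeR R) * d.-tuple (measurableTypeR R))) : R :=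
  match j with inl i => tnth q.1 i | inr i => zcoord i q.2 end.
apply: (@cmeas_coord _ _ _ c).
  case=> j.
    apply: (@measurableT_comp _ _ _ _ _ _ (fun t => tnth t j)) => //; exact: measurable_tnth.
  by apply: (@measurableT_comp _ _ _ _ _ _ (zcoord j)) => //; exact: measurable_zcoord.
move=> q h h0; have [e e0 He] := cf (row_of_tuple q.1, ztuple q.2) h h0.
have m0 : 0 < e / 2 / d.+1%:R by rewrite !divr_gt0.
exists (e / 2 / d.+1%:R) => // q' Hq; apply: He => /=.
  apply: row_close => // j; apply: lt_le_trans (Hq (inl j)) _.
  by rewrite ler_pM2r ?invr_gt0// ler_pdivrMr// ler_pMr// ler1n.
by apply: z_close => // j; exact: (Hq (inr j)).
Qed.

(** Continuous functions with an explicit integrable majorant. The rate in [okC] is 2 |z| because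
    the majorant on C^d is exp (- |Re z| - |Im z|), and |Re z| + |Im z| <= 2 |z|. *)
Definition okR (M : R) (f : V -> C) : Prop :=
  contR f /\ forall x, cabs (f x) <= M * expR (- nR x).
Definition okC (M : R) (f : Z -> C) : Prop :=
  contC f /\ forall z, cabs (f z) <= M * expR (- (2 * nC z)).

Definition gR (t : d.-tuple (measurableTypeR R)) : R := expR (- nR (row_of_tuple t)).
Definition gC (p : d.-tuple (measurableTypeR R) * d.-tuple (measurableTypeR R)) : R :=
  gR p.1 * gR p.2.

Lemma rint_gR (M : R) : rintegrable mu (fun t => M * gR t).
Proof. by have := integrableZl measurableT M (rint_exp R d). Qed.

Lemma rint_gC (M : R) : rintegrable (mu \x mu)%E (fun p => M * gC p).
Proof.
have h : rintegrable (mu \x mu)%E gC.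
  by apply: (prod_integrable _ _ (rint_exp R d) (rint_exp R d)) => ?; exact: expR_ge0.
by have := integrableZl measurableT M h.
Qed.

Lemma gC_ge p : expR (- (2 * nC (ztuple p))) <= gC p.
Proof.
rewrite /gC /gR -expRD ler_expR -opprD lerN2 mulr_natl mulr2n.
by rewrite -reV_ztuple -imV_ztuple lerD ?nR_reV ?nR_imV.
Qed.

Lemma cdomR M f : okR M f -> cdom (fun t => M * gR t) (f \o @row_of_tuple R d).
Proof. by move=> [cf H]; split; [exact: cmeas_row|move=> t; exact: H]. Qed.

Lemma okC_ge0 M f : okC M f -> 0 <= M.
Proof.
move=> [_ /(_ 0) H]; rewrite -(pmulr_lge0 _ (expR_gt0 (- (2 * nC (0 : Z))))).
exact: le_trans (cabs_ge0 _) H.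
Qed.

Lemma cdomC M f : okC M f -> cdom (fun p => M * gC p) (f \o ztuple).
Proof.
move=> okf; have M0 := okC_ge0 okf; case: okf => cf H; split; first exact: cmeas_z.
by move=> p; apply: le_trans (H _) _; rewrite ler_wpM2l// gC_ge.
Qed.

Lemma integralR_lin M N f g a b : okR M f -> okR N g ->
  integralR (fun x => a * f x + b * g x) = a * integralR f + b * integralR g.
Proof.
by move=> /cdomR df /cdomR dg; exact: (cint_lin a b (rint_gR M) (rint_gR N) df dg).
Qed.

Lemma integralC_lin M N f g a b : okC M f -> okC N g ->
  integralC (fun x => a * f x + b * g x) = a * integralC f + b * integralC g.
Proof.
by move=> /cdomC df /cdomC dg; exact: (cint_lin a b (rint_gC M) (rint_gC N) df dg).
Qed.

Lemma integralR_le : exists2 K : R, 0 <= K & forall M f, okR M f -> cabs (integralR f) <= K * M.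
Proof.
exists (2 * (\int[mu]_t gR t)%R).
  by rewrite mulr_ge0//; apply: Rintegral_ge0 => t _; exact: expR_ge0.
move=> M f /cdomR df; apply: le_trans (cint_le (rint_gR M) df) _.
by rewrite (RintegralZl M measurableT (rint_exp R d)) (mulrC M) mulrA.
Qed.

Lemma integralC_le : exists2 K : R, 0 <= K & forall M f, okC M f -> cabs (integralC f) <= K * M.
Proof.
exists (2 * (\int[(mu \x mu)%E]_p gC p)%R).
  by rewrite mulr_ge0//; apply: Rintegral_ge0 => t _; rewrite mulr_ge0// expR_ge0.
move=> M f /cdomC df; apply: le_trans (cint_le (rint_gC M) df) _.
have h : rintegrable (mu \x mu)%E gC.
  by apply: (prod_integrable _ _ (rint_exp R d) (rint_exp R d)) => ?; exact: expR_ge0.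
by rewrite (RintegralZl M measurableT h) (mulrC M) mulrA.
Qed.

Lemma integralR_shift v f : contR f -> integralR (fun x => f (x + v)) = integralR f.
Proof.
move=> /cmeas_row[m1 m2]; rewrite !integralRE /cint.
congr mkC.
  rewrite -[RHS](Rintegral_shift v m1); apply: eq_Rintegral => t _.
  by rewrite /= row_tshift.
rewrite -[RHS](Rintegral_shift v m2); apply: eq_Rintegral => t _.
by rewrite /= row_tshift.
Qed.

Lemma integralC_conj M f : okC M f -> integralC (fun z => cconj (f z)) = cconj (integralC f).
Proof. by move=> /cdomC df; exact: (cint_conj (rint_gC M) df). Qed.

Lemma integralR_conj M f : okR M f -> integralR (fun z => cconj (f z)) = cconj (integralR f).
Proof. by move=> /cdomR df; exact: (cint_conj (rint_gR M) df). Qed.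

Lemma integralC_dct M (f : nat -> Z -> C) : (forall n, okC M (f n)) ->
  (forall z (e : R), 0 < e -> \forall n \near \oo, cabs (f n z) < e) ->
  forall e : R, 0 < e -> \forall n \near \oo, cabs (integralC (f n)) < e.
Proof.
move=> H H0; apply: (cint_dct (rint_gC M)) => [n|p]; first exact: cdomC.
exact: H0.
Qed.

Lemma integral_fubini M (F : V * Z -> C) : 0 <= M -> contRC F ->
  (forall q, cabs (F q) <= M * expR (- nR q.1) * expR (- (2 * nC q.2))) ->
  integralR (fun y => integralC (fun z => F (y, z))) =
  integralC (fun z => integralR (fun y => F (y, z))).
Proof.
move=> M0 cF HF.
have H := @cint_fubini3 _ _ _ _ _ _ R mu mu mu
  (fun q => F (row_of_tuple q.1, ztuple q.2)) (fun t => M * gR t) (fun p => 1 * gC p).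
rewrite integralRE integralCE; apply: H.
- by move=> t; rewrite mulr_ge0// expR_ge0.
- by move=> p; rewrite mul1r mulr_ge0// expR_ge0.
- exact: rint_gR.
- exact: rint_gC.
- exact: cmeas_joint.
- move=> t p; apply: le_trans (HF _) _; rewrite mul1r ler_wpM2l ?gC_ge//.
  by rewrite mulr_ge0// expR_ge0.
Qed.

End VectorIntegrals.

(** * Oscillatory integrals of Gevrey functions *)

Section Chains.
Variables (R : realType) (d : nat).
Local Notation C := (Cplx R).
Local Notation V := 'rV[R]_d.

Lemma is_derive_shift (g : R -> R) (s l : R) :
  is_derive (0 : R) (1 : R) (fun h => g (h + s)) l -> is_derive s (1 : R) g l.
Proof.
have F : (fun h : R => h^-1 *: (((fun h => g (h + s)) \o shift 0) (h *: 1) - (fun h => g (h + s)) 0)) =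
  (fun h : R => h^-1 *: ((g \o shift s) (h *: 1) - g s)).
  by apply/funext => h /=; rewrite addr0 add0r.
by move=> [ex E]; split; [rewrite /derivable -F|rewrite -E /derive -F].
Qed.

Lemma rderiv_shift (f : R -> C) s l : rderiv (fun h => f (h + s)) 0 l -> rderiv f s l.
Proof.
by move=> [f1 f2]; split; [exact: is_derive_shift f1|exact: is_derive_shift f2].
Qed.

Lemma rderivM (f g : R -> C) t l m : rderiv f t l -> rderiv g t m ->
  rderiv (fun t => f t * g t) t (l * g t + f t * m).
Proof.
move=> [f1 f2] [g1 g2]; split.
- rewrite (_ : _ \o _ = (@reC R \o f) * (@reC R \o g) - (@imC R \o f) * (@imC R \o g)); last first.
    by apply/funext => s /=; rewrite reCM.
  have [ex E] := is_deriveB (is_deriveM f1 g1) (is_deriveM f2 g2).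
  apply: DeriveDef => //; apply: (etrans E).
  change (reC (f t) * reC m + reC (g t) * reC l - (imC (f t) * imC m + imC (g t) * imC l)
    = reC (l * g t + f t * m)).
  by rewrite reCD !reCM; ring.
- rewrite (_ : _ \o _ = (@reC R \o f) * (@imC R \o g) + (@imC R \o f) * (@reC R \o g)); last first.
    by apply/funext => s /=; rewrite imCM.
  have [ex E] := is_deriveD (is_deriveM f1 g2) (is_deriveM f2 g1).
  apply: DeriveDef => //; apply: (etrans E).
  change (reC (f t) * imC m + imC (g t) * reC l + (imC (f t) * reC m + reC (g t) * imC l)
    = imC (l * g t + f t * m)).
  by rewrite imCD !imCM; ring.
Qed.

Lemma rderiv_conj (f : R -> C) t l : rderiv f t l -> rderiv (fun t => cconj (f t)) t (cconj l).
Proof.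
move=> [f1 f2]; split.
- rewrite (_ : _ \o _ = @reC R \o f) ?reC_conj//.
  by apply/funext => s /=; rewrite reC_conj.
- rewrite (_ : _ \o _ = - (@imC R \o f)) ?imC_conj; first exact: is_deriveN.
  by apply/funext => s /=; rewrite imC_conj.
Qed.

Lemma contR_mul (f g : V -> C) : contR f -> contR g -> contR (fun x => f x * g x).
Proof.
move=> cf cg x h h0; have A0 := cabs_ge0 (f x); have B0 := cabs_ge0 (g x).
pose m := Num.min 1 (h / (cabs (f x) + cabs (g x) + 2)).
have s0 : 0 < cabs (f x) + cabs (g x) + 2 by rewrite ltr_wpDl// addr_ge0.
have m0 : 0 < m by rewrite lt_min ltr01 divr_gt0.
have [e e0 He] := cf x m m0; have [e' e0' He'] := cg x m m0.
exists (Num.min e e'); first by rewrite lt_min e0.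
move=> x'; rewrite lt_min => /andP[/He h1 /He' h2].
have -> : f x' * g x' - f x * g x = (f x' - f x) * (g x' - g x) + (f x' - f x) * g x
   + f x * (g x' - g x) by ring.
have m1 : m <= 1 by rewrite ge_min lexx.
have mh : m * (cabs (f x) + cabs (g x) + 2) <= h.
  by rewrite -ler_pdivlMr// ge_min lexx orbT.
apply: le_lt_trans (cabsD _ _) _; apply: le_lt_trans (lerD (cabsD _ _) (lexx _)) _.
rewrite !cabsM; have P1 := cabs_ge0 (f x' - f x); have P2 := cabs_ge0 (g x' - g x).
have q1 : cabs (f x' - f x) * cabs (g x' - g x) <= m * 1.
  by apply: ler_pM => //; [exact: ltW|exact: le_trans (ltW h2) m1].
have q2 : cabs (f x' - f x) * cabs (g x) <= m * cabs (g x) by rewrite ler_wpM2r// ltW.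
have q3 : cabs (f x) * cabs (g x' - g x) <= cabs (f x) * m by rewrite ler_wpM2l// ltW.
by move: q1 q2 q3 mh m0; lra.
Qed.

Lemma contR_lin (f g : V -> C) a b : contR f -> contR g -> contR (fun x => a * f x + b * g x).
Proof.
move=> cf cg x h h0; pose s := cabs a + cabs b + 1.
have s0 : 0 < s by rewrite ltr_wpDl// addr_ge0// cabs_ge0.
have m0 : 0 < h / s by rewrite divr_gt0.
have [e e0 He] := cf x _ m0; have [e' e0' He'] := cg x _ m0.
exists (Num.min e e'); first by rewrite lt_min e0.
move=> x'; rewrite lt_min => /andP[/He h1 /He' h2].
have -> : a * f x' + b * g x' - (a * f x + b * g x) = a * (f x' - f x) + b * (g x' - g x) by ring.
apply: le_lt_trans (cabsD _ _) _; rewrite !cabsM.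
apply: (@le_lt_trans _ _ ((cabs a + cabs b) * (h / s))).
  by rewrite mulrDl lerD// ler_wpM2l ?cabs_ge0// ltW.
by rewrite mulrCA gtr_pMr// ltr_pdivrMr// mul1r /s ltrDl.
Qed.

Lemma contR_conj (f : V -> C) : contR f -> contR (fun x => cconj (f x)).
Proof.
move=> cf x h h0; have [e e0 He] := cf x h h0; exists e => // x' /He.
by rewrite -conjCN -conjCD cabs_conj.
Qed.

Lemma contR_shift (f : V -> C) v : contR f -> contR (fun x => f (x + v)).
Proof.
move=> cf x h h0; have [e e0 He] := cf (x + v) h h0; exists e => // x' Hx; apply: He.
by rewrite opprD addrACA subrr addr0.
Qed.

Lemma continuous_contR (f : V -> C) : continuous (@reC R \o f) -> continuous (@imC R \o f) -> contR f.
Proof.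
move=> c1 c2 x h h0; have h20 : 0 < h / 2 by rewrite divr_gt0.
have /(@cvgrPdist_lt _ _ _ (nbhs x) (nbhs_filter x))/(_ _ h20)/nbhs_nR[e e0 He] := c1 x.
have /(@cvgrPdist_lt _ _ _ (nbhs x) (nbhs_filter x))/(_ _ h20)/nbhs_nR[e' e0' He'] := c2 x.
exists (Num.min e e'); first by rewrite lt_min e0.
move=> x'; rewrite lt_min => /andP[/He h1 /He' h2].
apply: le_lt_trans (cabs_reim _) _; rewrite reCB imCB [ltRHS]splitr.
by apply: ltrD; rewrite distrC.
Qed.

Lemma contR_csmooth (F : 'rV[C]_d -> C) : csmooth F -> contR (F \o @vecC R d).
Proof. by move=> /continuous_csmooth_real[c1 c2]; exact: continuous_contR. Qed.

Lemma contC_csmooth (F : 'rV[C]_d -> C) : csmooth F -> contC F.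
Proof.
move=> sF z h h0; have hC : 0 < toC h by rewrite -toC0 toC_lt.
have := differentiable_continuous (csmooth_diff z sF).
move=> /(@cvgrPdist_lt _ _ _ (nbhs z) (nbhs_filter z))/(_ _ hC)/nbhs_nC[e e0 He].
by exists e => // z' /He; rewrite Cnorm toC_lt cabsBC.
Qed.

Definition ej (j : 'I_d) : V := delta_mx 0 j.

(** A function together with its successive derivatives along one coordinate, as data. This treats
    alike smooth functions, restrictions of holomorphic ones, their conjugates and their
    products. *)
Definition chain (j : 'I_d) (F : nat -> V -> C) : Prop :=
  (forall k, contR (F k)) /\
  forall k y s, rderiv (fun h => F k (h *: ej j + y)) s (F k.+1 (s *: ej j + y)).

Lemma chain_at0 j F : (forall k, contR (F k)) ->
  (forall k y, rderiv (fun h => F k (h *: ej j + y)) 0 (F k.+1 y)) -> chain j F.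
Proof.
move=> cF H; split=> // k y s; apply: rderiv_shift.
by under eq_fun do rewrite scalerDl -addrA; exact: H.
Qed.

Lemma smooth_chain j (f : V -> C) : smooth f -> chain j (fun k => iter k (pderivR j) f).
Proof.
move=> sf; have E k : iter k (pderivR j) f = foldr (@pderivR R d) f (nseq k j).
  by elim: k => //= k ->.
apply: chain_at0 => k; have [c1 c2 dd] := sf (nseq k j).
  by rewrite E; exact: continuous_contR.
by move=> y; have := dd y j; rewrite -E => -[d1 d2]; exact: rderiv_pderivR.
Qed.

Lemma csmooth_chain j (F : 'rV[C]_d -> C) : csmooth F ->
  chain j (fun k => iter k (dd j) F \o @vecC R d).
Proof.
move=> sF; have E k : iter k (dd j) F = foldr (@dd R d) F (nseq k j).
  by elim: k => [|k IH]; [|rewrite iterS IH].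
have sk k : csmooth (iter k (dd j) F) by rewrite E; exact: csmooth_foldr.
apply: chain_at0 => [k|k y]; first exact: contR_csmooth.
have [h [d1 d2]] := pderivR_vecC j y (sk k).
by have := rderiv_pderivR d1 d2; rewrite h.
Qed.

Lemma chain_conj j F : chain j F -> chain j (fun k y => cconj (F k y)).
Proof.
move=> [cF rF]; split=> [k|k y s]; first exact: contR_conj.
exact: rderiv_conj (rF k y s).
Qed.

(** The Leibniz rule unfolded recursively: 2^k terms in place of binomial coefficients. *)
Fixpoint pchain (F G : nat -> V -> C) (k : nat) : V -> C :=
  if k is k'.+1 then fun y => pchain (fun i => F i.+1) G k' y + pchain F (fun i => G i.+1) k' y
  else fun y => F 0%N y * G 0%N y.

Lemma chainS j F : chain j F -> chain j (fun i => F i.+1).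
Proof. by move=> [cF rF]; split. Qed.

Lemma pchainP j F G : chain j F -> chain j G -> chain j (pchain F G).
Proof.
move=> cF cG; split=> k; elim: k F G cF cG => [|k IH] F G cF cG /=.
- by apply: contR_mul; [exact: (proj1 cF)|exact: (proj1 cG)].
- have h := contR_lin 1 1 (IH _ _ (chainS cF) cG) (IH _ _ cF (chainS cG)).
  by move=> x e e0; have [r r0 Hr] := h x e e0; exists r => // x' /Hr; rewrite !mul1r.
- by move=> y s; exact: (rderivM (proj2 cF 0%N y s) (proj2 cG 0%N y s)).
- by move=> y s; apply: rderivD; [exact: (IH _ _ (chainS cF) cG)|exact: (IH _ _ cF (chainS cG))].
Qed.

Lemma kk_mul (theta : R) i k : 0 <= theta -> kk theta i * kk theta k <= kk theta (i + k).
Proof.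
move=> t0; rewrite /kk -powRM ?exprn_ge0//; apply: ge0_ler_powR => //;
  rewrite ?nnegrE ?mulr_ge0 ?exprn_ge0// exprD.
by apply: ler_pM; rewrite ?exprn_ge0// lerXn2r ?nnegrE ?ler_nat ?leq_addr ?leq_addl.
Qed.

(** The induction is over chains already differentiated i and l times, as each use of the product
    rule shifts one of the two; the two alternatives add up to (A + B)^k, and [kk_mul] joins the
    Gevrey factors. *)
Lemma pchain_bound (theta : R) (M N A B : R) F G y : 0 <= theta -> 0 <= A -> 0 <= B ->
  0 <= M -> 0 <= N ->
  (forall k, cabs (F k y) <= M * A ^+ k * kk theta k) ->
  (forall k, cabs (G k y) <= N * B ^+ k * kk theta k) ->
  forall k, cabs (pchain F G k y) <= M * N * (A + B) ^+ k * kk theta k.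
Proof.
move=> t0 A0 B0 M0 N0 HF HG k.
suff H : forall k F G i l,
   (forall n, cabs (F n y) <= M * A ^+ (i + n) * kk theta (i + n)) ->
   (forall n, cabs (G n y) <= N * B ^+ (l + n) * kk theta (l + n)) ->
   cabs (pchain F G k y) <= M * N * (A ^+ i * B ^+ l * (A + B) ^+ k) * kk theta (i + l + k).
  by have := H k F G 0%N 0%N HF HG; rewrite !expr0 !mul1r.
elim=> [|n IH] {HF HG}F {}G i l HF HG /=.
  have hF := HF 0%N; have hG := HG 0%N; rewrite !addn0 in hF hG *.
  rewrite cabsM expr0 mulr1; apply: le_trans (ler_pM (cabs_ge0 _) (cabs_ge0 _) hF hG) _.
  rewrite mulrACA (mulrACA M) ler_wpM2l ?mulr_ge0 ?exprn_ge0//; exact: kk_mul.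
apply: le_trans (cabsD _ _) _.
apply: (@le_trans _ _ (M * N * (A ^+ i.+1 * B ^+ l * (A + B) ^+ n) * kk theta (i + l + n.+1)
   + M * N * (A ^+ i * B ^+ l.+1 * (A + B) ^+ n) * kk theta (i + l + n.+1))).
  apply: lerD.
    rewrite -addSnnS -addSn; apply: IH => // k'; rewrite addSnnS; exact: HF.
  rewrite -addSnnS -addnS; apply: IH => // k'; rewrite addSnnS; exact: HG.
rewrite -mulrDl -mulrDr (exprS _ i) (exprS _ l) (exprS _ n) le_eqVlt; apply/orP; left; apply/eqP.
by ring.
Qed.

End Chains.

Section Oscillation.
Variables (R : realType) (d : nat) (theta : R).
Hypotheses (d_gt0 : (0 < d)%N) (theta_ge : 2^-1 <= theta) (theta_lt : theta < 1).
Local Notation C := (Cplx R).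
Local Notation V := 'rV[R]_d.
Local Notation p := (theta^-1).

Definition wave (xi y : V) : C := cexp ('i * toC (- dot y xi)).

Lemma cabs_wave xi y : cabs (wave xi y) = 1.
Proof. by rewrite cabs_cexp reC_iM imC_toC oppr0 expR0. Qed.

Lemma wave_shift xi y v : wave xi (y + v) = wave xi v * wave xi y.
Proof. by rewrite /wave -cexpD -mulrDr -toCD dotDl addrC opprD. Qed.

Lemma contR_wave xi : contR (wave xi).
Proof.
have sF : csmooth (fun y : 'rV[C]_d => cexp ((- 'i) * dot y (vecC xi))).
  by apply: csmooth_cexp; apply: csmoothZ; apply: csmooth_dot; [exact: cvec_id|exact: cvec_cst].
have := contR_csmooth sF; rewrite (_ : _ \o _ = wave xi)//.
by apply/funext => y /=; rewrite /wave dot_vecC toCN mulNr mulrN.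
Qed.

Lemma gp_wave M x xi y : gp M x xi y = gp M x 0 y * wave xi y.
Proof.
rewrite /gp /gpC /wave /= -cexpD vecC0 dot0r mulr0 subr0; congr cexp.
by rewrite dot_vecC toCN mulrN.
Qed.

Lemma max_coord (x : V) : exists j, nR x <= d%:R * `|x 0 j|.
Proof.
have [j _ H] := @Order.TotalTheory.arg_maxP _ _ _ (Ordinal d_gt0) xpredT (fun i => `|x 0 i|) isT.
by exists j; rewrite nRE -sumr_const_ord; apply: ler_sum => i _; exact: H.
Qed.

(** The majorant is centred at a moving point v. By translation invariance, bounds on integrals do
    not depend on v, which makes the packet estimates uniform in position. *)
Definition okRv (v : V) (M : R) (f : V -> C) : Prop :=
  contR f /\ forall x, cabs (f x) <= M * expR (- nR (x - v)).

Lemma okRv_okR v M f : okRv v M f -> okR M (fun x => f (x + v)).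
Proof.
move=> [cf H]; split; first exact: contR_shift.
by move=> x; apply: le_trans (H _) _; rewrite addrK.
Qed.

Lemma integralRv_le : exists2 K : R, 0 <= K & forall v M f, okRv v M f -> cabs (integralR f) <= K * M.
Proof.
have [K K0 HK] := integralR_le R d; exists K => // v M f okf.
by rewrite -(integralR_shift v (proj1 okf)); apply: HK; exact: okRv_okR.
Qed.

Lemma integralRv_lin v M N f g a b : okRv v M f -> okRv v N g ->
  integralR (fun x => a * f x + b * g x) = a * integralR f + b * integralR g.
Proof.
move=> okf okg; rewrite -(integralR_shift v (proj1 okf)) -(integralR_shift v (proj1 okg)).
rewrite -(integralR_shift v (contR_lin a b (proj1 okf) (proj1 okg))).
exact: integralR_lin (okRv_okR okf) (okRv_okR okg).
Qed.

Lemma okRv_wave v M f xi : okRv v M f -> okRv v M (fun y => f y * wave xi y).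
Proof.
move=> [cf H]; split; first by apply: contR_mul => //; exact: contR_wave.
by move=> x; rewrite cabsM cabs_wave mulr1; exact: H.
Qed.

Lemma okRv_lin v M N f g a b : okRv v M f -> okRv v N g ->
  okRv v (cabs a * M + cabs b * N) (fun x => a * f x + b * g x).
Proof.
move=> [cf Hf] [cg Hg]; split; first exact: contR_lin.
move=> x; apply: le_trans (cabsD _ _) _; rewrite !cabsM mulrDl -!mulrA.
by apply: lerD; rewrite ler_wpM2l ?cabs_ge0.
Qed.

Lemma weight_step (v y : V) j (t : R) : 0 <= t <= 1 ->
  expR (- nR (t *: ej R j + y - v)) <= expR 1 * expR (- nR (y - v)).
Proof.
move=> /andP[t0 t1]; rewrite -expRD ler_expR lerNl opprD opprK addrC lerBlDr.
have -> : y - v = - (t *: ej R j) + (t *: ej R j + y - v) by rewrite -addrA addKr.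
apply: le_trans (nRD _ _) _; rewrite addrC lerD2l nRN nRZ nR_delta mulr1.
by rewrite ger0_norm.
Qed.

Lemma eq_of_linear (D Q : R) : (forall t : R, 0 < t <= 1 -> D <= t * Q) -> D <= 0.
Proof.
move=> H; rewrite leNgt; apply/negP => D0.
have q0 : 0 < 2 * (`|Q| + 1) by rewrite mulr_gt0// ltr_wpDl.
pose t := Num.min 1 (D / (2 * (`|Q| + 1))).
have t0 : 0 < t by rewrite lt_min ltr01 divr_gt0.
have /H : 0 < t <= 1 by rewrite t0 ge_min lexx.
have h1 : t * (2 * (`|Q| + 1)) <= D by rewrite -ler_pdivlMr// ge_min lexx orbT.
have h2 : t * Q <= t * `|Q| by rewrite ler_wpM2l ?(ltW t0) ?ler_norm.
by move: h1 h2 D0 t0; lra.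
Qed.

Lemma cexp_taylor_scale (a : C) (t : R) : 0 < t <= 1 ->
  cabs (cexp (toC t * a) - 1 - toC t * a) <= 4 * (cabs a ^+ 2 * expR (cabs a)) * t ^+ 2.
Proof.
move=> /andP[t0 t1].
  apply: le_trans (cexp_taylor1 _) _; rewrite -mulrA ler_wpM2l// cabsM cabs_toC gtr0_norm//.
  rewrite exprMn [X in X * expR _]mulrC -[leLHS]mulrA [X in _ * X <= _]mulrC [leLHS]mulrA.
  rewrite ler_wpM2r ?sqr_ge0// ler_wpM2l ?sqr_ge0// ler_expR.
  by rewrite ler_piMl ?cabs_ge0.
Qed.

Lemma phase_cancel (S : fieldType) (c1 c2 f w g1 g2 t : S) : c1 * c2 = 1 ->
  c1 * (f * (c2 * w)) + 1 * (-1 * (g1 * w) + - t * (g2 * w)) = (f - g1 - t * g2) * w.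
Proof.
move=> h; have -> : c1 * (f * (c2 * w)) = c1 * c2 * (f * w) by ring.
by rewrite h; ring.
Qed.

(** A translation by t e_j preserves the integral I of F times the wave and multiplies the wave by
    exp (- t a). Hence exp (t a) I = I + t I1 + O(t^2), I1 being the integral with F1, and comparing
    the terms of order t gives I1 = a I. *)
Lemma ibp_step j v M N F F1 xi : 0 <= M -> okRv v M F -> okRv v M F1 ->
  (forall t y, 0 < t <= 1 ->
     cabs (F (t *: ej R j + y) - F y - toC t * F1 y) <= N * t ^+ 2 * expR (- nR (y - v))) ->
  integralR (fun y => F1 y * wave xi y) =
  'i * toC (xi 0 j) * integralR (fun y => F y * wave xi y).
Proof.
move=> M0 oF oF1 HN; have [K K0 HK] := integralRv_le.
set I := integralR (fun y => F y * wave xi y); set I1 := integralR _.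
have oI := okRv_wave xi oF; have oI1 := okRv_wave xi oF1.
set a : C := 'i * toC (xi 0 j); pose L := 4 * (cabs a ^+ 2 * expR (cabs a)).
apply/eqP; rewrite -subr_eq0 -cabs_eq0 eq_le cabs_ge0 andbT.
apply: (@eq_of_linear _ (K * N + L * cabs I)) => t t01; have /andP[t0 t1] := t01.
have oS : okRv v (M * expR 1) (fun y => F (y + t *: ej R j) * wave xi (y + t *: ej R j)).
  split; first exact: (contR_shift _ (proj1 oI)).
  move=> y; rewrite cabsM cabs_wave mulr1; apply: le_trans (proj2 oF _) _.
  rewrite -mulrA; apply: ler_wpM2l => //; rewrite (addrC y).
  by apply: weight_step; rewrite (ltW t0).
have IS : integralR (fun y => F (y + t *: ej R j) * wave xi (y + t *: ej R j)) = I.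
  exact: (integralR_shift (t *: ej R j) (proj1 oI)).
have oD := okRv_lin (-1) (- toC t) oI oI1.
have := integralRv_lin (cexp (toC t * a)) 1 oS oD.
rewrite (integralRv_lin (-1) (- toC t) oI oI1) IS -/I -/I1.
set G := (fun y : V => _) => IG.
have GE y : G y = (F (t *: ej R j + y) - F y - toC t * F1 y) * wave xi y.
  rewrite /G wave_shift (_ : wave xi (t *: ej R j) = cexp (- (toC t * a))).
    by rewrite (addrC y); apply: phase_cancel; rewrite -cexpD subrr cexp0.
  rewrite /wave; congr cexp; rewrite dotZl dotC dot_delta toCN toCM /a; ring.
have oG : okRv v (N * t ^+ 2) G.
  split; first exact: (contR_lin _ _ (proj1 oS) (proj1 oD)).
  by move=> y; rewrite GE cabsM cabs_wave mulr1; exact: HN.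
have := HK _ _ _ oG; rewrite IG => h1.
have h2 : cabs (cexp (toC t * a) - 1 - toC t * a) <= L * t ^+ 2.
  exact: cexp_taylor_scale.
rewrite -(ler_pM2l t0); have -> : t * cabs (I1 - a * I) = cabs (toC t * (I1 - a * I)).
  by rewrite cabsM cabs_toC gtr0_norm.
have -> : toC t * (I1 - a * I) = (cexp (toC t * a) - 1 - toC t * a) * I -
   (cexp (toC t * a) * I + 1 * (-1 * I + - toC t * I1)) by ring.
apply: le_trans (cabsB _ _) _; rewrite cabsM.
have h3 := ler_wpM2r (cabs_ge0 I) h2.
have -> : t * (t * (K * N + L * cabs I)) = L * t ^+ 2 * cabs I + K * (N * t ^+ 2) by ring.
exact: lerD.
Qed.

Lemma chain_taylor j (v : V) (M : R) F : 0 <= M -> chain j F ->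
  (forall y, cabs (F 2%N y) <= M * expR (- nR (y - v))) ->
  forall t y, 0 < t <= 1 ->
  cabs (F 0%N (t *: ej R j + y) - F 0%N y - toC t * F 1%N y) <=
    4 * M * expR 1 * t ^+ 2 * expR (- nR (y - v)).
Proof.
move=> M0 [cF rF] HM t y t01; have /andP[t0 t1] := t01; have t0' := ltW t0.
set B := M * expR 1 * expR (- nR (y - v)).
have B0 : 0 <= B by rewrite !mulr_ge0// expR_ge0.
have h1 s : 0 <= s <= t -> cabs (F 1%N (s *: ej R j + y) - F 1%N y) <= 2 * B * t.
  move=> /andP[s0 st]; have := @mvt_cplx R (fun h => F 1%N (h *: ej R j + y))
    (fun h => F 2%N (h *: ej R j + y)) 0 s B s0.
  rewrite scale0r add0r subr0 => h; apply: le_trans (h _) _.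
    move=> h' /andP[h0 hs]; split; first exact: rF.
    apply: le_trans (HM _) _; rewrite /B -mulrA ler_wpM2l//; apply: weight_step.
    by rewrite h0 (le_trans hs)// (le_trans st).
  by rewrite ler_wpM2l// mulr_ge0.
have := @mvt_cplx R (fun h => F 0%N (h *: ej R j + y) + (-1) * (toC h * F 1%N y))
    (fun h => F 1%N (h *: ej R j + y) + - F 1%N y) 0 t (2 * B * t) t0'.
rewrite scale0r add0r subr0 toC0 mul0r mulr0 addr0 => h.
have -> : 4 * M * expR 1 * t ^+ 2 * expR (- nR (y - v)) = 2 * (2 * B * t) * t by rewrite /B; ring.
have -> : F 0%N (t *: ej R j + y) - F 0%N y - toC t * F 1%N y =
   F 0%N (t *: ej R j + y) + -1 * (toC t * F 1%N y) - F 0%N y by ring.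
apply: h => s st; split; last exact: h1.
by apply: rderivD; [exact: rF|exact: rderiv_linN].
Qed.

(* Integration by parts, from the translation invariance of the integral alone. *)
Lemma chain_ibp j v (M : nat -> R) F xi : (forall k, 0 <= M k) -> chain j F ->
  (forall k y, cabs (F k y) <= M k * expR (- nR (y - v))) ->
  forall k, integralR (fun y => F k y * wave xi y) =
    ('i * toC (xi 0 j)) ^+ k * integralR (fun y => F 0%N y * wave xi y).
Proof.
move=> M0 cF HM; elim=> [|k IH]; first by rewrite expr0 mul1r.
rewrite exprS -mulrA -IH.
have cFk : chain j (fun i => F (k + i)%N).
  by case: cF => c r; split=> // i y s; rewrite addnS; exact: r.
apply: (@ibp_step j v (M k + M k.+1) (4 * M k.+2 * expR 1)).
- by rewrite addr_ge0.
- split; first exact: (proj1 cF).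
  by move=> y; apply: le_trans (HM k y) _; rewrite ler_wpM2r ?expR_ge0// lerDl.
- split; first exact: (proj1 cF).
  by move=> y; apply: le_trans (HM k.+1 y) _; rewrite ler_wpM2r ?expR_ge0// lerDr.
- have := @chain_taylor j v (M k.+2) (fun i => F (k + i)%N) (M0 _) cFk.
  by rewrite addn0 addn1 addn2; apply.
Qed.

(** Integrating by parts k times in the coordinate where |xi_j| is largest bounds |xi|^k times the
    integral by (d (A + 1))^k [kk theta k], and [decay_opt] chooses k. The constants are independent
    of the centre v. *)
Lemma osc_decay (A : R) : 0 <= A -> exists e K : R, [/\ 0 < e, 0 <= K &
  forall (f : V -> C) (F : 'I_d -> nat -> V -> C) v (M : R) xi, 0 <= M ->
  (forall j, F j 0%N = f /\ chain j (F j)) ->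
  (forall j k y, cabs (F j k y) <= M * A ^+ k * kk theta k * expR (- nR (y - v))) ->
  cabs (integralR (fun y => f y * wave xi y)) <= K * M * expR (- (e * nR xi `^ p))].
Proof.
move=> A0; have c0 : 0 < d%:R * (A + 1) by rewrite mulr_gt0 ?ltr0n// ltr_wpDl.
have [e e0 He] := decay_opt theta_ge theta_lt c0.
have [K K0 HK] := integralRv_le.
exists e, (K * expR 1); split=> //; first by rewrite mulr_ge0// expR_ge0.
move=> f F v M xi M0 HF HM.
set I := integralR _.
rewrite (_ : K * expR 1 * M = K * M * expR 1); last by ring.
apply: He; rewrite ?cabs_ge0 ?nR_ge0// => k.
have [j Hj] := max_coord xi; have [Ff cF] := HF j.
have := chain_ibp xi (M := fun k => M * A ^+ k * kk theta k) _ cF (HM j) k.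
rewrite Ff -/I => /(_ _)/(congr1 (@cabs R)).
rewrite cabsM cabsX cabsM cabs_i mul1r cabs_toC => E.
have {}E : `|xi 0 j| ^+ k * cabs I <= K * (M * A ^+ k * kk theta k).
  rewrite -E; last by move=> i; rewrite !mulr_ge0 ?exprn_ge0 ?kk_ge0.
  apply: (HK v); apply: okRv_wave; split; first exact: (proj1 cF).
  exact: HM.
apply: (@le_trans _ _ (cabs I * (d%:R * `|xi 0 j|) ^+ k)).
  by rewrite ler_wpM2l ?cabs_ge0// lerXn2r ?nnegrE ?nR_ge0 ?mulr_ge0.
rewrite exprMn mulrCA [cabs I * _]mulrC exprMn.
apply: (@le_trans _ _ (d%:R ^+ k * (K * (M * A ^+ k * kk theta k)))).
  by rewrite ler_wpM2l ?exprn_ge0.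
have -> : K * M * (d%:R ^+ k * (A + 1) ^+ k) * kk theta k =
   d%:R ^+ k * (K * (M * (A + 1) ^+ k * kk theta k)) by ring.
rewrite ler_wpM2l ?exprn_ge0// ler_wpM2l// ler_wpM2r ?kk_ge0// ler_wpM2l//.
by rewrite lerXn2r ?nnegrE ?lerDl// addr_ge0.
Qed.

End Oscillation.

(** * Decay of pairings with wave packets *)

Section Decay.
Variables (R : realType) (d : nat) (theta : R).
Hypotheses (d_gt0 : (0 < d)%N) (theta_ge : 2^-1 <= theta) (theta_lt : theta < 1).
Local Notation V := 'rV[R]_d.
Local Notation p := (theta^-1).

Definition single (j : 'I_d) (k : nat) : mindex d := [ffun i => if i == j then k else 0%N].

Lemma mabs_single j k : mabs (single j k) = k.
Proof.
rewrite /mabs (bigD1 j)//= ffunE eqxx big1 ?addn0// => i /negPf ij.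
by rewrite ffunE ij.
Qed.

Lemma mfact_single j k : mfact (single j k) = k`!.
Proof.
rewrite /mfact (bigD1 j)//= ffunE eqxx big1 ?muln1// => i /negPf ij.
by rewrite ffunE ij.
Qed.

Lemma monomial_single j k (x : V) : monomial (single j k) x = x 0 j ^+ k.
Proof.
rewrite /monomial (bigD1 j)//= ffunE eqxx big1 ?mulr1// => i /negPf ij.
by rewrite ffunE ij expr0.
Qed.

Lemma miter_single (T : Type) (D : 'I_d -> T -> T) j k f :
  miter D (single j k) f = iter k (D j) f.
Proof.
rewrite /miter; have : j \in enum 'I_d by rewrite mem_enum.
have : uniq (enum 'I_d) by exact: enum_uniq.
elim: (enum 'I_d) => [//|i s IH] /= /andP[is_ us]; rewrite inE ffunE eq_sym.
case: eqP => [ij|_] /= js; last exact: IH.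
rewrite ij in is_ *; congr (iter k (D j)).
elim: s is_ {us IH js} => [//|i' s IH] /=; rewrite inE negb_or ffunE eq_sym.
by move=> /andP[/negPf -> js] /=; exact: IH.
Qed.

Lemma fact_kk k : (k`!)%:R `^ theta <= kk theta k.
Proof.
rewrite /kk; apply: (powRt_le theta_ge) => //; rewrite -natrX ler_nat.
elim: k => // k IH; rewrite factS expnS leq_mul2l /=.
apply: leq_trans IH _; case: k => // k; by rewrite leq_exp2r.
Qed.

(** Powers of the largest coordinate of y control |y| up to the factor d, so multi-indices supported
    on one coordinate are enough; [decay_opt] chooses the power. *)
Lemma gs_chain_bound (c : R) : 0 < c -> exists e K : R, [/\ 0 < e, 0 < K &
  forall m f, gsb theta c m f -> forall j k (y : V),
    cabs (iter k (pderivR j) f y) <= K * m * c ^+ k * kk theta k * expR (- (e * nR y `^ p))].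
Proof.
move=> c0; have dc0 : 0 < d%:R * c by rewrite mulr_gt0// ltr0n.
have [e e0 He] := decay_opt theta_ge theta_lt dc0.
exists e, (expR 1); split; rewrite ?expR_gt0// => m f gf j k y.
have m0 := gsb_ge0 c0 gf; have [_ H] := gf.
rewrite (_ : expR 1 * m * c ^+ k * kk theta k = m * c ^+ k * kk theta k * expR 1); last by ring.
apply: He; rewrite ?cabs_ge0 ?nR_ge0// => n.
have [i Hi] := max_coord d_gt0 y.
apply: (@le_trans _ _ (cabs (iter k (pderivR j) f y) * (d%:R * `|y 0 i|) ^+ n)).
  by rewrite ler_wpM2l ?cabs_ge0// lerXn2r ?nnegrE ?nR_ge0 ?mulr_ge0.
have := H (single i n) (single j k) y.
rewrite miter_single monomial_single /gs_weight !mabs_single !mfact_single normrX => h.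
rewrite exprMn mulrCA [cabs _ * _]mulrC exprMn.
apply: (@le_trans _ _ (d%:R ^+ n * (m * (c ^+ (n + k) * (n`! * k`!)%:R `^ theta)))).
  by rewrite ler_wpM2l ?exprn_ge0.
have -> : m * c ^+ k * kk theta k * (d%:R ^+ n * c ^+ n) * kk theta n =
   d%:R ^+ n * (m * (c ^+ (n + k) * (kk theta n * kk theta k))) by rewrite exprD; ring.
rewrite ler_wpM2l ?exprn_ge0// ler_wpM2l// ler_wpM2l ?exprn_ge0 ?(ltW c0)//.
by rewrite natrM powRM// ler_pM ?powR_ge0 ?fact_kk.
Qed.

Lemma gauss_chain_bound a M : posim a M -> exists b K : R, [/\ 0 < b, 0 < K &
  forall (x : V) j k (y : V), cabs (iter k (dd j) (gpC M x 0) (vecC y)) <=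
    1 * K ^+ k * kk theta k * expR (- (b * nR (y - x) ^+ 2))].
Proof.
move=> pM; have [a0 _ _] := pM; have a40 : 0 < a / 4 by rewrite divr_gt0.
have [K K0 HK] := gauss_derive d theta_ge theta_lt a40 (gpb_ge0 M a0) ltr01.
exists (a / 4 / 2), K; split; rewrite ?divr_gt0// => x j k y.
have E : iter k (dd j) (gpC M x 0) = foldr (@dd R d) (gpC M x 0) (nseq k j).
  by elim: k => [|k IH]; [|rewrite iterS IH].
have hb z : cabs (gpC M x 0 z) <= 1 * expR (- (a / 4 * nR (reV z - x) ^+ 2)
    + gpb a M * nR (imV z) ^+ 2 + nR (imV z) * 0).
  by rewrite mul1r; have := gpC_bound x 0 z pM; rewrite nR0.
have := HK x 0 1 _ (csmooth_gpC _ _ _) (lexx _) ler01 hb (nseq k j) y.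
by rewrite size_nseq powR0 ?(p_neq0 theta_ge theta_lt)// mulr0 expR0 mulr1 E mulrA.
Qed.

Lemma gauss_exp_le (b : R) : 0 < b -> exists2 K : R, 0 < K & forall r : R, 0 <= r ->
  expR (- (b * r ^+ 2)) <= K * expR (- r).
Proof.
move=> b0; exists (expR (b^-1)); first exact: expR_gt0.
move=> r r0; rewrite -expRD ler_expR lerBrDr addrC.
rewrite -(ler_pM2l b0) mulfV ?gt_eqF// mulrBr.
have := sqr_ge0 (b * r - 1); have := mulr_ge0 (ltW b0) r0.
have -> : b * (b * r ^+ 2) = (b * r) ^+ 2 by ring.
by move: (b * r) => X; rewrite !expr2; nra.
Qed.

Lemma expR_min_le (e1 e2 X Y : R) : 0 <= X -> 0 <= Y ->
  expR (- (e1 * X)) * expR (- (e2 * Y)) <= expR (- (Num.min e1 e2 * (X + Y))).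
Proof.
move=> X0 Y0; rewrite -expRD ler_expR.
have h1 : Num.min e1 e2 * X <= e1 * X by rewrite ler_wpM2r// ge_min lexx.
have h2 : Num.min e1 e2 * Y <= e2 * Y by rewrite ler_wpM2r// ge_min lexx orbT.
by move: h1 h2; rewrite mulrDr; lra.
Qed.

(** Half of the decay in y is spent on the integrable factor exp (- |y|). The other half and the
    Gaussian in y - x bound |x|^p, since |x|^p <= 4 (|y|^p + 1 + |y - x|^2). *)
Lemma packet_weight (e b N e1 : R) (x y : V) : 0 <= e1 -> e1 <= e / 8 -> e1 <= b / 4 ->
  nR y <= e / 2 * nR y `^ p + N ->
  expR (- (e * nR y `^ p)) * expR (- (b * nR (y - x) ^+ 2)) <=
  expR (4 * e1 + N) * expR (- (e1 * nR x `^ p)) * expR (- nR y).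
Proof.
move=> e10 h1 h2 q1; rewrite -!expRD ler_expR.
have q2 : nR x `^ p <= 4 * (nR y `^ p + (1 + nR (y - x) ^+ 2)).
  apply: (@le_trans _ _ ((nR y + nR (y - x)) `^ p)).
    by apply: powRp_le => //; rewrite ?nR_ge0// nRBC nR_le_dist.
  apply: le_trans (powRp_add theta_ge theta_lt (nR_ge0 _) (nR_ge0 _)) _.
  by rewrite ler_wpM2l// lerD2l; apply: (powRp_le_sqr theta_ge theta_lt); exact: nR_ge0.
have q3 := ler_wpM2l e10 q2.
have q4 := ler_wpM2r (powR_ge0 (nR y) p) h1.
have q5 := ler_wpM2r (sqr_ge0 (nR (y - x))) h2.
move: q1 q3 q4 q5 (powR_ge0 (nR y) p) (sqr_ge0 (nR (y - x))).
by move: (nR x `^ p) (nR y `^ p) (nR (y - x) ^+ 2) (nR y) => X Y Z y1; lra.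
Qed.

Lemma packet_weight2 (b b' e1 : R) (x x' y : V) : 0 <= e1 -> e1 <= b / 2 -> e1 <= b' / 4 ->
  expR (- (b' * nR (y - x') ^+ 2)) * expR (- (b * nR (y - x) ^+ 2)) <=
  expR e1 * expR (- (e1 * nR (x - x') `^ p)) * expR (- (b' / 2 * nR (y - x') ^+ 2)).
Proof.
move=> e10 h1 h2; rewrite -!expRD ler_expR.
have q2 : nR (x - x') `^ p <= 1 + nR (x - x') ^+ 2 by apply: powRp_le_sqr => //; exact: nR_ge0.
have q3 := ler_wpM2l e10 q2.
have q4 : nR (x - x') <= nR (y - x') + nR (y - x).
  by have := nRD (x - y) (y - x'); rewrite subrKA (nRBC x y) (addrC (nR (y - x))).
have q5 : nR (x - x') ^+ 2 <= (nR (y - x') + nR (y - x)) ^+ 2.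
  by rewrite lerXn2r ?nnegrE ?nR_ge0 ?addr_ge0 ?nR_ge0.
have q6 := ler_wpM2l e10 q5.
have g1 := ler_wpM2r (sqr_ge0 (nR (y - x))) h1.
have g2 := ler_wpM2r (sqr_ge0 (nR (y - x'))) h2.
have q7 := mulr_ge0 e10 (sqr_ge0 (nR (y - x') - nR (y - x))).
move: q3 q6 q7 g1 g2; rewrite !expr2.
move: (nR (y - x')) (nR (y - x)) (nR (x - x')) (nR (x - x') `^ p) => u v w z.
have -> : e1 * ((u + v) * (u + v)) = e1 * (u * u) + e1 * (v * v) + 2 * (e1 * (u * v)) by ring.
have -> : e1 * ((u - v) * (u - v)) = e1 * (u * u) + e1 * (v * v) - 2 * (e1 * (u * v)) by ring.
by lra.
Qed.

Lemma gs_gp_decay (c a : R) M : 0 < c -> posim a M -> exists e K : R, [/\ 0 < e, 0 <= K &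
  forall m f, gsb theta c m f -> forall x xi : V,
   cabs (integralR (fun y => f y * gp M x xi y)) <=
     K * m * expR (- (e * (nR x `^ p + nR xi `^ p)))].
Proof.
move=> c0 pM; have [e [K [e0 K0 HK]]] := gs_chain_bound c0.
have [b [L [b0 L0 HL]]] := gauss_chain_bound pM.
have AB0 : 0 <= c + L by rewrite addr_ge0 ?ltW.
have [e2 [K2 [e20 K20 H2]]] := osc_decay d_gt0 theta_ge theta_lt AB0.
pose e1 := Num.min (e / 8) (b / 4).
have e10 : 0 < e1 by rewrite lt_min !divr_gt0.
have [N N0 HN] := lin_le_powRp theta_ge theta_lt (divr_gt0 e0 (ltr0Sn R 1)).
pose e3 := Num.min e1 e2; have e30 : 0 < e3 by rewrite lt_min e10.
exists e3, (K2 * (K * expR (4 * e1 + N))); split=> //.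
  by rewrite mulr_ge0// mulr_ge0 ?expR_ge0// ltW.
move=> m f gf x xi; have m0 := gsb_ge0 c0 gf.
under eq_fun do rewrite gp_wave mulrA.
have := H2 (fun y => f y * gp M x 0 y)
  (fun j => pchain (fun k => iter k (pderivR j) f) (fun k => iter k (dd j) (gpC M x 0) \o @vecC R d))
  0 (K * m * expR (4 * e1 + N) * expR (- (e1 * nR x `^ p))) xi.
move=> h; apply: le_trans (h _ _ _) _.
- by rewrite !mulr_ge0 ?expR_ge0 ?(ltW K0).
- move=> j; split=> //; apply: pchainP; first exact: smooth_chain (proj1 gf).
  exact: csmooth_chain (csmooth_gpC _ _ _).
- move=> j k y; rewrite subr0.
  have hM : 0 <= K * m * expR (- (e * nR y `^ p)) by rewrite !mulr_ge0 ?expR_ge0 ?(ltW K0).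
  have hN : 0 <= expR (- (b * nR (y - x) ^+ 2)) by exact: expR_ge0.
  have h1 k' : cabs (iter k' (pderivR j) f y) <=
      K * m * expR (- (e * nR y `^ p)) * c ^+ k' * kk theta k'.
    apply: le_trans (HK m f gf j k' y) _; rewrite le_eqVlt; apply/orP; left; apply/eqP; ring.
  have h2 k' : cabs ((iter k' (dd j) (gpC M x 0) \o @vecC R d) y) <=
      expR (- (b * nR (y - x) ^+ 2)) * L ^+ k' * kk theta k'.
    apply: le_trans (HL x j k' y) _; rewrite le_eqVlt; apply/orP; left; apply/eqP; ring.
  have t0 : 0 <= theta := ltW (theta_gt0 theta_ge).
  have := @pchain_bound R d theta _ _ c L (fun k => iter k (pderivR j) f)
    (fun k => iter k (dd j) (gpC M x 0) \o @vecC R d) y t0 (ltW c0) (ltW L0) hM hN h1 h2 k.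
  move=> h3; apply: le_trans h3 _.
  have -> : K * m * expR (4 * e1 + N) * expR (- (e1 * nR x `^ p)) * (c + L) ^+ k * kk theta k *
      expR (- nR y) = K * m * (expR (4 * e1 + N) * expR (- (e1 * nR x `^ p)) * expR (- nR y))
      * (c + L) ^+ k * kk theta k by ring.
  apply: ler_wpM2r; first exact: kk_ge0.
  apply: ler_wpM2r; first exact: exprn_ge0.
  rewrite -[leLHS]mulrA.
  apply: ler_wpM2l; first exact: (mulr_ge0 (ltW K0) m0).
  apply: packet_weight (HN _ (nR_ge0 y)); rewrite ?(ltW e10)// ge_min ?lexx ?orbT//.
have -> B : K2 * (K * m * expR (4 * e1 + N) * expR (- (e1 * nR x `^ p))) * B =
  K2 * (K * expR (4 * e1 + N)) * m * (expR (- (e1 * nR x `^ p)) * B) by ring.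
apply: ler_wpM2l; first by rewrite !mulr_ge0 ?expR_ge0 ?(ltW K0).
by apply: expR_min_le; exact: powR_ge0.
Qed.

(** The frequencies combine into the single wave [xi - xi'], to which [osc_decay] applies; decay in
    x - x' is read off the product of the two Gaussians, part of the second being kept as the
    integrable majorant centred at x'. *)
Lemma gp_gp_decay (a a' : R) M M' : posim a M -> posim a' M' -> exists e K : R, [/\ 0 < e, 0 <= K &
  forall x xi x' xi' : V,
   cabs (integralR (fun y => cconj (gp M' x' xi' y) * gp M x xi y)) <=
     K * expR (- (e * (nR (x - x') `^ p + nR (xi - xi') `^ p)))].
Proof.
move=> pM pM'; have [b [L [b0 L0 HL]]] := gauss_chain_bound pM.
have [b' [L' [b'0 L'0 HL']]] := gauss_chain_bound pM'.
have AB0 : 0 <= L' + L by rewrite addr_ge0 ?ltW.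
have [e2 [K2 [e20 K20 H2]]] := osc_decay d_gt0 theta_ge theta_lt AB0.
pose e1 := Num.min (b / 2) (b' / 4).
have e10 : 0 < e1 by rewrite lt_min !divr_gt0.
have [N N0 HN] := gauss_exp_le (divr_gt0 b'0 (ltr0Sn R 1)).
pose e3 := Num.min e1 e2; have e30 : 0 < e3 by rewrite lt_min e10.
exists e3, (K2 * (N * expR e1)); split=> //.
  by rewrite mulr_ge0// mulr_ge0 ?expR_ge0// ltW.
move=> x xi x' xi'.
have E y : cconj (gp M' x' xi' y) * gp M x xi y =
    (cconj (gp M' x' 0 y) * gp M x 0 y) * wave (xi - xi') y.
  rewrite (gp_wave M') (gp_wave M) conjCM mulrACA; congr (_ * _).
  rewrite /wave cexp_conj -cexpD; congr cexp.
  apply: complexP; rewrite ?(reCD, imCD, reC_conj, imC_conj, reC_iM, imCM, reCi, imCi, reC_toC, imC_toC).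
    by rewrite !oppr0 addr0.
  by rewrite dotDr dotNr !mul0r !mul1r !add0r opprK opprD opprK addrC.
under eq_fun do rewrite E.
have := H2 (fun y => cconj (gp M' x' 0 y) * gp M x 0 y)
  (fun j => pchain (fun k y => cconj ((iter k (dd j) (gpC M' x' 0) \o @vecC R d) y))
                   (fun k => iter k (dd j) (gpC M x 0) \o @vecC R d))
  x' (N * expR e1 * expR (- (e1 * nR (x - x') `^ p))) (xi - xi').
move=> h; apply: le_trans (h _ _ _) _.
- by rewrite !mulr_ge0 ?expR_ge0 ?(ltW N0).
- move=> j; split=> //; apply: pchainP; last exact: csmooth_chain (csmooth_gpC _ _ _).
  by apply: chain_conj; exact: csmooth_chain (csmooth_gpC _ _ _).
- move=> j k y.
  have h1 k' : cabs (cconj ((iter k' (dd j) (gpC M' x' 0) \o @vecC R d) y)) <=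
      expR (- (b' * nR (y - x') ^+ 2)) * L' ^+ k' * kk theta k'.
    rewrite cabs_conj; apply: le_trans (HL' x' j k' y) _.
    by rewrite le_eqVlt; apply/orP; left; apply/eqP; ring.
  have h2 k' : cabs ((iter k' (dd j) (gpC M x 0) \o @vecC R d) y) <=
      expR (- (b * nR (y - x) ^+ 2)) * L ^+ k' * kk theta k'.
    apply: le_trans (HL x j k' y) _; rewrite le_eqVlt; apply/orP; left; apply/eqP; ring.
  have t0 : 0 <= theta := ltW (theta_gt0 theta_ge).
  have := @pchain_bound R d theta _ _ L' L
    (fun k y => cconj ((iter k (dd j) (gpC M' x' 0) \o @vecC R d) y))
    (fun k => iter k (dd j) (gpC M x 0) \o @vecC R d) y t0 (ltW L'0) (ltW L0) (expR_ge0 _) (expR_ge0 _) h1 h2 k.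
  move=> h3; apply: le_trans h3 _.
  have -> : N * expR e1 * expR (- (e1 * nR (x - x') `^ p)) * (L' + L) ^+ k * kk theta k *
      expR (- nR (y - x')) = (expR e1 * expR (- (e1 * nR (x - x') `^ p)) * (N * expR (- nR (y - x'))))
      * (L' + L) ^+ k * kk theta k by ring.
  rewrite ler_wpM2r ?kk_ge0// ler_wpM2r ?exprn_ge0//.
  have q1 := HN _ (nR_ge0 (y - x')).
  apply: (@le_trans _ _ (expR e1 * expR (- (e1 * nR (x - x') `^ p)) *
      expR (- (b' / 2 * nR (y - x') ^+ 2)))); last first.
    by rewrite ler_wpM2l// mulr_ge0// expR_ge0.
  by apply: packet_weight2; rewrite ?(ltW e10)// ge_min ?lexx ?orbT.
have -> B : K2 * (N * expR e1 * expR (- (e1 * nR (x - x') `^ p))) * B =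
  K2 * (N * expR e1) * (expR (- (e1 * nR (x - x') `^ p)) * B) by ring.
apply: ler_wpM2l; first by rewrite !mulr_ge0 ?expR_ge0 ?(ltW N0).
by apply: expR_min_le; exact: powR_ge0.
Qed.

End Decay.

(** * The transform of test functions *)

Section TransposedTransform.
Variables (R : realType) (d : nat) (theta : R) (phi : FBI_phase R d).
Hypotheses (d_gt0 : (0 < d)%N) (theta_ge : 2^-1 <= theta) (theta_lt : theta < 1).
Local Notation C := (Cplx R).
Local Notation V := 'rV[R]_d.
Local Notation p := (theta^-1).

Lemma cconjK (z : C) : cconj (cconj z) = z.
Proof. by apply: complexP; rewrite ?reC_conj ?imC_conj ?opprK. Qed.

Lemma pderivR_conj j (f : V -> C) : continuous_derivable f ->
  continuous_derivable (fun x => cconj (f x)) /\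
  pderivR j (fun x => cconj (f x)) = fun x => cconj (pderivR j f x).
Proof.
move=> [c1 c2 df].
have H x i := @pderivR_rderiv R d (fun x => cconj (f x)) x i _ (rderiv_conj (rderiv_pderivR (proj1 (df x i)) (proj2 (df x i)))).
split; last by apply/funext => x; have [] := H x j.
split; last by move=> x i; have [] := H x i.
  by rewrite (_ : _ \o _ = @reC R \o f)//; apply/funext => x /=; rewrite reC_conj.
rewrite (_ : _ \o _ = - (@imC R \o f)); last by apply/funext => x /=; rewrite imC_conj.
by move=> x; exact: (continuousN (c2 x)).
Qed.

Lemma foldr_pderivR_conj (f : V -> C) s : smooth f ->
  foldr (@pderivR R d) (fun x => cconj (f x)) s = fun x => cconj (foldr (@pderivR R d) f s x).
Proof.
move=> sf; elim: s => [//|j s IH]; rewrite [LHS]/= IH.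
by have [_ ->] := pderivR_conj j (sf s).
Qed.

Lemma gsb_conj c m (f : V -> C) : gsb theta c m f -> gsb theta c m (fun x => cconj (f x)).
Proof.
move=> [sf H]; split.
  move=> s; rewrite foldr_pderivR_conj//.
  by have [] := pderivR_conj (Ordinal d_gt0) (sf s).
move=> a b x; have [s _ E] := miter_foldr (@pderivR R d) b.
by rewrite E foldr_pderivR_conj// cabs_conj -E; exact: H.
Qed.

Lemma gs_conj (f : V -> C) : gs theta f -> gs theta (fun x => cconj (f x)).
Proof.
by move=> /gsP[c [m [c0 gf]]]; apply/gsP; exists c, m; split=> //; exact: gsb_conj.
Qed.

Lemma kk0 : kk theta 0 = 1 :> R. Proof. by rewrite kkE. Qed.

Lemma smooth_contR (f : V -> C) : smooth f -> contR f.
Proof. by move=> /(_ [::])[c1 c2 _]; exact: continuous_contR. Qed.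

Lemma gs_okR c : 0 < c -> exists2 K : R, 0 < K & forall m f, gsb theta c m f -> @okR R d (K * m) f.
Proof.
move=> c0; have [e [K [e0 K0 HK]]] := gs_chain_bound d_gt0 theta_ge theta_lt c0.
have [N N0 HN] := lin_le_powRp theta_ge theta_lt e0.
exists (K * expR N); first by rewrite mulr_gt0// expR_gt0.
move=> m f gf; split; first exact: smooth_contR (proj1 gf).
move=> y; have := HK m f gf (Ordinal d_gt0) 0%N y; rewrite expr0 kk0 !mulr1 => h.
apply: le_trans h _.
have -> B : K * expR N * m * B = K * m * (expR N * B) by ring.
apply: ler_wpM2l.
  by rewrite mulr_ge0 ?(ltW K0)//; exact: gsb_ge0 gf.
rewrite -expRD ler_expR; have := HN _ (nR_ge0 y); lra.
Qed.

Lemma okR_mul M B (f g : V -> C) : 0 <= M -> okR M f -> contR g -> (forall y, cabs (g y) <= B) ->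
  okR (M * B) (fun y => f y * g y).
Proof.
move=> M0 [cf Hf] cg Hg; split; first exact: contR_mul.
move=> y; rewrite cabsM mulrAC; apply: ler_pM; rewrite ?cabs_ge0//.
Qed.

Lemma gs_bounded c : 0 < c -> exists2 K : R, 0 < K & forall m (f : V -> C) y,
  gsb theta c m f -> cabs (f y) <= K * m.
Proof.
move=> c0; have [K K0 HK] := gs_okR c0; exists K => // m f y gf.
have [_ H] := HK m f gf; apply: le_trans (H y) _.
rewrite ler_piMr ?mulr_ge0 ?(ltW K0) ?(gsb_ge0 c0 gf)//.
by rewrite -expR0 ler_expR oppr_le0 nR_ge0.
Qed.

Lemma gs_pair_ok f g : gs theta f -> gs theta g -> exists M : R, @okR R d M (fun y => f y * g y).
Proof.
move=> /gsP[c [m [c0 gf]]] /gsP[c' [m' [c'0 gg]]].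
have [K K0 HK] := gs_okR c0; have [L L0 HL] := gs_bounded c'0.
exists (K * m * (L * m')); apply: okR_mul.
- by rewrite mulr_ge0 ?(ltW K0)//; exact: gsb_ge0 gf.
- exact: HK.
- exact: smooth_contR (proj1 gg).
- by move=> y; exact: HL.
Qed.

Lemma embed_lin f g h a b : gs theta f -> gs theta g -> gs theta h ->
  embed f (fun x => a * g x + b * h x) = a * embed f g + b * embed (d := d) f h :> C.
Proof.
move=> gf gg gh; have [M oM] := gs_pair_ok gf gg; have [N oN] := gs_pair_ok gf gh.
rewrite /embed -(integralR_lin a b oM oN); congr integralR; apply/funext => x; ring.
Qed.

Lemma embed_sym f g : embed f g = embed (d := d) g f :> C.
Proof. by rewrite /embed; congr integralR; apply/funext => x; rewrite mulrC. Qed.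

Lemma embed_dual f : gs theta f -> gs_dual theta (embed (d := d) f : functional R d).
Proof.
move=> gf; apply: dual_intro => // [g h a b gg gh|c c0]; first exact: embed_lin.
move/gsP: (gf) => [c' [m' [c'0 gf']]].
have [K K0 HK] := gs_okR c'0; have [L L0 HL] := gs_bounded c0.
have [I I0 HI] := integralR_le R d.
have m'0 := gsb_ge0 c'0 gf'.
exists (I * (K * m' * L)); first by rewrite !mulr_ge0 ?(ltW K0) ?(ltW L0).
move=> g m gg; rewrite -!mulrA mulrA !mulrA -mulrA -[leRHS]mulrA -[leRHS]mulrA.
have -> : I * (K * (m' * (L * m))) = I * (K * m' * (L * m)) by ring.
apply: HI; apply: okR_mul.
- by rewrite mulr_ge0 ?(ltW K0).
- exact: HK.
- exact: smooth_contR (proj1 gg).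
- by move=> y; exact: HL.
Qed.

(** The factor through which v enters [fbi_adj]: the transform of the conjugate, conjugated again,
    and so linear in v. *)
Definition Tst (v : V -> C) (z : 'rV[C]_d) : C :=
  cconj (fbi phi (embed (fun y => cconj (v y))) z).

Lemma kernel_gs z : gs theta (fbi_kernel phi z).
Proof.
have [c [K [c0 K0 H]]] := kernel_gsb phi d_gt0 theta_ge theta_lt ltr01.
by apply/gsP; exists c; eexists; split=> //; exact: H.
Qed.

Lemma Tst_contC v : gs theta v -> contC (Tst v).
Proof.
move=> /gs_conj/embed_dual/(fbi_csmooth phi d_gt0 theta_ge theta_lt)/contC_csmooth cT z h h0.
have [e e0 He] := cT z h h0; exists e => // z' /He.
by rewrite /Tst -conjCN -conjCD cabs_conj.
Qed.

Lemma conjC_toC (x : R) : cconj (toC x) = toC x :> C.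
Proof. by apply: complexP; rewrite ?reC_conj ?imC_conj ?reC_toC ?imC_toC ?oppr0. Qed.

Lemma Tst_lin v w a b z : gs theta v -> gs theta w ->
  Tst (fun y => a * v y + b * w y) z = a * Tst v z + b * Tst w z.
Proof.
move=> gv gw; rewrite /Tst /fbi; have gk := kernel_gs z.
rewrite (_ : (fun y => cconj (a * v y + b * w y)) =
  fun y => cconj a * cconj (v y) + cconj b * cconj (w y)); last first.
  by apply/funext => y; rewrite conjCD !conjCM.
rewrite ![embed _ (fbi_kernel _ _)]embed_sym embed_lin//; try exact: gs_conj.
rewrite !conjCM conjCD !conjCM !cconjK !conjC_toC; ring.
Qed.

Lemma integralR_scale M f c : @okR R d M f -> integralR (fun x => c * f x) = c * integralR f.
Proof.
move=> oM; have := integralR_lin c 0 oM oM; rewrite mul0r addr0 => <-; congr integralR.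
by apply/funext => x; rewrite mul0r addr0.
Qed.

Lemma gp_gs a M x xi : posim a M -> gs theta (@gp R d M x xi).
Proof.
move=> pM; have [c [K [c0 K0 H]]] := gp_gsb theta_ge theta_lt pM ltr01.
by apply/gsP; exists c; eexists; split=> //; exact: H.
Qed.

Lemma cabs_Tst v z : gs theta v -> cabs (Tst v z) = cabs (toC (c_phi phi) : C) *
  (expR (weight phi z) *
   cabs (integralR (fun y => cconj (v y) * gp (phC phi) (xz phi z) (xiz phi z) y))).
Proof.
move=> gv; have [a pQ] := phC_posim phi d_gt0.
have [M oM] := gs_pair_ok (gs_conj gv) (gp_gs (xz phi z) (xiz phi z) pQ).
rewrite /Tst cabs_conj /fbi cabsM; congr (_ * _).
rewrite -(cabs_pref phi d_gt0) -cabsM -(integralR_scale _ oM) fbi_kernel_split /embed.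
by congr (cabs (integralR _)); apply/funext => y; rewrite mulrCA.
Qed.

Lemma nC_le_phase : exists2 K : R, 0 < K & forall z,
  nC z `^ p <= K * (nR (xz phi z) `^ p + nR (xiz phi z) `^ p).
Proof.
have [K K0 [_ HK]] := phase_bounds phi.
exists (K `^ p * 4); first by rewrite mulr_gt0// powR_gt0.
move=> z; apply: (@le_trans _ _ ((K * (nR (xz phi z) + nR (xiz phi z))) `^ p)).
  by apply: powRp_le; rewrite ?nC_ge0// -{1}(chi_phase phi z).
rewrite powRM ?addr_ge0 ?nR_ge0 ?(ltW K0)// -mulrA ler_wpM2l ?powR_ge0//.
by apply: powRp_add; rewrite ?nR_ge0.
Qed.

Lemma Tst_bound c : 0 < c -> exists e K : R, [/\ 0 < e, 0 <= K & forall m v, gsb theta c m v ->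
  forall z, cabs (Tst v z) <= K * m * expR (- (e * nC z `^ p) + weight phi z)].
Proof.
move=> c0; have [a pQ] := phC_posim phi d_gt0.
have [e [K [e0 K0 HK]]] := gs_gp_decay d_gt0 theta_ge theta_lt c0 pQ.
have [L L0 HL] := nC_le_phase.
exists (e / L), (cabs (toC (c_phi phi) : C) * K); split.
- by rewrite divr_gt0.
- by rewrite mulr_ge0 ?cabs_ge0.
move=> m v gv z; have m0 := gsb_ge0 c0 gv.
have ggv : gs theta v by apply/gsP; exists c, m.
rewrite cabs_Tst// -!mulrA ler_wpM2l ?cabs_ge0//.
have := HK m _ (gsb_conj gv) (xz phi z) (xiz phi z); set I := cabs _ => h.
apply: le_trans (ler_wpM2l (expR_ge0 _) h) _.
rewrite mulrC -!mulrA ler_wpM2l// ler_wpM2l// -expRD ler_expR lerD2r lerN2.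
by rewrite ler_wpM2l ?(ltW e0)// mulrC ler_pdivrMr// mulrC; exact: HL.
Qed.

Lemma Tst_gp_bound a' M' : posim a' M' -> exists e K : R, [/\ 0 < e, 0 <= K &
  forall x' xi' z, cabs (Tst (gp M' x' xi') z) <= K *
    expR (- (e * (nR (xz phi z - x') `^ p + nR (xiz phi z - xi') `^ p)) + weight phi z)].
Proof.
move=> pM'; have [a pQ] := phC_posim phi d_gt0.
have [e [K [e0 K0 HK]]] := gp_gp_decay d_gt0 theta_ge theta_lt pQ pM'.
exists e, (cabs (toC (c_phi phi) : C) * K); split=> //; first by rewrite mulr_ge0 ?cabs_ge0.
move=> x' xi' z; rewrite cabs_Tst; last exact: gp_gs pM'.
rewrite -!mulrA ler_wpM2l ?cabs_ge0//.
have := HK (xz phi z) (xiz phi z) x' xi'; set I := cabs _ => h.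
apply: le_trans (ler_wpM2l (expR_ge0 _) h) _.
by rewrite mulrCA ler_wpM2l// -expRD addrC.
Qed.

End TransposedTransform.

(** * Convergence of the series defining the operator *)

Section Operator.
Variables (R : realType) (d : nat) (theta : R) (phi : FBI_phase R d).
Hypotheses (d_gt0 : (0 < d)%N) (theta_ge : 2^-1 <= theta) (theta_lt : theta < 1).
Local Notation C := (Cplx R).
Local Notation Z := 'rV[C]_d.
Local Notation p := (theta^-1).
Local Notation W := (weight phi).
Variable h : mindex d -> Z -> C.
Hypothesis h_entire : forall a, entire (h a).
Hypothesis h_bound : forall e : R, 0 < e -> exists2 D : R, 0 < D & forall a z,
  cabs (h a z) <= D * (e ^+ mabs a / (mfact a)%:R `^ theta) * expR (e * nC z `^ p).

Lemma contCP (f : Z -> C) : contC f <-> forall z, f w @[w --> z] --> f z.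
Proof.
split=> [cf z|cf z e e0].
  apply/(@cvgrPdist_lt _ _ _ (nbhs z) (nbhs_filter z)) => e /Cpos_re[-> e0].
  have [r r0 Hr] := cf z _ e0; apply/nbhs_nC; exists r => // w /Hr.
  by rewrite Cnorm toC_lt cabsBC.
have eC : 0 < toC e by rewrite -toC0 toC_lt.
have /(@cvgrPdist_lt _ _ _ (nbhs z) (nbhs_filter z))/(_ _ eC)/nbhs_nC[r r0 Hr] := cf z.
by exists r => // w /Hr; rewrite Cnorm toC_lt cabsBC.
Qed.

Lemma contC_mul (f g : Z -> C) : contC f -> contC g -> contC (fun z => f z * g z).
Proof.
by move=> /contCP cf /contCP cg; apply/contCP => z; exact: (cvgM (cf z) (cg z)).
Qed.

Lemma two_sided_dist (A B K z z' n e : R) : 0 <= K -> 0 <= n -> 0 <= z -> n <= 1 -> z' <= z + n ->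
  n * (K * (z + 2) + 1) < e -> A <= B + K * (z * n + n ^+ 2) -> B <= A + K * (z' * n + n ^+ 2) ->
  `|A - B| < e.
Proof.
move=> K0 n0 z0 n1 hz' hS h1 h2.
have b w : w <= z + 1 -> K * (w * n + n ^+ 2) <= n * (K * (z + 2) + 1).
  move=> hw; have -> : K * (w * n + n ^+ 2) = n * (K * (w + n)) by ring.
  apply: ler_wpM2l => //; rewrite -[leLHS]addr0; apply: lerD => //.
  by apply: ler_wpM2l => //; lra.
have b1 := b z; have b2 := b z'.
have c1 : z <= z + 1 by lra.
have c2 : z' <= z + 1 by lra.
have {}b1 := b1 c1; have {}b2 := b2 c2.
by rewrite ltr_norml; apply/andP; split; lra.
Qed.

Lemma weight_cont (z : Z) (e : R) : 0 < e -> exists2 r : R, 0 < r &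
  forall z', nC (z' - z) < r -> `|W z' - W z| < e.
Proof.
move=> e0; have [K K0 HK] := weight_lip phi d_gt0.
pose S := K * (nC z + 2) + 1.
have S0 : 0 < S by rewrite ltr_wpDl// mulr_ge0 ?(ltW K0)// addr_ge0 ?nC_ge0.
exists (Num.min 1 (e / S)); first by rewrite lt_min ltr01 divr_gt0.
move=> z' Hz; have w1 : nC (z' - z) <= 1 by apply: le_trans (ltW Hz) _; rewrite ge_min lexx.
have wS : nC (z' - z) * S < e.
  by rewrite -ltr_pdivlMr//; apply: lt_le_trans Hz _; rewrite ge_min lexx orbT.
have hz' : nC z' <= nC z + nC (z' - z) by rewrite -{1}(subrK z z') addrC nCD.
have h1 := HK z (z' - z); rewrite addrC subrK in h1.
have h2 := HK z' (z - z'); rewrite addrC subrK nCBC in h2.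
exact: (two_sided_dist (ltW K0) (nC_ge0 _) (nC_ge0 z) w1 hz' wS h1 h2).
Qed.

Lemma contC_weight : contC (fun z => toC (expR (- (2 * W z))) : C).
Proof.
move=> z e e0.
have cE : {for (- (2 * W z)), continuous (@expR R)} by exact: continuous_expR.
have /(@cvgrPdist_lt _ _ _ _ (nbhs_filter _))/(_ _ e0)/nbhs_ballP[r r0 Hr] := cE.
have r20 : 0 < r / 2 by rewrite divr_gt0.
have [t t0 Ht] := weight_cont z r20; exists t => // z' /Ht hz.
rewrite -toCB cabs_toC distrC; apply: Hr; rewrite /ball /=.
rewrite opprK addrC -mulrBr normrM ger0_norm// mulrC -ltr_pdivlMr//.
Qed.

Definition adj_pair (g t : Z -> C) : C :=
  integralC (fun z => g z * t z * toC (expR (- (2 * W z)))).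

Lemma fbi_adjE g v : fbi_adj phi g v = adj_pair g (Tst phi v). Proof. by []. Qed.

(** The factor exp (- 2 Phi) of the measure cancels one exp Phi from each function, and
    [lin_le_powRp] turns what remains into the exponential majorant of [okC]. *)
Lemma pair_ok (e : R) : 0 < e -> exists2 K : R, 0 < K & forall g t (M : R), 0 <= M ->
  contC g -> contC t -> (forall z, cabs (g z) * cabs (t z) <= M * expR (- (e * nC z `^ p) + 2 * W z)) ->
  okC (K * M) (fun z => g z * t z * toC (expR (- (2 * W z)))).
Proof.
move=> e0; have [N N0 HN] := lin_le_powRp theta_ge theta_lt (divr_gt0 e0 (ltr0Sn R 1)).
exists (expR (2 * N)); first exact: expR_gt0.
move=> g t M M0 cg ct H; split; first by apply: contC_mul contC_weight; exact: contC_mul.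
move=> z; rewrite !cabsM cabs_toC ger0_norm ?expR_ge0//.
apply: le_trans (ler_wpM2r (expR_ge0 _) (H z)) _.
have -> : expR (2 * N) * M * expR (- (2 * nC z)) = M * (expR (2 * N) * expR (- (2 * nC z))) by ring.
rewrite -mulrA; apply: ler_wpM2l => //; rewrite -!expRD ler_expR.
have := HN _ (nC_ge0 z); lra.
Qed.

Lemma contC_symbol u a : gs_dual theta u -> contC (symbol_term phi h u a).
Proof.
move=> du; apply: contC_mul.
  apply/contCP => z; exact: (differentiable_continuous (h_entire a z)).
have [s _ E] := miter_foldr (@pderivC R d) a; rewrite E.
apply: contC_csmooth; exact: (csmooth_foldr s (fbi_csmooth phi d_gt0 theta_ge theta_lt du)).
Qed.

(** A family with uniformly bounded transforms: a singleton for statements on one functional, the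
    range of a sequence for continuity. *)
Variable U : set (functional R d).
Hypothesis U_dual : forall u, U u -> gs_dual theta u.
Hypothesis U_fbi : forall e : R, 0 < e -> exists2 K : R, 0 <= K & forall u, U u -> forall z,
  cabs (fbi phi u z) <= K * expR (e * nC z `^ p + W z).

Lemma symbol_family (e : R) : 0 < e -> exists2 M : R, 0 <= M & forall u, U u -> forall a z,
  cabs (symbol_term phi h u a z) <= M * mweight R a * expR (e * nC z `^ p + W z).
Proof.
move=> e0; have [L L0 HL] := weight_lip phi d_gt0.
have [K K0 [e1 e10 H]] := symbol_global theta_ge theta_lt L0 HL h_bound e0.
have [M M0 HM] := U_fbi e10.
exists (K * M); first by rewrite mulr_ge0// ltW.
move=> u Uu a z.
have := H _ a z M (fbi_csmooth phi d_gt0 theta_ge theta_lt (U_dual Uu)) M0 (HM u Uu).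
rewrite /symbol_term => h1; apply: le_trans h1 _.
rewrite -[leRHS]mulrA; apply: ler_wpM2l; first by rewrite mulr_ge0// ltW.
rewrite /mweight -expRD ler_expR; have := ler0n R (mabs a).
set n := (mabs a)%:R; set t := e * _; move: n t (W z) => n t q; lra.
Qed.

Lemma adj_family c : 0 < c -> exists2 K : R, 0 <= K & forall u, U u -> forall m v, gsb theta c m v ->
  exists M : R, [/\ 0 <= M, M <= K * m & forall a,
   okC (M * mweight R a) (fun z => symbol_term phi h u a z * Tst phi v z * toC (expR (- (2 * W z))))].
Proof.
move=> c0; have [e [K [e0 K0 HK]]] := Tst_bound phi d_gt0 theta_ge theta_lt c0.
have [M M0 HM] := symbol_family (divr_gt0 e0 (ltr0Sn R 1)).
have [L L0 HL] := pair_ok (divr_gt0 e0 (ltr0Sn R 1)).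
exists (L * (M * K)); first by rewrite mulr_ge0 ?(ltW L0)// mulr_ge0.
move=> u Uu m v gv; have m0 := gsb_ge0 c0 gv.
exists (L * (M * K) * m); split=> //; first by rewrite !mulr_ge0 ?(ltW L0).
have ggv : gs theta v by apply/gsP; exists c, m.
move=> a; have a0 := mweight_ge0 R a.
have -> : L * (M * K) * m * mweight R a = L * (M * K * m * mweight R a) by ring.
apply: HL; rewrite ?mulr_ge0//.
- exact: contC_symbol (U_dual Uu).
- exact: Tst_contC ggv.
- move=> z; apply: le_trans (ler_pM (cabs_ge0 _) (cabs_ge0 _) (HM u Uu a z) (HK m v gv z)) _.
  rewrite mulrACA -expRD (_ : M * mweight R a * (K * m) = M * K * m * mweight R a); last by ring.
  rewrite ler_wpM2l ?mulr_ge0// ler_expR; lra.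
Qed.

Lemma adj_term_bound c : 0 < c -> exists2 K : R, 0 <= K & forall u, U u -> forall m v,
  gsb theta c m v -> forall a, cabs (fbi_adj phi (symbol_term phi h u a) v) <= K * m * mweight R a.
Proof.
move=> c0; have [K K0 HK] := adj_family c0; have [I I0 HI] := integralC_le R d.
exists (I * K); first by rewrite mulr_ge0.
move=> u Uu m v gv a; have [M [M0 MK oM]] := HK u Uu m v gv.
apply: le_trans (HI _ _ (oM a)) _; rewrite -!mulrA ler_wpM2l// mulrA.
by rewrite ler_wpM2r ?mweight_ge0.
Qed.

Lemma adj_cvg u v : U u -> gs theta v ->
  partial_sum (fun a => fbi_adj phi (symbol_term phi h u a) v) @ totally --> opA phi h u v.
Proof.
move=> Uu /gsP[c [m [c0 gv]]]; have [K K0 HK] := adj_term_bound c0.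
apply: (sum_cvg (mweight_ge0 R (d := d)) (@mweight_bound R d) _ (HK u Uu m v gv)).
by rewrite mulr_ge0//; exact: gsb_ge0 gv.
Qed.

Lemma opA_equi : exists2 S : R, 0 <= S & forall c, 0 < c -> exists2 K : R, 0 <= K &
  forall u, U u -> forall m v, gsb theta c m v -> cabs (opA phi h u v) <= S * (K * m).
Proof.
exists (((1 - expR (-1))^-1) ^+ d).
  by rewrite exprn_ge0// invr_ge0 subr_ge0 -expR0 ler_expR oppr_le0.
move=> c c0; have [K K0 HK] := adj_term_bound c0; exists K => // u Uu m v gv.
have Km : 0 <= K * m by rewrite mulr_ge0//; exact: gsb_ge0 gv.
have := sum_bound (mweight_ge0 R (d := d)) (@mweight_bound R d) Km (HK u Uu m v gv).
by rewrite mulrC.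
Qed.

Lemma adj_lin u a f g x y : U u -> gs theta f -> gs theta g ->
  fbi_adj phi (symbol_term phi h u a) (fun z => x * f z + y * g z) =
  x * fbi_adj phi (symbol_term phi h u a) f + y * fbi_adj phi (symbol_term phi h u a) g.
Proof.
move=> Uu gf gg; case/gsP: (gf) => [c [m [c0 gf']]]; case/gsP: (gg) => [c' [m' [c'0 gg']]].
have [K _ HK] := adj_family c0; have [M [_ _ oM]] := HK u Uu m f gf'.
have [K' _ HK'] := adj_family c'0; have [N [_ _ oN]] := HK' u Uu m' g gg'.
rewrite !fbi_adjE /adj_pair -(integralC_lin x y (oM a) (oN a)); congr integralC.
by apply/funext => z; rewrite (Tst_lin phi d_gt0 theta_ge theta_lt)//; ring.
Qed.

Lemma msum_lin (F G H : mindex d -> C) x y (M N : R) : (forall a, H a = x * F a + y * G a) ->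
  0 <= M -> 0 <= N -> (forall a, cabs (F a) <= M * mweight R a) ->
  (forall a, cabs (G a) <= N * mweight R a) -> sum H = x * sum F + y * sum G.
Proof.
move=> E M0 N0 HF HG; have -> : H = fun a => x * F a + y * G a by apply/funext.
exact: (sum_lin (mweight_ge0 R (d := d)) (@mweight_bound R d) x y M0 N0 HF HG).
Qed.

Lemma opA_lin u f g x y : U u -> gs theta f -> gs theta g ->
  opA phi h u (fun z => x * f z + y * g z) = x * opA phi h u f + y * opA phi h u g.
Proof.
move=> Uu gf gg.
case/gsP: (gf) => [c [m [c0 gf']]]; case/gsP: (gg) => [c' [m' [c'0 gg']]].
have [K K0 HK] := adj_term_bound c0; have [K' K'0 HK'] := adj_term_bound c'0.
have Km : 0 <= K * m by rewrite mulr_ge0//; exact: gsb_ge0 gf'.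
have Km' : 0 <= K' * m' by rewrite mulr_ge0//; exact: gsb_ge0 gg'.
exact: (msum_lin (fun a => adj_lin a x y Uu gf gg) Km Km' (HK u Uu m f gf') (HK' u Uu m' g gg')).
Qed.

Lemma opA_dual u : U u -> gs_dual theta (opA phi h u).
Proof.
move=> Uu; apply: dual_intro => //.
  by move=> f g x y gf gg; exact: opA_lin.
move=> c c0; have [S S0 HS] := opA_equi; have [K K0 HK] := HS c c0.
exists (S * K); first by rewrite mulr_ge0.
by move=> f m gf; rewrite -mulrA; exact: HK.
Qed.

End Operator.

(** * Mapping properties of the operator *)

Section RealRates.
Variable R : realType.
Implicit Types X Y N : R.

(** Here X, Y, N stand for |z|^p, |z - zeta|^p and |zeta|^p, where zeta is the centre of the packet.
    When the symbol decays at z, half of the common rate is kept for integrability in z and the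
    other half becomes decay in zeta. *)
Lemma near_rate X Y N (e1 e4 m : R) : 0 <= X -> 0 <= Y -> N <= 4 * (X + Y) ->
  0 <= m -> m <= e1 -> m <= e4 ->
  - (e1 * X) - e4 * Y <= - (m / 2 * X) - m / 8 * N.
Proof.
move=> X0 Y0 NXY m0 m1 m4.
have h1 : m * X <= e1 * X by rewrite ler_wpM2r.
have h4 : m * Y <= e4 * Y by rewrite ler_wpM2r.
have hN : m * N <= m * (4 * (X + Y)) by rewrite ler_wpM2l.
have hX : 0 <= m * X by rewrite mulr_ge0.
have hY : 0 <= m * Y by rewrite mulr_ge0.
by move: hN; rewrite mulrCA mulrDr; lra.
Qed.

(** When z is far from zeta, Y dominates both X and N. The rate del is chosen so that 2 del X takes
    at most half of e4 Y; the other half is at least e4 c N / 2. *)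
Lemma far_rate X Y N (e4 c : R) : 0 <= N -> 0 < c -> 0 < e4 -> c * N <= Y -> X <= 4 * (Y + N) ->
  e4 / (16 * (1 + c^-1)) * X - e4 * Y <= - (e4 / (16 * (1 + c^-1)) * X) - e4 * c / 2 * N.
Proof.
move=> N0 c0 e0 hY hX; set del := e4 / _.
have ci : 0 < c^-1 by rewrite invr_gt0.
have dE : del * (16 * (1 + c^-1)) = e4 by rewrite /del divfK// gt_eqF// mulr_gt0// addr_gt0.
have d0 : 0 <= del by rewrite divr_ge0 ?(ltW e0)// mulr_ge0// addr_ge0// ltW.
have hN : N <= c^-1 * Y by rewrite mulrC ler_pdivlMr// mulrC.
have h1 : del * X <= del * (4 * (Y + N)) by rewrite ler_wpM2l.
have h2 : del * N <= del * (c^-1 * Y) by rewrite ler_wpM2l.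
have h3 : e4 * (c * N) <= e4 * Y by rewrite ler_wpM2l// ltW.
have dE' : e4 * Y = del * (16 * (1 + c^-1)) * Y by rewrite dE.
have hd : e4 * Y = 16 * (del * Y) + 16 * (del * (c^-1 * Y)) by rewrite dE'; ring.
move: h1; rewrite mulrCA mulrDr => h1.
have -> : e4 * c / 2 * N = e4 * (c * N) / 2 by field.
lra.
Qed.

End RealRates.

Section MappingProperties.
Variables (R : realType) (d : nat) (theta : R) (phi : FBI_phase R d).
Hypotheses (d_gt0 : (0 < d)%N) (theta_ge : 2^-1 <= theta) (theta_lt : theta < 1).
Local Notation C := (Cplx R).
Local Notation Z := 'rV[C]_d.
Local Notation p := (theta^-1).
Local Notation W := (weight phi).
Variable h : mindex d -> Z -> C.
Hypothesis h_entire : forall a, entire (h a).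
Hypothesis h_bound : forall e : R, 0 < e -> exists2 D : R, 0 < D & forall a z,
  cabs (h a z) <= D * (e ^+ mabs a / (mfact a)%:R `^ theta) * expR (e * nC z `^ p).

Lemma powRp_tri (x y z : R) : 0 <= x -> 0 <= y -> 0 <= z -> x <= y + z ->
  x `^ p <= 4 * (y `^ p + z `^ p).
Proof.
move=> x0 y0 z0 xyz; apply: (@le_trans _ _ ((y + z) `^ p)); first exact: powRp_le.
exact: powRp_add.
Qed.

(** For fixed a and z the symbol term is a multiple of the value of the functional at one test
    function, common to all functionals. Linearity in u and pointwise weak convergence of the symbol
    terms follow. *)
Lemma symbol_kernel (u : functional R d) a z : gs_dual theta u -> exists2 s,
  gs theta (kerD phi s z) & forall v : functional R d, gs_dual theta v ->
  symbol_term phi h v a z = h a z * (toC (c_phi phi) * v (kerD phi s z)).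
Proof.
move=> du; have [s _ E] := miter_foldr (@pderivC R d) a; exists s.
  by have [_ + _] := fbi_family phi d_gt0 theta_ge theta_lt s du; exact.
move=> v dv; rewrite /symbol_term E.
by have [_ _ <-] := fbi_family phi d_gt0 theta_ge theta_lt s dv.
Qed.

Lemma symbol_sub u v a z : gs_dual theta u -> gs_dual theta v ->
  symbol_term phi h (fun f => u f - v f) a z = symbol_term phi h u a z - symbol_term phi h v a z.
Proof.
move=> du dv; have duv := dual_sub d_gt0 du dv.
have [s _ E] := symbol_kernel a z du.
by rewrite (E _ duv) (E _ du) (E _ dv); ring.
Qed.

Lemma fbi_growth1 u : gs_dual theta u -> forall e : R, 0 < e -> exists2 K : R, 0 <= K &
  forall v, [set u] v -> forall z, cabs (fbi phi v z) <= K * expR (e * nC z `^ p + W z).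
Proof.
by move=> /(dual_equibounded d_gt0) du e e0; exact: (equi_fbi phi d_gt0 theta_ge theta_lt du e0).
Qed.

Lemma dual1 (u : functional R d) : gs_dual theta u -> forall v, [set u] v -> gs_dual theta v.
Proof. by move=> du _ ->. Qed.

Lemma opA_sub u v f : gs_dual theta u -> gs_dual theta v -> gs theta f ->
  opA phi h (fun g => u g - v g) f = opA phi h u f - opA phi h v f.
Proof.
move=> du dv /gsP[c [m [c0 gf]]].
have m0 := gsb_ge0 c0 gf.
have [K K0 HK] := adj_family d_gt0 theta_ge theta_lt h_entire h_bound (dual1 du) (fbi_growth1 du) c0.
have [L L0 HL] := adj_family d_gt0 theta_ge theta_lt h_entire h_bound (dual1 dv) (fbi_growth1 dv) c0.
have [M [M0 _ oM]] := HK u erefl m f gf.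
have [N [N0 _ oN]] := HL v erefl m f gf.
have [I I0 HI] := integralC_le R d.
have b1 a : cabs (fbi_adj phi (symbol_term phi h u a) f) <= I * M * mweight R a.
  by rewrite -mulrA; exact: HI (oM a).
have b2 a : cabs (fbi_adj phi (symbol_term phi h v a) f) <= I * N * mweight R a.
  by rewrite -mulrA; exact: HI (oN a).
have E a : fbi_adj phi (symbol_term phi h (fun g => u g - v g) a) f =
    1 * fbi_adj phi (symbol_term phi h u a) f + (-1) * fbi_adj phi (symbol_term phi h v a) f.
  rewrite !fbi_adjE /adj_pair -(integralC_lin 1 (-1) (oM a) (oN a)); congr integralC.
  by apply/funext => z; rewrite symbol_sub//; ring.
have := msum_lin E (mulr_ge0 I0 M0) (mulr_ge0 I0 N0) b1 b2.
by rewrite mul1r mulN1r.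
Qed.

Lemma symbol_entire u a : gs_dual theta u -> entire (symbol_term phi h u a).
Proof.
move=> du z; rewrite /symbol_term; have [s _ E] := miter_foldr (@pderivC R d) a; rewrite E.
apply: differentiableM; first exact: h_entire.
apply: csmooth_diff; exact: (csmooth_foldr s (fbi_csmooth phi d_gt0 theta_ge theta_lt du)).
Qed.

Lemma symbol_admissible u a : gs_dual theta u -> fbi_admissible phi theta (symbol_term phi h u a).
Proof.
move=> du; split=> [|e e0]; first exact: symbol_entire.
have D0 : 0 < d%:R `^ p :> R by rewrite powR_gt0// ltr0n.
have [M M0 HM] := symbol_family d_gt0 theta_ge theta_lt h_bound (dual1 du) (fbi_growth1 du)
  (divr_gt0 e0 D0).
exists (M * mweight R a) => z; apply: le_trans (HM u erefl a z) _.
apply: ler_wpM2l; first by rewrite mulr_ge0// mweight_ge0.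
rewrite ler_expR lerD2r -mulrA; apply: ler_wpM2l; first exact: ltW.
rewrite mulrC ler_pdivrMr// mulrC -powRp_scale// ?sqrtr_ge0//.
by apply: powRp_le; rewrite ?nC_ge0// nC_le_cenorm.
Qed.

Variable U : set (functional R d).
Hypothesis U_dual : forall u, U u -> gs_dual theta u.
Hypothesis U_fbi : forall e : R, 0 < e -> exists2 K : R, 0 <= K & forall u, U u -> forall z,
  cabs (fbi phi u z) <= K * expR (e * nC z `^ p + W z).

(** Dominated convergence twice: Tannery over the multi-indices, and under the integral over C^d,
    where the integrands tend to 0 pointwise by [symbol_kernel]. *)
Lemma opA_weak_cvg0 wn : (forall n, U (wn n)) -> weak_cvg0 theta wn ->
  weak_cvg0 theta (fun n => opA phi h (wn n)).
Proof.
move=> Uw w0 f /gsP[c [m [c0 gf]]]; have m0 := gsb_ge0 c0 gf; apply/cvg0P.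
have [K K0 HK] := adj_family d_gt0 theta_ge theta_lt h_entire h_bound U_dual U_fbi c0.
have [L L0 HL] := adj_term_bound d_gt0 theta_ge theta_lt h_entire h_bound U_dual U_fbi c0.
have Lm : 0 <= L * m by rewrite mulr_ge0.
apply: (sum_tannery (mweight_ge0 R (d := d)) (@mweight_bound R d) Lm).
  by move=> n a; exact: (HL _ (Uw n) m f gf a).
move=> a; rewrite /fbi_adj; apply: (@integralC_dct R d (K * m * mweight R a)).
  move=> n; have [M [M0 MK oM]] := HK _ (Uw n) m f gf; have [oc ob] := oM a.
  split=> // z; apply: le_trans (ob z) _; rewrite ler_wpM2r ?expR_ge0//.
  by rewrite ler_wpM2r ?mweight_ge0.
move=> z; have [s gs_s E] := symbol_kernel a z (U_dual (Uw 0%N)).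
have /cvg0P w00 := w0 _ gs_s.
pose B := cabs (h a z * toC (c_phi phi) * Tst phi f z * toC (expR (- (2 * W z)))) + 1.
have B0 : 0 < B by rewrite ltr_wpDl ?cabs_ge0.
move=> e e0; have := w00 _ (divr_gt0 e0 B0); apply: filterS => n hn.
rewrite (E _ (U_dual (Uw n))) -/(Tst phi f z).
set x := wn n _ in hn *.
have -> : h a z * (toC (c_phi phi) * x) * Tst phi f z * toC (expR (- (2 * W z))) =
  h a z * toC (c_phi phi) * Tst phi f z * toC (expR (- (2 * W z))) * x by ring.
rewrite cabsM; apply: (@le_lt_trans _ _ (B * cabs x)).
  by apply: ler_wpM2r; rewrite ?cabs_ge0// lerDl.
by rewrite mulrC -ltr_pdivlMr.
Qed.

(* [Tst (gp M' x xi)] is concentrated near [chi x xi]: the symbol decays there with the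
   transform of [u], and elsewhere the Gaussian absorbs its subexponential growth. *)
Lemma microlocal z0 k e1 a' M' : z0 != 0 -> 0 < k -> 0 < e1 -> posim a' M' ->
  (exists2 M : R, 0 <= M & forall u, U u -> forall w s, 0 < s -> nC (w - toC s *: z0) <= k * s ->
     cabs (fbi phi u w) <= M * expR (- (e1 * nC w `^ p) + W w)) ->
  exists k' e' K : R, [/\ 0 < k', 0 < e', 0 <= K & forall u, U u -> forall x xi s, 0 < s ->
    nC (chi phi x xi - toC s *: z0) <= k' * s ->
    cabs (opA phi h u (gp M' x xi)) <= K * expR (- (e' * nC (chi phi x xi) `^ p))].
Proof.
move=> z00 k0 e10 pM' [M M0 HM].
have [L L0 HL] := weight_lip phi d_gt0.
have [k1 [e2 [e3 [K1 [k10 e20 e30 K10 Hcone]]]]] :=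
  symbol_cone theta_ge theta_lt L0 HL h_bound z00 k0 e10.
have [M2 M20 HM2] := U_fbi e30.
have [e5 [K2 [e50 K20 HT]]] := Tst_gp_bound phi d_gt0 theta_ge theta_lt pM'.
have [N N0 HN] := nC_le_phase phi theta_ge theta_lt.
pose e4 := e5 / N; have e40 : 0 < e4 by rewrite divr_gt0.
(* Two zones. If [ze] is within rho s of s z0 and z within rho s of [ze], then z lies in the cone of
   aperture k1. Otherwise |z - ze| exceeds rho s, hence (rho / S) |ze|, as |ze| <= S s. *)
pose rho := k1 / 2; have rho0 : 0 < rho by rewrite divr_gt0.
pose S := rho + nC z0.
have S0 : 0 < S by rewrite ltr_pwDl ?nC_ge0.
pose c := (rho / S) `^ p; have c0 : 0 < c by rewrite powR_gt0// divr_gt0.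
(* The growth allowed to the symbol terms away from the cone, as required by [far_rate]. *)
pose del := e4 / (16 * (1 + c^-1)).
have del0 : 0 < del by rewrite divr_gt0// mulr_gt0// addr_gt0// invr_gt0.
have [M3 M30 HM3] := symbol_family d_gt0 theta_ge theta_lt h_bound U_dual U_fbi del0.
pose m := Num.min e2 e4.
have m0 : 0 < m by rewrite lt_min e20.
pose ep := Num.min (m / 2) del; have ep0 : 0 < ep by rewrite lt_min del0 divr_gt0.
pose ep' := Num.min (m / 8) (e4 * c / 2).
have ep'0 : 0 < ep' by rewrite lt_min !divr_gt0// mulr_gt0.
pose KK := (K1 * (M + M2) + M3) * K2.
have KK0 : 0 <= KK by rewrite mulr_ge0// addr_ge0// mulr_ge0 ?(ltW K10)// addr_ge0.
have [P P0 HP] := pair_ok phi d_gt0 theta_ge theta_lt ep0.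
have [I I0 HI] := integralC_le R d.
pose S1 : R := ((1 - expR (-1))^-1) ^+ d.
have S10 : 0 <= S1 by rewrite exprn_ge0// invr_ge0 subr_ge0 -expR0 ler_expR oppr_le0.
exists rho, ep', (I * P * KK * S1); split=> //.
  exact: (mulr_ge0 (mulr_ge0 (mulr_ge0 I0 (ltW P0)) KK0) S10).
move=> u Uu x xi s s0 hs; set ze := chi phi x xi in hs *.
have du := U_dual Uu.
have T z : cabs (Tst phi (gp M' x xi) z) <= K2 * expR (- (e4 * nC (z - ze) `^ p) + W z).
  apply: le_trans (HT x xi z) _; apply: ler_wpM2l => //; rewrite ler_expR lerD2r lerN2.
  rewrite /e4 mulrAC -mulrA; apply: ler_wpM2l; first exact: ltW.
  rewrite ler_pdivrMr// mulrC; have := HN (z - ze).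
  by rewrite xzD xizD xzN xizN xz_chi xiz_chi.
have nze : nC ze <= S * s.
  rewrite -(subrK (toC s *: z0) ze); apply: le_trans (nCD _ _) _.
  by rewrite /S mulrDl nCZ cabs_toC gtr0_norm// mulrC (mulrC _ s) lerD// mulrC.
have main a z : cabs (symbol_term phi h u a z) * cabs (Tst phi (gp M' x xi) z) <=
    KK * expR (- (ep' * nC ze `^ p)) * mweight R a * expR (- (ep * nC z `^ p) + 2 * W z).
  have X0 := powR_ge0 (nC z) p; have Y0 := powR_ge0 (nC (z - ze)) p.
  have N1 := powR_ge0 (nC ze) p.
  have NXY : nC ze `^ p <= 4 * (nC z `^ p + nC (z - ze) `^ p).
    apply: powRp_tri; rewrite ?nC_ge0//.
    by rewrite -{1}(subKr z ze); apply: le_trans (nCD _ _) _; rewrite nCN.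
  have XYN : nC z `^ p <= 4 * (nC (z - ze) `^ p + nC ze `^ p).
    apply: powRp_tri; rewrite ?nC_ge0//.
    by rewrite -{1}(subrK ze z); exact: nCD.
  have w0 := mweight_ge0 R a.
  (* Common end of both zones: a bound with exponent B for the symbol term, paired with the decay of
     the packet's transform, has to leave ep |z|^p and ep' |ze|^p. *)
  have fin (A : R) (B : R) : 0 <= A -> A * K2 <= KK ->
      cabs (symbol_term phi h u a z) <= A * mweight R a * expR (B + W z) ->
      B - e4 * nC (z - ze) `^ p <= - (ep' * nC ze `^ p) - ep * nC z `^ p ->
      cabs (symbol_term phi h u a z) * cabs (Tst phi (gp M' x xi) z) <=
      KK * expR (- (ep' * nC ze `^ p)) * mweight R a * expR (- (ep * nC z `^ p) + 2 * W z).
    move=> A0 AK hA hB; apply: le_trans (ler_pM (cabs_ge0 _) (cabs_ge0 _) hA (T z)) _.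
    have -> : A * mweight R a * expR (B + W z) * (K2 * expR (- (e4 * nC (z - ze) `^ p) + W z)) =
      A * K2 * mweight R a * (expR (B + W z) * expR (- (e4 * nC (z - ze) `^ p) + W z)) by ring.
    have -> : KK * expR (- (ep' * nC ze `^ p)) * mweight R a * expR (- (ep * nC z `^ p) + 2 * W z) =
      KK * mweight R a * (expR (- (ep' * nC ze `^ p)) * expR (- (ep * nC z `^ p) + 2 * W z)) by ring.
    apply: ler_pM; rewrite ?mulr_ge0 ?expR_ge0//; first by rewrite ler_wpM2r.
    by rewrite -!expRD ler_expR; clear -hB; lra.
  have eN : ep' * nC ze `^ p <= m / 8 * nC ze `^ p by rewrite ler_wpM2r// ge_min lexx.
  have eN' : ep' * nC ze `^ p <= e4 * c / 2 * nC ze `^ p by rewrite ler_wpM2r// ge_min lexx orbT.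
  have eX : ep * nC z `^ p <= m / 2 * nC z `^ p by rewrite ler_wpM2r// ge_min lexx.
  have eX' : ep * nC z `^ p <= del * nC z `^ p by rewrite ler_wpM2r// ge_min lexx orbT.
  have K1M : 0 <= K1 * (M + M2) by rewrite mulr_ge0 ?addr_ge0// ltW.
  have [hz|hz] := leP (nC (z - ze)) (rho * s).
    have hzs : nC (z - toC s *: z0) <= k1 * s.
      rewrite -(subrKA ze); apply: le_trans (nCD _ _) _.
      by rewrite [k1]splitr mulrDl lerD.
    apply: (fin (K1 * (M + M2)) (- (e2 * nC z `^ p))) => //.
    - by rewrite ler_wpM2r// lerDl.
    - have sF := fbi_csmooth phi d_gt0 theta_ge theta_lt du.
      have := Hcone (fbi phi u) (M + M2) sF (addr_ge0 M0 M20) _ _ a z s s0 hzs.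
      rewrite -[in X in _ -> X]mulrA /mweight -expRD => H.
      rewrite /symbol_term; apply: le_trans (H _ _) _.
      + move=> w; apply: le_trans (HM2 u Uu w) _; apply: ler_wpM2r; first exact: expR_ge0.
        by rewrite lerDr.
      + move=> w t t0 hw; apply: le_trans (HM u Uu w t t0 hw) _.
        apply: ler_wpM2r; first exact: expR_ge0.
        by rewrite lerDl.
      + by apply: ler_wpM2l => //; rewrite ler_expR addrC.
    - have m2 : m <= e2 by rewrite ge_min lexx.
      have m4 : m <= e4 by rewrite ge_min lexx orbT.
      have := near_rate X0 Y0 NXY (ltW m0) m2 m4; clear -eN eX; lra.
  have cN : c * nC ze `^ p <= nC (z - ze) `^ p.
    have rS : 0 <= rho / S by rewrite divr_ge0 ?(ltW rho0) ?(ltW S0).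
    have -> : c * nC ze `^ p = (rho / S * nC ze) `^ p by rewrite powRp_scale ?nC_ge0.
    apply: powRp_le => //; first exact: (mulr_ge0 rS (nC_ge0 ze)).
    apply: le_trans (ltW hz); rewrite mulrAC -mulrA; apply: ler_wpM2l; first exact: ltW.
    by rewrite ler_pdivrMr// mulrC.
  apply: (fin M3 (del * nC z `^ p)) => //.
  - by rewrite ler_wpM2r// lerDr.
  - exact: HM3.
  - have := far_rate N1 c0 e40 cN XYN; rewrite -/del; clear -eN' eX'; lra.
have KE0 : 0 <= KK * expR (- (ep' * nC ze `^ p)) := mulr_ge0 KK0 (expR_ge0 _).
have okk a : okC (P * (KK * expR (- (ep' * nC ze `^ p)) * mweight R a))
    (fun z => symbol_term phi h u a z * Tst phi (gp M' x xi) z * toC (expR (- (2 * W z)))).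
  apply: (HP _ _ _ (mulr_ge0 KE0 (mweight_ge0 R a))).
  - exact: (contC_symbol phi d_gt0 theta_ge theta_lt h_entire a du).
  - by apply: (Tst_contC phi d_gt0 theta_ge theta_lt); exact: (gp_gs theta_ge theta_lt _ _ pM').
  - exact: main.
have X0 : 0 <= I * (P * (KK * expR (- (ep' * nC ze `^ p)))) := (mulr_ge0 I0 (mulr_ge0 (ltW P0) KE0)).
have := @sum_bound R _ (mweight R (d := d)) S1 (mweight_ge0 R (d := d)) (@mweight_bound R d)
  (fun a => fbi_adj phi (symbol_term phi h u a) (gp M' x xi)) _ X0.
rewrite /opA; have -> : I * P * KK * S1 * expR (- (ep' * nC ze `^ p)) =
  I * (P * (KK * expR (- (ep' * nC ze `^ p)))) * S1 by ring.
apply=> a; have := HI _ _ (okk a).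
have -> // : I * (P * (KK * expR (- (ep' * nC ze `^ p)) * mweight R a)) =
  I * (P * (KK * expR (- (ep' * nC ze `^ p)))) * mweight R a.
by ring.
Qed.

End MappingProperties.

(** * Entire functions generated by a Gaussian test function *)

Section ExponentialFamilies.
Variables (R : realType) (d : nat) (theta : R).
Hypotheses (d_gt0 : (0 < d)%N) (theta_ge : 2^-1 <= theta) (theta_lt : theta < 1).
Local Notation C := (Cplx R).
Local Notation V := 'rV[R]_d.
Local Notation Z := 'rV[C]_d.
Local Notation om := (@om R d).
Local Notation nsq y := (nR (reV y) ^+ 2 + nR (imV y) ^+ 2).

(** Multipliers growing more slowly than every Gaussian. They preserve the class [gdom] of functions
    with some Gaussian bound, whose constants are left free. *)
Definition subg (P : Z -> C) : Prop := csmooth P /\ forall e : R, 0 < e ->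
  exists2 K : R, 0 <= K & forall y, cabs (P y) <= K * expR (e * nsq y).

Definition gdom (H : Z -> C) : Prop := csmooth H /\ exists a b M : R,
  [/\ 0 < a, 0 <= b, 0 <= M & forall y, cabs (H y) <= M * om a b y].

Lemma subg_mul P Q : subg P -> subg Q -> subg (fun y => P y * Q y).
Proof.
move=> [sP HP] [sQ HQ]; split=> [|e e0]; first exact: csmoothM.
have [K K0 HK] := HP _ (divr_gt0 e0 (ltr0Sn R 1)).
have [L L0 HL] := HQ _ (divr_gt0 e0 (ltr0Sn R 1)).
exists (K * L); first exact: mulr_ge0.
move=> y; rewrite cabsM; apply: le_trans (ler_pM (cabs_ge0 _) (cabs_ge0 _) (HK y) (HL y)) _.
by rewrite mulrACA -expRD -mulrDl -splitr.
Qed.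

Lemma subg_lin P Q x z : subg P -> subg Q -> subg (fun y => x * P y + z * Q y).
Proof.
move=> [sP HP] [sQ HQ]; split=> [|e e0]; first by apply: csmoothD; exact: csmoothZ.
have [K K0 HK] := HP _ e0; have [L L0 HL] := HQ _ e0.
exists (cabs x * K + cabs z * L); first by rewrite addr_ge0 ?mulr_ge0 ?cabs_ge0.
move=> y; apply: le_trans (cabsD _ _) _; rewrite !cabsM mulrDl -!mulrA.
by apply: lerD; apply: ler_wpM2l; rewrite ?cabs_ge0.
Qed.

Lemma lin_le_sqr (a r t : R) : 0 < a -> r * t <= r ^+ 2 / a + a / 2 * t ^+ 2.
Proof.
move=> a0; have h := sqr_ge0 (a * t - r); have h' := sqr_ge0 r.
have -> : r ^+ 2 / a + a / 2 * t ^+ 2 = (r ^+ 2 + (a * t) ^+ 2 / 2) / a by field; rewrite gt_eqF.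
by rewrite ler_pdivlMr//; move: h h'; rewrite !expr2; lra.
Qed.

Lemma subg_exp P (A B : R) : csmooth P -> 0 <= A -> 0 <= B ->
  (forall y, cabs (P y) <= A * expR (B * (nR (reV y) + nR (imV y)))) -> subg P.
Proof.
move=> sP A0 B0 H; split=> // e e0; exists (A * expR (2 * (B ^+ 2 / e))).
  by rewrite mulr_ge0 ?expR_ge0.
move=> y; apply: le_trans (H y) _; rewrite -mulrA; apply: ler_wpM2l => //.
rewrite -expRD ler_expR.
have h1 := lin_le_sqr B (nR (reV y)) e0; have h2 := lin_le_sqr B (nR (imV y)) e0.
have h3 := mulr_ge0 (ltW e0) (sqr_ge0 (nR (reV y))).
have h4 := mulr_ge0 (ltW e0) (sqr_ge0 (nR (imV y))).
rewrite !mulrDr; lra.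
Qed.

Lemma gdom_mul P H : subg P -> gdom H -> gdom (fun y => P y * H y).
Proof.
move=> [sP HP] [sH [a [b [M [a0 b0 M0 HM]]]]]; split; first exact: csmoothM.
have [K K0 HK] := HP _ (divr_gt0 a0 (ltr0Sn R 1)).
exists (a / 2), (b + a / 2), (K * M); split.
- by rewrite divr_gt0.
- by rewrite addr_ge0// divr_ge0// ltW.
- exact: mulr_ge0.
move=> y; rewrite cabsM; apply: le_trans (ler_pM (cabs_ge0 _) (cabs_ge0 _) (HK y) (HM y)) _.
by rewrite mulrACA; apply: ler_wpM2l; [exact: mulr_ge0|rewrite -expRD ler_expR; lra].
Qed.

Lemma gdom_lin f g x z : gdom f -> gdom g -> gdom (fun y => x * f y + z * g y).
Proof.
move=> [sf [a [b [M [a0 b0 M0 HM]]]]] [sg [a' [b' [M' [a'0 b'0 M'0 HM']]]]]; split.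
  by apply: csmoothD; exact: csmoothZ.
exists (Num.min a a'), (b + b'), (cabs x * M + cabs z * M'); split.
- by rewrite lt_min a0.
- exact: addr_ge0.
- by rewrite addr_ge0 ?mulr_ge0 ?cabs_ge0.
move=> y; apply: le_trans (cabsD _ _) _; rewrite !cabsM mulrDl -!mulrA.
apply: lerD; apply: ler_wpM2l; rewrite ?cabs_ge0//.
  apply: le_trans (HM y) _; apply: ler_wpM2l => //; rewrite ler_expR lerD// ?lerN2.
    by rewrite ler_wpM2r ?sqr_ge0// ge_min lexx.
  by rewrite ler_wpM2r ?sqr_ge0// lerDl.
apply: le_trans (HM' y) _; apply: ler_wpM2l => //; rewrite ler_expR lerD// ?lerN2.
  by rewrite ler_wpM2r ?sqr_ge0// ge_min lexx orbT.
by rewrite ler_wpM2r ?sqr_ge0// lerDr.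
Qed.

Lemma gdom0 : gdom (fun=> 0).
Proof.
split; first exact: csmooth_cst.
by exists 1, 0, 0; split=> // y; rewrite cabs0 mul0r.
Qed.

Lemma gdom_gs H : gdom H -> gs theta (H \o @vecC R d).
Proof.
move=> [sH [a [b [M [a0 b0 M0 HM]]]]]; apply: (dominated_gs theta_ge theta_lt a0 b0).
by split=> //; exists M.
Qed.

Variable x : V.
Definition s_ (j : 'I_d) (y : Z) : C := (y - vecC x) 0 j.

Lemma nC_shift (y : Z) : nC (y - vecC x) <= nR (reV y) + nR (imV y) + nR x.
Proof.
apply: le_trans (nCD _ _) _; rewrite nCN nC_vecC lerD2r; exact: nC_reim.
Qed.

Lemma csmooth_s j : csmooth (s_ j).
Proof. exact: (cvecB (@cvec_id R d) (cvec_cst _ (vecC x))). Qed.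

Lemma subg_s j : subg (s_ j).
Proof.
apply: (@subg_exp _ (1 + nR x) 1); rewrite ?addr_ge0 ?nR_ge0//; first exact: csmooth_s.
move=> y; apply: le_trans (nC_coord _ _) _; apply: le_trans (nC_shift y) _.
rewrite mul1r; set t := nR (reV y) + _.
have t0 : 0 <= t by rewrite addr_ge0 ?nR_ge0.
have h := expR_ge1Dx t; have x0 := nR_ge0 x.
have : nR x * 1 <= nR x * expR t by rewrite ler_wpM2l// -expR0 ler_expR.
rewrite mulrDl mul1r; lra.
Qed.

(** The kernel of the generating function [GH], with exponential centred at x, so that derivatives
    in the parameter produce powers of y - x. *)
Definition kH (H : Z -> C) (q : Z * Z) : C := H q.2 * cexp (dot q.1 (q.2 - vecC x)).

Lemma csmooth_kH H : csmooth H -> csmooth (kH H).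
Proof.
move=> sH; apply: csmoothM; first exact: (csmooth_snd ('rV[C]_d : normedModType C) sH).
apply: csmooth_cexp; apply: csmooth_dot; first exact: cvec_fst.
exact: (cvecB (@cvec_snd R d _) (cvec_cst _ (vecC x))).
Qed.

Lemma kH_dominated H : gdom H -> exists a b : R,
  [/\ 0 < a, 0 <= b & locally_dominated (om a b) (kH H)].
Proof.
move=> [sH [a [b [M [a0 b0 M0 HM]]]]]; exists (a / 2), (b + a / 2); split.
- by rewrite divr_gt0.
- by rewrite addr_ge0// divr_ge0// ltW.
move=> r; have [r0|r0] := leP 0 r; last first.
  by exists 0 => // z zr; have := le_lt_trans zr r0; rewrite ltNge nC_ge0.
pose c := r ^+ 2 / a.
exists (M * expR (2 * c + r * nR x)); first by rewrite mulr_ge0 ?expR_ge0.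
move=> z zr y; rewrite /kH cabsM cabs_cexp.
apply: le_trans (ler_pM (cabs_ge0 _) (expR_ge0 _) (HM y) (lexx _)) _.
rewrite -!mulrA; apply: ler_wpM2l => //; rewrite -!expRD ler_expR.
have h1 : reC (dot z (y - vecC x)) <= r * (nR (reV y) + nR (imV y) + nR x).
  apply: le_trans (ler_norm _) _; apply: le_trans (cabs_re _) _.
  apply: le_trans (cabs_dot _ _) _; apply: ler_pM; rewrite ?nC_ge0//; exact: nC_shift.
have := lin_le_sqr r (nR (reV y)) a0; have := lin_le_sqr r (nR (imV y)) a0; move: h1; rewrite -/c.
rewrite !mulrDr !mulrDl; lra.
Qed.

Lemma ddz_kH H j : csmooth H -> ddz j (kH H) = kH (fun y => s_ j y * H y).
Proof.
move=> sH; apply/funext => -[z y]; rewrite /ddz.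
have s1 : csmooth (fun q : Z * Z => H q.2) by exact: (csmooth_snd ('rV[C]_d : normedModType C) sH).
have s2 : csmooth (fun q : Z * Z => dot q.1 (q.2 - vecC x)).
  apply: csmooth_dot; first exact: cvec_fst.
  exact: (cvecB (@cvec_snd R d _) (cvec_cst _ (vecC x))).
rewrite derive_mulE; [|exact: csmooth_diff|exact/csmooth_diff/csmooth_cexp].
rewrite derive_cexp_comp; last exact: csmooth_diff.
rewrite (@ddir_quad R _ (fun q : Z * Z => H q.2) (z, y) _ 0 0); last first.
  by move=> h; rewrite /= scaler0 addr0 mulr0 addr0 mulr0 addr0.
rewrite (@ddir_quad R _ _ (z, y) _ (s_ j y) 0); last first.
  move=> h; rewrite /= scaler0 addr0 mulr0 addr0 dotDl dotZl; congr (_ + _ * _).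
  by rewrite dotC dot_delta.
by rewrite /kH /=; ring.
Qed.

Variable u : functional R d.
Hypothesis du : gs_dual theta u.

Definition GH (H : Z -> C) (z : Z) : C := u ((fun y => kH H (z, y)) \o @vecC R d).

Lemma gs_kH H z : gdom H -> gs theta ((fun y => kH H (z, y)) \o @vecC R d).
Proof.
move=> gH; have [a [b [a0 b0 ld]]] := kH_dominated gH.
by have [_ + _] := dual_family d_gt0 theta_ge theta_lt du a0 b0 [::] (csmooth_kH (proj1 gH)) ld; exact.
Qed.

(** Each derivative in z_j brings down a factor (y - x)_j: values of u on polynomials in y - x times
    H are derivatives of one entire function, and Cauchy's estimate bounds them by its values on a
    ball. *)
Lemma GH_family H : gdom H -> csmooth (GH H) /\ forall i j,
  foldr (@dd R d) (GH H) [:: i; j] = GH (fun y => s_ i y * (s_ j y * H y)).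
Proof.
move=> gH; have [a [b [a0 b0 ld]]] := kH_dominated gH; split.
  by have [] := dual_family d_gt0 theta_ge theta_lt du a0 b0 [::] (csmooth_kH (proj1 gH)) ld.
move=> i j.
have [_ _ E] := dual_family d_gt0 theta_ge theta_lt du a0 b0 [:: i; j] (csmooth_kH (proj1 gH)) ld.
rewrite /GH E; apply/funext => z; congr u; apply/funext => y.
have sH := proj1 gH; have sjH : csmooth (fun y => s_ j y * H y).
  by apply: csmoothM => //; exact: csmooth_s.
have -> : foldr (@ddz R d d) (kH H) [:: i; j] = ddz i (ddz j (kH H)) by [].
by rewrite (ddz_kH j sH) (ddz_kH i sjH).
Qed.

Lemma GH_sum (I : Type) (r : seq I) (c : I -> C) (F : I -> Z -> C) z :
  (forall i, gdom (F i)) ->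
  gdom (fun y => \sum_(i <- r) c i * F i y) /\
  GH (fun y => \sum_(i <- r) c i * F i y) z = \sum_(i <- r) c i * GH (F i) z.
Proof.
move=> gF; elim: r => [|i r [gS IH]].
  rewrite (_ : (fun y => _) = fun=> 0); last by apply/funext => y; rewrite big_nil.
  split; first exact: gdom0.
  rewrite big_nil; have E0 := proj1 du _ _ 0 0 (gs_kH z gdom0) (gs_kH z gdom0).
  move: E0; set a := u _; set b := u _ => E0; rewrite -[RHS](_ : 0 * b + 0 * b = 0); last by ring.
  rewrite -E0 /a; congr u.
  by apply/funext => y; rewrite /kH /= !mul0r addr0.
have E : (fun y => \sum_(k <- i :: r) c k * F k y) =
    fun y => c i * F i y + 1 * \sum_(k <- r) c k * F k y.
  by apply/funext => y; rewrite big_cons mul1r.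
rewrite E; split; first exact: gdom_lin.
rewrite big_cons -IH -[X in _ + X]mul1r -(proj1 du); [|exact: gs_kH|exact: gs_kH].
by congr u; apply/funext => y; rewrite /kH /=; ring.
Qed.

Variable E : 'M[C]_d.
Definition qE (y : Z) : C := dot (mxact E (y - vecC x)) (y - vecC x).

Lemma qE_sum y : qE y = \sum_(q : 'I_d * 'I_d) E q.1 q.2 * (s_ q.1 y * s_ q.2 y).
Proof.
Transparent dot.
rewrite /qE /dot -(pair_bigA _ (fun i j => E i j * (s_ i y * s_ j y))) /=.
apply: eq_bigr => i _; rewrite mxactE mulr_suml; apply: eq_bigr => j _.
by rewrite /s_; ring.
Qed.
Opaque dot.

Lemma subg_qE : subg qE.
Proof.
have -> : qE = fun y => \sum_(q : 'I_d * 'I_d) E q.1 q.2 * (s_ q.1 y * s_ q.2 y).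
  by apply/funext => y; rewrite qE_sum.
elim: (index_enum _) => [|q r IH].
  rewrite (_ : (fun y => _) = fun=> 0); last by apply/funext => y; rewrite big_nil.
  apply: (@subg_exp _ 0 0) => //; first exact: csmooth_cst.
  by move=> y; rewrite cabs0 mul0r.
rewrite (_ : (fun y => _) = fun y => E q.1 q.2 * (s_ q.1 y * s_ q.2 y) +
  1 * \sum_(j <- r) E j.1 j.2 * (s_ j.1 y * s_ j.2 y)); last first.
  by apply/funext => y; rewrite big_cons mul1r.
by apply: subg_lin => //; apply: subg_mul; exact: subg_s.
Qed.

Lemma gdom_qE H k : gdom H -> gdom (fun y => qE y ^+ k * H y).
Proof.
move=> gH; elim: k => [|k IH].
  by rewrite (_ : (fun y => _) = H)//; apply/funext => y; rewrite expr0 mul1r.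
rewrite (_ : (fun y => _) = fun y => qE y * (qE y ^+ k * H y)).
  by apply: gdom_mul => //; exact: subg_qE.
by apply/funext => y; rewrite exprS mulrA.
Qed.

(** Under [GH], multiplication by [qE] is the operator sum_ij E_ij d_i d_j: two derivatives with
    radius r each, at the cost r^(-2). Its k-th iterate uses the total radius 2 r k. *)
Lemma GH_qE H z (r S : R) : gdom H -> 0 < r ->
  (forall w, nC (w - z) <= 2 * r -> cabs (GH H w) <= S) ->
  cabs (GH (fun y => qE y * H y) z) <= mnorm E / r ^+ 2 * S.
Proof.
move=> gH r0 HS; have [sG fG] := GH_family gH.
rewrite (_ : (fun y => qE y * H y) =
  fun y => \sum_(q : 'I_d * 'I_d) E q.1 q.2 * (s_ q.1 y * (s_ q.2 y * H y))); last first.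
  by apply/funext => y; rewrite qE_sum mulr_suml; apply: eq_bigr => q _; ring.
have gF (q : 'I_d * 'I_d) : gdom (fun y => s_ q.1 y * (s_ q.2 y * H y)).
  by apply: gdom_mul; [exact: subg_s|apply: gdom_mul => //; exact: subg_s].
have [_ ->] := GH_sum (index_enum _) (fun q => E q.1 q.2) z gF.
apply: le_trans (cabs_sum _ _ _) _.
Transparent mnorm.
rewrite /mnorm pair_bigA /= mulrAC -mulrA mulr_suml; apply: ler_sum => q _.
rewrite cabsM; apply: ler_wpM2l; first exact: cabs_ge0.
rewrite -fG; apply: (cauchy_foldr sG r0) => w; rewrite mulrC; exact: HS.
Qed.
Opaque mnorm.

Lemma GH_qE_iter H (r del S : R) k z : gdom H -> 0 < del -> 0 <= S ->
  (forall w, nC w <= r -> cabs (GH H w) <= S) -> nC z + 2 * del * k%:R <= r ->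
  cabs (GH (fun y => qE y ^+ k * H y) z) <= (mnorm E / del ^+ 2) ^+ k * S.
Proof.
move=> gH d0 S0 HS; elim: k z => [|k IH] z hz.
  rewrite (_ : (fun y => _) = H); last by apply/funext => y; rewrite expr0 mul1r.
  by rewrite expr0 mul1r; apply: HS; rewrite mulr0 addr0 in hz.
rewrite (_ : (fun y => _) = fun y => qE y * (qE y ^+ k * H y)); last first.
  by apply/funext => y; rewrite exprS mulrA.
rewrite exprS -mulrA; apply: GH_qE => //; first exact: gdom_qE.
move=> w hw; apply: IH; apply: le_trans hz.
have := nC_le_dist w z; rewrite -(addn1 k) natrD mulrDr mulr1; lra.
Qed.

End ExponentialFamilies.

(** * Changing the Gaussian *)

Section ExponentialRemainder.
Variable R : realType.
Local Notation C := (Cplx R).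

Lemma rderiv_cst (c : C) t : rderiv (fun=> c : C) t 0.
Proof. by split; exact: is_derive_cst. Qed.

Lemma rderiv_pow_rev (w : C) m t :
  rderiv (fun s => (toC (1 - s) * w) ^+ m.+1 / m.+1`!%:R) t
    (- w * ((toC (1 - t) * w) ^+ m / m`!%:R)).
Proof.
have L : rderiv (fun s => toC (1 - s) * w) t (- w).
  have := rderivD (rderiv_cst w t) (rderiv_linN w t); rewrite add0r.
  congr (rderiv _ _ _); apply/funext => s; rewrite toCB toC1; ring.
elim: m => [|m IH].
  have := L; rewrite expr0 fact0 divr1 mulr1.
  by congr (rderiv _ _ _); apply/funext => s; rewrite expr1 (fact0 : 1`! = 1)%N divr1.
have n0 : m.+2%:R != 0 :> C by rewrite pnatr_eq0.
have n1 : m.+1%:R != 0 :> C by rewrite pnatr_eq0.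
have f0 : m`!%:R != 0 :> C by rewrite pnatr_eq0 -lt0n fact_gt0.
have := rderivZ (m.+2%:R^-1) (rderivM L IH).
rewrite (_ : (fun s => _) = fun s => (toC (1 - s) * w) ^+ m.+2 / m.+2`!%:R); last first.
  apply/funext => s; rewrite (factS m.+1) (factS m) !natrM !exprS.
  by rewrite !invfM; ring.
congr (rderiv _ _ _); rewrite factS natrM exprS -(natr1 m.+1) !invfM.
have n2 : m.+1%:R + 1 != 0 :> C by rewrite natr1.
move: (m.+1%:R : C) n1 n2 (_ ^+ m) (m`!%:R^-1) => n n1 n2 P f.
by field; rewrite n1 n2.
Qed.

Definition cexp_rem (n : nat) (w : C) : C := cexp w - \sum_(k < n) w ^+ k / k`!%:R.

(** The curve exp (t w) times the Taylor polynomial of exp at (1 - t) w joins the polynomial at w,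
    for t = 0, to exp w, for t = 1. Its derivative telescopes to the single term exp (t w) w ((1 -
    t) w)^m / m!. *)
Lemma cexp_rem_bound m (w : C) :
  cabs (cexp_rem m.+1 w) <= 2 * (cabs w ^+ m.+1 / m`!%:R * expR (cabs w)).
Proof.
pose S t := \sum_(k < m.+1) (toC (1 - t) * w) ^+ k / k`!%:R.
pose f t := cexp (toC t * w) * S t.
have f1 : f 1 = cexp w.
  rewrite /f /S big_ord_recl subrr toC1 mul1r expr0 fact0 divr1.
  rewrite big1 ?addr0 ?mulr1// => i _; rewrite toC0 mul0r exprS mul0r mul0r//.
have f0 : f 0 = \sum_(k < m.+1) w ^+ k / k`!%:R.
  rewrite /f toC0 mul0r cexp0 mul1r; apply: eq_bigr => k _.
  by rewrite subr0 toC1 mul1r.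
have D t : rderiv f t (cexp (toC t * w) * (w * ((toC (1 - t) * w) ^+ m / m`!%:R))).
  rewrite /f /S; elim: m {S f f1 f0} => [|m IH].
    rewrite (_ : (fun s => _) = fun s => cexp (toC s * w)); last first.
      by apply/funext => s; rewrite big_ord1 expr0 fact0 divr1 mulr1.
    by rewrite expr0 fact0 divr1 mulr1 mulrC; exact: rderiv_cexp.
  have := rderivD IH (rderivM (rderiv_cexp w t) (rderiv_pow_rev w m t)).
  rewrite (_ : (fun s => _) = fun s =>
    cexp (toC s * w) * \sum_(k < m.+2) (toC (1 - s) * w) ^+ k / k`!%:R); last first.
    by apply/funext => s; rewrite [in RHS]big_ord_recr /= mulrDr.
  by congr (rderiv _ _ _); ring.
have := mvt_cplx (f := f) (df := fun t => cexp (toC t * w) * (w * ((toC (1 - t) * w) ^+ m / m`!%:R)))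
  (B := cabs w ^+ m.+1 / m`!%:R * expR (cabs w)) ler01.
rewrite f1 f0 subr0 mulr1; apply=> t /andP[t0 t1]; split=> //.
rewrite cabsM mulrC; apply: ler_pM; rewrite ?cabs_ge0//; last first.
  rewrite cabs_cexp ler_expR; apply: le_trans (ler_norm _) _; apply: le_trans (cabs_re _) _.
  by apply: cabs_scale01; rewrite t0.
rewrite cabsM cabsM cabsV cabs_nat cabsX exprS -mulrA; apply: ler_wpM2l; first exact: cabs_ge0.
apply: ler_wpM2r; first by rewrite invr_ge0.
apply: lerXn2r; rewrite ?nnegrE ?cabs_ge0//; apply: cabs_scale01.
by rewrite subr_ge0 t1 lerBlDr lerDl.
Qed.

Lemma pow_le_fact (x : R) n : 0 <= x -> x ^+ n / n`!%:R <= expR x.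
Proof.
move=> x0; case: n => [|n]; first by rewrite expr0 fact0 divr1 -expR0 ler_expR.
by have := expR_ge1Dxn n x0; apply: le_trans; rewrite lerDr.
Qed.

(** Since |w| is small relative to c X, the order m + 1 gains exp (- (m + 1)) over exp (c X). The
    factor 2 in the hypothesis pays for m + 1 <= 2^(m + 1), as m! stands in the remainder bound.
    With X = |y - x|^2 the loss exp (2 c X) is a Gaussian. *)
Lemma cexp_rem_exp m (w : C) (X c : R) : 0 < c -> 0 <= X -> 2 * cabs w <= expR (-1) * (c * X) ->
  cabs (cexp_rem m.+1 w) <= 2 * expR (- m.+1%:R) * expR (2 * (c * X)).
Proof.
move=> c0 X0 hw; apply: le_trans (cexp_rem_bound _ _) _.
have w0 := cabs_ge0 w; have cX : 0 <= c * X by rewrite mulr_ge0// ltW.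
rewrite -[leRHS]mulrA; apply: ler_wpM2l => //.
have -> : 2 * (c * X) = c * X + c * X by ring.
rewrite expRD mulrA; apply: ler_pM; rewrite ?expR_ge0 ?divr_ge0 ?exprn_ge0//; last first.
  rewrite ler_expR; have : expR (-1) * (c * X) <= 1 * (c * X).
    by rewrite ler_wpM2r// -expR0 ler_expR oppr_le0.
  by rewrite mul1r; lra.
apply: (@le_trans _ _ ((2 * cabs w) ^+ m.+1 / m.+1`!%:R)).
  rewrite factS natrM invfM mulrA; apply: ler_wpM2r; first by rewrite invr_ge0.
  rewrite ler_pdivlMr// exprMn mulrC; apply: ler_wpM2r; first exact: exprn_ge0.
  by rewrite -natrX ler_nat ltnW// ltn_expl.
apply: (@le_trans _ _ ((expR (-1) * (c * X)) ^+ m.+1 / m.+1`!%:R)).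
  apply: ler_wpM2r; first by rewrite invr_ge0.
  by apply: lerXn2r => //; rewrite nnegrE; [rewrite mulr_ge0|exact: mulr_ge0 (expR_ge0 _) cX].
rewrite exprMn -mulrA -expRM_natl mulrN1; apply: ler_wpM2l; first exact: expR_ge0.
exact: pow_le_fact.
Qed.

End ExponentialRemainder.

Section GaussianShift.
Variables (R : realType) (d : nat).
Local Notation C := (Cplx R).
Local Notation V := 'rV[R]_d.
Local Notation Z := 'rV[C]_d.

(** The equation is [phase_critical] at the point - i z for the FBI phase with A = 0, B = 1 and C =
    M. The bound on [al] comes from the imaginary part of the equation, Im M al = Im (i z), and the
    ellipticity of Im M. *)
Lemma iM_solve a (M : 'M[C]_d) (z : Z) : posim a M -> exists al be : V,
  [/\ mxact M (vecC al) + vecC be = 'i *: z, nR al <= nC z / a &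
      nR be <= (1 + mnorm M / a) * nC z].
Proof.
move=> pM; have [a0 sM hM] := pM.
have pos (y : V) : y != 0 -> 0 < dot (mxact (map_mx (@imC R) M) y) y.
  move=> y0; apply: lt_le_trans (hM y); rewrite mulr_gt0// exprn_gt0// lt_def nR_ge0 andbT.
  by apply: contra_neq y0 => /nR_eq0.
have d1 : \det (1%:M : 'M[C]_d) != 0 by rewrite det1 oner_eq0.
pose phi := @FBIPhase R d 0 1%:M M (trmx0 _ _ _) sM d1 pos.
pose al := xz phi (- ('i *: z)); pose be := xiz phi (- ('i *: z)).
have E : mxact M (vecC al) + vecC be = 'i *: z.
  have := phase_critical phi (- ('i *: z)); rewrite -/al -/be [mxact (phB phi) _]mxact1.
  by move=> /oppr_inj ->; rewrite addrC.
have hal : nR al <= nC z / a.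
  rewrite ler_pdivlMr//; have [al0|al0] := eqVneq (nR al) 0; first by rewrite al0 mul0r nC_ge0.
  have alp : 0 < nR al by rewrite lt_def al0 nR_ge0.
  rewrite -(ler_pM2r alp); apply: (@le_trans _ _ (a * nR al ^+ 2)); first by rewrite expr2; lra.
  apply: le_trans (hM al) _.
  have -> : mxact (map_mx (@imC R) M) al = imV ('i *: z).
    by rewrite -imV_mxact -E imVD imV_vecC addr0.
  apply: le_trans (ler_norm _) _; apply: le_trans (norm_dot _ _) _.
  apply: ler_wpM2r; first exact: nR_ge0.
  by apply: le_trans (nR_imV _) _; rewrite nCZ cabs_i mul1r.
exists al, be; split=> //.
have -> : be = reV ('i *: z) - mxact (map_mx (@reC R) M) al.
  by rewrite -reV_mxact -E reVD reV_vecC addrC addKr.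
apply: le_trans (nRD _ _) _; rewrite nRN mulrDl mul1r; apply: lerD.
  by apply: le_trans (nR_reV _) _; rewrite nCZ cabs_i mul1r.
apply: le_trans (nR_mxact_re _ _) _; rewrite mulrAC -mulrA.
by apply: ler_wpM2l; rewrite ?mnorm_ge0.
Qed.

Lemma shift_identity (F : numFieldType) (i A B Q b xb yb yx : F) : i * i = -1 -> b = yb - xb ->
  i * (2^-1 * A) - i * yx + B = i * xb - i * (2^-1 * Q) +
  (i * (2^-1 * (A + (1 + 1) * - (i * B - b) + Q)) - i * (yx + yb)).
Proof.
move=> i2 ->; have -> : i * xb - i * (2^-1 * Q) +
    (i * (2^-1 * (A + (1 + 1) * - (i * B - (yb - xb)) + Q)) - i * (yx + yb)) =
    i * (2^-1 * A) - i * yx - (i * i) * B by field.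
by rewrite i2 mulN1r opprK.
Qed.

(* A complex exponential moves a wave packet in phase space. *)
Lemma gpC_shift M (x xi al be : V) (z y : Z) : M^T = M ->
  mxact M (vecC al) + vecC be = 'i *: z ->
  gpC M x xi y * cexp (dot z (y - vecC x)) =
  cexp ('i * toC (dot x be) - 'i * (2^-1 * dot (mxact M (vecC al)) (vecC al))) *
  gpC M (x + al) (xi + be) y.
Proof.
move=> sM E; rewrite /gpC -!cexpD; congr cexp.
rewrite !vecCD opprD (addrA y).
have [s sE] : exists s, s = y - vecC x by exists (y - vecC x).
rewrite -sE.
rewrite (quad_add s (- vecC al) sM) mxactN !dotNl !dotNr opprK.
have Es : dot (mxact M s) (vecC al) = 'i * dot z s - dot (vecC be) s.
  by rewrite (dot_mxact_sym _ _ sM) -dotZl -E dotDl addrK.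
rewrite Es -dot_vecC (dotDr y); apply: shift_identity; first by rewrite -expr2 sqrCi.
by rewrite sE dotC dotDl dotNl.
Qed.

Lemma gpC_shift_bound a (M : 'M[C]_d) (x xi : V) (z : Z) : posim a M -> exists (k : C) (al be : V), [/\ nR al <= nC z / a,
  nR be <= (1 + mnorm M / a) * nC z,
  cabs k <= expR (2^-1 * mnorm M * (nC z / a) ^+ 2) &
  forall y, gpC M x xi y * cexp (dot z (y - vecC x)) = k * gpC M (x + al) (xi + be) y].
Proof.
move=> pM; have [a0 sM _] := pM; have [al [be [E hal hbe]]] := iM_solve z pM.
exists (cexp ('i * toC (dot x be) - 'i * (2^-1 * dot (mxact M (vecC al)) (vecC al)))), al, be.
split=> //; last by move=> y; exact: gpC_shift.
rewrite cabs_cexp ler_expR reCB !reC_iM imC_toC oppr0 add0r opprK imC_half -mulrA.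
apply: ler_wpM2l => //; apply: le_trans (ler_norm _) _; apply: le_trans (cabs_im _) _.
apply: le_trans (cabs_quad _ _ _) _; rewrite nC_vecC -mulrA; apply: ler_wpM2l.
  exact: mnorm_ge0.
by rewrite expr2; apply: ler_pM; rewrite ?nR_ge0.
Qed.

End GaussianShift.

Section HeatStep.
Variables (R : realType) (d : nat) (theta : R).
Hypotheses (d_gt0 : (0 < d)%N) (theta_ge : 2^-1 <= theta) (theta_lt : theta < 1).
Local Notation C := (Cplx R).
Local Notation V := 'rV[R]_d.
Local Notation Z := 'rV[C]_d.

Lemma gpC_gdom a (M : 'M[C]_d) x xi : posim a M -> gdom (gpC M x xi).
Proof.
move=> pM; have [a0 _ _] := pM; split; first exact: csmooth_gpC.
exists (a / 4 / 2), (gpb a M + 1), (expR (a / 4 * nR x ^+ 2 + nR xi ^+ 2)); split.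
- by rewrite !divr_gt0.
- by rewrite addr_ge0// gpb_ge0.
- exact: expR_ge0.
move=> y; apply: le_trans (gpC_bound _ _ _ pM) _.
by apply: om_shift; rewrite divr_ge0// ltW.
Qed.

Lemma gpC_add (M E : 'M[C]_d) x xi y :
  gpC (M + E) x xi y = gpC M x xi y * cexp ('i * (2^-1 * qE x E y)).
Proof.
rewrite /gpC -cexpD; congr cexp; rewrite mxactDl dotDl /qE.
set A := dot _ _; set B := dot _ _; set D := dot y _; ring.
Qed.

Lemma csmooth_qE x (E : 'M[C]_d) : csmooth (qE x E).
Proof. exact: (proj1 (subg_qE x E)). Qed.

Definition heat_rem (M E : 'M[C]_d) m x xi (y : Z) : C :=
  gpC M x xi y * cexp_rem m.+1 ('i * (2^-1 * qE x E y)).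

Lemma csmooth_heat_rem M E m x xi : csmooth (heat_rem M E m x xi).
Proof.
have sq : csmooth (fun y => 'i * (2^-1 * qE x E y)).
  by do 2!apply: csmoothZ; exact: csmooth_qE.
apply: csmoothM; first exact: csmooth_gpC.
apply: csmoothB; first exact: csmooth_cexp.
apply: csmooth_sum => k.
rewrite (_ : (fun z => _) = fun z => (k`!%:R)^-1 * ('i * (2^-1 * qE x E z)) ^+ k).
  by apply: csmoothZ; exact: csmoothX.
by apply/funext => z; rewrite mulrC.
Qed.

Lemma heat_rem_bound a (M E : 'M[C]_d) m x xi y : posim a M -> mnorm E <= expR (-1) * (a / 32) ->
  cabs (heat_rem M E m x xi y) <= 2 * expR (- m.+1%:R) *
    expR (- (a / 8 * nR (reV y - x) ^+ 2) + (gpb a M + a / 8) * nR (imV y) ^+ 2 + nR (imV y) * nR xi).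
Proof.
move=> pM hE; have [a0 _ _] := pM.
(* By |y - x|^2 <= 2 (|Re y - x|^2 + |Im y|^2), the loss exp (2 (a / 32) X) takes a / 8, half of the
   rate a / 4 of the packet. *)
have c0 : 0 < a / 32 by rewrite divr_gt0.
pose X := nC (y - vecC x) ^+ 2.
have X0 : 0 <= X by exact: sqr_ge0.
have hw : 2 * cabs ('i * (2^-1 * qE x E y)) <= expR (-1) * (a / 32 * X).
  rewrite !cabsM cabs_i mul1r cabsV cabs_nat mulrA divff ?pnatr_eq0// mul1r.
  apply: le_trans (cabs_quad _ _ _) _; rewrite -mulrA -expr2.
  by rewrite -/X mulrA; apply: ler_wpM2r.
rewrite /heat_rem cabsM mulrC.
apply: le_trans (ler_pM (cabs_ge0 _) (cabs_ge0 _) (cexp_rem_exp m c0 X0 hw) (gpC_bound _ _ _ pM)) _.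
rewrite -[leLHS]mulrA; apply: ler_wpM2l; first by rewrite mulr_ge0// expR_ge0.
rewrite -expRD ler_expR.
have hX : X <= 2 * (nR (reV y - x) ^+ 2 + nR (imV y) ^+ 2).
  have h : nC (y - vecC x) <= nR (reV y - x) + nR (imV y).
    by apply: le_trans (nC_reim _) _; rewrite reVB imVB reV_vecC imV_vecC subr0.
  apply: (@le_trans _ _ ((nR (reV y - x) + nR (imV y)) ^+ 2)).
    by rewrite lerXn2r ?nnegrE ?nC_ge0 ?addr_ge0 ?nR_ge0.
  have := sqr_ge0 (nR (reV y - x) - nR (imV y)); rewrite !expr2; lra.
have := ler_wpM2l (ltW c0) hX; rewrite mulrDl !mulrDr; lra.
Qed.

Variable u : functional R d.
Hypothesis du : gs_dual theta u.

Lemma GH0 x H : GH x u H 0 = u (H \o @vecC R d).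
Proof.
by congr u; apply/funext => y; rewrite /kH /= dot0l cexp0 mulr1.
Qed.

Lemma heat_identity a (M E : 'M[C]_d) m x xi : posim a M -> mnorm E <= expR (-1) * (a / 32) ->
  u (gp (M + E) x xi) =
  \sum_(k < m.+1) ('i / 2) ^+ k / k`!%:R * GH x u (fun y => qE x E y ^+ k * gpC M x xi y) 0 +
  u (heat_rem M E m x xi \o @vecC R d).
Proof.
move=> pM hE; have [a0 _ _] := pM; have gg := gpC_gdom x xi pM.
have gF (k : 'I_m.+1) : gdom (fun y => qE x E y ^+ k * gpC M x xi y) by exact: gdom_qE.
have [gS ES] := GH_sum d_gt0 theta_ge theta_lt x du (index_enum _)
  (fun k : 'I_m.+1 => ('i / 2) ^+ k / k`!%:R) 0 gF.
rewrite -ES GH0; have a80 : 0 < a / 8 by rewrite divr_gt0.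
have b0 : 0 <= gpb a M + a / 8 by rewrite addr_ge0 ?gpb_ge0// ltW.
have [c [K [c0 K0 H]]] := gauss_gsb d theta_ge theta_lt a80 b0 ltr01.
have gr : gs theta (heat_rem M E m x xi \o @vecC R d).
  apply/gsP; exists c; eexists; split=> //.
  apply: (H x (nR xi) (2 * expR (- m.+1%:R)) _ (csmooth_heat_rem M E m x xi)).
  - exact: nR_ge0.
  - by rewrite mulr_ge0// expR_ge0.
  - by move=> y; exact: heat_rem_bound.
have := proj1 du _ _ 1 1 (gdom_gs theta_ge theta_lt gS) gr; rewrite !mul1r => <-.
congr u; apply/funext => y; rewrite /gp /= gpC_add !mul1r /heat_rem /cexp_rem mulrBr.
rewrite addrC -addrA [X in _ + X](_ : _ = 0) ?addr0// addrC mulr_sumr -sumrB big1// => k _.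
have -> : 'i * (2^-1 * qE x E (vecC y)) = 'i / 2 * qE x E (vecC y) by ring.
move: ('i / 2) (qE x E _) => A q; rewrite exprMn.
move: (A ^+ k) (q ^+ k) (k`!%:R^-1) (gpC _ _ _ _) => b1 b2 b3 b4.
by apply/eqP; rewrite subr_eq0; apply/eqP; ring.
Qed.

(** The factor of the shifted packet in [gpC_shift_bound] is at most exp ([heat_B1 a B] k) on the
    ball of radius sqrt k. *)
Definition heat_B1 (a B : R) : R := B / (2 * a ^+ 2).

Lemma half_quad_div (m n a : R) : 2^-1 * m * (n / a) ^+ 2 = m * n ^+ 2 / (2 * a ^+ 2).
Proof. by rewrite expr_div_n (invfM 2); ring. Qed.

(* On the ball of radius [sqrt k] the entire function [GH] pairs [u] with packets shifted by
   [O(sqrt k)]; Cauchy's estimate there loses [k ^ k], which [k!] compensates. *)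
Lemma heat_term a B (M E : 'M[C]_d) k x xi (S : R) : posim a M -> mnorm M <= B ->
  mnorm E <= expR (- (heat_B1 a B + 1)) / 4 -> 0 <= S ->
  (forall al be : V, nR al + nR be <= (a^-1 + (1 + B / a)) * Num.sqrt k%:R ->
    cabs (u (gp M (x + al) (xi + be))) <= S) ->
  cabs (('i / 2) ^+ k / k`!%:R * GH x u (fun y => qE x E y ^+ k * gpC M x xi y) 0) <=
  2^-1 ^+ k * S.
Proof.
move=> pM MB hE S0 HS; have [a0 _ _] := pM; have gg := gpC_gdom x xi pM.
set B1 := heat_B1 a B in hE *.
have mM := mnorm_ge0 M; have mE := mnorm_ge0 E.
have B0 : 0 <= B := le_trans mM MB.
have base w : nC w <= Num.sqrt k%:R -> cabs (GH x u (gpC M x xi) w) <= expR (B1 * k%:R) * S.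
  move=> hw; have [ka [al [be [hal hbe hk E1]]]] := gpC_shift_bound x xi w pM.
  have w0 := nC_ge0 w.
  have w2 : nC w ^+ 2 <= k%:R.
    by rewrite -[leRHS]sqr_sqrtr// lerXn2r ?nnegrE ?sqrtr_ge0.
  have -> : GH x u (gpC M x xi) w = ka * u (gp M (x + al) (xi + be)).
    have gs1 : gs theta (gp M (x + al) (xi + be)) by exact: (gp_gs theta_ge theta_lt _ _ pM).
    have := proj1 du _ _ ka 0 gs1 gs1; rewrite mul0r addr0 => <-; congr u.
    by apply/funext => y; rewrite /kH /= E1 mul0r addr0.
  rewrite cabsM; apply: ler_pM; rewrite ?cabs_ge0//.
    apply: le_trans hk _; rewrite ler_expR /B1 /heat_B1.
    have -> : 2^-1 * mnorm M * (nC w / a) ^+ 2 = mnorm M * nC w ^+ 2 / (2 * a ^+ 2).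
      exact: half_quad_div.
    rewrite [leRHS]mulrAC; apply: ler_wpM2r; first by rewrite invr_ge0 mulr_ge0// sqr_ge0.
    by apply: ler_pM; rewrite ?sqr_ge0.
  apply: HS; apply: (@le_trans _ _ (nC w / a + (1 + B / a) * nC w)).
    apply: lerD => //; apply: le_trans hbe _; apply: ler_wpM2r => //.
    by rewrite lerD2l; apply: ler_wpM2r => //; rewrite invr_ge0 ltW.
  rewrite mulrC -mulrDl; apply: ler_wpM2l => //.
  by rewrite addr_ge0 ?invr_ge0 ?(ltW a0)// addr_ge0// divr_ge0// ltW.
have ES0 : 0 <= expR (B1 * k%:R) * S by rewrite mulr_ge0 ?expR_ge0.
case: k => [|k] in HS base ES0 *.
  rewrite !expr0 fact0 divr1 !mul1r (_ : (fun y => _) = gpC M x xi); last first.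
    by apply/funext => y; rewrite expr0 mul1r.
  have := base 0; rewrite nC0 sqrtr_ge0 mulr0 expR0 mul1r; exact.
set n := k.+1 in HS base ES0 *.
pose r := Num.sqrt (n%:R : R); have r0 : 0 < r by rewrite sqrtr_gt0 ltr0n.
have r2 : r ^+ 2 = n%:R by rewrite sqr_sqrtr.
(* k = n double derivatives use exactly the radius 2 del n = r. They cost (4 n |E|)^n, and n^n / n!
   <= exp n; the 4 in the bound on [mnorm E] is what leaves 2^-n. *)
pose del := (2 * r)^-1; have del0 : 0 < del by rewrite invr_gt0 mulr_gt0.
have hr : nC (0 : Z) + 2 * del * n%:R <= r.
  rewrite nC0 add0r -r2; have -> : 2 * del * r ^+ 2 = r by rewrite /del; field; rewrite gt_eqF.
  by [].
have := GH_qE_iter d_gt0 theta_ge theta_lt du E gg del0 ES0 base hr => h.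
rewrite cabsM; apply: le_trans (ler_wpM2l (cabs_ge0 _) h) _.
rewrite !cabsM cabsX cabsM cabs_i mul1r cabsV cabs_nat cabsV cabs_nat.
rewrite mulrA mulrA; apply: ler_wpM2r => //.
have dE : mnorm E / del ^+ 2 = 4 * n%:R * mnorm E.
  by rewrite /del -r2; field; rewrite gt_eqF.
rewrite dE.
have -> : 2^-1 ^+ n / n`!%:R * ((4 * n%:R * mnorm E) ^+ n * expR (B1 * n%:R)) =
    (2 * mnorm E * expR B1) ^+ n * (n%:R ^+ n / n`!%:R).
  rewrite (mulrC B1) expRM_natl !exprMn.
  have -> : (4 : R) ^+ n = 2 ^+ n * 2 ^+ n by rewrite -exprMn; congr (_ ^+ _); ring.
  rewrite exprVn; field; rewrite expf_neq0 ?pnatr_eq0//.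
  by rewrite -lt0n fact_gt0.
apply: (@le_trans _ _ ((2 * mnorm E * expR B1) ^+ n * expR n%:R)).
  by apply: ler_wpM2l; [rewrite exprn_ge0// !mulr_ge0 ?expR_ge0|exact: pow_le_fact].
rewrite -[n%:R]mulr1 expRM_natl -exprMn; apply: lerXn2r; rewrite ?nnegrE ?invr_ge0//.
  by rewrite !mulr_ge0 ?expR_ge0.
rewrite -(mulrA (2 * mnorm E)) -expRD; apply: (@le_trans _ _ (2 * (expR (- (B1 + 1)) / 4) * expR (B1 + 1))).
  by apply: ler_wpM2r; [exact: expR_ge0|apply: ler_wpM2l].
have -> : 2 * (expR (- (B1 + 1)) / 4) * expR (B1 + 1) =
  2^-1 * (expR (- (B1 + 1)) * expR (B1 + 1)) by field.
by rewrite -expRD addrC subrr expR0 mulr1.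
Qed.

End HeatStep.

Section HeatFlow.
Variables (R : realType) (d : nat) (theta : R).
Hypotheses (d_gt0 : (0 < d)%N) (theta_ge : 2^-1 <= theta) (theta_lt : theta < 1).
Local Notation C := (Cplx R).
Local Notation V := 'rV[R]_d.
Local Notation p := (theta^-1).
Variable u : functional R d.
Hypothesis du : gs_dual theta u.

(** The scale s measures both the size of the point and the width of the cone about the ray. A step
    between Gaussians halves the aperture k and displaces packets by at most k s / 2. *)
Definition gp_decay (M : 'M[C]_d) (x0 xi0 : V) : Prop :=
  exists k e K : R, [/\ 0 < k, 0 < e, 0 <= K & forall (x xi : V) (s : R), 0 < s ->
    nR (x - s *: x0) + nR (xi - s *: xi0) <= k * s ->
    cabs (u (gp M x xi)) <= K * expR (- (e * s `^ p))].

(** The first bound makes the terms of the expansion summable ([heat_term]), the second lets the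
    Gaussian absorb the remainder ([heat_rem_bound]). *)
Definition heat_eta (a B : R) : R :=
  Num.min (expR (- (heat_B1 a B + 1)) / 4) (expR (-1) * (a / 32)).

Lemma heat_eta_gt0 a B : 0 < a -> 0 < heat_eta a B.
Proof.
by move=> a0; rewrite lt_min; apply/andP; split; rewrite ?divr_gt0 ?mulr_gt0 ?expR_gt0 ?divr_gt0.
Qed.

Lemma nat_floor (x : R) : 0 <= x -> exists n : nat, n%:R <= x <= n.+1%:R.
Proof.
move=> /truncn_itv/andP[h1 /ltW h2]; exists (Num.Def.trunc x).
by apply/andP; split.
Qed.

Lemma heat_rate (c1 n s sp A del X : R) : 0 <= c1 -> c1 * s ^+ 2 <= n -> sp <= 1 + s ^+ 2 ->
  X <= A * sp -> 0 <= del -> del * (A + 1) = c1 / 2 -> 0 <= sp ->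
  - n + del * X <= c1 - c1 / 2 * sp.
Proof.
move=> c0 hn hs hX d0 dA s0.
have h1 : del * X <= del * (A * sp) by rewrite ler_wpM2l.
have h2 : del * (A * sp) <= c1 / 2 * sp.
  by rewrite -dA mulrA; apply: ler_wpM2r => //; rewrite ler_wpM2l// lerDl.
have h3 : c1 * sp <= c1 * (1 + s ^+ 2) by rewrite ler_wpM2l.
rewrite mulrDr mulr1 in h3; lra.
Qed.

(* About [s ^ 2] terms of the expansion see only packets inside the cone, and the remainder is
   [O(exp (- c s ^ 2))]. *)
Lemma heat_step a B (M E : 'M[C]_d) x0 xi0 : posim a M -> mnorm M <= B ->
  mnorm E <= heat_eta a B -> gp_decay M x0 xi0 -> gp_decay (M + E) x0 xi0.
Proof.
move=> pM MB hE [ka [e [K [ka0 e0 K0 HK]]]]; have [a0 _ _] := pM.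
have hE1 : mnorm E <= expR (- (heat_B1 a B + 1)) / 4 by apply: le_trans hE _; rewrite ge_min lexx.
have hE2 : mnorm E <= expR (-1) * (a / 32) by apply: le_trans hE _; rewrite ge_min lexx orbT.
have B0 : 0 <= B := le_trans (mnorm_ge0 M) MB.
pose L := a^-1 + (1 + B / a).
have L0 : 0 < L by rewrite addr_gt0 ?invr_gt0// ltr_pwDl// divr_ge0// ltW.
(* L is the displacement of packets per unit of sqrt k in [heat_term]. For k <= (q s)^2 it amounts
   to at most L q s = ka s / 2, so packets starting in the cone of aperture ka / 2 stay in that of
   aperture ka. *)
pose q := ka / (2 * L); have q0 : 0 < q by rewrite divr_gt0// mulr_gt0.
pose c1 := q ^+ 2; have c10 : 0 < c1 by rewrite exprn_gt0.
pose k' := ka / 2; have k'0 : 0 < k' by rewrite divr_gt0.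
pose A := (k' + nR x0) `^ p + (k' + nR xi0) `^ p.
have A0 : 0 <= A by rewrite addr_ge0 ?powR_ge0.
have A1 : 0 < A + 1 by rewrite ltr_wpDl.
(* The norm of the remainder grows like exp (del (|x|^p + |xi|^p)), at most exp (del A s^p) in the
   cone; with this del it takes at most half of the gain exp (- c1 s^p). *)
pose del := c1 / 2 / (A + 1); have del0 : 0 < del by rewrite !divr_gt0.
have delA : del * (A + 1) = c1 / 2 by rewrite /del divfK// gt_eqF.
have a80 : 0 < a / 8 by rewrite divr_gt0.
have b0 : 0 <= gpb a M + a / 8 by rewrite addr_ge0 ?gpb_ge0// ltW.
have [c [K2 [c0 K20 H2]]] := gauss_gsb d theta_ge theta_lt a80 b0 del0.
have [K3 K30 H3] := dual_bound d_gt0 du c0.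
pose K' := K3 * (K2 * 2 * expR c1).
have K'0 : 0 <= K' by rewrite mulr_ge0// mulr_ge0 ?expR_ge0// mulr_ge0// ltW.
exists k', (Num.min e (c1 / 2)), (2 * K + K'); split=> //.
- by rewrite lt_min e0 divr_gt0.
- by rewrite addr_ge0// mulr_ge0.
move=> x xi s s0 hs.
have sp0 := powR_ge0 s p.
have cs0 : 0 <= c1 * s ^+ 2 by rewrite mulr_ge0 ?sqr_ge0// ltW.
(* The lower bound m <= c1 s^2 keeps every k <= m below (q s)^2; the upper one gives exp (- (m + 1))
   <= exp (- c1 s^2), and s^p <= 1 + s^2. *)
have [m /andP[m1 m2]] := nat_floor cs0.
set mm := m.+1%:R in m2.
rewrite (heat_identity d_gt0 theta_ge theta_lt du m x xi pM hE2).
apply: le_trans (cabsD _ _) _; rewrite mulrDl; apply: lerD.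
  pose S := K * expR (- (e * s `^ p)); have S0 : 0 <= S by rewrite mulr_ge0 ?expR_ge0.
  apply: (@le_trans _ _ (2 * S)); last first.
    rewrite -mulrA; apply: ler_wpM2l => //; rewrite /S; apply: ler_wpM2l => //.
    by rewrite ler_expR lerN2 ler_wpM2r// ge_min lexx.
  apply: le_trans (cabs_sum _ _ _) _.
  apply: (@le_trans _ _ (\sum_(k < m.+1) 2^-1 ^+ k * S)); last first.
    rewrite -mulr_suml; apply: ler_wpM2r => //.
    have h12 : (0 < 2^-1 :> R) && (2^-1 < 1 :> R) by apply/andP; split; lra.
    apply: le_trans (geo_bound m.+1 h12) _.
    by have -> : 1 - 2^-1 = 2^-1 :> R; [lra|rewrite invrK].
  apply: ler_sum => k _.
  apply: (heat_term d_gt0 theta_ge theta_lt du pM MB hE1 S0) => al be hab.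
  apply: HK => //.
  have sk : Num.sqrt (k%:R : R) <= q * s.
    rewrite -[leRHS]ger0_norm; last by rewrite mulr_ge0 ?(ltW q0)// ltW.
    rewrite -sqrtr_sqr; apply: ler_wsqrtr; rewrite exprMn; apply: le_trans m1.
    by rewrite ler_nat -ltnS.
  have Lq : L * (q * s) = k' * s by rewrite /q /k'; field; rewrite gt_eqF.
  have hL : L * Num.sqrt (k%:R : R) <= k' * s by rewrite -Lq; apply: ler_wpM2l; rewrite ?(ltW L0).
  have h1 : nR (x + al - s *: x0) <= nR (x - s *: x0) + nR al by rewrite addrAC nRD.
  have h2 : nR (xi + be - s *: xi0) <= nR (xi - s *: xi0) + nR be by rewrite addrAC nRD.
  have -> : ka * s = k' * s + k' * s by rewrite -mulrDl -splitr.
  move: hab; rewrite -/L => hab; lra.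
have n20 : 0 <= 2 * expR (- mm) by rewrite mulr_ge0 ?expR_ge0.
have hg := H2 x (nR xi) (2 * expR (- mm)) _ (csmooth_heat_rem M E m x xi) (nR_ge0 xi) n20
  (fun y => heat_rem_bound m x xi y pM hE2).
apply: le_trans (H3 _ _ hg) _.
rewrite /K' -[leRHS]mulrA; apply: ler_wpM2l => //.
have -> : K2 * (2 * expR (- mm)) * expR (del * (nR x `^ p + nR xi `^ p)) =
  K2 * 2 * (expR (- mm) * expR (del * (nR x `^ p + nR xi `^ p))) by ring.
rewrite -[leRHS]mulrA; apply: ler_wpM2l; first by rewrite mulr_ge0// ltW.
rewrite -!expRD ler_expR.
have nx (y y0 : V) : nR (y - s *: y0) <= k' * s -> nR y `^ p <= (k' + nR y0) `^ p * s `^ p.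
  move=> hy; rewrite -powRp_scale ?(ltW s0) ?addr_ge0 ?nR_ge0 ?(ltW k'0)//.
  apply: powRp_le; rewrite ?nR_ge0// -(subrK (s *: y0) y); apply: le_trans (nRD _ _) _.
  by rewrite mulrDl lerD// nRZ gtr0_norm// mulrC.
have hX : nR x `^ p + nR xi `^ p <= A * s `^ p.
  rewrite mulrDl; apply: lerD; apply: nx; apply: le_trans hs.
    by rewrite lerDl nR_ge0.
  by rewrite lerDr nR_ge0.
have hsq := powRp_le_sqr theta_ge theta_lt (ltW s0).
apply: le_trans (heat_rate (ltW c10) m2 hsq hX (ltW del0) delA sp0) _.
by rewrite lerD2l lerN2; apply: ler_wpM2r => //; rewrite ge_min lexx orbT.
Qed.

Lemma mnormZ (c : C) (M : 'M[C]_d) : mnorm (c *: M) = cabs c * mnorm M.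
Proof.
Transparent mnorm.
rewrite /mnorm mulr_sumr; apply: eq_bigr => i _; rewrite mulr_sumr; apply: eq_bigr => j _.
by rewrite mxE cabsM.
Qed.
Lemma mnormD (M N : 'M[C]_d) : mnorm (M + N) <= mnorm M + mnorm N.
Proof.
rewrite /mnorm -big_split; apply: ler_sum => i _; rewrite -big_split; apply: ler_sum => j _.
by rewrite mxE cabsD.
Qed.
Opaque mnorm.

Lemma posim_segment a (M N : 'M[C]_d) t : posim a M -> posim a N -> 0 <= t <= 1 ->
  posim a (M + toC t *: (N - M)).
Proof.
move=> [a0 sM hM] [_ sN hN] /andP[t0 t1]; split=> //.
  by rewrite linearD linearZ /= linearB /= sM sN.
move=> x.
have -> : map_mx (@imC R) (M + toC t *: (N - M)) =
    (1 - t) *: map_mx (@imC R) M + t *: map_mx (@imC R) N.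
  apply/matrixP => i j; rewrite !mxE imCD imCM reC_toC imC_toC mul0r addr0 imCB; ring.
rewrite mxactDl !mxactZl dotDl !dotZl.
have h1 : (1 - t) * (a * nR x ^+ 2) <= (1 - t) * dot (mxact (map_mx (@imC R) M) x) x.
  by rewrite ler_wpM2l ?subr_ge0.
have h2 : t * (a * nR x ^+ 2) <= t * dot (mxact (map_mx (@imC R) N) x) x.
  by rewrite ler_wpM2l.
apply: le_trans (lerD h1 h2).
by rewrite -mulrDl subrK mul1r.
Qed.

Lemma posim_le a b (M : 'M[C]_d) : 0 < b -> b <= a -> posim a M -> posim b M.
Proof.
move=> b0 ba [a0 sM hM]; split=> // x; apply: le_trans (hM x).
by rewrite ler_wpM2r ?sqr_ge0.
Qed.

Lemma segment_step (M D : 'M[C]_d) (n k : nat) :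
  M + toC (k.+1%:R / n%:R) *: D = M + toC (k%:R / n%:R) *: D + toC (n%:R^-1) *: D.
Proof. by rewrite -addrA -scalerDl -toCD -[k.+1]addn1 natrD mulrDl mul1r. Qed.

Lemma segment_end (M N : 'M[C]_d) (n : nat) : (0 < n)%N ->
  M + toC (n%:R / n%:R) *: (N - M) = N.
Proof.
by move=> n0; rewrite divff ?pnatr_eq0 -?lt0n// toC1 scale1r addrC subrK.
Qed.

Lemma segment_norm (M D : 'M[C]_d) t : 0 <= t <= 1 ->
  mnorm (M + toC t *: D) <= mnorm M + mnorm D.
Proof.
move=> /andP[t0 t1]; apply: le_trans (mnormD _ _) _; rewrite lerD2l mnormZ cabs_toC ger0_norm//.
by rewrite -[leRHS]mul1r; apply: ler_wpM2r => //; exact: mnorm_ge0.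
Qed.

(** [posim c] is convex and [mnorm] is bounded by B along the segment, so one step size
    [heat_eta c B] serves throughout and finitely many steps lead from M to N. Aperture and rate
    shrink at each step but stay positive. *)
Lemma heat_flow a b (M N : 'M[C]_d) x0 xi0 : posim a M -> posim b N ->
  gp_decay M x0 xi0 -> gp_decay N x0 xi0.
Proof.
move=> pM pN dM; have [a0 _ _] := pM; have [b0 _ _] := pN.
pose c := Num.min a b; have c0 : 0 < c by rewrite lt_min a0.
have {}pM : posim c M by apply: posim_le pM; rewrite // ge_min lexx.
have {}pN : posim c N by apply: posim_le pN; rewrite // ge_min lexx orbT.
pose D := N - M; pose B := mnorm M + mnorm D.
have e0 : 0 < heat_eta c B by exact: heat_eta_gt0.
have [n' /andP[_ hn']] : exists n : nat, n%:R <= mnorm D / heat_eta c B <= n.+1%:R.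
  by apply: nat_floor; rewrite divr_ge0 ?mnorm_ge0// ltW.
pose n := n'.+1.
have n0 : 0 < n%:R :> R by rewrite ltr0n.
have hn : mnorm D / n%:R <= heat_eta c B.
  by rewrite ler_pdivrMr// mulrC -ler_pdivrMr.
have nD : mnorm (toC (n%:R^-1) *: D) <= heat_eta c B.
  by rewrite mnormZ cabs_toC ger0_norm ?invr_ge0// mulrC.
suff H k : (k <= n)%N -> gp_decay (M + toC (k%:R / n%:R) *: D) x0 xi0.
  by have := H n (leqnn n); rewrite /D segment_end.
elim: k => [_|k IH kn]; first by rewrite mul0r toC0 scale0r addr0.
have k1 : (0 <= k%:R / n%:R :> R) && (k%:R / n%:R <= 1 :> R).
  by rewrite divr_ge0//= ler_pdivrMr// mul1r ler_nat ltnW.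
have dk := IH (ltnW kn); rewrite segment_step.
exact: (heat_step (posim_segment pM pN k1) (segment_norm M D k1) nD dk).
Qed.

End HeatFlow.

(** * Series of functionals and uniform boundedness *)

Section SupSeries.
Variables (R : realType) (d : nat) (theta : R) (phi : FBI_phase R d).
Hypotheses (d_gt0 : (0 < d)%N) (theta_ge : 2^-1 <= theta) (theta_lt : theta < 1).
Local Notation C := (Cplx R).
Local Notation Z := 'rV[C]_d.
Local Notation p := (theta^-1).
Local Notation W := (weight phi).

(** The kernel with its variables exchanged, so that in the family lemmas y is the holomorphic
    parameter and the functional acts in z. *)
Definition kerS (q : Z * Z) : C := kerC phi (q.2, q.1).

Lemma csmooth_kerS : csmooth kerS.
Proof.
have Ll : linear (fun q : (Z * Z)%type => (q.2, q.1)) by [].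
pose L : {linear (Z * Z)%type -> (Z * Z)%type} :=
  HB.pack (fun q : (Z * Z)%type => (q.2, q.1)) (GRing.isLinear.Build _ _ _ _ _ Ll).
have -> : kerS = fun q => kerC phi (L q + 0) by apply/funext => q; rewrite addr0.
apply: csmooth_affine; last exact: csmooth_kerC.
by move=> q A [[P Q] /= [P0 Q0] PQ]; exists (Q, P) => //= -[a b] [/= Qa Pb]; apply: PQ.
Qed.

Definition omw (del : R) (w : Z) : R := expR (W w + del * nC w `^ p).

Lemma kerS_dominated del : 0 < del -> locally_dominated (omw del) kerS.
Proof.
move=> del0 r; have [r0|r0] := leP 0 r; last first.
  by exists 0 => // z zr; have := le_lt_trans zr r0; rewrite ltNge nC_ge0.
have [a pa] := phC_posim phi d_gt0; have [a0 _ _] := pa.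
have [K K0 [HK _]] := phase_bounds phi.
pose t := r * K + 1.
have t0 : 0 < t by rewrite ltr_wpDl// mulr_ge0// ltW.
have [N N0 HN] := lin_le_powRp theta_ge theta_lt (divr_gt0 del0 t0).
exists (expR (gpb a (phC phi) * r ^+ 2 + t * N)); first exact: expR_ge0.
move=> y yr w; rewrite /kerS /= kerC_split cabsM cabs_pref// /omw expRD.
rewrite mulrCA; apply: ler_wpM2l; first exact: expR_ge0.
apply: le_trans (gpC_bound _ _ _ pa) _; rewrite -expRD ler_expR.
have im : nR (imV y) <= r by apply: le_trans (nR_imV _) yr.
have w0 := nC_ge0 w.
have h1 : - (a / 4 * nR (reV y - xz phi w) ^+ 2) <= 0.
  by rewrite oppr_le0 mulr_ge0 ?sqr_ge0// divr_ge0// ltW.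
have h2 : gpb a (phC phi) * nR (imV y) ^+ 2 <= gpb a (phC phi) * r ^+ 2.
  by apply: ler_wpM2l; [exact: gpb_ge0|rewrite lerXn2r ?nnegrE ?nR_ge0].
have h3 : nR (imV y) * nR (xiz phi w) <= r * (K * nC w).
  apply: ler_pM; rewrite ?nR_ge0//; apply: le_trans (HK w); by rewrite lerDr nR_ge0.
have h4 : t * nC w <= t * (del / t * nC w `^ p + N) by rewrite ler_wpM2l ?(ltW t0)// HN.
have h5 : t * (del / t * nC w `^ p) = del * nC w `^ p by rewrite mulrA (mulrC t) divfK ?gt_eqF.
rewrite mulrDr h5 in h4; rewrite /t mulrDl mul1r in h4 *.
move: h3 h4; rewrite mulrA; lra.
Qed.

Lemma dd_slice (k : Z * Z -> C) j w (y : Z) : dd j (fun y => k (y, w)) y = ddz j k (y, w).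
Proof.
apply: (@derive_line R Z (Z * Z)%type (fun y => (y, w)) k y (delta_mx 0 j) (delta_mx 0 j, 0)).
by move=> h; congr pair; rewrite /= scaler0 add0r.
Qed.

Lemma foldr_ddz_slice (k : Z * Z -> C) s w :
  (fun y => foldr (@ddz R d d) k s (y, w)) = foldr (@dd R d) (fun y => k (y, w)) s.
Proof.
elim: s => [//|j s IH]; apply/funext => y.
transitivity (dd j (fun y => foldr (@ddz R d d) k s (y, w)) y); first by rewrite dd_slice.
by rewrite IH.
Qed.

Variables (l : (Z -> C) -> C) (del : R).
Hypothesis del_gt0 : 0 < del.
Local Notation om := (omw del).

(** A superposition of FBI kernels with density [l]: a weighted series of point evaluations in the
    gliding hump, a series of integrals against symbol terms in the action on test functions. *)
Definition sup_fun (y : Z) : C := l (fun w => kerC phi (w, y)).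

(* The kernels are bounded in a single step of [S_theta] relative to [omw]. *)
Lemma sup_gsb c K Kc : 0 < c -> 0 <= K ->
  (forall z, gsb theta c (Kc * expR (del * nC z `^ p + W z)) (fbi_kernel phi z)) ->
  (forall f g a b, dominated om f -> dominated om g ->
    l (fun y => a * f y + b * g y) = a * l f + b * l g) ->
  (forall f M, csmooth f -> 0 <= M -> (forall y, cabs (f y) <= M * om y) ->
    cabs (l f) <= K * M) ->
  gsb theta c (K * Kc) (sup_fun \o @vecC R d).
Proof.
move=> c0 K0 HKc ll lb.
have ld := kerS_dominated del_gt0.
have sG : csmooth sup_fun.
  exact: (family_csmooth K0 ll lb csmooth_kerS ld).
split; first exact: smooth_csmooth.
move=> a b x; have [s _ E] := miter_foldr (@pderivR R d) b.
have [s1 s2 s3] := family_foldr K0 ll lb s csmooth_kerS ld.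
rewrite E (pderivR_foldr s sG).
have -> : (foldr (@dd R d) sup_fun s \o @vecC R d) x = l (fun w => foldr (@ddz R d d) kerS s (vecC x, w)).
  exact: (congr1 (fun f => f (vecC x)) s3).
have Kc0 : 0 <= Kc.
  by have := gsb_ge0 c0 (HKc 0); rewrite pmulr_lge0// expR_gt0.
have gw := gs_weight_gt0 theta a b c0.
have [m0|m0] := eqVneq (monomial a x) 0.
  by rewrite m0 normr0 mul0r; apply: mulr_ge0 (ltW gw); exact: mulr_ge0.
have n0 : 0 < `|monomial a x| by rewrite normr_gt0.
pose M := Kc * gs_weight theta c a b / `|monomial a x|.
have M0 : 0 <= M by rewrite divr_ge0 ?(ltW n0)// mulr_ge0// ltW.
have Hf w : cabs (foldr (@ddz R d d) kerS s (vecC x, w)) <= M * om w.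
  have [_ /(_ a b x)] := HKc w; rewrite E fbi_kernelE pderivR_foldr; last first.
    exact: (csmooth_slice w (csmooth_kerC phi)).
  have -> : foldr (@ddz R d d) kerS s (vecC x, w) =
    (foldr (@dd R d) (fun y => kerC phi (w, y)) s \o @vecC R d) x.
    exact: (congr1 (fun f => f (vecC x)) (foldr_ddz_slice kerS s w)).
  have -> : M * om w = Kc * expR (del * nC w `^ p + W w) * gs_weight theta c a b / `|monomial a x|.
    by rewrite /M /omw (addrC (W w)); ring.
  by rewrite ler_pdivlMr// mulrC.
have sf : csmooth (fun w => foldr (@ddz R d d) kerS s (vecC x, w)).
  exact: csmooth_slice.
rewrite mulrC; apply: le_trans (ler_wpM2r (ltW n0) (lb _ M sf M0 Hf)) _.
by rewrite -mulrA /M divfK ?gt_eqF// mulrA.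
Qed.

End SupSeries.

Lemma shrink (R : realType) (e x : R) : 0 < e -> 0 <= x -> e * (x / (x + 1)) < e.
Proof.
move=> e0 x0; have x1 : 0 < x + 1 by rewrite ltr_wpDl.
by rewrite -[ltRHS]mulr1 ltr_pM2l// ltr_pdivrMr// mul1r ltrDl.
Qed.

Section SeriesOfFunctionals.
Variables (R : realType) (d : nat) (theta : R) (phi : FBI_phase R d).
Hypotheses (d_gt0 : (0 < d)%N) (theta_ge : 2^-1 <= theta) (theta_lt : theta < 1).
Local Notation C := (Cplx R).
Local Notation V := 'rV[R]_d.
Local Notation Z := 'rV[C]_d.
Local Notation p := (theta^-1).
Local Notation W := (weight phi).
Variables (I : choiceType) (w : I -> R) (S : R).
Hypothesis w_ge0 : forall i, 0 <= w i.
Hypothesis w_bound : forall A : {fset I}, partial_sum w A <= S.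
Variables (l : I -> (Z -> C) -> C) (del : R).
Hypothesis del_gt0 : 0 < del.
Local Notation om := (omw theta phi del).
Hypothesis l_lin : forall i f g a b, dominated om f -> dominated om g ->
  l i (fun y => a * f y + b * g y) = a * l i f + b * l i g.
Hypothesis l_bound : forall i f M, csmooth f -> 0 <= M -> (forall y, cabs (f y) <= M * om y) ->
  cabs (l i f) <= w i * M.

Definition lser (f : Z -> C) : C := sum (fun i => l i f).
Definition ltail (A : {fset I}) (f : Z -> C) : C := lser f - partial_sum (fun i => l i f) A.

Lemma dual_sum (u : functional R d) (T : Type) (r : seq T) (F : T -> V -> C) :
  gs_dual theta u -> (forall i, gs theta (F i)) ->
  gs theta (fun y => \sum_(i <- r) F i y) /\
  u (fun y => \sum_(i <- r) F i y) = \sum_(i <- r) u (F i).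
Proof.
move=> du gF; elim: r => [|i r [gS uS]].
  have E : (fun y => \sum_(i <- [::]) F i y) = fun=> 0.
    by apply/funext => y; rewrite big_nil.
  have g0 : gs theta (fun=> 0 : C) := gdom_gs theta_ge theta_lt (@gdom0 R d).
  rewrite E big_nil; split=> //; have := proj1 du _ _ 0 0 g0 g0.
  set b := u (fun=> 0); rewrite (_ : 0 * b + 0 * b = 0); last by ring.
  by move=> <-; congr u; apply/funext => y; ring.
have -> : (fun y => \sum_(j <- i :: r) F j y) = fun y => 1 * F i y + 1 * \sum_(j <- r) F j y.
  by apply/funext => y; rewrite big_cons !mul1r.
by rewrite (proj1 du)// big_cons uS !mul1r; split=> //; exact: gs_lin.
Qed.

Lemma dominated_bound f : dominated om f -> exists2 M : R, 0 <= M & forall i, cabs (l i f) <= M * w i.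
Proof.
move=> [sf [M HM]].
have M0 : 0 <= M.
  rewrite -(pmulr_lge0 _ (expR_gt0 (W 0 + del * nC (0 : Z) `^ p))); apply: le_trans (HM 0).
  exact: cabs_ge0.
by exists M => // i; rewrite mulrC; exact: l_bound.
Qed.

Lemma ltail_lin A f g a b : dominated om f -> dominated om g ->
  ltail A (fun y => a * f y + b * g y) = a * ltail A f + b * ltail A g.
Proof.
move=> df dg; have [M M0 HM] := dominated_bound df; have [N N0 HN] := dominated_bound dg.
rewrite /ltail /lser.
have E : (fun i => l i (fun y => a * f y + b * g y)) = fun i => a * l i f + b * l i g.
  by apply/funext => i; rewrite l_lin.
rewrite E (sum_lin w_ge0 w_bound a b M0 N0 HM HN).
have -> : partial_sum (fun i => a * l i f + b * l i g) A =
    a * partial_sum (fun i => l i f) A + b * partial_sum (fun i => l i g) A.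
  by rewrite /partial_sum big_split !mulr_sumr.
ring.
Qed.

Lemma ltail_bound A e : (forall B : {fset I}, [disjoint A & B]%fset -> partial_sum w B <= e) ->
  forall f M, csmooth f -> 0 <= M -> (forall y, cabs (f y) <= M * om y) ->
  cabs (ltail A f) <= e * M.
Proof.
move=> HA f M sf M0 HM; rewrite mulrC; apply: (sum_dist w_ge0 w_bound M0) => // i.
by rewrite mulrC; exact: l_bound.
Qed.

Lemma lser_lin f g a b : dominated om f -> dominated om g ->
  lser (fun y => a * f y + b * g y) = a * lser f + b * lser g.
Proof.
move=> df dg; have := ltail_lin fset0 a b df dg.
by rewrite /ltail !psumE !big_seq_fset0 !subr0.
Qed.

Lemma lser_bound f M : csmooth f -> 0 <= M -> (forall y, cabs (f y) <= M * om y) ->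
  cabs (lser f) <= S * M.
Proof.
move=> sf M0 HM; have S0 : forall B : {fset I}, [disjoint fset0 & B]%fset -> partial_sum w B <= S.
  by move=> B _.
by have := ltail_bound S0 sf M0 HM; rewrite /ltail psumE big_seq_fset0 subr0.
Qed.

Let S_ge0 : 0 <= S.
Proof. by apply: le_trans (w_bound fset0); rewrite psumE big_seq_fset0. Qed.

Lemma psum_single i : w i <= S.
Proof. by have := w_bound [fset i]%fset; rewrite psumE big_seq_fset1. Qed.

Lemma li_bound i f M : csmooth f -> 0 <= M -> (forall y, cabs (f y) <= M * om y) ->
  cabs (l i f) <= S * M.
Proof.
move=> sf M0 HM; apply: le_trans (l_bound i sf M0 HM) _.
by apply: ler_wpM2r => //; exact: psum_single.
Qed.

Local Notation G i := (sup_fun phi (l i) \o @vecC R d).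
Local Notation Gsum := (sup_fun phi lser \o @vecC R d).

Lemma sup_series_gs : gs theta Gsum /\ forall i, gs theta (G i).
Proof.
have [c [Kc [c0 Kc0 HKc]]] := kernel_gsb phi d_gt0 theta_ge theta_lt del_gt0.
split=> [|i]; apply/gsP; exists c; eexists; split=> //.
  exact: (sup_gsb d_gt0 theta_ge theta_lt del_gt0 c0 S_ge0 HKc lser_lin lser_bound).
exact: (sup_gsb d_gt0 theta_ge theta_lt del_gt0 c0 S_ge0 HKc (l_lin i) (li_bound i)).
Qed.

(** The tail of the series is again a superposition, with a small constant; by [sup_gsb] its norm in
    one fixed step is small, and u is bounded on that step. *)
Lemma sup_series u : gs_dual theta u -> exists2 D : R, 0 <= D &
  (forall i, cabs (u (G i)) <= D * w i) /\ u Gsum = sum (fun i => u (G i)).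
Proof.
move=> du; have [c [Kc [c0 Kc0 HKc]]] := kernel_gsb phi d_gt0 theta_ge theta_lt del_gt0.
have [D D0 HD] := dual_bound d_gt0 du c0.
have [gsum gi] := sup_series_gs.
exists (D * Kc); first by rewrite mulr_ge0// ltW.
have bi i : cabs (u (G i)) <= D * Kc * w i.
  rewrite -mulrA (mulrC Kc); apply: HD.
  exact: (sup_gsb d_gt0 theta_ge theta_lt del_gt0 c0 (w_ge0 i) HKc (l_lin i) (l_bound i)).
split=> //; apply/esym; apply: sum_unique.
apply/(@cvgrPdist_lt _ _ _ totally _) => e /Cpos_re[-> e0].
have DK : 0 < D * Kc + 1 by rewrite ltr_wpDl// mulr_ge0// ltW.
have [A HA] := psum_tail w_bound (divr_gt0 e0 DK).
exists A => // B AB; rewrite Cnorm toC_lt.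
have HB (B' : {fset I}) : [disjoint B & B']%fset -> partial_sum w B' <= reC e / (D * Kc + 1).
  by move=> h; apply: HA; exact: fdisjointWl AB h.
have e'0 : 0 <= reC e / (D * Kc + 1) by rewrite divr_ge0 ?ltW.
have gt := sup_gsb d_gt0 theta_ge theta_lt del_gt0 c0 e'0 HKc (ltail_lin B) (ltail_bound HB).
have uB : u (sup_fun phi (ltail B) \o @vecC R d) = u Gsum - partial_sum (fun i => u (G i)) B.
  have E : sup_fun phi (ltail B) \o @vecC R d =
      fun y => 1 * (Gsum y) + (-1) * \sum_(i <- B) (G i) y.
    by apply/funext => y; rewrite /= /sup_fun /ltail psumE mul1r mulN1r.
  have [gB uBE] := dual_sum (enum_fset B) du gi.
  by rewrite E (proj1 du)// uBE psumE mul1r mulN1r.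
rewrite -uB; apply: le_lt_trans (HD _ _ gt) _.
have -> : D * (reC e / (D * Kc + 1) * Kc) = reC e * (D * Kc / (D * Kc + 1)) by ring.
by apply: shrink => //; rewrite mulr_ge0// ltW.
Qed.

End SeriesOfFunctionals.

Section GlidingHump.
Variables (R : realType) (T : Type) (q : nat -> T -> R).
Hypothesis q_ge0 : forall n z, 0 <= q n z.

(* Gliding hump, in place of the Banach-Steinhaus theorem. *)
Lemma hump : (forall n, exists B : R, forall z, q n z <= B) ->
  (forall z, exists P : R, forall n, q n z <= P) ->
  (forall (e : nat -> R) (z : nat -> T), (forall j, 0 < e j /\ e j <= 2^-1 ^+ j) ->
    exists H : R, forall n k b, (forall N, \sum_(j < N | j != k :> nat) e j * q n (z j) <= b) ->
      e k * q n (z k) <= H + b) ->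
  exists2 K : R, 0 <= K & forall n z, q n z <= K.
Proof.
move=> HB HP HS; apply: contrapT => nK.
have /boolp.choice[pick Hpick] : forall K : R, exists r : nat * T, K < q r.1 r.2.
  move=> K; apply: contrapT => h; apply: nK; exists `|K| => // n z.
  rewrite leNgt; apply/negP => h'; apply: h; exists (n, z).
  exact: le_lt_trans (ler_norm _) h'.
have /boolp.choice[B HB'] : forall n, exists B : R, 0 <= B /\ forall z, q n z <= B.
  move=> n; have [B hB] := HB n; exists `|B|; split=> // z.
  exact: le_trans (hB z) (ler_norm _).
have /boolp.choice[P HP'] := HP.
(* A state is the coefficient e_k, the bound h_k = sum_(j < k) e_j P (z_j) for the earlier terms,
   and a pair (n_k, z_k) with e_k q (n_k, z_k) > k + 1 + h_k. Dividing by 2 (1 + B (n_k)) makes the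
   later terms contribute at most 1 in total at n_k. *)
pose step k (s : R * R * (nat * T)) :=
  let e := s.1.1 / (2 * (1 + B s.2.1)) in let h := s.1.2 + s.1.1 * P s.2.2 in
  (e, h, pick ((k.+2%:R + h) / e)).
pose st := fix st k := if k is k'.+1 then step k' (st k') else (1, 0, pick 1).
pose e k := (st k).1.1; pose h k := (st k).1.2; pose n k := (st k).2.1; pose z k := (st k).2.2.
have eS k : e k.+1 = e k / (2 * (1 + B (n k))) by [].
have hS k : h k.+1 = h k + e k * P (z k) by [].
have B0 k : 0 < 2 * (1 + B (n k)).
  by have [b0 _] := HB' (n k); rewrite mulr_gt0// ltr_pwDl.
have e0 k : 0 < e k by elim: k => [|k IH]; [exact: ltr01|rewrite eS divr_gt0].
have qS k : k.+1%:R + h k < e k * q (n k) (z k).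
  have main : (k.+1%:R + h k) / e k < q (n k) (z k).
    case: k => [|k]; last exact: Hpick.
    by rewrite /e /h /= addr0 divr1; exact: Hpick.
  by rewrite mulrC -ltr_pdivrMr.
have e2 k : e k.+1 <= e k / 2.
  rewrite eS; apply: ler_wpM2l; first exact: ltW.
  rewrite lef_pV2 ?posrE// ?B0//; have [b0 _] := HB' (n k); lra.
have eb j : e j <= 2^-1 ^+ j.
  elim: j => [|j IH]; first by rewrite expr0.
  apply: le_trans (e2 j) _; rewrite exprS mulrC; exact: ler_wpM2l.
have eB k i : e (k.+1 + i)%N * B (n k) <= 2^-1 ^+ i.+1.
  have [b0 _] := HB' (n k).
  elim: i => [|i IH].
    rewrite addn0 expr1 eS.
    have k1 : e k <= 1 by apply: le_trans (eb k) _; apply: exprn_ile1; lra.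
    have -> : e k / (2 * (1 + B (n k))) * B (n k) = e k * (B (n k) / (1 + B (n k))) / 2.
      by field; rewrite gt_eqF// ltr_pwDl.
    have b1 : B (n k) / (1 + B (n k)) <= 1 by rewrite ler_pdivrMr ?ltr_pwDl// mul1r lerDr.
    have b2 : 0 <= B (n k) / (1 + B (n k)) by rewrite divr_ge0// addr_ge0.
    have := ler_pM (ltW (e0 k)) b2 k1 b1; lra.
  rewrite addnS exprS; apply: (@le_trans _ _ (e (k.+1 + i)%N / 2 * B (n k))).
    exact: ler_wpM2r.
  by rewrite mulrAC mulrC; apply: ler_wpM2l.
have [H HH] := HS e z (fun j => conj (e0 j) (eb j)).
have low k N : (N <= k)%N -> \sum_(j < N | j != k :> nat) e j * q (n k) (z j) <= h N.
  elim: N => [_|N IH Nk]; first by rewrite big_ord0.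
  rewrite big_mkcond big_ord_recr -big_mkcond /= hS (ltn_eqF Nk) /=.
  apply: lerD; first exact/IH/ltnW.
  apply: ler_wpM2l; first exact: ltW.
  exact: HP'.
have high k i : \sum_(j < k.+1 + i | j != k :> nat) e j * q (n k) (z j) <= h k + 1 - 2^-1 ^+ i.
  elim: i => [|i IH].
    rewrite addn0 expr0 big_mkcond big_ord_recr -big_mkcond /= eqxx /= addr0 addrK.
    exact: low.
  rewrite addnS big_mkcond big_ord_recr -big_mkcond /= gtn_eqF ?leq_addr//=.
  have h1 : e (k.+1 + i)%N * q (n k) (z (k.+1 + i)%N) <= 2^-1 ^+ i.+1.
    apply: le_trans (eB k i); apply: ler_wpM2l; first exact: ltW.
    by have [_] := HB' (n k); exact.
  have -> : 2^-1 ^+ i.+1 = 2^-1 ^+ i - 2^-1 ^+ i.+1 :> R by rewrite !exprS; field.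
  lra.
have all k : forall N, \sum_(j < N | j != k :> nat) e j * q (n k) (z j) <= h k + 1.
  move=> N; apply: (@le_trans _ _ (\sum_(j < k.+1 + N | j != k :> nat) e j * q (n k) (z j))).
    rewrite (addnC k.+1) [leRHS]big_mkcond big_split_ord /= [leLHS]big_mkcond /=.
    rewrite lerDl; apply: sumr_ge0 => j _; case: ifP => // _.
    by rewrite mulr_ge0// ltW.
  apply: le_trans (high k N) _; have : 0 <= 2^-1 ^+ N :> R by rewrite exprn_ge0.
  lra.
(* The other terms at n_k sum to at most h_k + 1, so the hypothesis gives k + 1 + h_k < H + h_k + 1
   for every k; an index beyond H contradicts it. *)
have [k /andP[_ hk]] := nat_floor (normr_ge0 H).
have hH : H <= k.+1%:R := le_trans (ler_norm _) hk.
have h1 := HH (n k.+1) k.+1 _ (all k.+1); have := lt_le_trans (qS k.+1) h1.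
rewrite -(natr1 k.+1); lra.
Qed.

End GlidingHump.

Section WeaklyNull.
Variables (R : realType) (d : nat) (theta : R) (phi : FBI_phase R d).
Hypotheses (d_gt0 : (0 < d)%N) (theta_ge : 2^-1 <= theta) (theta_lt : theta < 1).
Local Notation C := (Cplx R).
Local Notation Z := 'rV[C]_d.
Local Notation p := (theta^-1).
Local Notation W := (weight phi).

Lemma fset_nat_le (f : nat -> R) (A : {fset nat}) : (forall j, 0 <= f j) ->
  exists N, \sum_(j <- A) f j <= \sum_(j < N) f j.
Proof.
move=> f0; have [N HN] : exists N, forall j, j \in A -> (j < N)%N.
  exists (\max_(j : A) val j).+1 => j jA; rewrite ltnS.
  exact: (@leq_bigmax _ (fun j : A => val j) [` jA]%fset).
exists N; rewrite -(big_mkord xpredT f) [leRHS](bigID (mem A)) /= -[leLHS]addr0.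
apply: lerD; last by apply: sumr_ge0.
rewrite -[leRHS]big_filter le_eqVlt; apply/orP; left; apply/eqP; apply: perm_big.
apply: uniq_perm; rewrite ?filter_uniq ?iota_uniq ?fset_uniq// => j.
rewrite mem_filter mem_index_iota /=; case jA : (j \in A) => //=.
by rewrite HN.
Qed.

Lemma weight_nat_ge0 j : 0 <= 2^-1 ^+ j :> R. Proof. by rewrite exprn_ge0. Qed.

Lemma weight_nat (A : {fset nat}) : partial_sum (fun j => 2^-1 ^+ j : R) A <= 2.
Proof.
have [N] := fset_nat_le A weight_nat_ge0; rewrite psumE => h; apply: le_trans h _.
have h12 : (0 < 2^-1 :> R) && (2^-1 < 1 :> R) by apply/andP; split; lra.
by apply: le_trans (geo_bound N h12) _; have -> : 1 - 2^-1 = 2^-1 :> R; [lra|rewrite invrK].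
Qed.

(** One term of a series is at most the sum of the series plus the others. In the gliding hump, the
    sum is the value of a functional at a single test function and is bounded by weak
    convergence. *)
Lemma sum_peel (x : nat -> C) (w : nat -> R) (D S b : R) k : 0 <= D -> (forall j, 0 <= w j) ->
  (forall A : {fset nat}, partial_sum w A <= S) -> (forall j, cabs (x j) <= D * w j) ->
  (forall N, \sum_(j < N | j != k :> nat) cabs (x j) <= b) -> cabs (x k) <= cabs (sum x) + b.
Proof.
move=> D0 wg wb hx hb; apply/ler_addgt0Pr => e e0.
have D1 : 0 < D + 1 by rewrite ltr_wpDl.
have [A HA] := psum_tail wb (divr_gt0 e0 D1).
pose B := (k |` A)%fset.
have HB (B' : {fset nat}) : [disjoint B & B']%fset -> partial_sum w B' <= e / (D + 1).
  by move=> h; apply: HA; apply: fdisjointWl h; exact: fsubsetU1.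
have h1 := sum_dist wg wb D0 hx HB.
have h2 : D * (e / (D + 1)) <= e.
  have -> : D * (e / (D + 1)) = e * (D / (D + 1)) by ring.
  exact/ltW/shrink.
have kB : k \in B by rewrite !inE eqxx.
have E : partial_sum x B = x k + \sum_(j <- B | j != k) x j.
  by rewrite psumE (bigD1_seq k)//= fset_uniq.
have h3 : cabs (\sum_(j <- B | j != k) x j) <= b.
  rewrite big_mkcond /=; apply: le_trans (cabs_sum _ _ _) _.
  have f0 j : 0 <= cabs (if j != k then x j else 0) by exact: cabs_ge0.
  have [N HN] := fset_nat_le B f0; apply: le_trans HN _; apply: le_trans (hb N).
  rewrite [leRHS]big_mkcond /=; apply: ler_sum => j _.
  by case: ifP => // _; rewrite cabs0.
have -> : x k = partial_sum x B - \sum_(j <- B | j != k) x j by rewrite E addrK.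
apply: le_trans (cabsB _ _) _; rewrite addrAC; apply: lerD => //.
have -> : partial_sum x B = sum x - (sum x - partial_sum x B) by rewrite subKr.
apply: le_trans (cabsB _ _) _; rewrite lerD2l; exact: le_trans h1 h2.
Qed.

(** The test function required by [hump] is sum_j e_j K_(z_j) / om (z_j). It lies in S_theta because
    the kernels divided by [om] are bounded in one step, and weak convergence bounds all functionals
    on it. *)
Lemma weakly_null_growth (un : nat -> functional R d) (del : R) :
  (forall n, gs_dual theta (un n)) -> weak_cvg0 theta un -> 0 < del ->
  exists2 K : R, 0 <= K & forall n z, cabs (fbi phi (un n) z) <= K * expR (del * nC z `^ p + W z).
Proof.
move=> du w0 del0.
pose om z := omw theta phi del z.
have om0 z : 0 < om z by exact: expR_gt0.
pose q n z := cabs (un n (fbi_kernel phi z)) / om z.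
have [K K0 HK] : exists2 K : R, 0 <= K & forall n z, q n z <= K.
  have [c [Kc [c0 Kc0 HKc]]] := kernel_gsb phi d_gt0 theta_ge theta_lt del0.
  apply: hump.
  - by move=> n z; rewrite divr_ge0 ?cabs_ge0// ltW.
  - move=> n; have [D D0 HD] := dual_bound d_gt0 (du n) c0; exists (D * Kc) => z.
    rewrite ler_pdivrMr// -mulrA; apply: le_trans (HD _ _ (HKc z)) _.
    by rewrite /om /omw addrC.
  - move=> z; have /cvg0P/(_ 1 ltr01)[N _ HN] := w0 _ (kernel_gs phi d_gt0 theta_ge theta_lt z).
    exists ((1 + \sum_(j < N) cabs (un j (fbi_kernel phi z))) / om z) => n.
    apply: ler_wpM2r; first by rewrite invr_ge0 ltW.
    have s0 : 0 <= \sum_(j < N) cabs (un j (fbi_kernel phi z)).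
      by apply: sumr_ge0 => j _; exact: cabs_ge0.
    have [nN|nN] := leqP N n.
      apply: (@le_trans _ _ 1); last by rewrite lerDl.
      by apply: ltW; exact: HN.
    rewrite (bigD1 (Ordinal nN))//= addrCA lerDl addr_ge0//.
    by apply: sumr_ge0 => j _; exact: cabs_ge0.
  - move=> e z he.
    (* Normalized so that the n-th functional has modulus e_j q n (z_j) on the j-th term. *)
    pose lam j : C := toC (e j / om (z j)).
    have cl j : cabs (lam j) = e j / om (z j).
      by rewrite cabs_toC ger0_norm// divr_ge0 ?ltW//; have [] := he j.
    pose l j (f : Z -> C) := lam j * f (z j).
    have ll i f g a b : dominated (omw theta phi del) f -> dominated (omw theta phi del) g ->
        l i (fun y => a * f y + b * g y) = a * l i f + b * l i g by rewrite /l => _ _; ring.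
    have lb i f M : csmooth f -> 0 <= M -> (forall y, cabs (f y) <= M * omw theta phi del y) ->
        cabs (l i f) <= 2^-1 ^+ i * M.
      move=> _ M0 HM; rewrite /l cabsM cl.
      apply: le_trans (ler_wpM2l _ (HM (z i))) _; first by rewrite -cl cabs_ge0.
      rewrite -/(om (z i)) mulrCA divfK ?gt_eqF// mulrC; apply: ler_wpM2r => //.
      by have [] := he i.
    have [gsum gi] := sup_series_gs d_gt0 theta_ge theta_lt weight_nat_ge0 weight_nat del0 ll lb.
    have /cvg0P/(_ 1 ltr01)[N _ HN] := w0 _ gsum.
    pose g := sup_fun phi (lser l) \o @vecC R d.
    exists (1 + \sum_(j < N) cabs (un j g)) => n k b hb.
    have [D D0 [hD uE]] := sup_series d_gt0 theta_ge theta_lt weight_nat_ge0 weight_nat del0 ll lb (du n).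
    have xE j : cabs (un n (sup_fun phi (l j) \o @vecC R d)) = e j * q n (z j).
      have -> : sup_fun phi (l j) \o @vecC R d = fun y => lam j * fbi_kernel phi (z j) y.
        by rewrite fbi_kernelE.
      rewrite (gs_linearZ _ (proj1 (du n))); last exact: kernel_gs.
      by rewrite cabsM cl /q mulrAC mulrA.
    have hb' N' : \sum_(j < N' | j != k :> nat) cabs (un n (sup_fun phi (l j) \o @vecC R d)) <= b.
      by apply: le_trans (hb N'); apply: ler_sum => j _; rewrite xE.
    have h := sum_peel D0 weight_nat_ge0 weight_nat hD hb'.
    have h' : cabs (un n (sup_fun phi (l k) \o @vecC R d)) <= cabs (un n g) + b.
      by apply: le_trans h _; rewrite lerD2r /g; move: uE => ->.
    rewrite -xE; apply: le_trans h' _; rewrite lerD2r.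
    have s0 : 0 <= \sum_(j < N) cabs (un j g) by apply: sumr_ge0 => j _; exact: cabs_ge0.
    have [nN|nN] := leqP N n.
      apply: (@le_trans _ _ 1); last by rewrite lerDl.
      by apply: ltW; exact: HN.
    rewrite (bigD1 (Ordinal nN))//= addrCA lerDl addr_ge0//.
    by apply: sumr_ge0 => j _; exact: cabs_ge0.
exists (cabs (toC (c_phi phi) : C) * K); first by rewrite mulr_ge0 ?cabs_ge0.
move=> n z; rewrite /fbi cabsM -mulrA; apply: ler_wpM2l; first exact: cabs_ge0.
have := HK n z; rewrite /q ler_pdivrMr// /om /omw addrC; exact.
Qed.

End WeaklyNull.

(** * The operator on test functions *)

Section SymbolDecay.
Variables (R : realType) (d : nat) (theta : R).
Hypotheses (theta_ge : 2^-1 <= theta) (theta_lt : theta < 1).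
Local Notation C := (Cplx R).
Local Notation p := (theta^-1).
Variables (W : 'rV[C]_d -> R) (L : R) (h : mindex d -> 'rV[C]_d -> C).
Hypothesis L_gt0 : 0 < L.
Hypothesis W_lip : forall z w, W (z + w) <= W z + L * (nC z * nC w + nC w ^+ 2).
Hypothesis h_bound : forall e : R, 0 < e -> exists2 D : R, 0 < D & forall a z,
  cabs (h a z) <= D * (e ^+ mabs a / (mfact a)%:R `^ theta) * expR (e * nC z `^ p).

Lemma symbol_decay (e : R) : 0 < e -> exists e' K : R, [/\ 0 < e', 0 < K &
  forall F a z (M : R), csmooth F -> 0 <= M ->
  (forall w, cabs (F w) <= M * expR (- (e * nC w `^ p) + W w)) ->
  cabs (h a z * miter (@pderivC R d) a F z) <=
  K * M * expR (- (e' * nC z `^ p) + W z - (mabs a)%:R)].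
Proof.
(* On the Cauchy ball |z|^p <= 4 (|z + w|^p + 1 + |a|): the rate e becomes e / 4 in z at the cost of
   exp (e (1 + |a|)). The part e of N pays for the latter and 1 remains; e / 8 is lost in
   [symbol_core]. *)
move=> e0; have N0 : 0 <= e + 1 by rewrite addr_ge0// ltW.
have [K K0 HK] := symbol_core theta_ge theta_lt L_gt0 W_lip h_bound N0 (divr_gt0 e0 (ltr0Sn R 7)).
exists (e / 8), (K * expR e); split; rewrite ?divr_gt0 ?mulr_gt0 ?expR_gt0//.
move=> F a z M sF M0 HF; pose n : R := (mabs a)%:R; pose X := nC z `^ p.
apply: le_trans (HK F a z M (- (e / 4 * X) + e * (1 + n)) sF M0 _) _.
  move=> w wr; apply: le_trans (HF _) _; apply: ler_wpM2l => //; rewrite ler_expR lerD2r.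
  have h1 : X <= 4 * (nC (z + w) `^ p + nC w `^ p).
    by apply: powRp_tri; rewrite ?nC_ge0// -{1}(addrK w z); apply: le_trans (nCD _ _) _; rewrite nCN.
  have h2 : nC w `^ p <= 1 + n.
    apply: le_trans (powRp_le_sqr theta_ge theta_lt (nC_ge0 _)) _; rewrite lerD2l.
    apply: (@le_trans _ _ (((mabs a)%:R `^ (1 - theta)) ^+ 2)).
      by rewrite lerXn2r ?nnegrE ?nC_ge0 ?powR_ge0.
    exact: nat_powR_sqr.
  have h3 := ler_wpM2l (ltW e0) h1; have h4 := ler_wpM2l (ltW e0) h2.
  rewrite mulrCA mulrDr in h3; rewrite -/n; lra.
have -> B : K * expR e * M * B = K * M * (expR e * B) by ring.
apply: ler_wpM2l; first by rewrite mulr_ge0// ltW.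
rewrite -expRD ler_expR -/n -/X; lra.
Qed.

End SymbolDecay.

Section Embedding.
Variables (R : realType) (d : nat) (theta : R) (phi : FBI_phase R d).
Hypotheses (d_gt0 : (0 < d)%N) (theta_ge : 2^-1 <= theta) (theta_lt : theta < 1).
Local Notation C := (Cplx R).
Local Notation V := 'rV[R]_d.
Local Notation Z := 'rV[C]_d.
Local Notation p := (theta^-1).
Local Notation W := (weight phi).

Lemma sum_conj (I : choiceType) (w : I -> R) (S M : R) (x : I -> C) :
  (forall i, 0 <= w i) -> (forall A : {fset I}, partial_sum w A <= S) -> 0 <= M ->
  (forall i, cabs (x i) <= M * w i) -> sum (fun i => cconj (x i)) = cconj (sum x).
Proof.
move=> w0 wS M0 hx; apply: sum_unique.
have /(@cvgrPdist_lt _ _ _ totally _) cx := sum_cvg w0 wS M0 hx.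
apply/(@cvgrPdist_lt _ _ _ totally _) => e e0; have := cx e e0; apply: filterS => A.
have -> : partial_sum (fun i => cconj (x i)) A = cconj (partial_sum x A).
  rewrite !psumE; elim: (enum_fset A) => [|i s IH]; last by rewrite !big_cons IH conjCD.
  by rewrite !big_nil; apply: complexP; rewrite ?reC_conj ?imC_conj ?reC0 ?imC0 ?oppr0.
by rewrite !Cnorm -conjCN -conjCD cabs_conj.
Qed.

Lemma mul_close (a b : C) (h : R) : 0 < h -> exists2 e : R, 0 < e & forall a' b',
  cabs (a' - a) < e -> cabs (b' - b) < e -> cabs (a' * b' - a * b) < h.
Proof.
move=> h0; pose S := cabs a + cabs b + 1.
have S0 : 0 < S by rewrite ltr_pwDr// addr_ge0 ?cabs_ge0.
exists (Num.min 1 (h / S)); first by rewrite lt_min ltr01 divr_gt0.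
move=> a' b'; rewrite !lt_min => /andP[a1 a2] /andP[b1 b2].
rewrite ltr_pdivlMr// in a2; rewrite ltr_pdivlMr// in b2.
have -> : a' * b' - a * b = (a' - a) * (b' - b) + ((a' - a) * b + a * (b' - b)) by ring.
apply: le_lt_trans (cabsD _ _) _; apply: le_lt_trans (lerD (lexx _) (cabsD _ _)) _.
rewrite !cabsM; move: a1 a2 b1 b2 (cabs_ge0 (a' - a)) (cabs_ge0 (b' - b)) (cabs_ge0 a) (cabs_ge0 b).
rewrite /S; move: (cabs (a' - a)) (cabs (b' - b)) (cabs a) (cabs b) => x y s t x1 x2 y1 y2 x0 y0 s0 t0.
wlog xy : x y s t x1 x2 y1 y2 x0 y0 s0 t0 / x <= y.
  move=> H; have [xy|/ltW yx] := leP x y; first exact: H.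
  have := H y x t s y1 _ x1 _ y0 x0 t0 s0 yx.
  rewrite (addrC t s) => H'; have := H' y2 x2.
  by rewrite (mulrC y x) (mulrC y s) (mulrC t x) (addrC (s * y)).
apply: le_lt_trans y2.
have h1 : x * y <= 1 * y by rewrite ler_wpM2r// ltW.
have h2 : x * t <= y * t by rewrite ler_wpM2r.
rewrite !mulrDr mulr1 (mulrC y s) mul1r in h1 *; lra.
Qed.

Lemma contRC_mul (f g : V * Z -> C) : contRC f -> contRC g -> contRC (fun q => f q * g q).
Proof.
move=> cf cg q h h0; have [e e0 He] := mul_close (f q) (g q) h0.
have [r r0 Hr] := cf q e e0; have [t t0 Ht] := cg q e e0.
exists (Num.min r t); first by rewrite lt_min r0.
move=> q'; rewrite !lt_min => /andP[a1 a2] /andP[b1 b2].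
by apply: He; [exact: Hr|exact: Ht].
Qed.

Lemma contRC_fst (f : V -> C) : contR f -> contRC (fun q => f q.1).
Proof. by move=> cf q h h0; have [e e0 He] := cf q.1 h h0; exists e => // q' /He. Qed.

Lemma contRC_snd (f : Z -> C) : contC f -> contRC (fun q => f q.2).
Proof. by move=> cf q h h0; have [e e0 He] := cf q.2 h h0; exists e => // q' _ /He. Qed.

Lemma contRC_kernel : contRC (fun q => fbi_kernel phi q.2 q.1).
Proof.
move=> q h h0; have eC : 0 < toC h by rewrite -toC0 toC_lt.
have := differentiable_continuous (csmooth_diff (q.2, vecC q.1) (csmooth_kerC phi)).
move=> /(@cvgrPdist_lt _ _ _ (nbhs _) (nbhs_filter _))/(_ _ eC).
case=> -[P Q] /= [/nbhs_nC[r r0 Hr] /nbhs_nC[t t0 Ht]] PQ.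
exists (Num.min r t); first by rewrite lt_min r0.
move=> q'; rewrite !lt_min => /andP[a1 a2] /andP[b1 b2].
have qq : (P `*` Q) (q'.2, vecC q'.1).
  by split; [exact: Hr|apply: Ht; rewrite -vecCB nC_vecC].
have H := PQ _ qq.
have {}H : cabs (kerC phi (q.2, vecC q.1) - kerC phi (q'.2, vecC q'.1)) < h.
  by rewrite -toC_lt -Cnorm; exact: H.
rewrite !fbi_kernelE cabsBC; exact: H.
Qed.

Lemma kernel_bound z (y : V) : cabs (fbi_kernel phi z y) <= expR (W z).
Proof.
have [a pQ] := phC_posim phi d_gt0; have [a0 _ _] := pQ.
rewrite fbi_kernel_split cabsM cabs_pref// -[leRHS]mulr1; apply: ler_wpM2l; first exact: expR_ge0.
apply: le_trans (gpC_bound _ _ (vecC y) pQ) _; rewrite -expR0 ler_expR.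
rewrite reV_vecC imV_vecC nR0 expr0n mulr0 mul0r !addr0 oppr_le0.
by rewrite mulr_ge0 ?sqr_ge0// divr_ge0// ltW.
Qed.

Lemma contC_conj (G : Z -> C) : contC G -> contC (fun z => cconj (G z)).
Proof.
move=> cG z h h0; have [r r0 Hr] := cG z h h0; exists r => // z' /Hr.
by rewrite -conjCN -conjCD cabs_conj.
Qed.

Lemma contC_kernel y : contC (fun z => fbi_kernel phi z y).
Proof.
move=> z h h0; have [r r0 Hr] := contRC_kernel (y, z) h0; exists r => // z' hz.
by apply: (Hr (y, z')) => //; rewrite subrr nR0.
Qed.

Lemma kernel_pair_bound (e : R) : 0 < e -> exists2 B : R, 0 < B & forall (G : Z -> C) (M : R) y,
  0 <= M -> (forall z, cabs (G z) <= M * expR (- (e * nC z `^ p) + W z)) ->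
  forall z, cabs (cconj (G z) * fbi_kernel phi z y * toC (expR (- (2 * W z)))) <=
    M * B * expR (- (2 * nC z)).
Proof.
move=> e0; have [N N0 HN] := lin_le_powRp theta_ge theta_lt (divr_gt0 e0 (ltr0Sn R 1)).
exists (expR (2 * N)) => [|G M y M0 hG z]; first exact: expR_gt0.
rewrite !cabsM cabs_conj cabs_toC ger0_norm ?expR_ge0//.
apply: le_trans (ler_wpM2r (expR_ge0 _) (ler_pM (cabs_ge0 _) (cabs_ge0 _) (hG z) (kernel_bound z y))) _.
rewrite -!mulrA; apply: ler_wpM2l => //; rewrite -!expRD ler_expR.
have := HN _ (nC_ge0 z); lra.
Qed.

Lemma embed_fubini (G : Z -> C) (e M : R) f : 0 < e -> 0 <= M -> contC G ->
  (forall z, cabs (G z) <= M * expR (- (e * nC z `^ p) + W z)) -> gs theta f ->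
  embed f (fun y => integralC (fun z => cconj (G z) * fbi_kernel phi z y * toC (expR (- (2 * W z))))) =
  integralC (fun z => cconj (G z) * embed f (fbi_kernel phi z) * toC (expR (- (2 * W z)))).
Proof.
move=> e0 M0 cG hG gf; have [B B0 HB] := kernel_pair_bound e0.
case/gsP: (gf) => [c [m [c0 gf']]]; have m0 := gsb_ge0 c0 gf'.
have [K K0 HK] := gs_okR d_gt0 theta_ge theta_lt c0; have [cf bf] := HK _ _ gf'.
pose X (q : V * Z) := cconj (G q.2) * fbi_kernel phi q.2 q.1 * toC (expR (- (2 * W q.2))).
pose F (q : V * Z) := f q.1 * X q.
have cF : contRC F.
  apply: contRC_mul; first exact: (contRC_fst cf).
  apply: contRC_mul; last exact: (contRC_snd (contC_weight phi d_gt0)).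
  by apply: contRC_mul; [exact: (contRC_snd (contC_conj cG))|exact: contRC_kernel].
have A0 : 0 <= K * m * (M * B) by rewrite !mulr_ge0 ?(ltW K0) ?(ltW B0).
have bF q : cabs (F q) <= K * m * (M * B) * expR (- nR q.1) * expR (- (2 * nC q.2)).
  have -> : K * m * (M * B) * expR (- nR q.1) * expR (- (2 * nC q.2)) =
    K * m * expR (- nR q.1) * (M * B * expR (- (2 * nC q.2))) by ring.
  rewrite cabsM; apply: ler_pM; rewrite ?cabs_ge0//; exact: HB.
have okX y : okC (M * B) (fun z => X (y, z)).
  split; last by move=> z; exact: HB.
  apply: contC_mul (contC_weight phi d_gt0).
  by apply: contC_mul; [exact: contC_conj|exact: contC_kernel].
have E := integral_fubini A0 cF bF.
transitivity (integralR (fun y => integralC (fun z => F (y, z)))).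
  rewrite /embed; congr integralR; apply/funext => y.
  have := integralC_lin (f y) 0 (okX y) (okX y); rewrite mul0r addr0 => <-.
  by congr integralC; apply/funext => z; rewrite mul0r addr0.
rewrite E; congr integralC; apply/funext => z.
have [M' oM] := gs_pair_ok d_gt0 theta_ge theta_lt gf (kernel_gs phi d_gt0 theta_ge theta_lt z).
have -> : cconj (G z) * embed f (fbi_kernel phi z) * toC (expR (- (2 * W z))) =
  cconj (G z) * toC (expR (- (2 * W z))) * embed f (fbi_kernel phi z) by ring.
rewrite /embed -(integralR_scale _ oM); congr integralR; apply/funext => y.
by rewrite /F /X /=; ring.
Qed.

Variable h : mindex d -> Z -> C.
Hypothesis h_entire : forall a, entire (h a).
Hypothesis h_bound : forall e : R, 0 < e -> exists2 D : R, 0 < D & forall a z,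
  cabs (h a z) <= D * (e ^+ mabs a / (mfact a)%:R `^ theta) * expR (e * nC z `^ p).

(** Fubini moves the integral over C^d inside the pairing, exhibiting T^* G as the conjugate of a
    superposition of kernels. The conjugations come from the sesquilinear pairing that defines
    [fbi_adj]. *)
Lemma adj_embed (G : Z -> C) (e M : R) v : 0 < e -> 0 <= M -> contC G ->
  (forall z, cabs (G z) <= M * expR (- (e * nC z `^ p) + W z)) -> gs theta v ->
  fbi_adj phi G v = cconj (embed (fun y => cconj (v y))
    (fun y => integralC (fun z => cconj (toC (c_phi phi) * G z) * fbi_kernel phi z y *
      toC (expR (- (2 * W z)))))).
Proof.
move=> e0 M0 cG hG gv; have gv' := gs_conj d_gt0 gv; set c : C := toC (c_phi phi).
have cG' : contC (fun z => c * G z).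
  move=> z q q0; have [r r0 Hr] := mul_close c (G z) q0.
  have [t t0 Ht] := cG z r r0; exists t => // z' /Ht hz; apply: Hr => //.
  by rewrite subrr cabs0.
have hG' z : cabs (c * G z) <= cabs c * M * expR (- (e * nC z `^ p) + W z).
  by rewrite cabsM -mulrA; apply: ler_wpM2l; rewrite ?cabs_ge0.
rewrite (embed_fubini e0 (mulr_ge0 (cabs_ge0 c) M0) cG' hG' gv').
have [e1 [K1 [e10 K10 HT]]] : exists e1 K1 : R, [/\ 0 < e1, 0 <= K1 &
    forall z, cabs (Tst phi v z) <= K1 * expR (- (e1 * nC z `^ p) + W z)].
  case/gsP: (gv) => [c1 [m [c10 gv1]]].
  have [e1 [K1 [h1 h2 h3]]] := Tst_bound phi d_gt0 theta_ge theta_lt c10.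
  exists e1, (K1 * m); split=> //; last exact: h3.
  by rewrite mulr_ge0//; exact: gsb_ge0 gv1.
have [P P0 HP] := pair_ok phi d_gt0 theta_ge theta_lt e0.
have okk : okC (P * (M * K1)) (fun z => G z * Tst phi v z * toC (expR (- (2 * W z)))).
  apply: HP => //; first exact: mulr_ge0.
    exact: (Tst_contC phi d_gt0 theta_ge theta_lt gv).
  move=> z; apply: le_trans (ler_pM (cabs_ge0 _) (cabs_ge0 _) (hG z) (HT z)) _.
  rewrite mulrACA -expRD; apply: ler_wpM2l; first exact: mulr_ge0.
  rewrite ler_expR; have := mulr_ge0 (ltW e10) (powR_ge0 (nC z) p); lra.
rewrite fbi_adjE /adj_pair -[LHS]cconjK -(integralC_conj okk); congr (cconj (integralC _)).
apply/funext => z; rewrite !conjCM conjC_toC conjC_toC /Tst cconjK /fbi -/c.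
by ring.
Qed.

(** The function g is the conjugate of the superposition of kernels weighted by all symbol terms.
    The transform of f decays by [Tst_bound], the symbol terms do by [symbol_decay], so
    [sup_series_gs] puts g in S_theta; [adj_embed] and [sup_series] identify its pairings with those
    of the operator. *)
Lemma opA_embed f : gs theta f -> exists2 g, gs theta g &
  forall v, gs theta v -> opA phi h (embed f) v = embed g v.
Proof.
move=> gf; have gf' := gs_conj d_gt0 gf.
have du := embed_dual d_gt0 theta_ge theta_lt gf.
case/gsP: (gf') => [c0 [m [c00 gm]]]; have m0 := gsb_ge0 c00 gm.
have [e0 [K0 [e00 K00 HT]]] := Tst_bound phi d_gt0 theta_ge theta_lt c00.
have [L L0 HL] := weight_lip phi d_gt0.
have [e [K [e_gt0 K_gt0 HS]]] := symbol_decay theta_ge theta_lt L0 HL h_bound e00.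
pose M := K * (K0 * m); have M0 : 0 <= M by rewrite mulr_ge0 ?(ltW K_gt0)// mulr_ge0.
pose G a := symbol_term phi h (embed f) a.
have hF z : cabs (fbi phi (embed f) z) <= K0 * m * expR (- (e0 * nC z `^ p) + W z).
  have -> : fbi phi (embed f) z = cconj (Tst phi (fun y => cconj (f y)) z).
    rewrite /Tst cconjK; congr (fbi phi (embed _) z).
    by apply/funext => y; rewrite cconjK.
  by rewrite cabs_conj; exact: HT gm z.
have hG a z : cabs (G a z) <= M * mweight R a * expR (- (e * nC z `^ p) + W z).
  apply: le_trans (HS _ a z _ (fbi_csmooth phi d_gt0 theta_ge theta_lt du) (mulr_ge0 K00 m0) hF) _.
  rewrite -/M -[leRHS]mulrA /mweight -expRD; apply: ler_wpM2l => //.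
  by rewrite ler_expR addrC.
have cG a : contC (G a) by exact: (contC_symbol phi d_gt0 theta_ge theta_lt h_entire a du).
pose c : C := toC (c_phi phi).
have cG' a : contC (fun z => cconj (c * G a z)).
  apply: contC_conj => z t t0; have [r r0 Hr] := mul_close c (G a z) t0.
  have [t' t'0 Ht] := cG a z r r0; exists t' => // z' /Ht hz; apply: Hr => //.
  by rewrite subrr cabs0.
have e20 : 0 < e / 2 by rewrite divr_gt0.
have [P P0 HP] := pair_ok phi d_gt0 theta_ge theta_lt e20.
have [I I0 HI] := integralC_le R d.
pose l a (F : Z -> C) := integralC (fun z => cconj (c * G a z) * F z * toC (expR (- (2 * W z)))).
pose B := I * P * (cabs c * M); have B0 : 0 <= B.
  exact: (mulr_ge0 (mulr_ge0 I0 (ltW P0)) (mulr_ge0 (cabs_ge0 c) M0)).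
pose w (a : mindex d) : R := B * mweight R a.
have w0 a : 0 <= w a by rewrite mulr_ge0 ?mweight_ge0.
pose S := B * ((1 - expR (-1))^-1) ^+ d.
have wS (A : {fset mindex d}) : partial_sum w A <= S.
  rewrite /partial_sum -mulr_sumr; apply: ler_wpM2l => //; exact: mweight_bound.
have okF a F N : csmooth F -> 0 <= N -> (forall z, cabs (F z) <= N * omw theta phi (e / 2) z) ->
    okC (P * (cabs c * M * mweight R a * N)) (fun z => cconj (c * G a z) * F z * toC (expR (- (2 * W z)))).
  move=> sF N0 hN; apply: HP => //.
  - exact: (mulr_ge0 (mulr_ge0 (mulr_ge0 (cabs_ge0 c) M0) (mweight_ge0 R a)) N0).
  - exact: contC_csmooth.
  - move=> z; rewrite cabs_conj cabsM.
    have h1 := ler_wpM2l (cabs_ge0 c) (hG a z).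
    have h2 := ler_pM (mulr_ge0 (cabs_ge0 _) (cabs_ge0 _)) (cabs_ge0 _) h1 (hN z).
    apply: le_trans h2 _; rewrite /omw.
    have -> : cabs c * (M * mweight R a * expR (- (e * nC z `^ p) + W z)) * (N * expR (W z + e / 2 * nC z `^ p)) =
      cabs c * M * mweight R a * N * (expR (- (e * nC z `^ p) + W z) * expR (W z + e / 2 * nC z `^ p)) by ring.
    apply: ler_wpM2l; first exact: (mulr_ge0 (mulr_ge0 (mulr_ge0 (cabs_ge0 c) M0) (mweight_ge0 R a)) N0).
    rewrite -expRD ler_expR; lra.
have dN F : dominated (omw theta phi (e / 2)) F -> exists2 N : R, 0 <= N &
    forall z, cabs (F z) <= N * omw theta phi (e / 2) z.
  move=> [_ [N HN]]; exists N => //.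
  rewrite -(pmulr_lge0 _ (expR_gt0 (W 0 + e / 2 * nC (0 : Z) `^ p))); apply: le_trans (HN 0).
  exact: cabs_ge0.
have ll a F F' x y : dominated (omw theta phi (e / 2)) F -> dominated (omw theta phi (e / 2)) F' ->
    l a (fun z => x * F z + y * F' z) = x * l a F + y * l a F'.
  move=> dF dF'; have [N N0 HN] := dN _ dF; have [N' N'0 HN'] := dN _ dF'.
  rewrite /l -(integralC_lin x y (okF a F N (proj1 dF) N0 HN) (okF a F' N' (proj1 dF') N'0 HN')).
  by congr integralC; apply/funext => z; ring.
have lb a F N : csmooth F -> 0 <= N -> (forall z, cabs (F z) <= N * omw theta phi (e / 2) z) ->
    cabs (l a F) <= w a * N.
  move=> sF N0 hN; apply: le_trans (HI _ _ (okF a F N sF N0 hN)) _.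
  by rewrite le_eqVlt; apply/orP; left; apply/eqP; rewrite /w /B; ring.
have [gsum gi] := sup_series_gs d_gt0 theta_ge theta_lt w0 wS e20 ll lb.
pose g0 := sup_fun phi (lser l) \o @vecC R d.
exists (fun y => cconj (g0 y)); first exact: gs_conj.
move=> v gv; have gv' := gs_conj d_gt0 gv.
have dv := embed_dual d_gt0 theta_ge theta_lt gv'.
have [D D0 [hD uE]] := sup_series d_gt0 theta_ge theta_lt w0 wS e20 ll lb dv.
have term a : fbi_adj phi (G a) v = cconj (embed (fun y => cconj (v y)) (sup_fun phi (l a) \o @vecC R d)).
  rewrite (adj_embed e_gt0 (mulr_ge0 M0 (mweight_ge0 R a)) (cG a) (hG a) gv) -/c.
  by congr (cconj (embed _ _)).
have [M' oM] := gs_pair_ok d_gt0 theta_ge theta_lt gv' gsum.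
transitivity (cconj (embed (fun y => cconj (v y)) g0)).
  rewrite /g0 uE -(sum_conj w0 wS D0 hD) /opA; congr sum; apply/funext => a; exact: term.
rewrite /embed -(integralR_conj oM); congr integralR; apply/funext => y.
by rewrite conjCM cconjK mulrC.
Qed.

End Embedding.

(** * Wave front sets *)

Section WaveFrontSets.
Variables (R : realType) (d : nat) (theta : R) (phi : FBI_phase R d).
Hypotheses (d_gt0 : (0 < d)%N) (theta_ge : 2^-1 <= theta) (theta_lt : theta < 1).
Local Notation C := (Cplx R).
Local Notation V := 'rV[R]_d.
Local Notation Z := 'rV[C]_d.
Local Notation p := (theta^-1).
Local Notation W := (weight phi).
Local Notation Q := (phC phi).

Lemma fbi_gp u z : gs_dual theta u ->
  cabs (fbi phi u z) = cabs (toC (c_phi phi) : C) * (expR (W z) * cabs (u (gp Q (xz phi z) (xiz phi z)))).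
Proof.
move=> du; have [a pQ] := phC_posim phi d_gt0.
rewrite /fbi cabsM fbi_kernel_split (gs_linearZ _ (proj1 du)); last exact: (gp_gs theta_ge theta_lt _ _ pQ).
by rewrite cabsM cabs_pref.
Qed.

Lemma chi0 : chi phi (0 : V) (0 : V) = 0.
Proof. by have := chiB phi (0 : V) (0 : V) 0 0; rewrite !subrr => <-. Qed.

Lemma chi_neq0 (w : V * V) : w != 0 -> chi phi w.1 w.2 != 0.
Proof.
apply: contra_neq => h; have h1 := xz_chi phi w.1 w.2; have h2 := xiz_chi phi w.1 w.2.
rewrite h in h1 h2; apply: injective_projections; rewrite -?h1 -?h2 ?xz0//.
by have := xizN phi 0; rewrite oppr0 => E; have : 0 = 0 :> V by []; move: E; set y := xiz phi 0;
  move/eqP; rewrite -addr_eq0 -mulr2n -scaler_nat scaler_eq0 pnatr_eq0 /= => /eqP.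
Qed.

(** Passage from conic neighbourhoods to the cones with explicit scale used in the estimates, by
    homogeneity. *)
Lemma cone_scale (z0 : Z) (L : set Z) : nbhs z0 L -> conicC L ->
  exists2 k : R, 0 < k & forall z s, 0 < s -> nC (z - toC s *: z0) <= k * s -> L z.
Proof.
move=> /nbhs_nC[r r0 Hr] cL; exists (r / 2); first by rewrite divr_gt0.
move=> z s s0 hz; have sN : toC s != 0 :> C by rewrite gt_eqF// -toC0 toC_lt.
rewrite -[z]scale1r -(divff sN) -scalerA; apply: cL => //; apply: Hr.
have -> : (toC s)^-1 *: z - z0 = (toC s)^-1 *: (z - toC s *: z0).
  by rewrite scalerBr scalerA mulVf// scale1r.
rewrite nCZ cabsV cabs_toC gtr0_norm// mulrC ltr_pdivrMr//.
by apply: le_lt_trans hz _; rewrite ltr_pM2r// ltr_pdivrMr// ltr_pMr// ltr1n.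
Qed.

Lemma cone_scaleR (x0 xi0 : V) (G : set (V * V)) : open G -> conic G -> G (x0, xi0) ->
  exists2 k : R, 0 < k & forall x xi s, 0 < s ->
    nR (x - s *: x0) + nR (xi - s *: xi0) <= k * s -> G (x, xi).
Proof.
move=> oG cG G0; have [[P S] /= [/nbhs_nR[r r0 Hr] /nbhs_nR[t t0 Ht]] PS] := open_nbhs_nbhs (conj oG G0).
pose k := Num.min r t / 2; have k0 : 0 < k by rewrite divr_gt0// lt_min r0.
have kr : k < r by rewrite /k ltr_pdivrMr// (le_lt_trans (_ : _ <= r))// ?ge_min ?lexx// ltr_pMr// ltr1n.
have kt : k < t by rewrite /k ltr_pdivrMr// (le_lt_trans (_ : _ <= t))// ?ge_min ?lexx ?orbT// ltr_pMr// ltr1n.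
exists k => // x xi s s0 h; have sN : s != 0 by rewrite gt_eqF.
have small (y y0 : V) b : nR (y - s *: y0) <= k * s -> k < b -> nR (s^-1 *: y - y0) < b.
  move=> hy kb; have -> : s^-1 *: y - y0 = s^-1 *: (y - s *: y0).
    by rewrite scalerBr scalerA mulVf// scale1r.
  rewrite nRZ gtr0_norm ?invr_gt0// mulrC ltr_pdivrMr//.
  by apply: le_lt_trans hy _; rewrite ltr_pM2r.
have -> : (x, xi) = s *: (s^-1 *: x, s^-1 *: xi).
  by congr pair; rewrite /= scalerA divff// scale1r.
apply: cG => //; apply: PS; split.
  by apply: Hr; apply: small kr; apply: le_trans h; rewrite lerDl nR_ge0.
by apply: Ht; apply: small kt; apply: le_trans h; rewrite lerDr nR_ge0.
Qed.

(** Within the chosen aperture |x| + |xi| is at least (|x0| + |xi0|) s / 2, which turns decay in the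
    phase space point into decay in s. The d in [q] comes from passing to Euclidean norms. *)
Lemma wave_gp_decay u (x0 xi0 : V) (G : set (V * V)) (c e : R) : (x0, xi0) != 0 ->
  open G -> conic G -> G (x0, xi0) -> 0 < c -> 0 < e ->
  (forall x xi, G (x, xi) -> cabs (u (wave_packet x xi)) <=
       c * expR (- e * (enorm x `^ p + enorm xi `^ p))) ->
  gp_decay theta u ('i%:M) x0 xi0.
Proof.
move=> w0 oG cG G0 c0 e0 H; have [k k0 Hk] := cone_scaleR oG cG G0.
pose n0 := nR x0 + nR xi0.
have n00 : 0 < n0.
  rewrite lt_def addr_ge0 ?nR_ge0// andbT; apply: contra_neq w0 => h.
  have h1 : nR x0 = 0 by have := nR_ge0 x0; have := nR_ge0 xi0; move: h; rewrite /n0; lra.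
  have h2 : nR xi0 = 0 by have := nR_ge0 x0; have := nR_ge0 xi0; move: h; rewrite /n0; lra.
  by rewrite (nR_eq0 h1) (nR_eq0 h2).
have d0 : 0 < d%:R :> R by rewrite ltr0n.
pose q := n0 / (2 * d%:R); have q0 : 0 < q by rewrite divr_gt0// mulr_gt0.
exists (Num.min k (n0 / 2)), (e / 4 * q `^ p), c; split=> //.
- by rewrite lt_min k0 divr_gt0.
- by rewrite mulr_gt0 ?divr_gt0// powR_gt0.
- exact: ltW.
move=> x xi s s0 hs.
have hk : nR (x - s *: x0) + nR (xi - s *: xi0) <= k * s.
  by apply: le_trans hs _; rewrite ler_pM2r// ge_min lexx.
have hn : nR (x - s *: x0) + nR (xi - s *: xi0) <= n0 / 2 * s.
  by apply: le_trans hs _; rewrite ler_pM2r// ge_min lexx orbT.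
rewrite -wave_packetE; apply: le_trans (H _ _ (Hk _ _ _ s0 hk)) _.
apply: ler_wpM2l; first exact: ltW.
rewrite ler_expR mulNr lerN2 -mulrA -powRp_scale ?(ltW q0) ?(ltW s0)//.
have en (y : V) : 0 <= enorm y by exact: sqrtr_ge0.
have h1 : q * s <= enorm x + enorm xi.
  have a1 := nR_le_enorm x; have a2 := nR_le_enorm xi.
  have b1 : nR (s *: x0) <= nR x + nR (x - s *: x0).
    by rewrite -{1}(subKr x (s *: x0)) (le_trans (nRD _ _))// nRN.
  have b2 : nR (s *: xi0) <= nR xi + nR (xi - s *: xi0).
    by rewrite -{1}(subKr xi (s *: xi0)) (le_trans (nRD _ _))// nRN.
  rewrite !nRZ gtr0_norm// in b1 b2.
  rewrite /q mulrAC ler_pdivrMr ?mulr_gt0//.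
  have := mulrDr s (nR x0) (nR xi0); rewrite -/n0 (mulrC s n0) => ds.
  move: hn; rewrite mulrAC; lra.
have h2 := powRp_tri theta_ge theta_lt (mulr_ge0 (ltW q0) (ltW s0)) (en x) (en xi) h1.
have := ler_wpM2l (ltW e0) h2; lra.
Qed.

Lemma fbi_cone_decay u (x0 xi0 : V) : gs_dual theta u -> gp_decay theta u Q x0 xi0 ->
  exists k e : R, [/\ 0 < k, 0 < e & exists2 M : R, 0 <= M & forall w s, 0 < s ->
    nC (w - toC s *: chi phi x0 xi0) <= k * s ->
    cabs (fbi phi u w) <= M * expR (- (e * nC w `^ p) + W w)].
Proof.
move=> du [k [e [M [k0 e0 M0 H]]]]; have [K K0 [HK _]] := phase_bounds phi.
set z0 := chi phi x0 xi0.
pose S := k / K + nC z0; have S0 : 0 < S by rewrite ltr_pwDl ?nC_ge0 ?divr_gt0.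
have Sp : 0 < S `^ p by rewrite powR_gt0.
exists (k / K), (e / S `^ p); split; rewrite ?divr_gt0//.
exists (cabs (toC (c_phi phi) : C) * M); first by rewrite mulr_ge0 ?cabs_ge0.
move=> w s s0 hw; rewrite fbi_gp// -mulrA; apply: ler_wpM2l; first exact: cabs_ge0.
have E : toC s *: z0 = chi phi (s *: x0) (s *: xi0) by rewrite chiZ.
have hb : nR (xz phi w - s *: x0) + nR (xiz phi w - s *: xi0) <= k * s.
  have := HK (w - toC s *: z0); rewrite E xzD xizD xzN xizN xz_chi xiz_chi => h.
  apply: le_trans h _; rewrite -E mulrC -ler_pdivlMr//.
  by apply: le_trans hw _; rewrite mulrAC.
rewrite expRD (mulrC (expR _) (expR (W w))) mulrCA; apply: ler_wpM2l; first exact: expR_ge0.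
apply: le_trans (H _ _ _ s0 hb) _; apply: ler_wpM2l => //.
rewrite ler_expR lerN2 mulrAC -mulrA; apply: ler_wpM2l; first exact: ltW.
rewrite ler_pdivrMr// -powRM ?(ltW s0) ?(ltW S0)//; apply: powRp_le => //; first exact: nC_ge0.
rewrite -(subrK (toC s *: z0) w); apply: le_trans (nCD _ _) _.
by rewrite /S mulrDr (mulrC s) lerD// nCZ cabs_toC gtr0_norm.
Qed.

Variable h : mindex d -> Z -> C.
Hypothesis h_entire : forall a, entire (h a).
Hypothesis h_bound : forall e : R, 0 < e -> exists2 D : R, 0 < D & forall a z,
  cabs (h a z) <= D * (e ^+ mabs a / (mfact a)%:R `^ theta) * expR (e * nC z `^ p).

Lemma ncone_not0 (z0 : Z) (k s : R) : 0 < s -> 0 < k -> k <= nC z0 / 2 ->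
  ~ nC (0 - toC s *: z0) < k * s.
Proof.
move=> s0 k0 kz; rewrite sub0r nCN nCZ cabs_toC gtr0_norm//; apply/negP; rewrite -leNgt.
rewrite mulrC; apply: ler_wpM2l; first exact: ltW.
by apply: le_trans kz _; rewrite ler_pdivrMr// ler_peMr ?nC_ge0// ler1n.
Qed.

(** Decay on the packets with M = i is carried to those with M = C by [heat_flow], hence to the
    transform in a cone about chi (x0, xi0). [microlocal] is then applied with M' = i, so that its
    conclusion concerns the packets of [WF]; pulling the cone back by [chi] gives the open cone in
    phase space. *)
Lemma WF_opA u : gs_dual theta u -> WF theta (opA phi h u) `<=` WF theta u.
Proof.
move=> du [x0 xi0] [w0 nG]; split=> // -[G [oG cG _ G0 [c [e [c0 e0 H]]]]]; apply: nG.
have [a pQ] := phC_posim phi d_gt0; have pI := posim_i R d_gt0.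
have dI := wave_gp_decay w0 oG cG G0 c0 e0 H.
have dQ := heat_flow d_gt0 theta_ge theta_lt du pI pQ dI.
have [k [e1 [k0 e10 [M M0 HM]]]] := fbi_cone_decay du dQ.
set z0 := chi phi x0 xi0 in HM; have z00 : z0 != 0 by exact: (chi_neq0 w0).
have HU : exists2 M : R, 0 <= M & forall v, [set u] v -> forall w s, 0 < s ->
    nC (w - toC s *: z0) <= k * s -> cabs (fbi phi v w) <= M * expR (- (e1 * nC w `^ p) + W w).
  by exists M => // _ ->.
have [k' [e' [K [k'0 e'0 K0 HK]]]] := microlocal d_gt0 theta_ge theta_lt h_entire h_bound
  (dual1 du) (fbi_growth1 phi d_gt0 theta_ge theta_lt du) z00 k0 e10 pI HU.
have Z0 : 0 < nC z0 by rewrite lt_def nC_ge0 andbT; apply: contra_neq z00 => /nC_eq0.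
(* The aperture is kept at most |z0| / 2, so that the cone avoids the origin. *)
pose q := Num.min k' (nC z0 / 2); have q0 : 0 < q by rewrite lt_min k'0 divr_gt0.
have [L L0 [_ HL]] := phase_bounds phi.
exists [set w | exists2 s : R, 0 < s & nC (chi phi w.1 w.2 - toC s *: z0) < q * s]; split.
- rewrite openE => -[x xi] [s s0 hs]; rewrite /interior.
  pose t := q * s - nC (chi phi x xi - toC s *: z0); have t0 : 0 < t by rewrite subr_gt0.
  have t20 : 0 < t / (2 * L) by rewrite divr_gt0// mulr_gt0.
  exists ([set y | nR (y - x) < t / (2 * L)], [set y | nR (y - xi) < t / (2 * L)]).
    by split; apply/nbhs_nR; exists (t / (2 * L)).
  move=> -[y eta] [/= hy heta]; exists s => //=.
  have h1 : nC (chi phi y eta - chi phi x xi) < t.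
    rewrite chiB; apply: le_lt_trans (HL _ _) _.
    rewrite mulrC -ltr_pdivlMr//; apply: lt_le_trans (ltrD hy heta) _.
    by rewrite le_eqVlt; apply/orP; left; apply/eqP; field; rewrite gt_eqF.
  rewrite -(subrKA (chi phi x xi)); apply: le_lt_trans (nCD _ _) _.
  by move: h1; rewrite /t; lra.
- move=> t t0 [x xi] [s s0 hs]; exists (t * s); first exact: mulr_gt0.
  rewrite /= chiZ toCM -scalerA -scalerBr nCZ cabs_toC gtr0_norm// mulrCA.
  by rewrite ltr_pM2l.
- move=> [s s0]; rewrite (_ : chi phi _ _ = 0); last exact: chi0.
  by apply: ncone_not0 => //; rewrite ge_min lexx orbT.
- exists 1 => //=; rewrite toC1 scale1r subrr nC0 mulr1; exact: q0.
- have [S S0 HS] := xz_growth phi theta_ge theta_lt.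
  exists (K + 1), (e' / S); split; rewrite ?divr_gt0//; first by rewrite ltr_wpDl.
  move=> x xi [s s0 hs]; rewrite wave_packetE.
  have hs' : nC (chi phi x xi - toC s *: z0) <= k' * s.
    by apply: le_trans (ltW hs) _; rewrite ler_pM2r// ge_min lexx.
  apply: le_trans (HK u erefl x xi s s0 hs') _.
  apply: ler_pM => //.
    by rewrite lerDl.
  rewrite ler_expR mulNr lerN2 mulrAC -mulrA; apply: ler_wpM2l; first exact: ltW.
  rewrite ler_pdivrMr// mulrC; have := HS (chi phi x xi); rewrite xz_chi xiz_chi.
  apply: le_trans; apply: lerD; apply: powRp_le => //; rewrite ?sqrtr_ge0//; exact: enorm_le_nR.
Qed.

Lemma opA_dual_cone G u : gs_dual_cone theta G u -> gs_dual_cone theta G (opA phi h u).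
Proof.
move=> [du uG]; split.
  exact: (opA_dual d_gt0 theta_ge theta_lt h_entire h_bound (dual1 du)
    (fbi_growth1 phi d_gt0 theta_ge theta_lt du)).
exact: subset_trans (WF_opA du) uG.
Qed.

(** The family in [microlocal] is the range of un - u, whose transforms are uniformly bounded by
    [weakly_null_growth]. Here M' = C, since convergence is measured on the FBI transform, which is
    a pairing with those packets. *)
Lemma opA_cone_cvg G (un : nat -> functional R d) u :
  (forall n, gs_dual theta (un n)) -> gs_dual theta u -> cone_cvg phi theta G un u ->
  cone_cvg phi theta G (fun n => opA phi h (un n)) (opA phi h u).
Proof.
move=> dun du [wk mic]; pose wn n : functional R d := fun f => un n f - u f.
have dwn n : gs_dual theta (wn n) by exact: dual_sub.
pose U : set (functional R d) := range wn.
have U_dual v : U v -> gs_dual theta v by move=> [n _ <-].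
have Uw n : U (wn n) by exists n.
have U_fbi (e : R) : 0 < e -> exists2 K : R, 0 <= K & forall v, U v -> forall z,
    cabs (fbi phi v z) <= K * expR (e * nC z `^ p + W z).
  move=> e0; have [K K0 HK] := weakly_null_growth phi d_gt0 theta_ge theta_lt dwn wk e0.
  by exists K => // _ [n _ <-].
have sub n f : gs theta f -> opA phi h (un n) f - opA phi h u f = opA phi h (wn n) f.
  by move=> gf; rewrite (opA_sub phi d_gt0 theta_ge theta_lt h_entire h_bound (dun n) du gf).
have [a pQ] := phC_posim phi d_gt0.
split=> [f gf|w w0 Gw].
  have := opA_weak_cvg0 d_gt0 theta_ge theta_lt h_entire h_bound U_dual U_fbi Uw wk gf.
  by rewrite (_ : (fun n => opA phi h (wn n) f) =
    fun n => opA phi h (un n) f - opA phi h u f)//; apply/funext => n; rewrite sub.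
have [L [nL cL _ [c [e [c0 e0 HLc]]]]] := mic w w0 Gw; rewrite chi_bE in nL *.
have [k k0 Hk] := cone_scale nL cL; set z0 := chi phi w.1 w.2 in Hk *.
have z00 : z0 != 0 by exact: chi_neq0.
have dp : 0 < d%:R `^ p :> R by rewrite powR_gt0// ltr0n.
have e10 : 0 < e / d%:R `^ p by rewrite divr_gt0.
have HU : exists2 M : R, 0 <= M & forall v, U v -> forall z s, 0 < s ->
    nC (z - toC s *: z0) <= k * s ->
    cabs (fbi phi v z) <= M * expR (- (e / d%:R `^ p * nC z `^ p) + W z).
  exists c; first exact: ltW.
  move=> _ [n _ <-] z s s0 hz; apply: le_trans (HLc n z (Hk z s s0 hz)) _.
  apply: ler_wpM2l; first exact: ltW.
  rewrite ler_expR lerD2r mulNr lerN2 -mulrA; apply: ler_wpM2l; first exact: ltW.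
  rewrite mulrC ler_pdivrMr// mulrC -powRp_scale ?sqrtr_ge0//.
  by apply: powRp_le; rewrite ?nC_ge0// nC_le_cenorm.
have [k' [e' [K [k'0 e'0 K0 HK]]]] := microlocal d_gt0 theta_ge theta_lt h_entire h_bound
  U_dual U_fbi z00 k0 e10 pQ HU.
have Z0 : 0 < nC z0 by rewrite lt_def nC_ge0 andbT; apply: contra_neq z00 => /nC_eq0.
pose q := Num.min k' (nC z0 / 2); have q0 : 0 < q by rewrite lt_min k'0 divr_gt0.
exists [set z | exists2 s : R, 0 < s & nC (z - toC s *: z0) < q * s]; split.
- apply/nbhs_nC; exists q => // z hz; exists 1; first exact: ltr01.
  by rewrite toC1 scale1r mulr1.
- move=> t t0 z [s s0 hs]; exists (t * s); first exact: mulr_gt0.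
  rewrite toCM -scalerA -scalerBr nCZ cabs_toC gtr0_norm// mulrCA.
  by rewrite ltr_pM2l.
- by move=> [s s0]; apply: ncone_not0 => //; rewrite ge_min lexx orbT.
- pose cc := cabs (toC (c_phi phi) : C).
  exists (cc * K + 1), e'; split=> //.
    by rewrite ltr_wpDl// mulr_ge0 ?cabs_ge0.
  move=> n z [s s0 hs].
  have -> : fbi phi (fun f => opA phi h (un n) f - opA phi h u f) z = fbi phi (opA phi h (wn n)) z.
    by rewrite /fbi sub//; exact: kernel_gs.
  have dA := opA_dual d_gt0 theta_ge theta_lt h_entire h_bound U_dual U_fbi (Uw n).
  rewrite fbi_gp// -/cc.
  have hs' : nC (chi phi (xz phi z) (xiz phi z) - toC s *: z0) <= k' * s.
    by rewrite chi_phase; apply: le_trans (ltW hs) _; rewrite ler_pM2r// ge_min lexx.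
  have h1 := HK _ (Uw n) _ _ s s0 hs'; rewrite chi_phase in h1.
  apply: le_trans (ler_wpM2l (cabs_ge0 _) (ler_wpM2l (expR_ge0 _) h1)) _.
  rewrite expRD -/cc.
  have -> : cc * (expR (W z) * (K * expR (- (e' * nC z `^ p)))) =
    cc * K * (expR (- (e' * nC z `^ p)) * expR (W z)) by ring.
  have E0 : 0 <= expR (- (e' * nC z `^ p)) * expR (W z) by rewrite mulr_ge0 ?expR_ge0.
  apply: ler_pM => //; first by rewrite mulr_ge0 ?cabs_ge0.
    by rewrite lerDl.
  apply: ler_wpM2r; first exact: expR_ge0.
  rewrite ler_expR mulNr lerN2; apply: ler_wpM2l; first exact: ltW.
  by apply: powRp_le; rewrite ?sqrtr_ge0// cenorm_le_nC.
Qed.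

End WaveFrontSets.

Theorem theorem4p5 (R : realType) (d : nat) (hd : (0 < d)%N)
  (theta : R) (theta_ge : 2^-1 <= theta) (theta_lt : theta < 1)
  (phi : FBI_phase R d)
  (h : mindex d -> 'rV[Cplx R]_d -> Cplx R)
  (h_entire : forall a, entire (h a))
  (D : R -> mindex d -> R) (D' : R -> R)
  (D_gt0 : forall e a, 0 < e -> 0 < D e a)
  (h_le : forall e a z, 0 < e ->
    cabs (h a z) <= D e a * expR (e * cenorm z `^ theta^-1))
  (D'_gt0 : forall e, 0 < e -> 0 < D' e)
  (D_le : forall e a, 0 < e ->
    D e a <= D' e * e ^+ mabs a / (mfact a)%:R `^ theta) :
  [/\ forall u, gs_dual theta u ->
        (forall a, fbi_admissible phi theta (symbol_term phi h u a)) /\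
        (forall v, gs theta v ->
          cvg (partial_sum (fun a => fbi_adj phi (symbol_term phi h u a) v)
               @ totally)),
      forall G, closed_cone G ->
        (forall u, gs_dual_cone theta G u -> gs_dual_cone theta G (opA phi h u)) /\
        (forall (un : nat -> functional R d) (u : functional R d),
          (forall n, gs_dual_cone theta G (un n)) -> gs_dual_cone theta G u ->
          cone_cvg phi theta G un u ->
          cone_cvg phi theta G (fun n => opA phi h (un n)) (opA phi h u)),
      forall u, gs_dual theta u -> WF theta (opA phi h u) `<=` WF theta u &
      forall f, gs theta f -> exists2 g, gs theta g &
        forall v, gs theta v -> opA phi h (embed f) v = embed g v].
Proof.
(* The two bounds on the constants are merged into one, and the Euclidean norm is replaced by the
   larger [nC]. *)
have h_bound (e : R) : 0 < e -> exists2 D0 : R, 0 < D0 & forall a z,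
    cabs (h a z) <= D0 * (e ^+ mabs a / (mfact a)%:R `^ theta) * expR (e * nC z `^ theta^-1).
  move=> e0; exists (D' e) => [|a z]; first exact: D'_gt0.
  apply: le_trans (h_le e a z e0) _; rewrite mulrA.
  apply: ler_pM; rewrite ?expR_ge0 ?(ltW (D_gt0 e a e0))//; first exact: D_le.
  rewrite ler_expR; apply: ler_wpM2l; first exact: ltW.
  by apply: powRp_le; rewrite ?sqrtr_ge0// cenorm_le_nC.
split.
- move=> u du; split=> [a|v gv]; first exact: symbol_admissible.
  apply/cvg_ex; exists (opA phi h u v).
  exact: (adj_cvg hd theta_ge theta_lt h_entire h_bound (dual1 du)
    (fbi_growth1 phi hd theta_ge theta_lt du) (erefl u) gv).
- move=> G _; split=> [u|un u dun du cv]; first exact: opA_dual_cone.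
  by apply: opA_cone_cvg => // [n|]; [have [] := dun n|have [] := du].
- by move=> u; exact: WF_opA.
- by move=> f; exact: opA_embed.
Qed.
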